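(* Let $N\ge0$, let $0<\tau_0\le\tau<k$ with $\tau_0<1/2$ and $k$ an integer, and let $\varphi\in G^{\tau_0}_{\tau,k}$ be such that $0\notin\varphi(\mathbb{S})$. Let $0<N_0<N+\tau_0$. If $f\in B^1_{-N_0}$ and $h\in B^\infty_\tau$ satisfy $$\varphi f=\mathcal{K}^N(f\bar\partial\varphi)+h\quad\text{on }\mathbb{B},$$ then $f\in B^\infty_\tau$ and $\|f\|_{B^\infty_\tau}\le C\left(\|f\|_{B^1_{-N_0}}+\|h\|_{B^\infty_\tau}\right)$, where $C>0$ is a constant not depending on $f$ and $h$.
   Context: $\mathbb{B}$ is the open unit ball of $\mathbb{C}^n$ ($n\ge1$), $\mathbb{S}$ its boundary, $\sigma$ the normalized Lebesgue measure on $\mathbb{S}$, $\nu$ Lebesgue measure on $\mathbb{B}$, $H$ the space of holomorphic functions on $\mathbb{B}$, $\bar wz=\sum_j\bar w_jz_j$. Derivatives: $|\partial^j\varphi|=\sum_{|\alpha|=j}|\partial_\alpha\varphi|$ (holomorphic derivatives), $|d^j\varphi|=\sum_{|\alpha|+|\beta|=j}|\partial_\alpha\bar\partial_\beta\varphi|$, $|\bar\partial\varphi|=\sum_j|\bar\partial_j\varphi|$, and $|\bar\partial_T\varphi|=\sum_{1\le i<j\le n}|(z_i\bar\partial_j-z_j\bar\partial_i)\varphi|$ (which is $0$ if $n=1$). For $\varphi\in\mathcal{C}^1(\mathbb{B})$ let $\widetilde\varphi(z)=(1-|z|^2)|\bar\partial\varphi(z)|+(1-|z|^2)^{1/2}|\bar\partial_T\varphi(z)|$.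 For $t\in\mathbb{R}$ let $\omega_t(z)=(1-|z|^2)^{\min(t,0)}$ if $t\ne0$ and $\omega_0(z)=\log\frac{e}{1-|z|^2}$. $G^{\tau_0}_{\tau,k}$ is the space of all $\varphi\in\mathcal{C}^k(\mathbb{B})\cap\mathcal{C}(\overline{\mathbb{B}})$ (complex-valued) with $$\|\varphi\|_{G^{\tau_0}_{\tau,k}}=\sum_{j=0}^k\sup_{z\in\mathbb{B}}\frac{|\partial^j\varphi(z)|}{\omega_{\tau-j}(z)}+\sup_{z\in\mathbb{B}}\frac{\widetilde\varphi(z)}{(1-|z|^2)^{\tau_0}}<\infty.$$ $B^\infty_\tau$ is the space of $f\in H$ with $\|f\|_{B^\infty_\tau}=\sum_{j=0}^m\sup_{z\in\mathbb{B}}|d^jf(z)|(1-|z|^2)^{m-\tau}<\infty$ for an integer $m>\tau$ (different $m$ give equivalent norms). For $N_0>0$, $B^1_{-N_0}$ is the space of $f\in H$ with $\|f\|_{B^1_{-N_0}}=\int_{\mathbb{B}}|f(z)|(1-|z|^2)^{N_0-1}d\nu(z)<\infty$. For $N>0$, $\mathcal{P}^N(\psi)(z)=\int_{\mathbb{B}}\frac{\psi(w)}{(1-\bar wz)^{n+N}}d\nu_N(w)$ with $d\nu_N(w)=\frac{\Gamma(n+N)}{n!\,\Gamma(N)}(1-|w|^2)^{N-1}d\nu(w)$ ($\nu$ normalized so that $\nu_N(\mathbb{B})=1$), and $\mathcal{P}^0(\psi)(z)=\int_{\mathbb{S}}\frac{\psi(\zeta)}{(1-\bar\zeta z)^n}d\sigma(\zeta)$.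 $\mathcal{K}^N$ is the integral operator of Charpentier's representation formula: for each $N\ge0$ there is an $(n,n-1)$-form (in $w$) $\mathcal{K}^N(w,z)$, of class $\mathcal{C}^\infty$ on $\mathbb{B}\times\mathbb{B}$ off the diagonal, such that, with $\mathcal{K}^N(\theta)(z)=\int_{\mathbb{B}}\mathcal{K}^N(w,z)\wedge\theta(w)$ for $(0,1)$-forms $\theta$, every $\psi\in\mathcal{C}^1(\overline{\mathbb{B}})$ decomposes as $\psi=\mathcal{P}^N(\psi)+\mathcal{K}^N(\bar\partial\psi)$ on $\mathbb{B}$, and for every $\psi\in\mathcal{C}^1(\mathbb{B})$ $$|\mathcal{K}^N(w,z)\wedge\bar\partial\psi(w)|\le C\,\frac{(1-|w|^2)^{N-1}}{|1-\bar wz|^{N-n+1}D(w,z)^{n-1/2}}\,\widetilde\psi(w),\qquad D(w,z)=|1-\bar wz|^2-(1-|w|^2)(1-|z|^2),$$ with $C$ independent of $\psi,w,z$. The integral $\mathcal{K}^N(f\bar\partial\varphi)(z)$ converges absolutely for every $z\in\mathbb{B}$ when $\varphi\in G^{\tau_0}_{\tau,k}$, $f\in B^1_{-N_0}$ and $0<N_0<N+\tau_0$. *)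

(* Defs.v *)
From HB Require Import structures.
From mathcomp Require Import all_boot all_order all_algebra.
From mathcomp Require Import all_classical all_reals all_analysis.
From mathcomp Require Import complex.
Set Implicit Arguments.
Unset Strict Implicit.
Unset Printing Implicit Defensive.
Import Order.TTheory GRing.Theory Num.Theory numFieldNormedType.Exports.
Local Open Scope classical_set_scope.
Local Open Scope ring_scope.
Local Open Scope complex_scope.

(* R[i], packed so that the topology of a numFieldType is inferred on it. *)
Definition cplx (R : realType) : numClosedFieldType := R[i].

Notation Cn R n := 'rV[cplx R]_n.

(** Geometry of C^n *)
Section Geometry.
Variables (R : realType) (n : nat).
Local Notation C := (cplx R).
Implicit Types z w : Cn R n.

(* [`|c|] in R[i] is itself a complex number; this is the real modulus. *)
Definition modC (c : C) : R := complex.Re `|c|.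

Definition sqnorm z : R := \sum_(j < n) modC (z 0 j) ^+ 2.
Definition weight z : R := 1 - sqnorm z.

Definition uball : set (Cn R n) := [set z | sqnorm z < 1].
Definition cball : set (Cn R n) := [set z | sqnorm z <= 1].
Definition usphere : set (Cn R n) := [set z | sqnorm z = 1].

Definition herm w z : C := \sum_(j < n) (w 0 j)^* * z 0 j.

Definition Ddist w z : R := modC (1 - herm w z) ^+ 2 - weight w * weight z.

End Geometry.

(** Differentiation; m complex variables viewed as 2m real ones *)
Section Differentiation.
Variables (R : realType) (m : nat).
Local Notation C := (cplx R).
Local Notation V := (Cn R m).
Implicit Types (phi : V -> C) (v z : V) (U : set V).

Definition lineRe phi z v (t : R) : R := complex.Re (phi (z + t%:C *: v)).
Definition lineIm phi z v (t : R) : R := complex.Im (phi (z + t%:C *: v)).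

Definition dir_derivable v phi z : Prop :=
  derivable (lineRe phi z v) 0 1 /\ derivable (lineIm phi z v) 0 1.
Definition dir_deriv v phi z : C :=
  derive1 (lineRe phi z v) 0 +i* derive1 (lineIm phi z v) 0.

Definition xdir (j : 'I_m) : V := delta_mx 0 j.
Definition ydir (j : 'I_m) : V := 'i%C *: delta_mx 0 j.

(* The class C^k on an open set U, real sense. *)
Fixpoint Ck (k : nat) U phi : Prop :=
  (forall z, U z -> {for z, continuous phi}) /\
  if k is k'.+1 then
    forall j v, v = xdir j \/ v = ydir j ->
      (forall z, U z -> dir_derivable v phi z) /\ Ck k' U (dir_deriv v phi)
  else True.

(* Wirtinger derivatives. *)
Definition dz (j : 'I_m) phi z : C :=
  (dir_deriv (xdir j) phi z - 'i%C * dir_deriv (ydir j) phi z) / 2.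
Definition dbar (j : 'I_m) phi z : C :=
  (dir_deriv (xdir j) phi z + 'i%C * dir_deriv (ydir j) phi z) / 2.

Definition dzs (a : 'I_m -> nat) phi : V -> C :=
  foldr (fun j g => iter (a j) (dz j) g) phi (enum 'I_m).
Definition dbars (b : 'I_m -> nat) phi : V -> C :=
  foldr (fun j g => iter (b j) (dbar j) g) phi (enum 'I_m).

(* Entries of a multi-index of length j are at most j. *)
Definition abs_dz (j : nat) phi z : R :=
  \sum_(a : {ffun 'I_m -> 'I_j.+1} | (\sum_i a i == j)%N)
    modC (dzs (fun i => a i) phi z).
Definition abs_d (j : nat) phi z : R :=
  \sum_(ab : {ffun 'I_m -> 'I_j.+1} * {ffun 'I_m -> 'I_j.+1}
        | (\sum_i ab.1 i + \sum_i ab.2 i == j)%N)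
    modC (dzs (fun i => ab.1 i) (dbars (fun i => ab.2 i) phi) z).
Definition abs_dbar phi z : R := \sum_(j < m) modC (dbar j phi z).
Definition abs_dbarT phi z : R :=
  \sum_(i < m) \sum_(j < m | (i < j)%N)
    modC (z 0 i * dbar j phi z - z 0 j * dbar i phi z).

(* The (0,1)-form dbar phi, as the row of its coefficients. *)
Definition dbarv phi z : V := \row_j dbar j phi z.

Definition holomorphic U (f : V -> C) : Prop :=
  forall z, U z -> differentiable f z.

End Differentiation.

(** Integration over the ball and the sphere *)
Section Lebesgue.
Variable R : realType.
Local Notation mR := (measurableTypeR R).

Definition cons_pair (m : nat) (p : m.-tuple mR * mR) : m.+1.-tuple mR :=
  [tuple of p.2 :: p.1].

Lemma measurable_cons_pair m : measurable_fun [set: _] (@cons_pair m).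
Proof. exact: measurable_cons measurable_snd measurable_fst. Qed.

Definition leb_step m (mu : {measure set (m.-tuple mR) -> \bar R}) :
    {measure set (m.+1.-tuple mR) -> \bar R} :=
  measure_function_pushforward__canonical__measure_function_Measure
    (mu \x (@lebesgue_measure R))%E (@measurable_cons_pair m).

(* Lebesgue measure on R^m. *)
Fixpoint leb (m : nat) : {measure set (m.-tuple mR) -> \bar R} :=
  if m is m'.+1 then leb_step (leb m') else \d_ [tuple].

End Lebesgue.

Section Integration.
Variables (R : realType) (n : nat).
Local Notation C := (cplx R).
Local Notation V := (Cn R n).
Local Notation T := ((n + n).-tuple (measurableTypeR R)).

(* (x, y) |-> x + iy *)
Definition toC (t : T) : V :=
  \row_j (tnth t (lshift n j) +i* tnth t (rshift n j)).

Definition ballT : set T := toC @^-1` @uball R n.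

Definition vol_inv : {nonneg R} := `| (fine (leb R (n + n) ballT))^-1 |%:nng.

(* Lebesgue measure, normalized so that the unit ball has measure 1. *)
Definition nu : {measure set T -> \bar R} := mscale vol_inv (leb R (n + n)).

Definition cintB (g : V -> C) : C :=
  (\int[nu]_(t in ballT) complex.Re (g (toC t)))
  +i* (\int[nu]_(t in ballT) complex.Im (g (toC t))).

(* The normalized Lebesgue measure sigma of the sphere is the image of nu
   restricted to the ball under w |-> w / |w| (polar coordinates). *)
Definition sphproj (w : V) : V := (Num.sqrt (sqnorm w))^-1%:C *: w.
Definition cintS (g : V -> C) : C := cintB (fun w => g (sphproj w)).

End Integration.

(** Function spaces *)
Section Spaces.
Variables (R : realType) (n : nat).
Local Notation C := (cplx R).
Local Notation V := (Cn R n).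
Implicit Types (phi f : V -> C) (z : V).

Definition supB (g : V -> R) : \bar R :=
  ereal_sup [set (g z)%:E | z in @uball R n].

Definition tilde phi z : R :=
  weight z * abs_dbar phi z + weight z `^ (1 / 2) * abs_dbarT phi z.

Definition omega (t : R) z : R :=
  if t == 0 then ln (expR 1 / weight z) else weight z `^ Num.min t 0.

Definition normG (tau0 tau : R) (k : nat) phi : \bar R :=
  (\sum_(j < k.+1) supB (fun z => abs_dz j phi z / omega (tau - j%:R)%R z)%R
   + supB (fun z => tilde phi z / weight z `^ tau0)%R)%E.

Definition inG (tau0 tau : R) (k : nat) phi : Prop :=
  [/\ Ck k (@uball R n) phi,
      {within @cball R n, continuous phi}
    & (normG tau0 tau k phi < +oo)%E].

(* m is the integer > tau used to define the norm of B^oo_tau. *)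
Definition normBinf (m : nat) (tau : R) f : \bar R :=
  (\sum_(j < m.+1)
     supB (fun z => abs_d j f z * weight z `^ (m%:R - tau))%R)%E.

Definition inBinf (m : nat) (tau : R) f : Prop :=
  holomorphic (@uball R n) f /\ (normBinf m tau f < +oo)%E.

(* B^1_{-N0} *)
Definition normB1 (N0 : R) f : \bar R :=
  (\int[nu R n]_(t in @ballT R n)
     (modC (f (toC t)) * weight (toC t) `^ (N0 - 1))%:E)%E.

Definition inB1 (N0 : R) f : Prop :=
  holomorphic (@uball R n) f /\ (normB1 N0 f < +oo)%E.

(* C^1 up to the boundary: the first derivatives extend continuously. *)
Definition C1_cball (psi : V -> C) : Prop :=
  [/\ Ck 1 (@uball R n) psi,
      {within @cball R n, continuous psi}
    & forall j v, v = xdir R j \/ v = ydir R j ->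
      exists2 g : V -> C, {within @cball R n, continuous g}
        & forall z, uball z -> g z = dir_deriv v psi z].

End Spaces.

(** The operators P^N and K^N *)
Section Operators.
Variables (R : realType) (n : nat).
Local Notation C := (cplx R).
Local Notation V := (Cn R n).

Definition Gamma (s : R) : R :=
  \int[@lebesgue_measure R]_(x in `]0, +oo[) (x `^ (s - 1) * expR (- x)).

(* Principal branch of c ^ s, for c in the right half-plane (where the
   argument is atan (Im c / Re c)); there Re (1 - herm w z) > 0. *)
Definition cpow (c : C) (s : R) : C :=
  let theta := atan (complex.Im c / complex.Re c) in
  (modC c `^ s)%:C * (cos (s * theta) +i* sin (s * theta)).

(* Density of nu_N with respect to nu. *)
Definition nuN_density (N : R) (w : V) : R :=
  Gamma (n%:R + N) / (n`!%:R * Gamma N) * weight w `^ (N - 1).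

Definition Pop (N : R) (psi : V -> C) (z : V) : C :=
  if N == 0 then cintS (fun w => psi w / (1 - herm w z) ^+ n)
  else cintB (fun w =>
    psi w / cpow (1 - herm w z) (n%:R + N) * (nuN_density N w)%:C).

(* An (n, n-1)-form in w is given by the row (K_j)_j of its coefficients in
   the basis eta_1, .., eta_n of (n, n-1)-covectors dual to d\bar w_1, ..,
   d\bar w_n, i.e. eta_i /\ d\bar w_j = delta_ij dnu.  Hence the wedge product
   with the (0,1)-form sum_j theta_j d\bar w_j is (sum_j K_j theta_j) dnu. *)
Definition wedge (kappa theta : V) : C := \sum_(j < n) kappa 0 j * theta 0 j.

Definition Kop (K : V -> V -> V) (theta : V -> V) (z : V) : C :=
  cintB (fun w => wedge (K w z) (theta w)).

(* B x B minus the diagonal, in C^(n+n). *)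
Definition offdiag : set (Cn R (n + n)) :=
  [set x | [/\ uball (lsubmx x), uball (rsubmx x) & lsubmx x <> rsubmx x]].

(* K is a kernel K^N(w, z) of Charpentier's representation formula.  By
   dilation and dominated convergence, the three conditions determine the value
   of Kop K (f dbar phi) for the f and phi considered in the main statement. *)
Definition charpentier_kernel (N : R) (K : V -> V -> V) : Prop :=
  [/\ forall (j : 'I_n) (k : nat),
        Ck k offdiag (fun x => K (lsubmx x) (rsubmx x) 0 j),
      forall psi : V -> C, C1_cball psi ->
        forall z, uball z -> psi z = Pop N psi z + Kop K (dbarv psi) z
    & exists c : R, forall psi : V -> C, Ck 1 (@uball R n) psi ->
        forall w z, uball w -> uball z -> w <> z ->
        modC (wedge (K w z) (dbarv psi w)) <=
          c * (weight w `^ (N - 1)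
               / (modC (1 - herm w z) `^ (N - n%:R + 1)
                  * Ddist w z `^ (n%:R - 1 / 2)))
            * tilde psi w].

End Operators.

(* Main.v *)
(* Charpentier's formula for [phi (r .) f (r .)], [r -> 1], turns the equation into [h = P^N (phi f)],
   with [P^N] integrated by parts so that it makes sense for [f] in [B^1]; likewise [f = P^N f]. Hence
   [phi(z) d_J f(z) - d_J h(z)] is an integral of [f] against [phi w - phi z] or an antiholomorphic
   derivative of [phi], and, [phi] being Hoelder of order [tau0] in the nonisotropic distance, the
   singularity improves by [eps = tau0 / 2]. As [phi] does not vanish near the sphere, one may divide
   by it. Iterating with the Forelli-Rudin estimates first bounds [f]; after [k] integrations by parts
   in [P^N], each step raises the smoothness of [f] by [eps], up to [tau]. *)
Require Import Defs.
From HB Require Import structures.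
From mathcomp Require Import all_boot all_order all_algebra.
From mathcomp Require Import all_classical all_reals all_analysis.
From mathcomp Require Import complex ring lra zify.
From mathcomp Require Import measurable_realfun.
Import Order.TTheory GRing.Theory Num.Theory numFieldNormedType.Exports.
Local Open Scope classical_set_scope.
Local Open Scope ring_scope.
Local Open Scope complex_scope.
Set Implicit Arguments.
Unset Strict Implicit.
Unset Printing Implicit Defensive.

Local Notation mfun := (measurable_fun setT).
Local Notation "'forB' z , P" := (forall z, uball z -> P) (at level 200, z name, P at level 200).
Local Notation cont_at f z := {for z, continuous f}.

(** For [N = 0] the operator [P^N] integrates over the sphere, where [f] has no values, and for
    [N > 0] the weight [N - 1] can be too singular for [f]. One integration by parts with the
    antiholomorphic radial field raises the weight to [N]; its cost, a derivative of [phi] of size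
    [weight^(tau0 - 1)], is what [N0 < N + tau0] pays for. The size of the kernel of [K] matters
    only for the passage [r -> 1], and there the obstacle is an integrable majorant common to all
    dilates of [f]: the reproducing formula yields a potential of [|f|]. No volume or value of
    [Gamma] is computed. The normalizing constants are positive because constants are reproduced,
    and the Forelli-Rudin estimates start from reproducing the kernel itself; a dyadic sum gives the
    other exponents. The loss of one half in [eps] is due to [|w - z|^2 <= 2 |1 - <w,z>|]. Integer
    orders would produce logarithms; a small exponent [eta] absorbs them. Since the final constant
    may not depend on [f] and [h], every estimate quantifies its constant first and lets [f] and [h]
    enter through one bound [M]. *)

Lemma eqle d (T : porderType d) (x y : T) : x = y -> (x <= y)%O. by move=> ->. Qed.

(** * Complex numbers: modulus, real and imaginary parts, conjugation *)

Section ComplexBasics.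
Variable R : realType.
Local Notation C := (cplx R).
Implicit Types (a b c : C) (x y : R).

Definition re (c : C) : R := complex.Re c.
Definition im (c : C) : R := complex.Im c.
Definition rc (x : R) : C := x%:C.
Definition cj (c : C) : C := conjc c.
Definition ii : C := 'i%C.
Definition mkC (x y : R) : C := x +i* y.
Lemma modCE c : modC c = Num.sqrt (re c ^+ 2 + im c ^+ 2).
by rewrite /modC normc_def. Qed.
Lemma modC_sqr c : modC c ^+ 2 = re c ^+ 2 + im c ^+ 2.
by rewrite modCE sqr_sqrtr// addr_ge0// sqr_ge0. Qed.
Lemma normC_modC c : `|c| = rc (modC c).
by rewrite /modC normc_def. Qed.
Lemma modC_ge0 c : 0 <= modC c.
by rewrite modCE sqrtr_ge0. Qed.
Hint Resolve modC_ge0 : core.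
Lemma RtoC_inj : injective rc.
by move=> x y []. Qed.
Lemma modCM a b : modC (a * b) = modC a * modC b.
by apply: RtoC_inj; rewrite [RHS]rmorphM -[LHS]normC_modC normrM !normC_modC. Qed.
Lemma modCD a b : modC (a + b) <= modC a + modC b.
have : `|a + b| <= `|a| + `|b| by exact: ler_normD.
by rewrite !normC_modC -rmorphD /= lecR.
Qed.
Lemma modC0 : modC (0 : C) = 0.
by apply: RtoC_inj; rewrite -normC_modC normr0. Qed.
Lemma modC1 : modC (1 : C) = 1.
by apply: RtoC_inj; rewrite -normC_modC normr1. Qed.
Lemma modCN a : modC (- a) = modC a.
by rewrite /modC normrN. Qed.
Lemma modCB a b : modC (a - b) <= modC a + modC b.
by rewrite -(modCN b) modCD. Qed.
Lemma modC_distC a b : modC (a - b) = modC (b - a).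
by rewrite -opprB modCN. Qed.
Lemma modC_distD c a b : modC (a - b) <= modC (a - c) + modC (c - b).
by rewrite -(subrKA c) modCD. Qed.
Lemma modCBr a b : modC a - modC b <= modC (a - b).
by have := modCD (a - b) b; rewrite subrK lerBlDr. Qed.
Lemma modC_eq0 a : (modC a == 0) = (a == 0).
apply/eqP/eqP => [h|->]; last exact: modC0.
by apply/eqP; rewrite -normr_eq0 normC_modC h.
Qed.
Lemma modC_gt0 a : (0 < modC a) = (a != 0).
by rewrite lt_def modC_ge0 andbT modC_eq0. Qed.
Lemma modCV a : modC a^-1 = (modC a)^-1.
have [->|a0] := eqVneq a 0; first by rewrite invr0 modC0 invr0.
have a0' : modC a != 0 by rewrite modC_eq0.
by apply: (mulfI a0'); rewrite -modCM !divff// modC1.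
Qed.
Lemma modCR x : modC (rc x) = `|x|.
by rewrite modCE /= expr0n /= addr0 sqrtr_sqr. Qed.
Lemma modCi : modC ii = 1.
by rewrite modCE /= expr0n expr1n add0r sqrtr1. Qed.
Lemma modCJ a : modC (cj a) = modC a.
by rewrite !modCE; case: a => u v /=; rewrite sqrrN. Qed.
Lemma ler_Re_modC a : `|re a| <= modC a.
by rewrite modCE -sqrtr_sqr; apply: ler_wsqrtr; rewrite lerDl sqr_ge0. Qed.
Lemma ler_Im_modC a : `|im a| <= modC a.
by rewrite modCE -sqrtr_sqr; apply: ler_wsqrtr; rewrite lerDr sqr_ge0. Qed.

Lemma modC_le_ri a : modC a <= `|re a| + `|im a|.
rewrite modCE -[leRHS]ger0_norm// -(sqrtr_sqr (`|re a| + _)).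
apply: ler_wsqrtr.
rewrite sqrrD -!normrX (ger0_norm (sqr_ge0 _)) (ger0_norm (sqr_ge0 (im a))).
by rewrite lerD2r lerDl mulrn_wge0// mulr_ge0.
Qed.

Lemma ReD a b : re (a + b) = re a + re b. by case: a; case: b. Qed.
Lemma ImD a b : im (a + b) = im a + im b. by case: a; case: b. Qed.
Lemma ReImM : (forall a b, re (a * b) = re a * re b - im a * im b) *
 (forall a b, im (a * b) = re a * im b + im a * re b) *
 (forall a, re (cj a) = re a) * (forall a, im (cj a) = - im a) *
 (forall a, re (- a) = - re a) * (forall a, im (- a) = - im a) *
 (forall x, re (rc x) = x) * (forall x, im (rc x) = 0) * (re ii = 0) * (im ii = 1) *
 (re (0 : C) = 0) * (im (0 : C) = 0) * (re (1 : C) = 1) * (im (1 : C) = 0).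
by do !split; case=> [? ?]// [? ?]. Qed.
Definition ReImE := (ReD, ImD, ReImM).

Lemma cplxP a b : re a = re b -> im a = im b -> a = b.
by case: a => u v; case: b => u' v' /= -> ->. Qed.
Lemma Re_sum I (r : seq I) (P : pred I) (F : I -> C) :
 re (\sum_(i <- r | P i) F i) = \sum_(i <- r | P i) re (F i).
by elim/big_rec2: _ => //= i y x _ <-; rewrite ReD. Qed.
Lemma Im_sum I (r : seq I) (P : pred I) (F : I -> C) :
 im (\sum_(i <- r | P i) F i) = \sum_(i <- r | P i) im (F i).
by elim/big_rec2: _ => //= i y x _ <-; rewrite ImD. Qed.

Lemma modC_sum I (r : seq I) (P : pred I) (F : I -> C) :
 modC (\sum_(i <- r | P i) F i) <= \sum_(i <- r | P i) modC (F i).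
elim/big_rec2: _ => [|i y x _ h]; first by rewrite modC0.
by rewrite (le_trans (modCD _ _))// lerD2l.
Qed.

Lemma RtoCM x y : rc (x * y) = rc x * rc y :> C. exact: rmorphM. Qed.
Lemma RtoCD x y : rc (x + y) = rc x + rc y :> C. exact: rmorphD. Qed.
Lemma RtoCB x y : rc (x - y) = rc x - rc y :> C. exact: rmorphB. Qed.
Lemma RtoCN x : rc (- x) = - rc x :> C. exact: rmorphN. Qed.
Lemma RtoCV x : rc x^-1 = (rc x)^-1 :> C. exact: fmorphV. Qed.
Lemma RtoC1 : rc 1 = 1. by []. Qed.
Lemma RtoC0 : rc 0 = 0. by []. Qed.
Lemma rc_neq0 x : x != 0 -> rc x != 0. by apply: contra_neq => -[]. Qed.
Lemma RtoC_nat k : rc k%:R = k%:R. exact: rmorph_nat. Qed.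
Lemma conjCM a b : cj (a * b) = cj a * cj b. exact: rmorphM. Qed.
Lemma conjCN a : cj (- a) = - cj a. exact: rmorphN. Qed.
Lemma conjCB a b : cj (a - b) = cj a - cj b. exact: rmorphB. Qed.
Lemma conjCK a : cj (cj a) = a. exact: conjcK. Qed.
Lemma conjC1 : cj (1 : C) = 1. exact: rmorph1. Qed.
Lemma conjC0 : cj (0 : C) = 0. exact: rmorph0. Qed.
Lemma conjC_sum I (r : seq I) (P : pred I) (F : I -> C) :
 cj (\sum_(i <- r | P i) F i) = \sum_(i <- r | P i) cj (F i).
exact: rmorph_sum. Qed.
Lemma conjCR x : cj (rc x) = rc x. exact: conjc_real. Qed.

End ComplexBasics.
Local Notation wtp c w := (rc (weight w `^ c)).

#[global] Hint Extern 0 (is_true (0 <= modC _)) => exact: modC_ge0 : core.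

(** * Geometry of the ball: Hermitian product, weight, nonisotropic distance *)

Section Hermitian.
Variables (R : realType) (n : nat).
Local Notation C := (cplx R).
Local Notation V := (Cn R n).
Implicit Types (z w u : V) (c : C) (r : R).

Definition nr z : R := Num.sqrt (sqnorm z).
Lemma sqnorm_ge0 z : 0 <= sqnorm z.
by apply: sumr_ge0 => i _; rewrite sqr_ge0. Qed.
Hint Resolve sqnorm_ge0 : core.
Lemma nr_ge0 z : 0 <= nr z. exact: sqrtr_ge0. Qed.
Hint Resolve nr_ge0 : core.
Lemma nr_sqr z : nr z ^+ 2 = sqnorm z.
by rewrite sqr_sqrtr. Qed.
Lemma hermE w z : herm w z = \sum_(j < n) cj (w 0 j) * z 0 j.
by []. Qed.
Lemma hermDr w z u : herm w (z + u) = herm w z + herm w u.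
by rewrite !hermE -big_split/=; apply: eq_bigr => i _; rewrite mxE mulrDr. Qed.
Lemma hermDl w z u : herm (w + u) z = herm w z + herm u z.
rewrite !hermE -big_split/=; apply: eq_bigr => i _.
by rewrite mxE [cj _]rmorphD mulrDl.
Qed.
Lemma hermZr c w z : herm w (c *: z) = c * herm w z.
by rewrite !hermE mulr_sumr; apply: eq_bigr => i _; rewrite mxE mulrCA. Qed.
Lemma hermZl c w z : herm (c *: w) z = cj c * herm w z.
rewrite !hermE mulr_sumr; apply: eq_bigr => i _.
by rewrite mxE conjCM mulrA.
Qed.
Lemma hermNr w z : herm w (- z) = - herm w z.
by rewrite -scaleN1r hermZr mulN1r. Qed.
Lemma hermNl w z : herm (- w) z = - herm w z.
by rewrite -scaleN1r hermZl conjCN conjC1 mulN1r. Qed.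
Lemma hermBr w z u : herm w (z - u) = herm w z - herm w u.
by rewrite hermDr hermNr. Qed.
Lemma hermBl w z u : herm (w - u) z = herm w z - herm u z.
by rewrite hermDl hermNl. Qed.
Lemma herm0r w : herm w 0 = 0.
by rewrite -(scale0r 0) hermZr mul0r. Qed.
Lemma herm0l w : herm 0 w = 0.
by rewrite -(scale0r 0) hermZl conjC0 mul0r. Qed.
Lemma hermC w z : herm z w = cj (herm w z).
rewrite !hermE conjC_sum; apply: eq_bigr => i _.
by rewrite conjCM conjCK mulrC.
Qed.
Lemma hermzz z : herm z z = rc (sqnorm z).
rewrite !hermE /sqnorm [rc _]rmorph_sum; apply: eq_bigr => i _ /=.
by rewrite modC_sqr; apply: cplxP; rewrite !ReImE /=; ring.
Qed.
Lemma sqnormE z : sqnorm z = re (herm z z). by rewrite hermzz. Qed.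
Lemma sqnorm0 : sqnorm (0 : V) = 0.
by rewrite sqnormE herm0r. Qed.
Lemma nr0 : nr (0 : V) = 0. by rewrite /nr sqnorm0 sqrtr0. Qed.
Lemma sqnormZ c z : sqnorm (c *: z) = modC c ^+ 2 * sqnorm z.
rewrite /sqnorm mulr_sumr; apply: eq_bigr => i _.
by rewrite mxE modCM exprMn.
Qed.
Lemma nrZ c z : nr (c *: z) = modC c * nr z.
by rewrite /nr sqnormZ sqrtrM ?sqr_ge0// sqrtr_sqr ger0_norm// modC_ge0. Qed.
Lemma nrZR r z : nr (rc r *: z) = `|r| * nr z.
by rewrite nrZ modCR. Qed.
Lemma nrN z : nr (- z) = nr z.
by rewrite -scaleN1r nrZ modCN modC1 mul1r. Qed.
Lemma nr_distC z w : nr (z - w) = nr (w - z).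
by rewrite -opprB nrN. Qed.

Lemma sqnorm_eq0 z : (sqnorm z == 0) = (z == 0).
apply/eqP/eqP => [h|->]; last exact: sqnorm0.
apply/rowP => i; rewrite mxE; apply/eqP.
have /psumr_eq0P := h => /(_ (fun _ _ => sqr_ge0 _)) /(_ i isT) /eqP.
by rewrite sqrf_eq0 modC_eq0.
Qed.

Lemma nr_eq0 z : (nr z == 0) = (z == 0).
by rewrite -sqnorm_eq0 -nr_sqr sqrf_eq0. Qed.
Lemma sqnormD z w : sqnorm (z + w) = sqnorm z + sqnorm w + 2 * re (herm z w).
rewrite !sqnormE hermDr !hermDl !ReD (hermC z w) [re (cj _)]ReImE; ring.
Qed.
Lemma sqnormB z w : sqnorm (z - w) = sqnorm z + sqnorm w - 2 * re (herm z w).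
by rewrite sqnormD hermNr ReImE -(nr_sqr (- w)) nrN nr_sqr; ring. Qed.

(* Gram determinant: [|w - (<z,w>/|z|^2) z|^2 >= 0]. *)
Lemma herm_CS z w : modC (herm z w) ^+ 2 <= sqnorm z * sqnorm w.
have [->|z0] := eqVneq z 0; first by rewrite herm0l modC0 sqnorm0 mul0r expr0n.
have sz : 0 < sqnorm z by rewrite lt_def sqnorm_eq0 z0/=.
have := sqnorm_ge0 (rc (sqnorm z) *: w - herm z w *: z).
rewrite sqnormB !sqnormZ modCR (ger0_norm (sqnorm_ge0 z)) hermZl hermZr conjCR.
rewrite (hermC z w) !ReImE /= modC_sqr => h.
by rewrite -(ler_pM2l sz); nra.
Qed.

Lemma herm_le z w : modC (herm z w) <= nr z * nr w.
rewrite -(@ler_pXn2r _ 2)// ?nnegrE// ?mulr_ge0//.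
by rewrite exprMn !nr_sqr herm_CS.
Qed.

Lemma nrD z w : nr (z + w) <= nr z + nr w.
rewrite -(@ler_pXn2r _ 2)// ?nnegrE// ?addr_ge0//.
rewrite sqrrD !nr_sqr sqnormD.
have : re (herm z w) <= nr z * nr w.
 by rewrite (le_trans _ (herm_le z w))// (le_trans (ler_norm _))// ler_Re_modC.
lra.
Qed.

Lemma nr_distD u z w : nr (z - w) <= nr (z - u) + nr (u - w).
by rewrite -(subrKA u) nrD. Qed.
Lemma nrBr z w : nr z - nr w <= nr (z - w).
by have := nrD (z - w) w; rewrite subrK lerBlDr. Qed.
Lemma modC_coord z j : modC (z 0 j) <= nr z.
rewrite -(@ler_pXn2r _ 2)// ?nnegrE// nr_sqr /sqnorm (bigD1 j)//= lerDl.
by apply: sumr_ge0 => i _; rewrite sqr_ge0.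
Qed.

Lemma nr_le_sum z : nr z <= \sum_j modC (z 0 j).
have s0 : 0 <= \sum_j modC (z 0 j) by apply: sumr_ge0.
rewrite -(@ler_pXn2r _ 2)// ?nnegrE// nr_sqr /sqnorm expr2 mulr_suml.
apply: ler_sum => i _; rewrite expr2 ler_wpM2l// (bigD1 i)//= lerDl.
by apply: sumr_ge0.
Qed.

Lemma nr_delta (j : 'I_n) : nr (delta_mx 0 j : V) = 1.
rewrite /nr /sqnorm (bigD1 j)//= mxE !eqxx modC1 expr1n big1 ?addr0 ?sqrtr1//.
by move=> i ij; rewrite mxE eqxx (negbTE ij) modC0 expr0n.
Qed.
Lemma uballE z : uball z = (nr z < 1) :> Prop.
rewrite /uball /=; congr is_true; apply/idP/idP => h.
 by rewrite -(@ltr_pXn2r _ 2)// ?nnegrE// nr_sqr expr1n.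
by rewrite -nr_sqr expr_lt1.
Qed.
Lemma uball_le z : uball z -> nr z <= 1. by rewrite uballE => /ltW. Qed.
Lemma weight_gt0 z : uball z -> 0 < weight z.
by rewrite /weight subr_gt0. Qed.
Lemma weightE z : weight z = (1 - nr z) * (1 + nr z).
by rewrite /weight -nr_sqr; ring. Qed.
Lemma weight_le1 z : weight z <= 1.
by rewrite /weight gerBl. Qed.
Lemma weight_mono (c d : R) z : c <= d -> uball z -> weight z `^ d <= weight z `^ c.
by move=> cd zB; apply: ger_powR => //; rewrite weight_gt0// weight_le1. Qed.
Lemma weight_powR_le1 (c : R) z : 0 <= c -> uball z -> weight z `^ c <= 1.
by move=> c0 zB; rewrite -(powRr0 (weight z)) weight_mono. Qed.
Lemma weight_powR_ge1 (c : R) z : c <= 0 -> uball z -> 1 <= weight z `^ c.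
by move=> c0 zB; rewrite -(powRr0 (weight z)) weight_mono. Qed.
Lemma weight_ge z : nr z <= 1 -> 1 - nr z <= weight z.
by move=> h; rewrite weightE; have := nr_ge0 z; nra. Qed.
Lemma weight_le z : nr z <= 1 -> weight z <= 2 * (1 - nr z).
by move=> h; rewrite weightE; have := nr_ge0 z; nra. Qed.
Definition dist w z : R := modC (1 - herm w z).
Lemma dist_ge0 w z : 0 <= dist w z. exact: modC_ge0. Qed.
Hint Resolve dist_ge0 : core.
Lemma distC w z : dist w z = dist z w.
by rewrite /dist (hermC w z) -{2}(conjC1 R) -conjCB modCJ. Qed.
Lemma dist_ge w z : 1 - nr w * nr z <= dist w z.
rewrite /dist (le_trans _ (modCBr _ _))// modC1 lerB//; exact: herm_le.
Qed.
Lemma Re_herm_lt w z : nr w * nr z < 1 -> 0 < re (1 - herm w z).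
move=> h; rewrite !ReImE subr_gt0 (le_lt_trans _ h)// (le_trans _ (herm_le _ _))//.
by rewrite (le_trans (ler_norm _))// ler_Re_modC.
Qed.
Lemma dist_gt0 w z : nr w <= 1 -> nr z < 1 -> 0 < dist w z.
by move=> h1 h2; rewrite (lt_le_trans _ (dist_ge w z))//; have := nr_ge0 w; have := nr_ge0 z; nra.
Qed.
Lemma dist_le2 w z : nr w <= 1 -> nr z <= 1 -> dist w z <= 2.
move=> h1 h2; rewrite /dist (le_trans (modCB _ _))// modC1 lerD2l.
by rewrite (le_trans (herm_le _ _))//; have := nr_ge0 w; have := nr_ge0 z; nra.
Qed.
Lemma weight_le_dist w z : nr w <= 1 -> nr z <= 1 -> weight w <= 2 * dist w z.
move=> h1 h2; rewrite (le_trans (weight_le h1))// ler_pM2l//.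
rewrite (le_trans _ (dist_ge w z))//; have := nr_ge0 w; have := nr_ge0 z; nra.
Qed.
Lemma weight_le_distr w z : nr w <= 1 -> nr z <= 1 -> weight z <= 2 * dist w z.
by move=> h1 h2; rewrite distC weight_le_dist. Qed.

(** Expanding [|w - z|^2] and bounding both norms by 1 leaves at most [2 Re (1 - <w,z>)]. The square
    is why Euclidean Hoelder exponents are halved with respect to [dist]. *)
Lemma sqdist_le w z : nr w <= 1 -> nr z <= 1 -> nr (w - z) ^+ 2 <= 2 * dist w z.
move=> h1 h2; rewrite nr_sqr sqnormB -!nr_sqr.
have : re (1 - herm w z) <= dist w z.
 by rewrite (le_trans (ler_norm _))// ler_Re_modC.
rewrite !ReImE; have := nr_ge0 w; have := nr_ge0 z; nra.
Qed.

(* Quasi-triangle inequality of the nonisotropic distance: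
  [1 - <z,u> = (1 - <z,w>) + <w,w-u> + <z-w,w-u>]. *)
Lemma dist_quasi z w u : nr z <= 1 -> nr w <= 1 -> nr u <= 1 ->
 dist z u <= 2 * dist z w + 4 * dist w u.
move=> hz hw hu.
have -> : dist z u = modC ((1 - herm z w) + herm w (w - u) + herm (z - w) (w - u)).
 by rewrite /dist !hermBr !hermBl; congr modC; ring.
rewrite (le_trans (modCD _ _))//.
have h1 : modC (herm (z - w) (w - u)) <= dist z w + dist w u.
 rewrite (le_trans (herm_le _ _))//.
 have := sqdist_le hz hw; have := sqdist_le hw hu.
 by have := sqr_ge0 (nr (z - w) - nr (w - u)); nra.
have h2 : modC (herm w (w - u)) <= 3 * dist w u.
 have -> : herm w (w - u) = (1 - herm w u) - rc (weight w).
  by rewrite hermBr hermzz /weight RtoCB RtoC1; ring.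
 rewrite (le_trans (modCB _ _))// modCR (ger0_norm _).
  by have := weight_le_dist hw hu; rewrite /dist; lra.
 by have := weight_ge hw; lra.
have := modCD (1 - herm z w) (herm w (w - u)); rewrite -/(dist z w); lra.
Qed.

Lemma dist_scale_le (s : R) w z : 0 <= s -> s <= 1 -> nr w <= 1 -> nr z <= 1 ->
 dist w (rc s *: z) <= dist w z + (1 - s).
move=> s0 s1 hw hz.
have -> : dist w (rc s *: z) = modC ((1 - herm w z) + rc (1 - s) * herm w z).
 by rewrite /dist hermZr; congr modC; rewrite RtoCB RtoC1; ring.
rewrite (le_trans (modCD _ _))// modCM modCR ger0_norm ?subr_ge0// lerD2l.
have : modC (herm w z) <= 1.
 by rewrite (le_trans (herm_le _ _))//; have := nr_ge0 w; have := nr_ge0 z; nra.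
have := modC_ge0 (herm w z); nra.
Qed.

(** The two sides differ by [|<w - z, z>|^2]. This bounds the Charpentier kernel, for fixed [z], by
    the Euclidean singularity [|w - z|^(1 - 2n)]. *)
Lemma Ddist_ge w z : nr z <= 1 -> nr (w - z) ^+ 2 * weight z <= Ddist w z.
move=> hz; rewrite /Ddist.
rewrite /weight modC_sqr !ReImE nr_sqr sqnormB.
have := sqr_ge0 (re (herm w z) - sqnorm z); have := sqr_ge0 (im (herm w z)); nra.
Qed.

End Hermitian.

Ltac nneg := solve [repeat (assumption || exact: modC_ge0 || exact: powR_ge0 || exact: nr_ge0 || exact: ltW || apply: mulr_ge0 || apply: addr_ge0 || apply: exprn_ge0)].
#[global] Hint Extern 0 (is_true (0 <= _ * _)) => nneg : core.
#[global] Hint Extern 0 (is_true (0 <= _ + _)) => nneg : core.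
#[global] Hint Extern 0 (is_true (0 <= _ `^ _)) => exact: powR_ge0 : core.
#[global] Hint Extern 0 (is_true (Order.le _ (EFin _))) => rewrite lee_fin; nneg : core.
#[global] Hint Extern 0 (is_true (0 <= sqnorm _)) => exact: sqnorm_ge0 : core.
#[global] Hint Extern 0 (is_true (0 <= nr _)) => exact: nr_ge0 : core.
#[global] Hint Extern 0 (is_true (0 <= dist _ _)) => exact: dist_ge0 : core.

(** * Topology and derivatives in epsilon-delta form; mean value inequalities *)

Section Bridge.
Variable R : realType.
Local Notation C := (cplx R).

Lemma ball_CE (a b : C) (e : C) : 0 < e -> ball a e b = (modC (a - b) < re e) :> Prop.
move=> e0; rewrite -ball_normE /ball_ /=.
have -> : e = rc (re e).
 by move: e0; rewrite ltcE /= => /andP[/eqP i _]; apply: cplxP; rewrite ?ReImE.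
by rewrite normC_modC /rc ltcR.
Qed.

Lemma rc_gt0 (x : R) : (0 < rc x) = (0 < x).
by rewrite /rc ltcR. Qed.
Lemma re_gt0 (e : C) : 0 < e -> 0 < re e.
by rewrite ltcE => /andP[]. Qed.

Section V.
Variable n : nat.
Local Notation V := (Cn R n).

Lemma nbhs_nrP (z : V) (A : set V) :
 nbhs z A <-> exists2 e : R, 0 < e & forall w, nr (w - z) < e -> A w.
split.
- move/nbhs_ballP => [e /= e0 zA]; exists (re e); first exact: re_gt0.
 move=> w wz; apply: zA; split=> // i j; rewrite ball_CE// ord1.
 rewrite (le_lt_trans _ wz)// nr_distC.
 by have := modC_coord (z - w) j; rewrite !mxE.
- move=> [e e0 zA]; apply/nbhs_ballP.
 (* The sum of [n] coordinates, each below [e / n.+1], stays below [e]; the successor also covers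
    [n = 0]. *)
 exists (rc (e / n.+1%:R)) => /=; first by rewrite rc_gt0 divr_gt0.
 move=> w [_ wz]; apply: zA; rewrite (le_lt_trans (nr_le_sum _))//.
 apply: (@le_lt_trans _ _ (\sum_(j < n) e / n.+1%:R)).
  apply: ler_sum => j _; have := wz ord0 j.
  rewrite ball_CE ?rc_gt0 ?divr_gt0// ReImE !mxE modC_distC; exact: ltW.
 rewrite sumr_const card_ord -[X in X < _]mulr_natr -mulrA gtr_pMr// mulrC.
 by rewrite ltr_pdivrMr// mul1r ltr_nat.
Qed.

Lemma nbhs_CP (c : C) (A : set C) :
 nbhs c A <-> exists2 e : R, 0 < e & forall w, modC (w - c) < e -> A w.
split.
- move/nbhs_ballP => [e /= e0 zA]; exists (re e); first exact: re_gt0.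
 by move=> w wz; apply: zA; rewrite ball_CE// modC_distC.
- move=> [e e0 zA]; apply/nbhs_ballP.
 exists (rc e) => /=; first by rewrite rc_gt0.
 by move=> w; rewrite ball_CE ?rc_gt0// modC_distC; exact: zA.
Qed.

Lemma contP (phi : V -> C) z : cont_at phi z <->
 (forall e : R, 0 < e -> exists2 d : R, 0 < d &
  forall w, nr (w - z) < d -> modC (phi w - phi z) < e).
split.
- move=> h e e0.
 have /h /nbhs_nrP[d d0 hd] : nbhs (phi z) [set c | modC (c - phi z) < e].
  by apply/nbhs_CP; exists e.
 by exists d.
- move=> h A /nbhs_CP[e e0 hA]; apply/nbhs_nrP.
 by have [d d0 hd] := h e e0; exists d => // w wz; exact/hA/hd.
Qed.

Lemma within_contP (S : set V) (phi : V -> C) : {within S, continuous phi} <->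
 (forall z, S z -> forall e : R, 0 < e -> exists2 d : R, 0 < d &
  forall w, S w -> nr (w - z) < d -> modC (phi w - phi z) < e).
rewrite subspace_continuousP; split.
- move=> h z Sz e e0.
 have /(h z Sz) /nbhs_nrP[d d0 hd] : nbhs (phi z) [set c | modC (c - phi z) < e].
  by apply/nbhs_CP; exists e.
 by exists d => // w Sw /hd; apply.
- move=> h z Sz A /nbhs_CP[e e0 hA]; rewrite /fmap /within /=; apply/nbhs_nrP.
 by have [d d0 hd] := h z Sz e e0; exists d => // w wz Sw; exact/hA/hd.
Qed.

End V.

(** Stated over any numeric field because it serves both the real derivative [rder] and, later, the
    complex derivative [cdiff]. *)
Lemma is_deriveP (K : numFieldType) (f : K -> K) (t d : K) : is_derive t (1 : K) f d <->
 (forall e : K, 0 < e -> exists2 del : K, 0 < del & forall h : K, `|h| < del ->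
   `|f (t + h) - f t - h * d| <= e * `|h|).
split.
- move=> [df <-] e e0; move: df => /derivableP[df _].
 have : h^-1 *: (f (h + t) - f t) @[h --> 0^'] --> 'D_1 f t.
  have := df; rewrite /derivable => /cvg_ex[l hl].
  move: (hl); rewrite /derive => /cvg_lim -> //.
  by under eq_fun do rewrite -{1}[X in f (X + t)]mulr1; exact: hl.
 move=> /cvgrPdist_le /(_ e e0)[del /= del0 hdel].
 exists del => // h hh; have [->|h0] := eqVneq h 0.
  by rewrite addr0 subrr mul0r subrr normr0 mulr0.
 have := hdel h; rewrite /= sub0r normrN => /(_ hh h0).
 rewrite -(ler_pM2r (x := `|h|)) ?normr_gt0// -normrM mulrBl.
 rewrite /GRing.scale /= mulrAC mulVf// mul1r distrC (addrC h).
 by rewrite (mulrC ('D_1 f t)).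
- move=> H.
 have : h^-1 *: (f (h + t) - f t) @[h --> 0^'] --> d.
  apply/cvgrPdist_le => e e0; have [del del0 hdel] := H e e0.
  exists del => //= h; rewrite /= sub0r normrN => hh h0.
  rewrite -(ler_pM2r (x := `|h|)) ?normr_gt0// -normrM mulrBl.
  rewrite /GRing.scale /= mulrAC mulVf// mul1r distrC (addrC h) (mulrC d).
  exact: hdel.
 move=> hc; have hc' : h^-1 *: ((f \o shift t) (h *: 1) - f t) @[h --> 0^'] --> d.
  rewrite (_ : (fun h : K => _) = (fun h => h^-1 *: (f (h + t) - f t)))//.
  by apply/funext => h /=; rewrite [h%:A]mulr1.
 split; first by apply/cvg_ex; exists d.
 exact: cvg_lim hc'.
Qed.

Definition rder (f : R -> R) (t d : R) : Prop := is_derive t (1 : R) f d.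
Lemma rder_eq f t d d' : rder f t d -> d = d' -> rder f t d'.
by move=> h <-. Qed.
Lemma rderD f g t d d' : rder f t d -> rder g t d' ->
 rder (fun s => f s + g s) t (d + d').
by move=> h1 h2; exact: (is_deriveD h1 h2). Qed.
Lemma rderB f g t d d' : rder f t d -> rder g t d' ->
 rder (fun s => f s - g s) t (d - d').
by move=> h1 h2; exact: (is_deriveB h1 h2). Qed.
Lemma rderM f g t d d' : rder f t d -> rder g t d' ->
 rder (fun s => f s * g s) t (d * g t + f t * d').
move=> h1 h2; apply: (is_derive_eq (is_deriveM h1 h2)).
by rewrite /GRing.scale /=; ring.
Qed.
Lemma rder_cst c t : rder (fun=> c) t 0.
exact: is_derive_cst. Qed.
Lemma rder_id t : rder (fun s => s) t 1.
exact: is_derive_id. Qed.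
Lemma rderZ c f t d : rder f t d -> rder (fun s => c * f s) t (c * d).
by move=> h; apply: rder_eq (rderM (rder_cst c t) h) _; ring. Qed.
Lemma rder_comp f g t d dg : rder g t dg -> rder f (g t) d ->
 rder (fun s => f (g s)) t (d * dg).
by move=> hg hf; exact: (is_derive1_comp hf hg). Qed.
(** Derivative of a complex-valued curve in a real variable. The little-o form suits difference
    quotients and the chain rule; [cderP] links it to the pair of real derivatives in
    [dir_derivable]. *)
Definition cder (u : R -> C) (t : R) (d : C) := forall e : R, 0 < e ->
 exists2 del : R, 0 < del & forall h : R, `|h| < del ->
   modC (u (t + h) - u t - rc h * d) <= e * `|h|.

Lemma cderP u t d : cder u t d <->
 rder (fun s => re (u s)) t (re d) /\
 rder (fun s => im (u s)) t (im d).
split.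
- move=> H; split; apply/is_deriveP => e e0; have [del del0 hdel] := H e e0;
  exists del => // h /hdel; apply: le_trans.
 + by apply: le_trans (ler_Re_modC _); rewrite !ReImE mul0r subr0.
 + by apply: le_trans (ler_Im_modC _); rewrite !ReImE mul0r addr0.
- move=> [/is_deriveP hr /is_deriveP hi] e e0.
 have e2 : 0 < e / 2 by rewrite divr_gt0.
 have [d1 d10 h1] := hr _ e2; have [d2 d20 h2] := hi _ e2.
 exists (Num.min d1 d2) => [|h]; rewrite lt_min ?d10// => /andP[k1 k2].
 rewrite (le_trans (modC_le_ri _))// !ReImE !mul0r subr0 addr0.
 by have := h1 h k1; have := h2 h k2; lra.
Qed.

Lemma cder_near u v t d : cder u t d ->
 (exists2 r : R, 0 < r & forall h : R, `|h| < r -> u (t + h) = v (t + h)) ->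
 cder v t d.
move=> H [r r0 hr] e e0; have [del del0 hdel] := H e e0.
exists (Num.min del r) => [|h]; rewrite lt_min ?del0// => /andP[k1 k2].
rewrite -hr//; have := hr 0; rewrite normr0 addr0 => <-//.
exact: hdel.
Qed.

Lemma eq_cder u v t d : cder u t d -> u =1 v -> cder v t d.
by move=> h uv; apply: cder_near h _; exists 1. Qed.
Lemma cder_cst c t : cder (fun _ => c) t 0.
by apply/cderP; split; apply: rder_cst. Qed.

Lemma cderD u v t d d' : cder u t d -> cder v t d' ->
 cder (fun s => u s + v s) t (d + d').
move=> /cderP[? ?] /cderP[? ?]; apply/cderP; rewrite !ReImE; split.
- by under eq_fun do rewrite ReImE; exact: rderD.
- by under eq_fun do rewrite ReImE; exact: rderD.
Qed.

Lemma cderM u v t d d' : cder u t d -> cder v t d' ->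
 cder (fun s => u s * v s) t (d * v t + u t * d').
move=> /cderP[h1 h2] /cderP[h3 h4]; apply/cderP; split.
- under eq_fun do rewrite ReImE.
 apply: rder_eq (rderB (rderM h1 h3) (rderM h2 h4)) _.
 by rewrite !ReImE; ring.
- under eq_fun do rewrite ReImE.
 apply: rder_eq (rderD (rderM h1 h4) (rderM h2 h3)) _.
 by rewrite !ReImE; ring.
Qed.

Lemma cderZ c u t d : cder u t d -> cder (fun s => c * u s) t (c * d).
by move=> h; have := cderM (cder_cst c t) h; rewrite mul0r add0r. Qed.
Lemma cderN u t d : cder u t d -> cder (fun s => - u s) t (- d).
move=> h; have := cderZ (-1) h; rewrite mulN1r => h'.
by apply: eq_cder h' _ => s; rewrite mulN1r.
Qed.
Lemma cderB u v t d d' : cder u t d -> cder v t d' ->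
 cder (fun s => u s - v s) t (d - d').
by move=> h1 /cderN; exact: cderD. Qed.
Lemma cder_rc (f : R -> R) t d : rder f t d ->
 cder (fun s => rc (f s)) t (rc d).
by move=> h; apply/cderP; split=> //; exact: rder_cst. Qed.
Lemma cder_cj u t d : cder u t d -> cder (fun s => cj (u s)) t (cj d).
move=> H e /H[del del0 h]; exists del => // k /h.
by rewrite -(modCJ (_ - _)) !conjCB conjCM conjCR.
Qed.

Lemma cder_comp u (g : R -> R) t d dg : rder g t dg ->
 cder u (g t) d -> cder (fun s => u (g s)) t (rc dg * d).
move=> hg /cderP[h1 h2]; apply/cderP; split.
- by apply: rder_eq (rder_comp hg h1) _; rewrite !ReImE; ring.
- by apply: rder_eq (rder_comp hg h2) _; rewrite !ReImE; ring.
Qed.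

Lemma cder_cont u t d : cder u t d -> forall e : R, 0 < e ->
 exists2 del : R, 0 < del & forall h : R, `|h| < del -> modC (u (t + h) - u t) < e.
move=> H e e0; have [del del0 hd] := H 1 ltr01.
have M0 : 0 < 1 + modC d by rewrite ltr_pwDl.
exists (Num.min del (e / (1 + modC d))) => [|h].
 by rewrite lt_min del0 divr_gt0.
rewrite lt_min => /andP[/hd k1 k2].
have -> : u (t + h) - u t = (u (t + h) - u t - rc h * d) + rc h * d by ring.
rewrite (le_lt_trans (modCD _ _))// modCM modCR.
move: k2; rewrite ltr_pdivlMr// => k2; nra.
Qed.

Lemma real_incr (f df : R -> R) (a b : R) : a <= b ->
 (forall t : R, a <= t <= b -> rder f t (df t)) ->
 (forall t : R, a <= t <= b -> 0 <= df t) -> f a <= f b.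
rewrite le_eqVlt => /orP[/eqP -> //|ab] hf df0.
have [|c|c] := MVT ab (f := f) (df := df).
- by move=> x; rewrite in_itv /= => /andP[x1 x2]; apply: hf; rewrite !ltW.
- apply: derivable_within_continuous => x; rewrite in_itv /= => xab.
 by have [] := hf x xab.
- rewrite in_itv /= => /andP[c1 c2] e; rewrite -subr_ge0 e mulr_ge0 ?subr_ge0 ?(ltW ab)//.
 by rewrite df0// !ltW.
Qed.

(* The factor 2 is lost by treating the real and imaginary parts separately. *)
Lemma cder_le (u du : R -> C) (g dg : R -> R) (a b : R) : a <= b ->
 (forall t : R, a <= t <= b -> cder u t (du t)) ->
 (forall t : R, a <= t <= b -> rder g t (dg t)) ->
 (forall t : R, a <= t <= b -> modC (du t) <= dg t) ->
 modC (u b - u a) <= 2 * (g b - g a).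
move=> ab hu hg hd.
have aux (f df : R -> R) : (forall t : R, a <= t <= b -> rder f t (df t)) ->
  (forall t : R, a <= t <= b -> `|df t| <= dg t) -> `|f b - f a| <= g b - g a.
 move=> hf hdf; rewrite ler_norml; apply/andP; split.
 - have : g a + f a <= g b + f b.
   apply: (@real_incr (fun t => g t + f t) (fun t => dg t + df t)) => // t tab.
    by apply: rderD; [exact: hg|exact: hf].
   by have := hdf t tab; rewrite ler_norml; lra.
  lra.
 - have : g a - f a <= g b - f b.
   apply: (@real_incr (fun t => g t - f t) (fun t => dg t - df t)) => // t tab.
    by apply: rderB; [exact: hg|exact: hf].
   by have := hdf t tab; rewrite ler_norml; lra.
  lra.
rewrite (le_trans (modC_le_ri _))// !ReImE.
have := aux (fun t => re (u t)) (fun t => re (du t)).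
have := aux (fun t => im (u t)) (fun t => im (du t)).
move=> h1 h2.
have : `|im (u b) - im (u a)| <= g b - g a.
 apply: h1 => t tab; first by have /cderP[] := hu t tab.
 exact: le_trans (ler_Im_modC _) (hd t tab).
have : `|re (u b) - re (u a)| <= g b - g a.
 apply: h2 => t tab; first by have /cderP[] := hu t tab.
 exact: le_trans (ler_Re_modC _) (hd t tab).
lra.
Qed.

Lemma cder_lip (u du : R -> C) (M a b : R) : a <= b ->
 (forall t : R, a <= t <= b -> cder u t (du t)) ->
 (forall t : R, a <= t <= b -> modC (du t) <= M) ->
 modC (u b - u a) <= 2 * M * (b - a).
move=> ab hu hd.
rewrite -mulrA mulrBr.
apply: (@cder_le u du (fun t => M * t) (fun=> M)) => // t tab.
by apply: rder_eq (rderZ M (rder_id t)) _; rewrite mulr1.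
Qed.

Section Dir.
Variable n : nat.
Local Notation V := (Cn R n).

Lemma dirP (phi : V -> C) v z d :
 cder (fun s => phi (z + rc s *: v)) 0 d <->
 dir_derivable v phi z /\ dir_deriv v phi z = d.
rewrite /dir_derivable /dir_deriv (_ : lineRe phi z v = fun s => re (phi (z + rc s *: v)))//.
rewrite (_ : lineIm phi z v = fun s => im (phi (z + rc s *: v)))// !derive1E; split=> [/cderP[[h1 e1] [h2 e2]]|[[h1 h2] <-]].
 rewrite e1 e2; apply: (conj (conj h1 h2)); exact: cplxP.
apply: (iffRL (cderP _ _ _)); exact: (conj (DeriveDef h1 erefl) (DeriveDef h2 erefl)).
Qed.

Lemma cder_shift (u : R -> C) t d :
 cder u t d <-> cder (fun s => u (t + s)) 0 d.
by split=> H e /H[del del0 h]; exists del => // k /h; rewrite addr0 add0r.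
Qed.

Lemma dir_line (phi : V -> C) v z t d :
 dir_derivable v phi (z + rc t *: v) -> dir_deriv v phi (z + rc t *: v) = d ->
 cder (fun s => phi (z + rc s *: v)) t d.
move=> h1 h2; have : cder (fun s => phi ((z + rc t *: v) + rc s *: v)) 0 d.
 by apply/dirP.
move=> h; apply/cder_shift; apply: eq_cder h _ => s.
by rewrite RtoCD scalerDl addrA.
Qed.

End Dir.

End Bridge.

(** * The classes C^k: products, total differential, chain rule, symmetry of second derivatives *)

Section SmoothClasses.
Variables (R : realType) (n : nat).
Local Notation C := (cplx R).
Local Notation V := (Cn R n).
Implicit Types (U : set V) (phi psi : V -> C) (z w v h : V).

Definition openU U := forall z, U z -> exists2 r : R, 0 < r &
 forall w, nr (w - z) < r -> U w.
Definition crd v := exists j, v = xdir R j \/ v = ydir R j.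
Lemma xdirE j : xdir R j = delta_mx 0 j :> V. by []. Qed.
Lemma ydirE j : ydir R j = ii R *: delta_mx 0 j :> V. by []. Qed.
Lemma addKl (A : zmodType) (x y : A) : x + y - x = y.
by rewrite addrC addKr. Qed.
Lemma addKl2 (A : zmodType) (x y z : A) : x + y + z - x = y + z.
by rewrite -(addrA x) addKl. Qed.
Lemma addr_perm4 (A : zmodType) (z a b p : A) : z + (a + b + p) = z + p + b + a.
by rewrite !addrA addrAC [z + a + p]addrAC addrAC. Qed.
Lemma nr_crd v : crd v -> nr v = 1.
by move=> [j [->|->]]; rewrite ?ydirE ?nrZ ?modCi ?mul1r nr_delta.
Qed.
Lemma openU_uball : openU (@uball R n).
move=> z; rewrite uballE => z1; exists (1 - nr z); first by rewrite subr_gt0.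
by move=> w wz; rewrite uballE; have := nrBr w z; lra.
Qed.

Lemma cder_line_loc U phi psi z v t d : openU U ->
 (forall w, U w -> phi w = psi w) -> U (z + rc t *: v) ->
 cder (fun s => phi (z + rc s *: v)) t d ->
 cder (fun s => psi (z + rc s *: v)) t d.
move=> oU e Uz H; apply: cder_near H _; have [r r0 hr] := oU _ Uz.
have nv : 0 < nr v + 1 by rewrite ltr_wpDl.
exists (r / (nr v + 1)) => [|h hh]; first by rewrite divr_gt0.
apply: e; apply: hr; rewrite RtoCD scalerDl addrA addKl nrZR.
move: hh; rewrite ltr_pdivlMr//; have := nr_ge0 v; have := normr_ge0 h; nra.
Qed.

Lemma dir_loc U phi psi z v : openU U -> (forall w, U w -> phi w = psi w) ->
 U z -> dir_derivable v phi z ->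
 dir_derivable v psi z /\ dir_deriv v psi z = dir_deriv v phi z.
move=> oU e Uz hp; apply/dirP; apply: (cder_line_loc oU e).
 by rewrite scale0r addr0.
by apply/dirP.
Qed.

Lemma Ck_cont k U phi : Ck k U phi -> forall z, U z -> cont_at phi z.
by case: k => [|k] []. Qed.
Lemma Ck_der k U phi v z : Ck k.+1 U phi -> crd v -> U z -> dir_derivable v phi z.
by move=> [_ h] [j e] Uz; have [] := h j v e; move=> /(_ z Uz). Qed.
Lemma Ck_dir k U phi v : Ck k.+1 U phi -> crd v -> Ck k U (dir_deriv v phi).
by move=> [_ h] [j e]; have [] := h j v e. Qed.

Lemma CkS_intro k U phi : (forall z, U z -> cont_at phi z) ->
 (forall v, crd v -> (forall z, U z -> dir_derivable v phi z)
           /\ Ck k U (dir_deriv v phi)) -> Ck k.+1 U phi.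
by move=> hc hd; split=> // j v e; apply: hd; exists j. Qed.

Lemma Ck_ext k U phi psi : openU U -> (forall w, U w -> phi w = psi w) ->
 Ck k U phi -> Ck k U psi.
move=> oU; have c k' (f g : V -> C) : (forall w, U w -> f w = g w) -> Ck k' U f -> Ck 0 U g.
 move=> e hk; split=> // z Uz; apply/contP => eps eps0.
 have /contP/(_ _ eps0)[d d0 hd] := Ck_cont hk Uz.
 have [r r0 hr] := oU _ Uz; exists (Num.min d r); first by rewrite lt_min d0.
 by move=> w; rewrite lt_min -(e z Uz) => /andP[/hd h1 /hr /e <-].
elim: k phi psi => [|k ih] phi psi e hk; first exact: c e hk.
apply: CkS_intro => [|v cv]; first exact: Ck_cont (c _ _ _ e hk).
split=> [z Uz|]; first by have [] := dir_loc oU e Uz (Ck_der hk cv Uz).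
apply: ih (Ck_dir hk cv) => w Uw.
by have [_ ->] := dir_loc oU e Uw (Ck_der hk cv Uw).
Qed.

Lemma Ck_le1 k U phi : Ck k.+1 U phi -> Ck k U phi.
elim: k phi => [|k ih] phi hk; first by split=> //; exact: Ck_cont hk.
apply: CkS_intro => [|v cv]; first exact: Ck_cont hk.
by split=> [z Uz|]; [exact: Ck_der hk cv Uz|exact/ih/(Ck_dir hk cv)].
Qed.

Lemma Ck_le k l U phi : (l <= k)%N -> Ck k U phi -> Ck l U phi.
elim: k => [|k ih]; first by rewrite leqn0 => /eqP ->.
rewrite leq_eqVlt => /orP[/eqP -> //|lk] /Ck_le1; exact: ih.
Qed.

Lemma Ck_cst k U c : Ck k U (fun=> c).
elim: k c => [|k ih] c.
 by split=> // z _; apply/contP => e e0; exists 1 => // w _; rewrite subrr modC0.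
apply: CkS_intro => [|v cv].
 by move=> z _; apply/contP => e e0; exists 1 => // w _; rewrite subrr modC0.
have hd z : dir_derivable v (fun=> c) z /\ dir_deriv v (fun=> c) z = 0.
 by apply/dirP; exact: cder_cst.
split=> [z _|]; first by have [] := hd z.
by rewrite (_ : dir_deriv v _ = fun=> 0)//; apply/funext => z; have [] := hd z.
Qed.

Lemma cont_add phi psi z : cont_at phi z -> cont_at psi z ->
 cont_at (fun w => phi w + psi w) z.
move=> /contP h1 /contP h2; apply/contP => e e0.
have e2 : 0 < e / 2 by rewrite divr_gt0.
have [d1 d10 k1] := h1 _ e2; have [d2 d20 k2] := h2 _ e2.
exists (Num.min d1 d2) => [|w]; first by rewrite lt_min d10.
rewrite lt_min => /andP[/k1 l1 /k2 l2].
have -> : phi w + psi w - (phi z + psi z) = (phi w - phi z) + (psi w - psi z) by ring.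
by rewrite (le_lt_trans (modCD _ _))//; lra.
Qed.

Lemma cont_mul phi psi z : cont_at phi z -> cont_at psi z ->
 cont_at (fun w => phi w * psi w) z.
move=> /contP h1 /contP h2; apply/contP => e e0.
pose A := modC (phi z) + 1; pose B := modC (psi z) + 1.
have A0 : 0 < A by rewrite ltr_wpDl. have B0 : 0 < B by rewrite ltr_wpDl.
have eB : 0 < e / 2 / B by rewrite divr_gt0// divr_gt0.
have eA : 0 < Num.min 1 (e / 2 / A) by rewrite lt_min ltr01/= divr_gt0// divr_gt0.
have [d1 d10 k1] := h1 _ eB; have [d2 d20 k2] := h2 _ eA.
exists (Num.min d1 d2) => [|w]; first by rewrite lt_min d10.
rewrite lt_min => /andP[/k1 l1 /k2]; rewrite lt_min => /andP[l2 l3].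
have -> : phi w * psi w - phi z * psi z =
 (phi w - phi z) * psi w + phi z * (psi w - psi z) by ring.
rewrite (le_lt_trans (modCD _ _))// !modCM.
have hw : modC (psi w) <= B by have := modCBr (psi w) (psi z); rewrite /B; lra.
move: l1 l3; rewrite !ltr_pdivlMr// => l1 l3.
have := modC_ge0 (phi w - phi z); have := modC_ge0 (psi w - psi z).
have := modC_ge0 (phi z); have := modC_ge0 (psi w); rewrite /A in l3; nra.
Qed.

Lemma dir_add phi psi v z : dir_derivable v phi z -> dir_derivable v psi z ->
 dir_derivable v (fun w => phi w + psi w) z /\
 dir_deriv v (fun w => phi w + psi w) z = dir_deriv v phi z + dir_deriv v psi z.
by move=> h1 h2; apply/dirP; apply: cderD; apply/dirP. Qed.

Lemma dir_mul phi psi v z : dir_derivable v phi z -> dir_derivable v psi z ->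
 dir_derivable v (fun w => phi w * psi w) z /\
 dir_deriv v (fun w => phi w * psi w) z =
  dir_deriv v phi z * psi z + phi z * dir_deriv v psi z.
move=> h1 h2; apply/dirP.
have /dirP a : dir_derivable v phi z /\ dir_deriv v phi z = dir_deriv v phi z by [].
have /dirP b : dir_derivable v psi z /\ dir_deriv v psi z = dir_deriv v psi z by [].
by have := cderM a b; rewrite scale0r addr0.
Qed.

Lemma Ck_add k U phi psi : openU U -> Ck k U phi -> Ck k U psi ->
 Ck k U (fun w => phi w + psi w).
move=> oU; elim: k phi psi => [|k ih] phi psi h1 h2.
 by split=> // z Uz; apply: cont_add; [exact: Ck_cont h1 _ Uz|exact: Ck_cont h2 _ Uz].
apply: CkS_intro => [z Uz|v cv].
 by apply: cont_add; [exact: Ck_cont h1 _ Uz|exact: Ck_cont h2 _ Uz].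
have hd z : U z -> _ := fun Uz => dir_add (Ck_der h1 cv Uz) (Ck_der h2 cv Uz).
split=> [z /hd[]//|]; apply: (Ck_ext oU _ (ih _ _ (Ck_dir h1 cv) (Ck_dir h2 cv))).
by move=> z /hd[_ ->].
Qed.

Lemma Ck_mul k U phi psi : openU U -> Ck k U phi -> Ck k U psi ->
 Ck k U (fun w => phi w * psi w).
move=> oU; elim: k phi psi => [|k ih] phi psi h1 h2.
 by split=> // z Uz; apply: cont_mul; [exact: Ck_cont h1 _ Uz|exact: Ck_cont h2 _ Uz].
apply: CkS_intro => [z Uz|v cv].
 by apply: cont_mul; [exact: Ck_cont h1 _ Uz|exact: Ck_cont h2 _ Uz].
have hd z : U z -> _ := fun Uz => dir_mul (Ck_der h1 cv Uz) (Ck_der h2 cv Uz).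
split=> [z /hd[]//|];
by apply: (Ck_ext oU _ (Ck_add oU (ih _ _ (Ck_dir h1 cv) (Ck_le1 h2)) (ih _ _ (Ck_le1 h1) (Ck_dir h2 cv)))) => z /hd[_ ->].
Qed.

Lemma Ck_scale k U c phi : openU U -> Ck k U phi -> Ck k U (fun w => c * phi w).
by move=> oU; apply: Ck_mul => //; exact: Ck_cst. Qed.

Lemma Ck_sum k U I (r : seq I) (F : I -> V -> C) : openU U ->
 (forall i, Ck k U (F i)) -> Ck k U (fun w => \sum_(i <- r) F i w).
move=> oU h; elim: r => [|i r ih].
 by apply: (Ck_ext oU _ (Ck_cst k U 0)) => w _; rewrite big_nil.
by apply: (Ck_ext oU _ (Ck_add oU (h i) ih)) => w _; rewrite big_cons.
Qed.

Lemma cder_coord z v t j : cder (fun s => (z + rc s *: v) 0 j) t (v 0 j).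
have h : cder (fun s => z 0 j + rc s * v 0 j) t (0 + (rc 1 * v 0 j + rc t * 0)).
 apply: cderD (cder_cst _ _) _; apply: cderM (cder_cst _ _).
 exact: cder_rc (rder_id t).
move: h; rewrite add0r RtoC1 mul1r mulr0 addr0 => h.
by apply: eq_cder h _ => s; rewrite !mxE.
Qed.

Lemma Ck_coord k U j : Ck k U (fun w => w 0 j).
have hc z : cont_at (fun w : V => (w 0 j : C)) z.
 apply/contP => e e0; exists e => // w; apply: le_lt_trans.
 by have := modC_coord (w - z) j; rewrite !mxE.
case: k => // k.
apply: CkS_intro => [z _|v cv]; first exact: hc.
have hd z : dir_derivable v (fun w => (w 0 j : C)) z /\
      dir_deriv v (fun w => (w 0 j : C)) z = v 0 j.
 by apply/dirP; exact: cder_coord.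
split=> [z _|]; first by have [] := hd z.
rewrite (_ : dir_deriv v _ = fun=> v 0 j); first exact: Ck_cst.
by apply/funext => z; have [] := hd z.
Qed.

Lemma crd_x j : crd (xdir R j). by exists j; left. Qed.
Lemma crd_y j : crd (ydir R j). by exists j; right. Qed.
Hint Resolve crd_x crd_y : core.

Lemma dzE j phi z : dz j phi z =
 (dir_deriv (xdir R j) phi z - ii R * dir_deriv (ydir R j) phi z) / 2.
by []. Qed.
Lemma dbarE j phi z : dbar j phi z =
 (dir_deriv (xdir R j) phi z + ii R * dir_deriv (ydir R j) phi z) / 2.
by []. Qed.

Lemma reimE (c : C) : c = rc (re c) + ii R * rc (im c).
by apply: cplxP; rewrite !ReImE; ring. Qed.
Lemma xyE (c : C) j : rc (re c) *: xdir R j + rc (im c) *: ydir R j =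
 c *: delta_mx 0 j :> V.
by rewrite ydirE xdirE scalerA -scalerDl {3}(reimE c) (mulrC (ii R)). Qed.
Lemma sum_xy h : \sum_(j <- enum 'I_n)
 (rc (re (h 0 j)) *: xdir R j + rc (im (h 0 j)) *: ydir R j) = h.
rewrite big_enum /= [RHS]row_sum_delta; apply: eq_bigr => j _; exact: xyE.
Qed.

Opaque dir_deriv dz dbar dir_derivable xdir ydir.

Lemma ii2 : ii R * ii R = -1.
by apply: cplxP; rewrite !ReImE; ring. Qed.
Lemma dxE j phi z : dir_deriv (xdir R j) phi z = dz j phi z + dbar j phi z.
by rewrite dzE dbarE -mulrDl addrACA addNr addr0 -mulr2n -[_ *+ 2]mulr_natr mulfK ?pnatr_eq0. Qed.

Lemma dyE j phi z : dir_deriv (ydir R j) phi z = ii R * (dz j phi z - dbar j phi z).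
rewrite dzE dbarE; move: (dir_deriv _ _ _) (dir_deriv _ _ _) => a b.
have -> : (a - ii R * b) / 2 - (a + ii R * b) / 2 = - (ii R * b).
 by field.
by rewrite mulrN mulrA ii2 mulN1r opprK.
Qed.

Lemma Ck_dz k U phi j : openU U -> Ck k.+1 U phi -> Ck k U (dz j phi).
move=> oU h;
have := Ck_scale (2^-1) oU (Ck_add oU (Ck_dir h (crd_x j)) (Ck_scale (- ii R) oU (Ck_dir h (crd_y j)))).
by apply: Ck_ext => // w _; rewrite dzE mulNr mulrC.
Qed.

Lemma Ck_dbar k U phi j : openU U -> Ck k.+1 U phi -> Ck k U (dbar j phi).
move=> oU h;
have := Ck_scale (2^-1) oU (Ck_add oU (Ck_dir h (crd_x j)) (Ck_scale (ii R) oU (Ck_dir h (crd_y j)))).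
by apply: Ck_ext => // w _; rewrite dbarE mulrC.
Qed.

Lemma dz_loc U phi psi z j : openU U -> (forall w, U w -> phi w = psi w) ->
 U z -> Ck 1 U phi -> dz j psi z = dz j phi z /\ dbar j psi z = dbar j phi z.
move=> oU e Uz h; rewrite !dzE !dbarE.
have [_ ->] := dir_loc oU e Uz (Ck_der h (crd_x j) Uz).
by have [_ ->] := dir_loc oU e Uz (Ck_der h (crd_y j) Uz).
Qed.

Lemma dz_add U phi psi z j : U z -> Ck 1 U phi -> Ck 1 U psi ->
 dz j (fun w => phi w + psi w) z = dz j phi z + dz j psi z.
move=> Uz h1 h2; rewrite !dzE.
have [_ ->] := dir_add (Ck_der h1 (crd_x j) Uz) (Ck_der h2 (crd_x j) Uz).
have [_ ->] := dir_add (Ck_der h1 (crd_y j) Uz) (Ck_der h2 (crd_y j) Uz).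
by rewrite -mulrDl mulrDr opprD addrACA.
Qed.

Lemma dzbar_mul U phi psi z j : U z -> Ck 1 U phi -> Ck 1 U psi ->
 dz j (fun w => phi w * psi w) z = dz j phi z * psi z + phi z * dz j psi z /\
 dbar j (fun w => phi w * psi w) z = dbar j phi z * psi z + phi z * dbar j psi z.
move=> Uz h1 h2; rewrite !dzE !dbarE.
have [_ ->] := dir_mul (Ck_der h1 (crd_x j) Uz) (Ck_der h2 (crd_x j) Uz).
have [_ ->] := dir_mul (Ck_der h1 (crd_y j) Uz) (Ck_der h2 (crd_y j) Uz).
move: (dir_deriv _ _ _) (dir_deriv _ _ _) (dir_deriv _ _ _) (dir_deriv _ _ _) (phi z) (psi z).
by move=> a b c d e f; split; ring.
Qed.
Lemma dz_mul U phi psi z j : U z -> Ck 1 U phi -> Ck 1 U psi ->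
 dz j (fun w => phi w * psi w) z = dz j phi z * psi z + phi z * dz j psi z.
by move=> Uz h1 h2; case: (dzbar_mul j Uz h1 h2). Qed.
Lemma dbar_mul U phi psi z j : U z -> Ck 1 U phi -> Ck 1 U psi ->
 dbar j (fun w => phi w * psi w) z = dbar j phi z * psi z + phi z * dbar j psi z.
by move=> Uz h1 h2; case: (dzbar_mul j Uz h1 h2). Qed.

Lemma dz_cst c z j : dz j (fun=> c) z = 0.
have hd v : dir_derivable v (fun _ : V => c) z /\ dir_deriv v (fun=> c) z = 0.
 by apply/dirP; exact: cder_cst.
have [_ ex] := hd (xdir R j); have [_ ey] := hd (ydir R j).
by rewrite dzE ex ey mulr0 subr0 mul0r.
Qed.

Lemma dz_coord i z j : dz j (fun w => w 0 i) z = (i == j)%:R.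
have hd v : dir_derivable v (fun w => (w 0 i : C)) z /\
      dir_deriv v (fun w => (w 0 i : C)) z = v 0 i.
 by apply/dirP; exact: cder_coord.
have [_ ex] := hd (xdir R j); have [_ ey] := hd (ydir R j).
rewrite dzE ex ey xdirE ydirE !mxE eqxx /= mulrA ii2.
by case: (i == j) => /=; field.
Qed.

(** Mean value inequality for [phi (p + t a v) - t a d_v phi(z)] in [t]. The point is uniformity in
    the base point [p], which [frechet] needs when it changes one coordinate after another. *)
Lemma C1_line U phi v z : openU U -> Ck 1 U phi -> crd v -> U z ->
 forall e : R, 0 < e -> exists2 d : R, 0 < d & forall p (a : R),
  nr (p - z) < d -> `|a| < d ->
  modC (phi (p + rc a *: v) - phi p - rc a * dir_deriv v phi z) <= e * `|a|.
move=> oU h cv Uz e e0; have [r r0 hr] := oU _ Uz.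
have /contP/(_ _ (divr_gt0 e0 (ltr0n R 2)))[d d0 hd] := Ck_cont (Ck_dir h cv) Uz.
pose m := Num.min d r; have m0 : 0 < m by rewrite lt_min d0.
exists (m / 2); first by rewrite divr_gt0.
move=> p a hp ha.
have near t : 0 <= t <= 1 -> nr (p + rc (t * a) *: v - z) < m.
 move=> /andP[t0 t1]; rewrite addrAC (le_lt_trans (nrD _ _))// nrZR (nr_crd cv) mulr1.
 by rewrite normrM (ger0_norm t0); have := normr_ge0 a; nra.
have hl t : 0 <= t <= 1 -> cder (fun s => phi (p + rc (s * a) *: v) - rc (s * a) * dir_deriv v phi z) t
  (rc a * (dir_deriv v phi (p + rc (t * a) *: v) - dir_deriv v phi z)).
 move=> t01; rewrite mulrBr.
 have hs : rder (fun s => s * a) t a.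
  by apply: rder_eq (rderM (rder_id t) (rder_cst a t)) _; ring.
 apply: cderB.
  apply: (cder_comp hs (u := fun s => phi (p + rc s *: v))); apply: dir_line => //.
  apply: (Ck_der h cv); apply: hr.
  by have := near t t01; rewrite lt_min => /andP[].
 have := cderM (cder_rc hs) (cder_cst (dir_deriv v phi z) t).
 by rewrite mulr0 addr0.
have e0a : rc (0 * a) = 0 by rewrite mul0r.
have e1a : rc (1 * a) = rc a by rewrite mul1r.
have := @cder_lip _ _ _ (e / 2 * `|a|) 0 1 ler01 hl.
rewrite e0a e1a scale0r addr0 mul0r !subr0 mulr1.
have -> : 2 * (e / 2 * `|a|) = e * `|a| by field.
have -> : phi (p + rc a *: v) - rc a * dir_deriv v phi z - phi p =
 phi (p + rc a *: v) - phi p - rc a * dir_deriv v phi z by ring.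
apply=> t t01; rewrite modCM modCR mulrC ler_wpM2r// ltW//; apply: hd.
by have := near t t01; rewrite lt_min => /andP[].
Qed.

Lemma tele3 (a1 a2 a3 a0 x y l : C) (r s t : R) : modC (a1 - a2 - x) <= r ->
 modC (a2 - a3 - y) <= s -> modC (a3 - a0 - l) <= t ->
 modC (a1 - a0 - (x + y + l)) <= r + s + t.
move=> h1 h2 h3.
have -> : a1 - a0 - (x + y + l) = (a1 - a2 - x) + (a2 - a3 - y) + (a3 - a0 - l) by ring.
apply: le_trans (modCD _ _) _; apply: lerD h3.
by apply: le_trans (modCD _ _) _; exact: lerD.
Qed.

(** The real differential of [phi] at [z] applied to [h], in Wirtinger coordinates. *)
Definition Dlin phi z h : C := \sum_j (h 0 j * dz j phi z + cj (h 0 j) * dbar j phi z).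

Lemma DlinE phi z h : Dlin phi z h = \sum_j (rc (re (h 0 j)) * dir_deriv (xdir R j) phi z
 + rc (im (h 0 j)) * dir_deriv (ydir R j) phi z).
apply: eq_bigr => j _; rewrite dxE dyE.
have -> : cj (h 0 j) = rc (re (h 0 j)) - ii R * rc (im (h 0 j)).
 by apply: cplxP; rewrite !ReImE; ring.
rewrite {1}(reimE (h 0 j)); ring.
Qed.

(** Continuous partial derivatives give a total differential: [z + h] is reached by moves along the
    real coordinate axes, [P l h] being the part of [h] carried by the indices in [l], and each move
    is controlled by [C1_line]. *)
Lemma frechet U phi z : openU U -> Ck 1 U phi -> U z ->
 forall e : R, 0 < e -> exists2 d : R, 0 < d & forall h, nr h < d ->
  modC (phi (z + h) - phi z - Dlin phi z h) <= e * nr h.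
move=> oU hC Uz.
pose P (l : seq 'I_n) h : V := \sum_(j <- l)
 (rc (re (h 0 j)) *: xdir R j + rc (im (h 0 j)) *: ydir R j).
pose L (l : seq 'I_n) h : C := \sum_(j <- l) (rc (re (h 0 j)) * dir_deriv (xdir R j) phi z
 + rc (im (h 0 j)) * dir_deriv (ydir R j) phi z).
have nP l h : nr (P l h) <= 2 * (size l)%:R * nr h.
 elim: l => [|j l ih]; first by rewrite /P big_nil nr0 !mulr0 mul0r.
 rewrite /P big_cons (le_trans (nrD _ _))// (le_trans (lerD (nrD _ _) ih))//.
 rewrite !nrZR (nr_crd (crd_x j)) (nr_crd (crd_y j)) !mulr1 /= -natr1.
 have := le_trans (ler_Re_modC (h 0 j)) (modC_coord h j).
 have := le_trans (ler_Im_modC (h 0 j)) (modC_coord h j); lra.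
have main l : forall e : R, 0 < e -> exists2 d : R, 0 < d & forall h, nr h < d ->
  modC (phi (z + P l h) - phi z - L l h) <= e * nr h.
 elim: l => [|j l ih] e e0.
  by exists 1 => // h _; rewrite /P /L !big_nil addr0 subrr subr0 modC0 mulr_ge0// ltW.
 have e3 : 0 < e / 3 by rewrite divr_gt0.
 have [d1 d10 h1] := ih _ e3.
 have [d2 d20 h2] := C1_line oU hC (crd_x j) Uz e3.
 have [d3 d30 h3] := C1_line oU hC (crd_y j) Uz e3.
 (* The partial move has length at most [2 (size l) |h|] and the next move in [y] at most [|h|], so
    all base points stay within [d2] and [d3]. *)
 exists (Num.min d1 (Num.min d2 d3 / (2 * (size l)%:R + 2))) => [|h].
  by rewrite lt_min d10 divr_gt0// lt_min d20.
 rewrite lt_min => /andP[k1]; rewrite ltr_pdivlMr// lt_min => /andP[k2 k3].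
 have rx := le_trans (ler_Re_modC (h 0 j)) (modC_coord h j).
 have ry := le_trans (ler_Im_modC (h 0 j)) (modC_coord h j).
 have s0 : 0 <= (size l)%:R :> R by [].
 set a := re (h 0 j) in rx *; set b := im (h 0 j) in ry *.
 have np := nP l h.
 have q1 : modC (phi ((z + P l h) + rc b *: ydir R j) - phi (z + P l h) -
          rc b * dir_deriv (ydir R j) phi z) <= e / 3 * `|b|.
  by apply: h3; [rewrite addKl; nra|nra].
 have q2 : modC (phi ((z + P l h + rc b *: ydir R j) + rc a *: xdir R j)
   - phi (z + P l h + rc b *: ydir R j) - rc a * dir_deriv (xdir R j) phi z)
   <= e / 3 * `|a|.
  apply: h2; last by nra.
  rewrite addKl2 (le_lt_trans (nrD _ _))// nrZR (nr_crd (crd_y j)) mulr1.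
  by nra.
 have eP : z + P (j :: l) h = z + P l h + rc b *: ydir R j + rc a *: xdir R j.
  have -> : P (j :: l) h = rc a *: xdir R j + rc b *: ydir R j + P l h.
   by rewrite {1}/P big_cons.
  exact: addr_perm4.
 have eL : L (j :: l) h = rc a * dir_deriv (xdir R j) phi z +
   rc b * dir_deriv (ydir R j) phi z + L l h by rewrite /L big_cons.
 rewrite eP eL.
 apply: le_trans (tele3 q2 q1 (h1 h k1)) _; move: rx ry e3; clear; nra.
move=> e e0; have [d d0 hd] := main (enum 'I_n) e e0; exists d => // h hh.
have eP : P (enum 'I_n) h = h by exact: sum_xy.
have := hd h hh; rewrite eP DlinE /L big_enum //=.
Qed.

Definition vder (g : R -> V) (t : R) v := forall j, cder (fun s => g s 0 j) t (v 0 j).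

Lemma vder_nr g t v : vder g t v -> forall e : R, 0 < e ->
 exists2 d : R, 0 < d & forall h : R, `|h| < d ->
  nr (g (t + h) - g t - rc h *: v) <= e * `|h|.
move=> hg e e0.
have en : 0 < e / n.+1%:R by rewrite divr_gt0.
have [d d0 hd] : exists2 d : R, 0 < d & forall (j : 'I_n) (h : R), `|h| < d ->
  modC (g (t + h) 0 j - g t 0 j - rc h * v 0 j) <= e / n.+1%:R * `|h|.
 have : forall l : seq 'I_n, exists2 d : R, 0 < d & forall (j : 'I_n) (h : R), j \in l -> `|h| < d ->
  modC (g (t + h) 0 j - g t 0 j - rc h * v 0 j) <= e / n.+1%:R * `|h|.
  elim=> [|j l [d d0 hd]]; first by exists 1.
  have [d' d'0 hd'] := hg j _ en; exists (Num.min d d'); first by rewrite lt_min d0.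
  move=> i h; rewrite in_cons lt_min => /orP[/eqP ->|il] /andP[k1 k2].
   exact: hd'.
  exact: hd.
 move=> /(_ (enum 'I_n))[d d0 hd]; exists d => // j h; apply: hd.
 by rewrite mem_enum.
exists d => // h hh; rewrite (le_trans (nr_le_sum _))//.
apply: (@le_trans _ _ (\sum_(j < n) e / n.+1%:R * `|h|)).
 by apply: ler_sum => j _; rewrite !mxE; exact: hd.
rewrite sumr_const card_ord -[X in X <= _]mulr_natr mulrAC ler_wpM2r//.
by rewrite mulrAC ler_pdivrMr// ler_pM2l// ler_nat.
Qed.

Lemma modC_Dlin phi z h : modC (Dlin phi z h) <=
 (\sum_j (modC (dz j phi z) + modC (dbar j phi z))) * nr h.
rewrite (le_trans (modC_sum _ _ _))// mulr_suml; apply: ler_sum => j _.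
rewrite (le_trans (modCD _ _))// (modCM (h 0 j)) (modCM (cj _)) modCJ mulrDl.
have := modC_coord h j; have := modC_ge0 (dz j phi z).
have := modC_ge0 (dbar j phi z); nra.
Qed.

Lemma DlinB phi z h k : Dlin phi z (h - k) = Dlin phi z h - Dlin phi z k.
rewrite /Dlin -sumrB /=; apply: eq_bigr => j _.
by rewrite !mxE conjCB; ring.
Qed.
Lemma DlinZ phi z (r : R) h : Dlin phi z (rc r *: h) = rc r * Dlin phi z h.
rewrite /Dlin mulr_sumr; apply: eq_bigr => j _.
by rewrite !mxE conjCM conjCR; ring.
Qed.

(** For arbitrary curves and not only lines: it will be applied to the rotation of one
    coordinate. *)
Lemma chain U phi g t v : openU U -> Ck 1 U phi -> U (g t) -> vder g t v ->
 cder (fun s => phi (g s)) t (Dlin phi (g t) v).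
move=> oU hC Ug hg e e0.
pose M := \sum_j (modC (dz j phi (g t)) + modC (dbar j phi (g t))) + 1.
have S0 : 0 <= \sum_j (modC (dz j phi (g t)) + modC (dbar j phi (g t))).
 by apply: sumr_ge0 => j _; rewrite addr_ge0.
have M0 : 0 < M by rewrite ltr_wpDl.
pose N := nr v + 1; have N0 : 0 < N by rewrite ltr_wpDl.
have e1 : 0 < e / 2 / N by rewrite !divr_gt0.
have [d1 d10 h1] := frechet oU hC Ug e1.
have e2 : 0 < Num.min 1 (e / 2 / M) by rewrite lt_min ltr01 /= !divr_gt0.
have [d2 d20 h2] := vder_nr hg e2.
exists (Num.min d2 (d1 / N)) => [|h]; first by rewrite lt_min d20 divr_gt0.
rewrite lt_min => /andP[k1]; rewrite ltr_pdivlMr// => k2.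
have q := h2 h k1; set D := g (t + h) - g t.
have nD : nr D <= N * `|h|.
 have -> : D = (D - rc h *: v) + rc h *: v by rewrite subrK.
 rewrite (le_trans (nrD _ _))// nrZR.
 have : Num.min 1 (e / 2 / M) <= 1 by rewrite ge_min lexx.
 have := normr_ge0 h; rewrite -/D in q; rewrite /N; nra.
have a1 : modC (phi (g t + D) - phi (g t) - Dlin phi (g t) D) <= e / 2 * `|h|.
 apply: le_trans (h1 D _) _; first by lra.
 have -> : e / 2 * `|h| = e / 2 / N * (N * `|h|) by field; rewrite lt0r_neq0.
 by rewrite ler_wpM2l// ltW.
have -> : g (t + h) = g t + D by rewrite [RHS]addrC subrK.
have -> : phi (g t + D) - phi (g t) - rc h * Dlin phi (g t) v =
 (phi (g t + D) - phi (g t) - Dlin phi (g t) D) + Dlin phi (g t) (D - rc h *: v).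
 by rewrite (DlinB _ _ D) DlinZ; ring.
rewrite (le_trans (modCD _ _))//.
have : modC (Dlin phi (g t) (D - rc h *: v)) <= e / 2 * `|h|.
 apply: le_trans (modC_Dlin _ _ _) _.
 have k3 : nr (D - rc h *: v) <= e / 2 / M * `|h|.
  by apply: le_trans q _; rewrite ler_wpM2r// ge_min lexx orbT.
 have -> : e / 2 * `|h| = M * (e / 2 / M * `|h|) by field; rewrite lt0r_neq0.
 apply: ler_pM => //; by rewrite /M lerDl.
lra.
Qed.

Lemma dir_Dlin U phi z v : openU U -> Ck 1 U phi -> U z ->
 dir_derivable v phi z /\ dir_deriv v phi z = Dlin phi z v.
move=> oU hC Uz; apply/dirP.
have hv : vder (fun s => z + rc s *: v) 0 v by move=> j; exact: cder_coord.
by have := chain oU hC _ hv; rewrite scale0r addr0; apply.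
Qed.

(** Mean value inequality in [t] for [phi (z + s w + t v) - phi (z + t v) - t s A] on [[0, s]]; its
    derivative is [o(s)] by [C1_line] for [d_v phi]. *)
Lemma second_diff U phi v w z : openU U -> Ck 2 U phi -> crd v -> crd w -> U z ->
 forall e : R, 0 < e -> exists2 d : R, 0 < d & forall s : R, 0 < s -> s < d ->
  modC (phi (z + rc s *: v + rc s *: w) - phi (z + rc s *: v)
     - phi (z + rc s *: w) + phi z - rc (s ^+ 2) * dir_deriv w (dir_deriv v phi) z)
  <= e * s ^+ 2.
move=> oU hC cv cw Uz e e0.
have [r r0 hr] := oU _ Uz.
have e2 : 0 < e / 2 by rewrite divr_gt0.
have [d d0 hd] := C1_line oU (Ck_dir hC cv) cw Uz e2.
pose m := Num.min d r; have m0 : 0 < m by rewrite lt_min d0.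
exists (m / 2) => [|s s0 sm]; first by rewrite divr_gt0.
set A := dir_deriv w _ z.
have inU t : 0 <= t <= s -> U (z + rc t *: v) /\ U (z + rc t *: v + rc s *: w).
 move=> /andP[t0 ts]; have := sm; rewrite ltr_pdivlMr// lt_min => /andP[k1 k2].
 split; apply: hr.
  by rewrite addKl nrZR (nr_crd cv) mulr1 ger0_norm//; lra.
 rewrite addKl2 (le_lt_trans (nrD _ _))// !nrZR (nr_crd cv) (nr_crd cw).
 by rewrite !mulr1 !ger0_norm ?(ltW s0)//; lra.
have hl t : 0 <= t <= s -> cder (fun t => phi (z + rc s *: w + rc t *: v) - phi (z + rc t *: v)
  - rc (t * s) * A) t (dir_deriv v phi (z + rc s *: w + rc t *: v) -
    dir_deriv v phi (z + rc t *: v) - rc s * A).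
 move=> ts; have [u1 u2] := inU t ts.
 apply: cderB; first apply: cderB.
 - apply: dir_line => //; apply: (Ck_der hC cv).
  by rewrite addrAC.
 - by apply: dir_line => //; exact: (Ck_der hC cv).
 - have hs : rder (fun t => t * s) t s.
   by apply: rder_eq (rderM (rder_id t) (rder_cst s t)) _; ring.
  have := cderM (cder_rc hs) (cder_cst A t).
  by rewrite mulr0 addr0.
have := @cder_lip _ _ _ (e / 2 * s) 0 s (ltW s0) hl.
rewrite mul0r RtoC0 scale0r !addr0 mul0r !subr0.
have -> : 2 * (e / 2 * s) * s = e * s ^+ 2 by field.
rewrite [z + rc s *: w + rc s *: v]addrAC.
have -> : forall a b c dd : C, a - b - dd - (c - phi z) = a - b - c + phi z - dd.
 by move=> a b c dd; ring.
rewrite -expr2; apply => t ts.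
have := hd (z + rc t *: v) s; rewrite addKl nrZR (nr_crd cv) mulr1.
have := sm; rewrite ltr_pdivlMr// lt_min => /andP[k1 k2].
move: ts => /andP[t0 ts].
rewrite [z + rc s *: w + rc t *: v]addrAC !ger0_norm ?(ltW s0)//; apply; lra.
Qed.

Lemma diff2 (F P Q r a b : C) (E : R) : modC (F - P - Q + r - a) <= E ->
 modC (F - Q - P + r - b) <= E -> modC (a - b) <= 2 * E.
move=> q1 q2; have -> : a - b = (F - Q - P + r - b) - (F - P - Q + r - a) by ring.
by rewrite (le_trans (modCB _ _))//; lra.
Qed.

(** The second difference is symmetric in [v] and [w], so both mixed derivatives are its limit after
    division by [s^2]. *)
Lemma schwarz U phi v w z : openU U -> Ck 2 U phi -> crd v -> crd w -> U z ->
 dir_deriv w (dir_deriv v phi) z = dir_deriv v (dir_deriv w phi) z.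
move=> oU hC cv cw Uz; apply/eqP/negPn/negP.
set A := dir_deriv w _ z; set B := dir_deriv v _ z => AB.
have m0 : 0 < modC (A - B) by rewrite modC_gt0 subr_eq0.
pose e := modC (A - B) / 4.
have e0 : 0 < e by rewrite divr_gt0.
have [d1 d10 h1] := second_diff oU hC cv cw Uz e0.
have [d2 d20 h2] := second_diff oU hC cw cv Uz e0.
pose s := Num.min d1 d2 / 2.
have m1 : 0 < Num.min d1 d2 by rewrite lt_min d10.
have s0 : 0 < s by rewrite divr_gt0.
have sm : s < Num.min d1 d2 by rewrite /s; lra.
move: (sm); rewrite lt_min => /andP[sm1 sm2].
have k1 := h1 s s0 sm1; have k2 := h2 s s0 sm2.
rewrite -/A in k1; rewrite -/B [z + rc s *: w + rc s *: v]addrAC in k2.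
have s20 : 0 < s ^+ 2 by rewrite exprn_gt0.
have := diff2 k1 k2; rewrite -mulrBr modCM modCR ger0_norm ?(ltW s20)//.
move: s20 m0; rewrite /e; move: (s ^+ 2) (modC _) => s2 m; clear; nra.
Qed.

Lemma dz_comm U phi i j z : openU U -> Ck 2 U phi -> U z ->
 dz i (dz j phi) z = dz j (dz i phi) z.
move=> oU hC Uz.
have hd v a : crd v -> dir_deriv v (dz a phi) z =
  (dir_deriv v (dir_deriv (xdir R a) phi) z - ii R * dir_deriv v (dir_deriv (ydir R a) phi) z) / 2.
 move=> cv; apply: (proj2 (iffLR (dirP _ _ _ _) _)).
 have hx : dir_derivable v (dir_deriv (xdir R a) phi) z.
  exact: (Ck_der (Ck_dir hC (crd_x a)) cv Uz).
 have hy : dir_derivable v (dir_deriv (ydir R a) phi) z.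
  exact: (Ck_der (Ck_dir hC (crd_y a)) cv Uz).

 have := cderZ 2^-1 (cderB ((iffRL (dirP _ _ _ _)) (conj hx erefl)) (cderZ (ii R) ((iffRL (dirP _ _ _ _)) (conj hy erefl)))).
 by rewrite mulrC; under eq_fun do rewrite mulrC.
have alg (a b c d a' b' c' d' : C) : a = a' -> b = c' -> c = b' -> d = d' ->
  ((a - ii R * b) / 2 - ii R * ((c - ii R * d) / 2)) / 2 =
  ((a' - ii R * b') / 2 - ii R * ((c' - ii R * d') / 2)) / 2.
 by move=> -> -> -> ->; field.
rewrite (dzE i (dz j phi)) (dzE j (dz i phi)).
rewrite (hd _ j (crd_x i)) (hd _ j (crd_y i)) (hd _ i (crd_x j)) (hd _ i (crd_y j)).
apply: alg.
- exact: (schwarz oU hC (crd_x j) (crd_x i) Uz).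
- exact: (schwarz oU hC (crd_y j) (crd_x i) Uz).
- exact: (schwarz oU hC (crd_x j) (crd_y i) Uz).
- exact: (schwarz oU hC (crd_y j) (crd_y i) Uz).
Qed.

End SmoothClasses.

(** * Exponential, logarithm and real powers on the right half-plane *)

Section ComplexPower.
Variable R : realType.
Local Notation C := (cplx R).
Implicit Types (c d : C) (s t x y : R) (u : R -> C).

Definition cexp c : C := rc (expR (re c)) * mkC (cos (im c)) (sin (im c)).
(** The principal branch only on the right half-plane, where [atan (im / re)] is the argument; this
    is the branch of [cpow]. *)
Definition clog c : C := mkC (ln (modC c)) (atan (im c / re c)).
Lemma re_mkC x y : re (mkC x y) = x. by []. Qed.
Lemma im_mkC x y : im (mkC x y) = y. by []. Qed.
Lemma modC_cis x : modC (mkC (cos x) (sin x)) = 1.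
by rewrite modCE re_mkC im_mkC cos2Dsin2 sqrtr1. Qed.
Lemma modC_cexp c : modC (cexp c) = expR (re c).
by rewrite /cexp modCM modC_cis modCR mulr1 ger0_norm ?expR_ge0. Qed.

Lemma cexpD c d : cexp (c + d) = cexp c * cexp d.
rewrite /cexp !ReImE expRD RtoCM sinD cosD.
have -> : mkC (cos (im c) * cos (im d) - sin (im c) * sin (im d))
   (sin (im c) * cos (im d) + cos (im c) * sin (im d)) =
   mkC (cos (im c)) (sin (im c)) * mkC (cos (im d)) (sin (im d)).
 by apply: cplxP; rewrite !ReImE !re_mkC !im_mkC; ring.
ring.
Qed.

Lemma cexp0 : cexp 0 = 1.
rewrite /cexp !ReImE expR0 cos0 sin0; apply: cplxP;
by rewrite !ReImE ?re_mkC ?im_mkC; ring.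
Qed.
Lemma cj_cexp c : cj (cexp c) = cexp (cj c).
rewrite /cexp conjCM conjCR !ReImE cosN sinN; congr (_ * _).
Qed.

Lemma cder_cexp u t d : cder u t d -> cder (fun s => cexp (u s)) t (d * cexp (u t)).
move=> /cderP[h1 h2]; apply/cderP.
have e1 : rder (fun s => expR (re (u s))) t (expR (re (u t)) * re d).
 exact: rder_comp h1 (is_derive_expR _).
have c1 : rder (fun s => cos (im (u s))) t (- sin (im (u t)) * im d).
 exact: rder_comp h2 (is_derive_cos _).
have s1 : rder (fun s => sin (im (u s))) t (cos (im (u t)) * im d).
 exact: rder_comp h2 (is_derive_sin _).
split.
- have f : (fun s => re (cexp (u s))) =
   (fun s => expR (re (u s)) * cos (im (u s))).
  by apply/funext => s; rewrite /cexp !ReImE re_mkC mul0r subr0.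
 rewrite f; apply: rder_eq (rderM e1 c1) _.
 rewrite /cexp !ReImE re_mkC im_mkC; ring.
- have f : (fun s => im (cexp (u s))) =
   (fun s => expR (re (u s)) * sin (im (u s))).
  by apply/funext => s; rewrite /cexp !ReImE im_mkC mul0r addr0.
 rewrite f; apply: rder_eq (rderM e1 s1) _.
 rewrite /cexp !ReImE re_mkC im_mkC; ring.
Qed.

Lemma modC_gt0_re c : 0 < re c -> 0 < modC c.
by move=> h; rewrite (lt_le_trans h)// (le_trans (ler_norm _))// ler_Re_modC. Qed.
Lemma neq0_re c : 0 < re c -> c != 0.
by move=> /modC_gt0_re; rewrite modC_gt0. Qed.
Lemma sin_atan x : sin (atan x) = x * cos (atan x).
have := atanK x; rewrite /tan => h.
by rewrite -{2}h mulfVK// cos_atan invr_eq0 sqrtr_eq0 -ltNge ltr_wpDr ?sqr_ge0.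
Qed.

Lemma clogK c : 0 < re c -> cexp (clog c) = c.
move=> r0; have m0 := modC_gt0_re r0.
rewrite /cexp /clog re_mkC im_mkC lnK ?posrE// sin_atan cos_atan.
have -> : Num.sqrt (1 + (im c / re c) ^+ 2) = modC c / re c.
 have -> : 1 + (im c / re c) ^+ 2 = (modC c / re c) ^+ 2.
  by rewrite !exprMn modC_sqr exprVn; field; rewrite lt0r_neq0.
 by rewrite sqrtr_sqr ger0_norm// divr_ge0 ?ltW.
apply: cplxP; rewrite !ReImE !re_mkC !im_mkC; field;
by rewrite ?lt0r_neq0.
Qed.

Lemma modC2_neq0 c : 0 < re c -> re c ^+ 2 + im c ^+ 2 != 0.
by move=> h; rewrite -modC_sqr sqrf_eq0 lt0r_neq0// modC_gt0_re. Qed.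

Lemma divCE c d : 0 < re c -> d / c =
 mkC ((re d * re c + im d * im c) / (re c ^+ 2 + im c ^+ 2))
   ((im d * re c - re d * im c) / (re c ^+ 2 + im c ^+ 2)).
move=> r0; apply: (mulIf (neq0_re r0)); rewrite mulfVK ?neq0_re//.
apply: cplxP; rewrite !ReImE !re_mkC !im_mkC; field; exact: modC2_neq0.
Qed.

Lemma cder_clog u t d : cder u t d -> 0 < re (u t) ->
 cder (fun s => clog (u s)) t (d / u t).
move=> /cderP[h1 h2] r0; apply/cderP; rewrite (divCE _ r0) re_mkC im_mkC.
have q0 : 0 < re (u t) ^+ 2 + im (u t) ^+ 2.
 by rewrite lt_def modC2_neq0// addr_ge0 ?sqr_ge0.
split.
- have f : (fun s => re (clog (u s))) =
   (fun s => 2^-1 * ln (re (u s) * re (u s) + im (u s) * im (u s))).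
  apply/funext => s; rewrite /clog re_mkC -!expr2 -modC_sqr.
  have [->|m0] := eqVneq (modC (u s)) 0; first by rewrite expr0n/= ln0 ?mulr0.
  have m1 : 0 < modC (u s) by rewrite lt_def m0 modC_ge0.
  by rewrite lnXn// mulr2n; field.
 rewrite f.
 have := rderZ 2^-1 (rder_comp (rderD (rderM h1 h1) (rderM h2 h2))
   (is_derive1_ln (x := re (u t) * re (u t) + im (u t) * im (u t)) _)).
 move=> h; apply: rder_eq (h _) _; first by rewrite -!expr2.
 by rewrite -(expr2 (re (u t))) -(expr2 (im (u t))); field; exact: modC2_neq0.
- have h3 : rder (fun s => (re (u s))^-1) t (- (re (u t)) ^- 2 * re d).
  apply: rder_comp h1 _.
  have := is_deriveV (lt0r_neq0 r0) (is_derive_id (re (u t)) (1 : R)).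
  move=> h; apply: (is_derive_eq h).
  by rewrite /GRing.scale /= mulr1.
 apply: rder_eq (rder_comp (rderM h2 h3) (is_derive1_atan (im (u t) / re (u t)))) _; field.
 by apply/andP; split; [exact: modC2_neq0|exact: lt0r_neq0].
Qed.

Lemma cpowE c s : 0 < re c -> cpow c s = cexp (rc s * clog c).
move=> r0; rewrite /cpow /cexp !ReImE !mul0r subr0 addr0 re_mkC im_mkC.
by rewrite /powR gt_eqF ?modC_gt0_re.
Qed.
Lemma cpow_neq0 c s : 0 < re c -> cpow c s != 0.
by move=> r0; rewrite cpowE// -modC_gt0 modC_cexp expR_gt0. Qed.
Lemma cpowD c s t : 0 < re c -> cpow c (s + t) = cpow c s * cpow c t.
by move=> r0; rewrite !cpowE// RtoCD mulrDl cexpD. Qed.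
Lemma cpow0 c : 0 < re c -> cpow c 0 = 1.
by move=> r0; rewrite cpowE// RtoC0 mul0r cexp0. Qed.
Lemma cpow1 c : 0 < re c -> cpow c 1 = c.
by move=> r0; rewrite cpowE// RtoC1 mul1r clogK. Qed.
Lemma cpowN c s : 0 < re c -> cpow c (- s) = (cpow c s)^-1.
move=> r0; apply: (mulfI (cpow_neq0 s r0)).
by rewrite -cpowD// subrr cpow0// divff// cpow_neq0.
Qed.
Lemma cpow_nat c k : 0 < re c -> cpow c k%:R = c ^+ k.
move=> r0; elim: k => [|k ih]; first by rewrite cpow0// expr0.
by rewrite -natr1 cpowD// ih cpow1// exprSr.
Qed.
Lemma modC_cpow c s : 0 < re c -> modC (cpow c s) = modC c `^ s.
move=> r0; rewrite cpowE// modC_cexp !ReImE mul0r subr0 /clog re_mkC.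
by rewrite /powR gt_eqF ?modC_gt0_re.
Qed.
Lemma cj_cpow c s : 0 < re c -> cj (cpow c s) = cpow (cj c) s.
move=> r0; rewrite !cpowE ?ReImE// cj_cexp conjCM conjCR; congr (cexp (_ * _)).
by rewrite /clog modCJ !ReImE mulNr atanN.
Qed.

Lemma cpow_real x s : 0 < x -> cpow (rc x) s = rc (x `^ s).
move=> x0; rewrite cpowE ?ReImE// /cexp /clog modCR !ReImE re_mkC im_mkC.
rewrite !mul0r atan0 mulr0 !addr0 subr0 cos0 sin0 ger0_norm ?ltW//.
rewrite /powR gt_eqF// (_ : mkC 1 0 = 1) ?mulr1//.
Qed.

Lemma cder_cpow u t d s : cder u t d -> 0 < re (u t) ->
 cder (fun x => cpow (u x) s) t (rc s * cpow (u t) (s - 1) * d).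
move=> h r0.
have [del del0 hd] : exists2 del : R, 0 < del & forall k : R, `|k| < del -> 0 < re (u (t + k)).
 have [del del0 hd] := cder_cont h r0; exists del => // k /hd k1.
 have := le_lt_trans (ler_Re_modC _) k1; rewrite !ReImE ltr_norml; lra.
have : cder (fun x => cexp (rc s * clog (u x))) t (rc s * cpow (u t) (s - 1) * d).
 move: (cder_cexp (cderZ (rc s) (cder_clog h r0))); congr cder; rewrite -cpowE//.
 rewrite cpowD// cpowN// cpow1//; ring.
move=> h3; apply: cder_near h3 _; exists del => // k /hd k1.
by rewrite cpowE.
Qed.

End ComplexPower.

(** * The kernel [(1 - <w,z>)^(-a)]: size, derivatives, smoothness *)

Section Kernel.
Variables (R : realType) (n : nat).
Local Notation C := (cplx R).
Local Notation V := (Cn R n).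
Implicit Types (w z h v : V) (a : R).

Definition ker a w z : C := cpow (1 - herm w z) (- a).
Lemma modC_ker a w z : nr w * nr z < 1 -> modC (ker a w z) = dist w z `^ (- a).
by move=> h; rewrite modC_cpow// Re_herm_lt. Qed.
Lemma modC_ker3 a b c w z : nr w * nr z < 1 -> 0 <= a ->
 modC (rc a * c * ker b w z) = a * modC c * dist w z `^ (- b).
by move=> h a0; rewrite modCM modC_ker// modCM modCR ger0_norm.
Qed.
Lemma kerV a w z : nr w * nr z < 1 -> ker a w z = (cpow (1 - herm w z) a)^-1.
by move=> h; rewrite /ker cpowN// Re_herm_lt. Qed.
Lemma ker_nat k w z : nr w * nr z < 1 -> ker k%:R w z = (1 - herm w z) ^- k.
by move=> h; rewrite kerV// cpow_nat// Re_herm_lt. Qed.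
Lemma cj_ker a w z : nr w * nr z < 1 -> cj (ker a w z) = ker a z w.
move=> h; rewrite /ker cj_cpow ?Re_herm_lt// conjCB conjC1 (hermC w z).
by [].
Qed.
Lemma ker_diag a z : uball z -> ker a z z = wtp (- a) z.
move=> uz; rewrite /ker hermzz -RtoC1 -RtoCB cpow_real//; exact: weight_gt0.
Qed.

Lemma cder_hermr w z h t : cder (fun s => herm w (z + rc s *: h)) t (herm w h).
have h1 := cderD (cder_cst (herm w z) t)
 (cderM (cder_rc (rder_id t)) (cder_cst (herm w h) t)).
move: h1; rewrite add0r RtoC1 mul1r mulr0 addr0 => h1.
by apply: eq_cder h1 _ => s; rewrite hermDr hermZr.
Qed.

Lemma cder_herml w z h t : cder (fun s => herm (w + rc s *: h) z) t (herm h z).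
have h1 := cderD (cder_cst (herm w z) t)
 (cderM (cder_rc (rder_id t)) (cder_cst (herm h z) t)).
move: h1; rewrite add0r RtoC1 mul1r mulr0 addr0 => h1.
by apply: eq_cder h1 _ => s; rewrite hermDl hermZl conjCR.
Qed.

Lemma cder_kerr a w z h t : nr w * nr (z + rc t *: h) < 1 ->
 cder (fun s => ker a w (z + rc s *: h)) t
  (rc a * herm w h * ker (a + 1) w (z + rc t *: h)).
move=> hw;
have := cder_cpow (- a) (cderB (cder_cst 1 t) (cder_hermr w z h t)) (Re_herm_lt hw); congr cder.
by rewrite /ker RtoCN opprD sub0r; ring.
Qed.

Lemma cder_kerl a w z h t : nr (w + rc t *: h) * nr z < 1 ->
 cder (fun s => ker a (w + rc s *: h) z) t
  (rc a * herm h z * ker (a + 1) (w + rc t *: h) z).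
move=> hw;
have := cder_cpow (- a) (cderB (cder_cst 1 t) (cder_herml w z h t)) (Re_herm_lt hw); congr cder.
by rewrite /ker RtoCN opprD sub0r; ring.
Qed.

Lemma cont_of_line (phi : V -> C) (M r : R) z : 0 < r ->
 (forall h (t : R), nr h < r -> 0 <= t <= 1 -> exists2 d, cder (fun s => phi (z + rc s *: h)) t d &
   modC d <= M * nr h) -> cont_at phi z.
move=> r0 H; apply/contP => e e0.
exists (Num.min r (e / (2 * `|M| + 1))) => [|w]; first by rewrite lt_min r0 divr_gt0.
rewrite lt_min ltr_pdivlMr// => /andP[k1 k2].
(* The derivative given for each [t] in the segment is made a function of [t]; its value 0 elsewhere
   never enters. *)
pose d t := if pselect (0 <= t <= 1) is left p then projT1 (cid2 (H _ t k1 p)) else 0.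
have := @cder_lip _ (fun s => phi (z + rc s *: (w - z))) d (`|M| * nr (w - z)) 0 1 ler01.
rewrite RtoC1 scale1r RtoC0 scale0r addr0 [z + (w - z)]addrC subrK => hl.
apply: le_lt_trans (hl _ _) _.
- by move=> t p; rewrite /d; case: pselect => // p'; case: cid2.
- move=> t p; rewrite /d; case: pselect => // p'; case: cid2 => x _ /= hx.
 by apply: le_trans hx _; rewrite ler_wpM2r// ler_norm.
by rewrite subr0 mulr1; have := nr_ge0 (w - z); nra.
Qed.

Lemma dist_line_ge w z h (t : R) : nr w <= 1 -> nr h < (1 - nr z) / 2 -> 0 <= t <= 1 ->
 nr (z + rc t *: h) <= (1 + nr z) / 2 /\ (1 - nr z) / 2 <= dist w (z + rc t *: h).
move=> hw hh /andP[t0 t1].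
have h1 : nr (z + rc t *: h) <= (1 + nr z) / 2.
 rewrite (le_trans (nrD _ _))// nrZR ger0_norm//.
 have := nr_ge0 h; nra.
split=> //; apply: le_trans (dist_ge _ _).
have := nr_ge0 w; have := nr_ge0 (z + rc t *: h); nra.
Qed.

Lemma powRN_le x y a : 0 <= a -> 0 < x -> x <= y -> y `^ (- a) <= x `^ (- a).
move=> a0 x0 xy; rewrite !powRN lef_pV2 ?posrE ?powR_gt0//.
 by apply: ge0_ler_powR; rewrite ?nnegrE// ?ltW// (lt_le_trans x0).
exact: lt_le_trans xy.
Qed.

(** Two mean value inequalities along the segment, the distance from [w] staying at least
    [(1 - |z|) / 2]. The constant is uniform in [w], which is what differentiation under the
    integral sign requires. *)
Lemma ker_taylor a w z h : 0 <= a -> nr w <= 1 -> nr z < 1 -> nr h < (1 - nr z) / 2 ->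
 modC (ker a w (z + h) - ker a w z - rc a * herm w h * ker (a + 1) w z) <=
 4 * a * (a + 1) * ((1 - nr z) / 2) `^ (- (a + 2)) * nr h ^+ 2.
move=> a0 hw hz hh.
set D := _ `^ _.
have inb (t : R) : 0 <= t <= 1 -> nr w * nr (z + rc t *: h) < 1.
 move=> t01; have [k1 _] := dist_line_ge hw hh t01.
 have := nr_ge0 w; have := nr_ge0 (z + rc t *: h); nra.
have hm : modC (herm w h) <= nr h.
 rewrite (le_trans (herm_le _ _))//; have := nr_ge0 h; nra.
have lip2 (t : R) : 0 <= t <= 1 -> modC (ker (a + 1) w (z + rc t *: h) - ker (a + 1) w z) <=
  2 * ((a + 1) * nr h * D).
 move=> /andP[t0 t1].
 have := @cder_lip _ (fun s => ker (a + 1) w (z + rc s *: h))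
  (fun s => rc (a + 1) * herm w h * ker (a + 1 + 1) w (z + rc s *: h))
  ((a + 1) * nr h * D) 0 t t0.
 rewrite RtoC0 scale0r addr0 subr0 => H; apply: le_trans (H _ _) _.
 - move=> s /andP[s0 s1]; apply: cder_kerr; apply: inb; rewrite s0/=; lra.
 - move=> s /andP[s0 s1]; have s01 : 0 <= s <= 1 by rewrite s0/=; lra.
  rewrite modC_ker3 ?inb//.
  have [k1 k2] := dist_line_ge hw hh s01.
  rewrite ler_pM//.
   by rewrite ler_wpM2l//; lra.
  by rewrite -addrA; apply: powRN_le => //; lra.
 have : 0 <= (a + 1) * nr h * D by rewrite !mulr_ge0 ?powR_ge0//; lra.
 nra.
have := @cder_lip _ (fun s => ker a w (z + rc s *: h) - rc s * (rc a * herm w h * ker (a + 1) w z))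
  (fun s => rc a * herm w h * (ker (a + 1) w (z + rc s *: h) - ker (a + 1) w z))
  (a * nr h * (2 * ((a + 1) * nr h * D))) 0 1 ler01.
rewrite RtoC0 RtoC1 scale0r scale1r addr0 subr0 mul0r mul1r mulr1 subr0 => H.
rewrite addrAC; apply: le_trans (H _ _) _.
- move=> t t01; rewrite mulrBr; apply: cderB; first exact: cder_kerr (inb _ t01).
 have := cderM (cder_rc (rder_id t)) (cder_cst (rc a * herm w h * ker (a + 1) w z) t).
 by rewrite RtoC1 mul1r mulr0 addr0.
- move=> t t01; rewrite (modCM (_ * _)) (modCM (rc a)) modCR (ger0_norm a0).
 apply: ler_pM; rewrite//; last exact: lip2.
 by rewrite ler_wpM2l.
by apply: eqle; ring.
Qed.

Lemma herm_xdirl j z : herm (xdir R j) z = z 0 j.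
rewrite xdirE hermE (bigD1 j)//= mxE !eqxx conjC1 mul1r big1 ?addr0// => i ij.
by rewrite mxE (negbTE ij) andbF conjC0 mul0r.
Qed.
Lemma herm_ydirl j z : herm (ydir R j) z = - ii R * z 0 j.
rewrite ydirE hermZl -xdirE herm_xdirl; congr (_ * _).
by apply: cplxP; rewrite !ReImE ?oppr0.
Qed.
Lemma herm_xdirr j w : herm w (xdir R j) = cj (w 0 j).
by rewrite hermC herm_xdirl. Qed.
Lemma herm_ydirr j w : herm w (ydir R j) = ii R * cj (w 0 j).
rewrite hermC herm_ydirl conjCM; congr (_ * _).
by apply: cplxP; rewrite !ReImE ?oppr0 ?opprK.
Qed.

Lemma ker_dirl a w z v : nr w * nr z < 1 ->
 dir_derivable v (fun w => ker a w z) w /\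
 dir_deriv v (fun w => ker a w z) w = rc a * herm v z * ker (a + 1) w z.
move=> h; apply/dirP.
by have := @cder_kerl a w z v 0; rewrite RtoC0 scale0r addr0; apply.
Qed.

Lemma ker_dirr a w z v : nr w * nr z < 1 ->
 dir_derivable v (fun z => ker a w z) z /\
 dir_deriv v (fun z => ker a w z) z = rc a * herm w v * ker (a + 1) w z.
move=> h; apply/dirP.
by have := @cder_kerr a w z v 0; rewrite RtoC0 scale0r addr0; apply.
Qed.

Lemma ker_dzl a w z j : nr w * nr z < 1 ->
 dz j (fun w => ker a w z) w = 0 /\
 dbar j (fun w => ker a w z) w = rc a * z 0 j * ker (a + 1) w z.
move=> h; have [_ hx] := ker_dirl a (xdir R j) h.
have [_ hy] := ker_dirl a (ydir R j) h.
rewrite dzE dbarE hx hy herm_xdirl herm_ydirl.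
have e : ii R * (rc a * (- ii R * z 0 j) * ker (a + 1) w z) =
 rc a * z 0 j * ker (a + 1) w z.
 rewrite (_ : ii R * (rc a * (- ii R * z 0 j) * ker (a + 1) w z) =
  - (ii R * ii R) * (rc a * z 0 j * ker (a + 1) w z)); last by ring.
 by rewrite (ii2 R) opprK mul1r.
by rewrite e subrr mul0r; split=> //; field.
Qed.

Lemma ker_dzr a w z j : nr w * nr z < 1 ->
 dz j (fun z => ker a w z) z = rc a * cj (w 0 j) * ker (a + 1) w z /\
 dbar j (fun z => ker a w z) z = 0.
move=> h; have [_ hx] := ker_dirr a (xdir R j) h.
have [_ hy] := ker_dirr a (ydir R j) h.
rewrite dzE dbarE hx hy herm_xdirr herm_ydirr.
have e : ii R * (rc a * (ii R * cj (w 0 j)) * ker (a + 1) w z) =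
 - (rc a * cj (w 0 j) * ker (a + 1) w z).
 rewrite (_ : ii R * (rc a * (ii R * cj (w 0 j)) * ker (a + 1) w z) =
  (ii R * ii R) * (rc a * cj (w 0 j) * ker (a + 1) w z)); last by ring.
 by rewrite (ii2 R) mulN1r.
by rewrite e opprK subrr mul0r; split=> //; field.
Qed.

Lemma ker_contr a w z : 0 <= a -> nr w <= 1 -> uball z -> cont_at (fun z => ker a w z) z.
rewrite uballE => a0 hw hz.
have r0 : 0 < (1 - nr z) / 2 by rewrite divr_gt0// subr_gt0.
apply: (@cont_of_line _ (a * ((1 - nr z) / 2) `^ (- (a + 1))) _ _ r0) => h t hh t01.
have [k1 k2] := dist_line_ge hw hh t01.
have hb : nr w * nr (z + rc t *: h) < 1.
 have := nr_ge0 w; have := nr_ge0 (z + rc t *: h); nra.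
exists (rc a * herm w h * ker (a + 1) w (z + rc t *: h)); first exact: cder_kerr.
rewrite modC_ker3// mulrAC.
have hm : modC (herm w h) <= nr h.
 rewrite (le_trans (herm_le _ _))//; have := nr_ge0 h; nra.
rewrite ler_pM// ler_wpM2l// powRN_le//; lra.
Qed.

Lemma Ck_kerr k a w : 0 <= a -> nr w <= 1 -> Ck k (@uball R n) (fun z => ker a w z).
move=> a0 hw; elim: k a a0 => [|k ih] a a0.
 by split=> // z uz; exact: ker_contr.
apply: CkS_intro => [z uz|v cv]; first exact: ker_contr.
have hb z : uball z -> nr w * nr z < 1.
 by rewrite uballE => hz; have := nr_ge0 w; have := nr_ge0 z; nra.
split=> [z /hb hz|]; first by have [] := ker_dirr a v hz.
have := Ck_scale (rc a * herm w v) (@openU_uball R n) (ih (a + 1) (addr_ge0 a0 ler01)).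
apply: Ck_ext => [|z /hb hz]; first exact: openU_uball.
by have [_ ->] := ker_dirr a v hz.
Qed.

Lemma cont_cj (phi : V -> C) z : cont_at phi z ->
 cont_at (fun w => cj (phi w)) z.
move=> /contP h; apply/contP => e /h[d d0 hd]; exists d => // w /hd.
by rewrite -conjCB modCJ.
Qed.

Lemma Ck_cj k U (phi : V -> C) : openU U -> Ck k U phi -> Ck k U (fun w => cj (phi w)).
move=> oU; elim: k phi => [|k ih] phi h.
 by split=> // z Uz; apply: cont_cj; exact: Ck_cont h _ Uz.
apply: CkS_intro => [z Uz|v cv]; first by apply: cont_cj; exact: Ck_cont h _ Uz.
have hd z : U z -> dir_derivable v (fun w => cj (phi w)) z /\
   dir_deriv v (fun w => cj (phi w)) z = cj (dir_deriv v phi z).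
 move=> Uz; apply/dirP; apply: cder_cj; apply/dirP; split=> //.
 exact: Ck_der h cv Uz.
split=> [z /hd[]//|]; apply: (Ck_ext oU _ (ih _ (Ck_dir h cv))) => z /hd[_ ->//].
Qed.

Lemma Ck_kerl k a z : 0 <= a -> nr z <= 1 -> Ck k (@uball R n) (fun w => ker a w z).
move=> a0 hz; apply: (Ck_ext (@openU_uball R n) _
 (Ck_cj (@openU_uball R n) (Ck_kerr k a0 hz))) => w; rewrite uballE => hw.
rewrite cj_ker//; have := nr_ge0 w; have := nr_ge0 z; nra.
Qed.

End Kernel.

(** * Integrals of continuous functions over a segment *)

Section IntervalIntegral.
Variable R : realType.
Local Notation mu := (@lebesgue_measure R).
Implicit Types (f g : R -> R) (a b c x : R).

Definition itvint f a b : R := \int[mu]_(x in `[a, b]) f x.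
Definition cont_on f a b := forall x, a <= x <= b -> cont_at f x.
Lemma cont_on_within f a b : cont_on f a b -> {within `[a, b], continuous f}.
by move=> h; apply: continuous_in_subspaceT => x; rewrite inE /= in_itv => /h.
Qed.
Lemma cont_on_integrable f a b : cont_on f a b -> mu.-integrable `[a, b] (EFin \o f).
move=> /cont_on_within h; apply: continuous_compact_integrable => //.
exact: segment_compact.
Qed.

Lemma itvint_split f a m b : a <= m -> m <= b -> cont_on f a b ->
 itvint f a b = itvint f a m + itvint f m b.
move=> am mb h.
have hi := cont_on_integrable h.
have := @Rintegral_itvB R f (BLeft a) (BRight b) m hi.
rewrite !bnd_simp => /(_ am mb) e.
rewrite /itvint -(@Rintegral_itv_obnd_cbnd R m (BRight b) f); last first.
 apply: integrableS hi => //; by apply: subset_itvr; rewrite bnd_simp.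
by rewrite -e addrC subrK.
Qed.

(** Meant for [f] and [g] on opposite sides of a rectangle, with [c] the difference of their linear
    parts. *)
Lemma itvint_diff f g c M a b : a <= b -> cont_on f a b -> cont_on g a b ->
 (forall x, a <= x <= b -> `|f x - g x - c| <= M) ->
 `|itvint f a b - itvint g a b - c * (b - a)| <= M * (b - a).
move=> ab hf hg hM.
have mab : mu `[a, b] = (b - a)%:E.
 rewrite lebesgue_measure_itv /= lte_fin; move: ab; rewrite le_eqVlt.
 by move=> /orP[/eqP ->|->]; rewrite ?ltxx ?subrr ?EFinB.
have ic x : mu.-integrable `[a, b] (EFin \o cst x).
 by apply: cont_on_integrable => y _; exact: cst_continuous.
have if_ := cont_on_integrable hf; have ig := cont_on_integrable hg.
have cE x : \int[mu]_(t in `[a, b]) cst x t = x * (b - a).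
 by rewrite Rintegral_cst//; congr (x * _); rewrite -[RHS]/(fine (b - a)%:E) -mab.
have ifg : mu.-integrable `[a, b] (EFin \o (fun x => f x - g x)).
 by apply: eq_integrable (integrableB _ if_ ig) => //.
have ifgc : mu.-integrable `[a, b] (EFin \o (fun x => f x - g x - c)).
 by apply: eq_integrable (integrableB _ ifg (ic c)) => //.
rewrite /itvint -RintegralB// -cE -RintegralB//.
apply: le_trans (le_normr_Rintegral _ _) _ => //.
rewrite -cE; apply: le_Rintegral => //.
 by apply: eq_integrable (integrable_norm ifgc).
Qed.

Lemma itvint_bound f M a b : a <= b -> cont_on f a b ->
 (forall x, a <= x <= b -> `|f x| <= M) -> `|itvint f a b| <= M * (b - a).
move=> ab hf hM.
have hc x : cont_on (cst x) a b by move=> y _; exact: cst_continuous.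
have := @itvint_diff f (cst 0) 0 M a b ab hf (hc 0).
have -> : itvint (cst 0) a b = 0 by rewrite /itvint Rintegral_cst// mul0r.
rewrite mul0r !subr0; apply => x /hM; by rewrite !subr0.
Qed.

End IntervalIntegral.

(** * Goursat's theorem for closed forms on a rectangle *)

Section Goursat.
Variable R : realType.
Implicit Types (P Q : R -> R -> R) (x y : R).

Definition diff2v P x y p1 p2 := forall e : R, 0 < e -> exists2 d : R, 0 < d &
 forall h k : R, `|h| < d -> `|k| < d ->
  `|P (x + h) (y + k) - P x y - p1 * h - p2 * k| <= e * (`|h| + `|k|).
(** Circulation of [P dx + Q dy] along the boundary of the rectangle, counterclockwise. *)
Definition circ P Q (x0 x1 y0 y1 : R) : R :=
 (itvint (P ^~ y0) x0 x1 - itvint (P ^~ y1) x0 x1) +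
 (itvint (Q x1) y0 y1 - itvint (Q x0) y0 y1).

Variables (P Q : R -> R -> R) (a b c d : R).
(** The form is closed: the same [r] is the derivative of [P] in [y] and of [Q] in [x]. Only
    pointwise differentiability is assumed, since continuity of complex derivatives will be a
    consequence of Cauchy's estimate. *)
Hypothesis hPQ : forall x y, a <= x <= b -> c <= y <= d -> exists p1 q2 r,
 diff2v P x y p1 r /\ diff2v Q x y r q2.

Lemma diff2v_cont1 T x y p1 p2 : diff2v T x y p1 p2 ->
 cont_at (T ^~ y) x /\ cont_at (T x) y.
move=> H; have [dl dl0 hd] := H 1 ltr01.
pose M := `|p1| + `|p2| + 1; have M0 : 0 < M by rewrite ltr_wpDl ?addr_ge0.
split; apply/cvgrPdist_lt => e e0.
- exists (Num.min dl (e / M)) => /=; first by rewrite lt_min dl0 divr_gt0.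
 move=> t /=; rewrite lt_min distrC ltr_pdivlMr// => /andP[k1 k2].
 have := hd (t - x) 0; rewrite normr0 addr0 => /(_ k1 dl0).
 rewrite [x + (t - x)]addrC subrK mulr0 subr0 addr0 mul1r => k3; rewrite distrC.
 have -> : T t y - T x y = (T t y - T x y - p1 * (t - x)) + p1 * (t - x) by ring.
 rewrite (le_lt_trans (ler_normD _ _))// normrM.
 have := normr_ge0 (t - x); have := normr_ge0 p1; have := normr_ge0 p2; rewrite /M in k2; nra.
- exists (Num.min dl (e / M)) => /=; first by rewrite lt_min dl0 divr_gt0.
 move=> t /=; rewrite lt_min distrC ltr_pdivlMr// => /andP[k1 k2].
 have := hd 0 (t - y); rewrite normr0 addr0 => /(_ dl0 k1).
 rewrite [y + (t - y)]addrC subrK mulr0 subr0 add0r mul1r => k3; rewrite distrC.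
 have -> : T x t - T x y = (T x t - T x y - p2 * (t - y)) + p2 * (t - y) by ring.
 rewrite (le_lt_trans (ler_normD _ _))// normrM.
 have := normr_ge0 (t - y); have := normr_ge0 p1; have := normr_ge0 p2; rewrite /M in k2; nra.
Qed.

Lemma contP1 y x0 x1 : a <= x0 -> x1 <= b -> c <= y <= d -> cont_on (P ^~ y) x0 x1.
move=> h1 h2 hy x /andP[x1' x2'].
have [|p1 [q2 [r [hP _]]]] := hPQ (x := x) (y := y) _ hy.
 by rewrite (le_trans h1)//= (le_trans x2').
by have [] := diff2v_cont1 hP.
Qed.

Lemma contQ2 x y0 y1 : c <= y0 -> y1 <= d -> a <= x <= b -> cont_on (Q x) y0 y1.
move=> h1 h2 hx y /andP[x1' x2'].
have [|p1 [q2 [r [_ hQ]]]] := hPQ (x := x) (y := y) hx _.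
 by rewrite (le_trans h1)//= (le_trans x2').
by have [] := diff2v_cont1 hQ.
Qed.

Lemma circ_split x0 xm x1 y0 ym y1 : a <= x0 -> x0 <= xm -> xm <= x1 -> x1 <= b ->
 c <= y0 -> y0 <= ym -> ym <= y1 -> y1 <= d ->
 circ P Q x0 x1 y0 y1 = circ P Q x0 xm y0 ym + circ P Q xm x1 y0 ym +
  (circ P Q x0 xm ym y1 + circ P Q xm x1 ym y1).
move=> ax0 x0m xm1 x1b cy0 y0m ym1 y1d; rewrite /circ.
have hy y : y0 <= y <= y1 -> c <= y <= d by move=> /andP[u v]; rewrite (le_trans cy0)//= (le_trans v).
have hx x : x0 <= x <= x1 -> a <= x <= b by move=> /andP[u v]; rewrite (le_trans ax0)//= (le_trans v).
have y01 : y0 <= y1 by rewrite (le_trans y0m).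
have x01 : x0 <= x1 by rewrite (le_trans x0m).
rewrite (itvint_split (f := P ^~ y0) x0m xm1); last first.
 by apply: contP1 => //; apply: hy; rewrite lexx.
rewrite (itvint_split (f := P ^~ y1) x0m xm1); last first.
 by apply: contP1 => //; apply: hy; rewrite lexx andbT.
rewrite (itvint_split (f := Q x1) y0m ym1); last first.
 by apply: contQ2 => //; apply: hx; rewrite lexx andbT.
rewrite (itvint_split (f := Q x0) y0m ym1); last first.
 by apply: contQ2 => //; apply: hx; rewrite lexx.
ring.
Qed.

(** The affine parts of [P] and [Q] form a closed form, so their contributions [- r h w] and [r w h]
    cancel; only the error terms contribute, over a perimeter of order [w + h]. *)
Lemma circ_small (w h e x y x0 y0 r p1 q2 : R) : 0 < w -> 0 < h -> 0 < e ->
 a <= x0 -> x0 + w <= b -> c <= y0 -> y0 + h <= d ->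
 (forall u v, x0 <= u <= x0 + w -> y0 <= v <= y0 + h ->
   `|P u v - P x y - p1 * (u - x) - r * (v - y)| <= e * (w + h) /\
   `|Q u v - Q x y - r * (u - x) - q2 * (v - y)| <= e * (w + h)) ->
 `|circ P Q x0 (x0 + w) y0 (y0 + h)| <= 2 * e * (w + h) ^+ 2.
move=> w0 h0 e0 ax0 xb cy0 yd H.
have xw : x0 <= x0 + w by rewrite lerDl ltW.
have yh : y0 <= y0 + h by rewrite lerDl ltW.
have cy1 : c <= y0 <= d by rewrite cy0 (le_trans yh).
have cy2 : c <= y0 + h <= d by rewrite yd (le_trans cy0).
have ax1 : a <= x0 <= b by rewrite ax0 (le_trans xw).
have ax2 : a <= x0 + w <= b by rewrite xb (le_trans ax0).
have := @itvint_diff R (P ^~ y0) (P ^~ (y0 + h)) (- (r * h)) (2 * e * (w + h)) x0 (x0 + w) xw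
 (contP1 ax0 xb cy1) (contP1 ax0 xb cy2).
have := @itvint_diff R (Q (x0 + w)) (Q x0) (r * w) (2 * e * (w + h)) y0 (y0 + h) yh
 (contQ2 cy0 yd ax2) (contQ2 cy0 yd ax1).
have y00 : y0 <= y0 <= y0 + h by rewrite lexx.
have y0h : y0 <= y0 + h <= y0 + h by rewrite lexx andbT.
have x00 : x0 <= x0 <= x0 + w by rewrite lexx.
have x0w : x0 <= x0 + w <= x0 + w by rewrite lexx andbT.
move=> HQ HP.
have {}HP := HP _; have {}HQ := HQ _.
have kP : `|itvint (P ^~ y0) x0 (x0 + w) - itvint (P ^~ (y0 + h)) x0 (x0 + w) -
  - (r * h) * (x0 + w - x0)| <= 2 * e * (w + h) * (x0 + w - x0).
 apply: HP => u hu; have [k1 _] := H u y0 hu y00; have [k2 _] := H u (y0 + h) hu y0h.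
 move: k1 k2; rewrite !ler_norml => /andP[? ?] /andP[? ?]; apply/andP; split; lra.
have kQ : `|itvint (Q (x0 + w)) y0 (y0 + h) - itvint (Q x0) y0 (y0 + h) -
  r * w * (y0 + h - y0)| <= 2 * e * (w + h) * (y0 + h - y0).
 apply: HQ => v hv; have [_ k1] := H x0 v x00 hv; have [_ k2] := H (x0 + w) v x0w hv.
 move: k1 k2; rewrite !ler_norml => /andP[? ?] /andP[? ?]; apply/andP; split; lra.
move: kP kQ; rewrite /circ.
move: (itvint _ _ _) (itvint _ _ _) => A B.
move: (itvint _ _ _) (itvint _ _ _) => A' B'; clear.
rewrite !ler_norml => /andP[? ?] /andP[? ?]; apply/andP; split; nra.
Qed.

Section Bisection.
Variables (w0 h0 e : R).
Let W (k : nat) : R := w0 / 2 ^+ k.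
Let H (k : nat) : R := h0 / 2 ^+ k.
Definition big_at k (p : R * R) : bool :=
 e * (W k * H k) < `|circ P Q p.1 (p.1 + W k) p.2 (p.2 + H k)|.
(** Select a quarter whose circulation still exceeds [e] times its area. The last branch makes no
    test: if the other three fail, [bis_big] shows that it is big. *)
Definition bis_next k (p : R * R) : R * R :=
 if big_at k.+1 p then p
 else if big_at k.+1 (p.1 + W k.+1, p.2) then (p.1 + W k.+1, p.2)
 else if big_at k.+1 (p.1, p.2 + H k.+1) then (p.1, p.2 + H k.+1)
 else (p.1 + W k.+1, p.2 + H k.+1).
Fixpoint bis k : R * R := if k is k'.+1 then bis_next k' (bis k') else (a, c).

Hypotheses (w0_gt0 : 0 < w0) (h0_gt0 : 0 < h0) (e_gt0 : 0 < e).
Hypotheses (abw : a + w0 = b) (cdh : c + h0 = d).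

Lemma WS k : W k = W k.+1 + W k.+1.
by rewrite /W exprS; field. Qed.
Lemma HS k : H k = H k.+1 + H k.+1.
by rewrite /H exprS; field. Qed.
Lemma W_gt0 k : 0 < W k. by rewrite divr_gt0// exprn_gt0. Qed.
Lemma H_gt0 k : 0 < H k. by rewrite divr_gt0// exprn_gt0. Qed.

Lemma bis_cases k : (bis k.+1).1 = (bis k).1 \/ (bis k.+1).1 = (bis k).1 + W k.+1.
rewrite /= /bis_next; case: ifP => _; first by left.
case: ifP => _; first by right.
by case: ifP => _; [left|right].
Qed.
Lemma bis_cases2 k : (bis k.+1).2 = (bis k).2 \/ (bis k.+1).2 = (bis k).2 + H k.+1.
rewrite /= /bis_next; case: ifP => _; first by left.
case: ifP => _; first by left.
by case: ifP => _; right.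
Qed.

Lemma bis_bounds k : [/\ a <= (bis k).1, (bis k).1 + W k <= b,
 c <= (bis k).2 & (bis k).2 + H k <= d].
elim: k => [|k [i1 i2 i3 i4]].
 by rewrite /W /H /= expr0 !divr1 abw cdh !lexx.
have := W_gt0 k.+1; have := H_gt0 k.+1.
rewrite (WS k) in i2; rewrite (HS k) in i4.
by case: (bis_cases k) => ->; case: (bis_cases2 k) => -> *; split; lra.
Qed.

Lemma bis_big k : big_at 0 (a, c) -> big_at k (bis k).
move=> h; elim: k => [//|k ih].
rewrite [bis _]/= /bis_next; case: ifP => // b1; case: ifP => // b2; case: ifP => // b3.
apply: contraT => b4; move: ih b1 b2 b3 b4.
have [i1 i2 i3 i4] := bis_bounds k.
have := W_gt0 k.+1; have := H_gt0 k.+1; move: i2 i4.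
rewrite /big_at (WS k) (HS k) /=.
set x := (bis k).1 in i1 *; set y := (bis k).2 in i3 *.
set w := W k.+1; set hh := H k.+1 => i2 i4 hp wp.
have -> : circ P Q x (x + (w + w)) y (y + (hh + hh)) =
 circ P Q x (x + w) y (y + hh) + circ P Q (x + w) (x + w + w) y (y + hh) +
 (circ P Q x (x + w) (y + hh) (y + hh + hh) +
  circ P Q (x + w) (x + w + w) (y + hh) (y + hh + hh)).
 rewrite (addrA x) (addrA y); apply: circ_split => //; lra.
move=> + /negbT + /negbT + /negbT; rewrite -!leNgt.
move: (circ _ _ _ _ _ _) (circ _ _ _ _ _ _) (circ _ _ _ _ _ _) (circ _ _ _ _ _ _).
move=> c1 c2 c3 c4 k0 k1 k2 k3 k4.
have := ler_normD (c4 + c3) (c2 + c1); have := ler_normD c4 c3; have := ler_normD c2 c1.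
lra.
Qed.

Lemma bis_mono k j : (k <= j)%N -> [/\ (bis k).1 <= (bis j).1, (bis j).1 + W j <= (bis k).1 + W k,
 (bis k).2 <= (bis j).2 & (bis j).2 + H j <= (bis k).2 + H k].
elim: j => [|j ih]; first by rewrite leqn0 => /eqP ->; rewrite !lexx.
rewrite leq_eqVlt => /orP[/eqP ->|]; first by rewrite !lexx.
rewrite ltnS => /ih[i1 i2 i3 i4].
have := W_gt0 j.+1; have := H_gt0 j.+1.
rewrite (WS j) in i2; rewrite (HS j) in i4.
by case: (bis_cases j) => ->; case: (bis_cases2 j) => -> *; split; lra.
Qed.

Lemma nested_point (u l : nat -> R) : (forall k, 0 < l k) ->
 (forall k j, (k <= j)%N -> u k <= u j /\ u j + l j <= u k + l k) ->
 exists x, forall k, u k <= x <= u k + l k.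
move=> l0 hm; pose S := [set u k | k in setT].
have ubS k : ubound S (u k + l k).
 move=> _ [j _ <-]; have [kj|jk] := leqP k j.
  by have [_ h1] := hm _ _ kj; have := l0 j; lra.
 by have [h1 _] := hm _ _ (ltnW jk); have := l0 k; lra.
have hs : has_sup S by split; [exists (u 0); exists 0|exists (u 0 + l 0); exact: ubS].
exists (sup S) => k; apply/andP; split.
 by apply: (ub_le_sup hs.2); exists k.
by apply: ge_sup; [case: hs|exact: ubS].
Qed.

Lemma not_big : ~ big_at 0 (a, c).
move=> h0'.
have [x hx] := @nested_point (fun k => (bis k).1) W W_gt0
 (fun k j kj => let: And4 p q _ _ := bis_mono kj in conj p q).
have [y hy] := @nested_point (fun k => (bis k).2) H H_gt0
 (fun k j kj => let: And4 _ _ p q := bis_mono kj in conj p q).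
have hW0 : W 0 = w0 by rewrite /W expr0 divr1.
have hH0 : H 0 = h0 by rewrite /H expr0 divr1.
have xab : a <= x <= b by have := hx 0%N; rewrite /= hW0 abw.
have ycd : c <= y <= d by have := hy 0%N; rewrite /= hH0 cdh.
have [p1 [q2 [r [hP hQ]]]] := hPQ xab ycd.
(* Chosen so that the bound [2 e1 (W k + H k)^2] of [circ_small] is half of [e (W k * H k)],
   whatever [k] is. *)
pose e1 := e * (w0 * h0) / (4 * (w0 + h0) ^+ 2).
have s0 : 0 < w0 + h0 by rewrite addr_gt0.
have e10 : 0 < e1 by rewrite divr_gt0 ?mulr_gt0 ?exprn_gt0.
have [d1 d10 k1] := hP _ e10; have [d2 d20 k2] := hQ _ e10.
pose dd := Num.min d1 d2; have dd0 : 0 < dd by rewrite lt_min d10.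
have dd1 : dd <= d1 by rewrite ge_min lexx.
have dd2 : dd <= d2 by rewrite ge_min lexx orbT.
have [k hk] : exists k, W k + H k < dd.
 have : exists k : nat, (w0 + h0) / dd < k%:R.
  by exists (Num.truncn ((w0 + h0) / dd)).+1; rewrite truncnS_gt.
 move=> [k hk]; exists k; rewrite /W /H -mulrDl ltr_pdivrMr ?exprn_gt0//.
 rewrite mulrC -ltr_pdivrMr//; apply: lt_le_trans hk _.
 by rewrite -natrX ler_nat ltnW// ltn_expl.
have [b1 b2 b3 b4] := bis_bounds k.
have wk := W_gt0 k; have hk0 := H_gt0 k.
have := @circ_small (W k) (H k) e1 x y (bis k).1 (bis k).2 r p1 q2 wk hk0 e10 b1 b2 b3 b4.
have := bis_big k h0'; rewrite /big_at => hb hs.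
have {}hs : `|circ P Q (bis k).1 ((bis k).1 + W k) (bis k).2 ((bis k).2 + H k)| <=
 2 * e1 * (W k + H k) ^+ 2.
 apply: hs => u v /andP[u1 u2] /andP[v1 v2].
 have /andP[x1 x2] := hx k; have /andP[y1 y2] := hy k.
 have ux : `|u - x| <= W k by rewrite ler_norml; apply/andP; split; lra.
 have vy : `|v - y| <= H k by rewrite ler_norml; apply/andP; split; lra.
 have q1 : `|u - x| < d1 by lra.
 have q3 : `|v - y| < d1 by lra.
 have q4 : `|u - x| < d2 by lra.
 have q5 : `|v - y| < d2 by lra.
 have := k1 _ _ q1 q3; have := k2 _ _ q4 q5.
 rewrite ![x + _]addrC ![y + _]addrC !subrK => m2 m1.
 by split; [apply: le_trans m1 _|apply: le_trans m2 _]; rewrite ler_pM2l// lerD.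
have ee : 2 * e1 * (W k + H k) ^+ 2 = e / 2 * (W k * H k).
 rewrite /e1 /W /H -mulrDl exprMn; field.
 by rewrite expf_neq0//= lt0r_neq0.
have : 0 < e * (W k * H k) by rewrite !mulr_gt0.
lra.
Qed.

End Bisection.

Lemma goursat : a < b -> c < d -> circ P Q a b c d = 0.
move=> ab cd; apply/eqP; rewrite -normr_eq0 eq_le normr_ge0 andbT leNgt.
apply/negP => c0.
have w0 : 0 < b - a by rewrite subr_gt0.
have h0 : 0 < d - c by rewrite subr_gt0.
(* Half of the circulation per unit of area, so that the whole rectangle is strictly big. *)
pose e := `|circ P Q a b c d| / (2 * ((b - a) * (d - c))).
have e0 : 0 < e by rewrite divr_gt0// !mulr_gt0.
apply: (@not_big (b - a) (d - c) e w0 h0 e0); rewrite ?(addrC _ (_ - _)) ?subrK//.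
rewrite /big_at /= expr0 !divr1 !(addrC _ (_ - _)) !subrK /e.
rewrite (_ : `|circ P Q a b c d| / (2 * ((b - a) * (d - c))) * ((b - a) * (d - c)) =
 `|circ P Q a b c d| / 2).
 by rewrite ltr_pdivrMr// ltr_pMr// ltr1n.
by field; rewrite !lt0r_neq0.
Qed.

End Goursat.

Lemma is_derive_comp (K : numFieldType) (f g : K -> K) (x a b : K) :
 is_derive (g x) (1 : K) f a -> is_derive x (1 : K) g b -> is_derive x (1 : K) (f \o g) (b * a).
move=> [/derivable1_diffP df <-] [/derivable1_diffP dg <-].
have h := differentiable_comp dg df.
apply: DeriveDef; first by apply/derivable1_diffP.
have E u : 'd f (g x) u = u * 'd f (g x) 1 by rewrite -[in LHS](mulr1 u) linearZ.
by rewrite (deriveE _ h) (deriveE _ dg) (deriveE _ df) diff_comp//= E.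
Qed.

(** * One complex variable: Cauchy-Riemann equations, invariant means, Cauchy's estimate *)

Section MeanValue.
Variable R : realType.
Local Notation C := (cplx R).
Implicit Types (F G : C -> C) (l m d : C).

Definition cdiff F l d := forall e : R, 0 < e -> exists2 del : R, 0 < del &
 forall m, modC m < del -> modC (F (l + m) - F l - m * d) <= e * modC m.

Lemma cdiffP F l d : cdiff F l d <-> is_derive l (1 : C) F d.
split=> [H|/is_deriveP H]; last first.
 move=> e e0; have [|del del0 h] := H (rc e); first by rewrite /rc ltcR.
 have dE : del = rc (re del) by move: del0; rewrite ltcE /= => /andP[/eqP i _]; apply: cplxP; rewrite ?ReImE.
 exists (re del) => [|m hm]; first exact: re_gt0.
 by have := h m; rewrite !normC_modC dE /rc ltcR -rmorphM /= lecR; apply.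
apply/is_deriveP => e e0.
have eE : e = rc (re e) by move: e0; rewrite ltcE /= => /andP[/eqP i _]; apply: cplxP; rewrite ?ReImE.
have [del del0 h] := H _ (re_gt0 e0); exists (rc del) => [|m]; first by rewrite /rc ltcR.
by rewrite !normC_modC eE /rc ltcR -rmorphM /= lecR; exact: h.
Qed.

Lemma cdiffM F G l d d' : cdiff F l d -> cdiff G l d' ->
 cdiff (fun x => F x * G x) l (d * G l + F l * d').
move=> /cdiffP h1 /cdiffP h2; apply/cdiffP; apply: (is_derive_eq (is_deriveM h1 h2)).
by rewrite /GRing.scale /= addrC [G l * d]mulrC.
Qed.

Lemma cdiff_comp F G l d d' : cdiff G l d' -> cdiff F (G l) d ->
 cdiff (fun x => F (G x)) l (d' * d).
by move=> /cdiffP h1 /cdiffP h2; apply/cdiffP; exact: (is_derive_comp h2 h1).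
Qed.

(** Along the segment from 0 to [m], one mean value inequality bounds [e^m - 1] and a second one
    bounds [e^m - 1 - m]. *)
Lemma cdiff_cexp l : cdiff (@cexp R) l (cexp l).
move=> e e0; pose A := 4 * expR 1 * modC (cexp l).
have A0 : 0 <= A by rewrite !mulr_ge0// expR_ge0.
have A1 : 0 < A + 1 by rewrite ltr_wpDl.
exists (Num.min 1 (e / (A + 1))) => [|m]; first by rewrite lt_min ltr01 divr_gt0.
rewrite lt_min ltr_pdivlMr// => /andP[m1 m2].
have h2 (t : R) : 0 <= t <= 1 -> cder (fun s => cexp (rc s * m)) t (m * cexp (rc t * m)).
 move=> _; apply: cder_cexp.
 have := cderM (cder_rc (rder_id t)) (cder_cst m t).
 by rewrite RtoC1 mul1r mulr0 addr0.
have b1 (t : R) : 0 <= t <= 1 -> modC (cexp (rc t * m)) <= expR 1.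
 move=> /andP[t0 t1]; rewrite modC_cexp ler_expR !ReImE mul0r subr0.
 have := ler_Re_modC m; rewrite ler_norml; nra.
have b2 (t : R) : 0 <= t <= 1 -> modC (cexp (rc t * m) - 1) <= 2 * (expR 1 * modC m).
 move=> /andP[t0 t1].
 have := @cder_lip _ (fun s => cexp (rc s * m)) (fun s => m * cexp (rc s * m))
  (expR 1 * modC m) 0 t t0.
 rewrite RtoC0 mul0r cexp0 subr0 => H; apply: le_trans (H _ _) _.
 - by move=> s /andP[s0 s1]; apply: h2; rewrite s0/=; lra.
 - move=> s /andP[s0 s1]; rewrite modCM mulrC ler_wpM2r// b1// s0/=; lra.
 - have : 0 <= expR 1 * modC m by [].
  nra.
have := @cder_lip _ (fun s => cexp (rc s * m) - rc s * m) (fun s => m * (cexp (rc s * m) - 1))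
 (modC m * (2 * (expR 1 * modC m))) 0 1 ler01.
rewrite RtoC0 RtoC1 mul0r mul1r cexp0 !subr0 mulr1 => H.
rewrite cexpD (_ : cexp l * cexp m - cexp l - m * cexp l = cexp l * (cexp m - m - 1)); last by ring.
rewrite modCM; apply: (@le_trans _ _ (modC (cexp l) * (2 * (modC m * (2 * (expR 1 * modC m)))))).
 rewrite ler_wpM2l//; apply: H.
 - move=> t t01; rewrite mulrBr mulr1; apply: cderB; first exact: h2.
  have := cderM (cder_rc (rder_id t)) (cder_cst m t).
  by rewrite RtoC1 mul1r mulr0 addr0.
 - by move=> t t01; rewrite modCM ler_wpM2l// b2.
rewrite (_ : _ * _ = A * modC m * modC m); last by rewrite /A; ring.
rewrite ler_wpM2r//; have := modC_ge0 m; nra.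
Qed.

(** The Cauchy-Riemann equations: the differential is multiplication by [d]. *)
Lemma cdiff_2v F (x y : R) d : cdiff F (mkC x y) d ->
 diff2v (fun s t => re (F (mkC s t))) x y (re d) (- im d) /\
 diff2v (fun s t => im (F (mkC s t))) x y (im d) (re d).
move=> H.
have aux (e : R) : 0 < e -> exists2 dl : R, 0 < dl & forall h k : R, `|h| < dl -> `|k| < dl ->
  modC (F (mkC (x + h) (y + k)) - F (mkC x y) - mkC h k * d) <= e * (`|h| + `|k|).
 move=> e0; have [dl dl0 hd] := H e e0; exists (dl / 2); first by rewrite divr_gt0.
 move=> h k hh hk; have hm := modC_le_ri (mkC h k); rewrite re_mkC im_mkC in hm.
 have -> : mkC (x + h) (y + k) = mkC x y + mkC h k by [].
 apply: le_trans (hd _ _) _; first by lra.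
 by rewrite ler_wpM2l// ltW.
split=> e /aux[dl dl0 hd]; exists dl => // h k hh hk; apply: le_trans (hd h k hh hk).
- apply: le_trans (ler_Re_modC _); rewrite !ReImE re_mkC im_mkC.
 by apply: eqle; congr Num.norm; ring.
- apply: le_trans (ler_Im_modC _); rewrite !ReImE re_mkC im_mkC.
 by apply: eqle; congr Num.norm; ring.
Qed.

Lemma diff2vN P x y (p1 p2 : R) : diff2v P x y p1 p2 -> diff2v (fun s t => - P s t) x y (- p1) (- p2).
move=> H e /H[d d0 hd]; exists d => // h k /hd/[apply]; congr (_ <= _).
by rewrite -normrN; congr Num.norm; ring.
Qed.
Lemma norm_close (i x t e : R) : `|i| <= t -> `|i - x| <= e -> `|x| <= t + e.
by rewrite !ler_norml; lra. Qed.

(* The mean of [G] over the period [0, 2 pi] of the line [Re = s] does not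
  depend on [s], by Goursat's theorem on [s0, s1] x [0, 2 pi]. *)
Lemma periodic_mean_bound G (l : C) (s1 M : R) :
 (forall x y : R, x <= s1 -> exists d, cdiff G (mkC x y) d) ->
 (forall x y : R, G (mkC x (y + 2 * pi)) = G (mkC x y)) ->
 (forall e : R, 0 < e -> exists s, forall x y : R, x <= s -> modC (G (mkC x y) - l) <= e) ->
 (forall y : R, modC (G (mkC s1 y)) <= M) -> modC l <= 2 * M.
move=> hd per lim hM.
have p0 : 0 < 2 * pi :> R by rewrite mulr_gt0// pi_gt0.
pose f (b : bool) (x y : R) : R := if b then re (G (mkC x y)) else im (G (mkC x y)).
have lE (b : bool) (c : C) : `|if b then re c else im c| <= modC c.
 by case: b; [exact: ler_Re_modC|exact: ler_Im_modC].
have contf b x : x <= s1 -> cont_on (f b x) 0 (2 * pi).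
 move=> xs y _; have [d /cdiff_2v[h1 h2]] := hd x y xs.
 by case: b; [have [] := diff2v_cont1 h1|have [] := diff2v_cont1 h2].
have inv b s : s < s1 -> itvint (f b s1) 0 (2 * pi) = itvint (f b s) 0 (2 * pi).
 move=> ss.
 (* [P dx + f b dy] is the imaginary part of [G dz] for [b] true and minus its real part for [b]
    false. The horizontal sides cancel by periodicity. *)
 pose P := fun x y : R => if b then im (G (mkC x y)) else - re (G (mkC x y)).
 have H (x y : R) : s <= x <= s1 -> 0 <= y <= 2 * pi ->
   exists p1 q2 r, diff2v P x y p1 r /\ diff2v (f b) x y r q2.
  move=> /andP[_ xs] _; have [d /cdiff_2v[h1 h2]] := hd x y xs.
  rewrite /P /f; case: (b).
  - by exists (im d), (- im d), (re d).
  - exists (- re d), (re d), (im d); split=> //.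
   by have := diff2vN h1; rewrite opprK.
 have := goursat H ss p0; rewrite /circ.
 have -> : (P ^~ 0) = (P ^~ (2 * pi)).
  apply/funext => x; rewrite /P; have := per x 0; rewrite add0r => ->.
  by [].
 by rewrite subrr add0r => /eqP; rewrite subr_eq0 => /eqP.
have bnd b : `|if b then re l else im l| <= M.
 rewrite -(ler_pM2r p0); apply/ler_addgt0Pl => e e0.
 pose e' := e / (2 * pi); have e'0 : 0 < e' by rewrite divr_gt0.
 have [s hs] := lim _ e'0.
 pose s' := Num.min s (s1 - 1).
 have ss1 : s' < s1 by rewrite /s' gt_min; apply/orP; right; rewrite gtrBl.
 have h1 : `|itvint (f b s1) 0 (2 * pi)| <= M * (2 * pi - 0).
  apply: itvint_bound => //; first exact: contf.
  by move=> y _; apply: le_trans (hM y); rewrite /f; exact: lE.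
 have h2 : `|itvint (f b s') 0 (2 * pi) - itvint (fun=> 0) 0 (2 * pi) -
    (if b then re l else im l) * (2 * pi - 0)| <= e' * (2 * pi - 0).
  apply: itvint_diff; [by []|exact: contf (ltW ss1)|by move=> y _; exact: cst_continuous|].
  move=> y _; rewrite subr0.
  have k1 : modC (G (mkC s' y) - l) <= e' by apply: hs; rewrite ge_min lexx.
  apply: le_trans k1; apply: le_trans (lE b _); rewrite /f.
  by case: (b); rewrite !ReImE.
 have z0 : itvint (fun=> 0) 0 (2 * pi) = 0 :> R.
  have := @itvint_bound R (fun=> 0) 0 0 (2 * pi) (ltW p0).
  rewrite mul0r => H; apply/eqP; rewrite -normr_eq0 eq_le normr_ge0 andbT.
  by apply: H => [y _|y _]; [exact: cst_continuous|rewrite normr0].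
 move: h1 h2; rewrite z0 subr0 (inv b s' ss1) !subr0.
 have -> : e' * (2 * pi) = e by rewrite /e' mulfVK// lt0r_neq0.
 move=> h1 h2; rewrite -{1}(gtr0_norm p0) -normrM.
 by rewrite addrC; exact: norm_close h1 h2.
have := bnd true; have := bnd false; have := modC_le_ri l; rewrite /=; lra.
Qed.

(* Cauchy's estimate, via [w |-> (F (e^w) - F 0) e^-w]. *)
Lemma cauchy_disc F (d0 : C) (r M : R) : 0 < r -> cdiff F 0 d0 ->
 (forall l, modC l <= r -> exists d, cdiff F l d) ->
 (forall l, modC l <= r -> modC (F l) <= M) -> modC d0 <= 4 * M / r.
move=> r0 hd0 hd hM.
have e_neq0 (w : C) : cexp w != 0 by rewrite -modC_gt0 modC_cexp expR_gt0.
pose G (w : C) := (F (cexp w) - F 0) * cexp (- w).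
have cexpNE (w : C) : cexp (- w) = (cexp w)^-1.
 by apply: (mulfI (e_neq0 w)); rewrite -cexpD subrr cexp0 divff.
have hG (x y : R) : x <= ln r -> exists d, cdiff G (mkC x y) d.
 move=> xr; have lr : modC (cexp (mkC x y)) <= r.
  by rewrite modC_cexp re_mkC -(@lnK _ r) ?posrE// ler_expR.
 have [d hdl] := hd _ lr.
 have /cdiffP h1 := cdiff_comp (cdiff_cexp (mkC x y)) hdl.
 have h2 := iffRL (cdiffP _ _ _) (is_deriveB h1 (is_derive_cst (F 0) _ _)).
 have h3 := iffRL (cdiffP _ _ _) (is_deriveNid (mkC x y) 1).
 by eexists; exact: cdiffM h2 (cdiff_comp h3 (cdiff_cexp (- mkC x y))).
have := @periodic_mean_bound G d0 (ln r) (2 * M / r) hG.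
move=> H; apply: le_trans (H _ _ _) _.
- move=> x y; rewrite /G (_ : mkC x (y + 2 * pi) = mkC x y + mkC 0 (2 * pi)); last first.
  by apply: cplxP; rewrite !ReImE /re /im /= ?addr0.
 have e2 : cexp (mkC 0 (2 * pi)) = 1 :> C.
  rewrite /cexp re_mkC im_mkC expR0 (_ : mkC (cos _) _ = 1) ?mulr1// /mkC.
  by rewrite mulrC mulr_natr cos2pi sin2pi.
 by rewrite !cexpNE cexpD e2 mulr1.
- move=> e e0; have [dl dl0 hdl] := hd0 e e0.
 exists (ln (dl / 2)) => x y xs.
 have dl2 : 0 < dl / 2 by rewrite divr_gt0.
 have m1 : modC (cexp (mkC x y)) < dl.
  rewrite modC_cexp re_mkC; apply: (@le_lt_trans _ _ (dl / 2)); last by lra.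
  by rewrite -(@lnK _ (dl / 2)) ?posrE// ler_expR.
 have := hdl _ m1; rewrite add0r /G cexpNE => k1.
 rewrite (_ : _ - d0 = (F (cexp (mkC x y)) - F 0 - cexp (mkC x y) * d0) / cexp (mkC x y)); last first.
  by field; exact: e_neq0.
 by rewrite modCM modCV ler_pdivrMr// modC_gt0.
- move=> y; rewrite /G modCM cexpNE modCV modC_cexp re_mkC lnK ?posrE//.
 rewrite ler_wpM2r ?invr_ge0 ?(ltW r0)//.
 apply: le_trans (modCB _ _) _.
 have := hM 0; rewrite modC0 => /(_ (ltW r0)).
 have := hM (cexp (mkC (ln r) y)); rewrite modC_cexp re_mkC lnK ?posrE// => /(_ (lexx _)).
 lra.
by apply: eqle; ring.
Qed.

End MeanValue.

(** * Holomorphic functions of several variables are of class C^1 *)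

Section Hol.
Variables (R : realType) (n : nat).
Local Notation C := (cplx R).
Local Notation V := (Cn R n).
Implicit Types (U : set V) (f g : V -> C) (z w v h a : V).

Definition blin a h : C := \sum_j a 0 j * h 0 j.
Lemma blinZ a (c : C) h : blin a (c *: h) = c * blin a h.
by rewrite /blin mulr_sumr; apply: eq_bigr => j _; rewrite mxE mulrCA. Qed.
Definition fder f z a := forall e : R, 0 < e -> exists2 d : R, 0 < d &
 forall h, nr h < d -> modC (f (z + h) - f z - blin a h) <= e * nr h.
(** Complex differentiability at every point and nothing more; regularity is recovered in [hol_C1]
    and [hol_dz]. *)
Definition hol U f := forall z, U z -> exists a, fder f z a.

Lemma fder_cdiff f z a v (l : C) : fder f (z + l *: v) a ->
 cdiff (fun m => f (z + m *: v)) l (blin a v).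
move=> H e e0.
have N0 : 0 < nr v + 1 by rewrite ltr_wpDl.
have [d d0 hd] := H _ (divr_gt0 e0 N0).
exists (d / (nr v + 1)) => [|m]; first by rewrite divr_gt0.
rewrite ltr_pdivlMr// => hm.
have := hd (m *: v); rewrite nrZ blinZ scalerDl addrA.
have m1 : modC m * nr v <= modC m * (nr v + 1) by rewrite ler_wpM2l// lerDl.
move=> /(_ (le_lt_trans m1 hm)) k; apply: le_trans k _.
rewrite -mulrA ler_wpM2l ?(ltW e0)// mulrC ler_pdivrMr//.
Qed.

Lemma fder_cder f z a v (t : R) : fder f (z + rc t *: v) a ->
 cder (fun s => f (z + rc s *: v)) t (blin a v).
move=> /fder_cdiff H e /H[d d0 hd]; exists d => // h hh.
by have := hd (rc h); rewrite modCR RtoCD => /(_ hh).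
Qed.
Lemma fder_dir f z a v : fder f z a ->
 dir_derivable v f z /\ dir_deriv v f z = blin a v.
move=> H; apply/dirP.
by have := @fder_cder f z a v 0; rewrite RtoC0 scale0r addr0; apply.
Qed.
Lemma hol_dir U f z v : hol U f -> U z -> dir_derivable v f z.
by move=> h /h[a /(fder_dir v)[]]. Qed.
Lemma blin_x a j : blin a (xdir R j) = a 0 j.
rewrite /blin (bigD1 j)//= xdirE mxE !eqxx mulr1 big1 ?addr0// => i ij.
by rewrite mxE (negbTE ij) andbF mulr0.
Qed.
Lemma blin_y a j : blin a (ydir R j) = ii R * a 0 j.
by rewrite ydirE blinZ -xdirE blin_x. Qed.

Lemma fder_dz f z a j : fder f z a -> dz j f z = a 0 j /\ dbar j f z = 0.
move=> H; have [_ hx] := fder_dir (xdir R j) H; have [_ hy] := fder_dir (ydir R j) H.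
rewrite dzE dbarE hx hy blin_x blin_y mulrA ii2 mulN1r opprK subrr mul0r.
by split=> //; field.
Qed.

Lemma hol_dbar U f z j : hol U f -> U z -> dbar j f z = 0.
by move=> h /h[a /(fder_dz j)[]]. Qed.
Lemma hol_dirE U f z v : hol U f -> U z -> dir_deriv v f z = \sum_j dz j f z * v 0 j.
move=> h /h[a ha]; have [_ ->] := fder_dir v ha; apply: eq_bigr => j _.
by have [-> _] := fder_dz j ha.
Qed.

Lemma hol_cont U f z : hol U f -> U z -> cont_at f z.
move=> hf /hf[a H]; apply/contP => e e0; have [d d0 hd] := H 1 ltr01.
pose M := \sum_j modC (a 0 j) + 1.
have S0 : 0 <= \sum_j modC (a 0 j) by apply: sumr_ge0.
have M0 : 0 < M by rewrite ltr_wpDl.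
have hb h : modC (blin a h) <= (\sum_j modC (a 0 j)) * nr h.
 rewrite (le_trans (modC_sum _ _ _))// mulr_suml; apply: ler_sum => j _.
 by rewrite modCM ler_wpM2l// modC_coord.
exists (Num.min d (e / M)) => [|w]; first by rewrite lt_min d0 divr_gt0.
rewrite lt_min ltr_pdivlMr// => /andP[/hd + k2]; rewrite [z + _]addrC subrK => k1.
have -> : f w - f z = (f w - f z - blin a (w - z)) + blin a (w - z) by ring.
rewrite (le_lt_trans (modCD _ _))//.
have := hb (w - z); rewrite /M in k2; have := nr_ge0 (w - z); nra.
Qed.

(** One-variable Cauchy estimate on the complex line through [z] in direction [v], on a disc of
    radius [r / |v|]. *)
Lemma cauchy_dir f z v (r M : R) : 0 < r ->
 (forall w, nr (w - z) <= r -> exists a, fder f w a) ->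
 (forall w, nr (w - z) <= r -> modC (f w) <= M) ->
 modC (dir_deriv v f z) <= 4 * M / r * nr v.
move=> r0 hf hM.
have [v0|v0] := eqVneq (nr v) 0.
 have [a ha] : exists a, fder f z a by apply: hf; rewrite subrr nr0 ltW.
 have [_ ->] := fder_dir v ha.
 move/eqP: v0; rewrite nr_eq0 => /eqP ->.
 by rewrite -(scale0r 0) blinZ mul0r scale0r nr0 mulr0 modC0.
have vp : 0 < nr v by rewrite lt_def v0 /=.
have [a ha] : exists a, fder f z a by apply: hf; rewrite subrr nr0 ltW.
have [_ ->] := fder_dir v ha.
have inr (l : C) : modC l <= r / nr v -> nr (z + l *: v - z) <= r.
 by rewrite addKl nrZ ler_pdivlMr.
have := @cauchy_disc R (fun m => f (z + m *: v)) (blin a v) (r / nr v) M (divr_gt0 r0 vp).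
move=> H; apply: le_trans (H _ _ _) _.
- by apply: fder_cdiff; rewrite scale0r addr0.
- move=> l /inr /hf[b hb]; exists (blin b v); exact: fder_cdiff.
- by move=> l /inr; exact: hM.
by apply: eqle; field; rewrite v0 lt0r_neq0.
Qed.

(** Cauchy's estimate on balls of radius [r] about the points of the segment, which is why the
    hypotheses concern the radius [2 * r]. *)
Lemma hol_lip U f z (r M : R) : 0 < r -> hol U f ->
 (forall w, nr (w - z) <= 2 * r -> U w) ->
 (forall w, nr (w - z) <= 2 * r -> modC (f w) <= M) ->
 forall w w', nr (w - z) <= r -> nr (w' - z) <= r ->
 modC (f w - f w') <= 8 * M / r * nr (w - w').
move=> r0 hf hU hM w w' hw hw'.
have seg (t : R) : 0 <= t <= 1 -> nr (w' + rc t *: (w - w') - z) <= r.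
 move=> /andP[t0 t1].
 have -> : w' + rc t *: (w - w') - z = rc (1 - t) *: (w' - z) + rc t *: (w - z).
  by apply/rowP => j; rewrite !mxE RtoCB RtoC1; ring.
 rewrite (le_trans (nrD _ _))// !nrZR !ger0_norm ?subr_ge0//; nra.
have near (t : R) p : 0 <= t <= 1 -> nr (p - (w' + rc t *: (w - w'))) <= r -> nr (p - z) <= 2 * r.
 move=> /seg h1 h2; apply: le_trans (nr_distD (w' + rc t *: (w - w')) _ _) _; lra.
have := @cder_lip _ (fun s => f (w' + rc s *: (w - w')))
 (fun s => dir_deriv (w - w') f (w' + rc s *: (w - w')))
 (4 * M / r * nr (w - w')) 0 1 ler01.
rewrite RtoC1 scale1r RtoC0 scale0r addr0 [w' + (w - w')]addrC subrK subr0 mulr1.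
have -> : 2 * (4 * M / r * nr (w - w')) = 8 * M / r * nr (w - w') by ring.
apply => t t01.
- apply: dir_line => //; apply: hol_dir hf _; apply: hU; apply: (near t) => //.
 by rewrite subrr nr0 ltW.
- apply: cauchy_dir => // p hp; have := near t p t01 hp.
 + by move=> /hU /hf.
 + exact: hM.
Qed.

Lemma hol_shift_sub U f z u (r : R) : hol U f ->
 (forall w, nr (w - z) <= r + nr u -> U w) ->
 forall w, nr (w - z) <= r -> exists a, fder (fun w => f (w + u) - f w) w a.
move=> hf hU w hw.
have u0 := nr_ge0 u.
have [a ha] : exists a, fder f w a by apply: hf; apply: hU; lra.
have [b hb] : exists b, fder f (w + u) b.
 apply: hf; apply: hU; rewrite (_ : w + u - z = (w - z) + u); last by rewrite addrAC.
 by apply: le_trans (nrD _ _) _; lra.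
exists (b - a) => e e0; have e2 : 0 < e / 2 by rewrite divr_gt0.
have [d1 d10 h1] := ha _ e2; have [d2 d20 h2] := hb _ e2.
exists (Num.min d1 d2) => [|h]; first by rewrite lt_min d10.
rewrite lt_min => /andP[/h1 k1 /h2 k2].
have -> : blin (b - a) h = blin b h - blin a h.
 by rewrite /blin -sumrB; apply: eq_bigr => j _; rewrite !mxE mulrBl.
rewrite [w + h + u]addrAC.
have -> : f (w + u + h) - f (w + h) - (f (w + u) - f w) - (blin b h - blin a h) =
 (f (w + u + h) - f (w + u) - blin b h) - (f (w + h) - f w - blin a h) by ring.
by apply: le_trans (modCB _ _) _; lra.
Qed.

(** Continuity of a partial derivative: the difference of its values at [z + u] and [z] is the
    derivative of [f (. + u) - f], which is holomorphic and [O(|u|)] by [hol_lip]; Cauchy's estimate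
    concludes. *)
Lemma hol_C1 U f : openU U -> hol U f -> Ck 1 U f.
move=> oU hf; apply: CkS_intro => [z Uz|v cv]; first exact: hol_cont hf Uz.
split=> [z Uz|]; first exact: hol_dir hf Uz.
split=> // z Uz; apply/contP => e e0.
have [r r0 hr] := oU _ Uz.
have /contP/(_ _ ltr01)[d d0 hd] := hol_cont hf Uz.
(* Lipschitz bounds on a ball of radius [2 q] use the ball of radius [4 q], which must lie in [U]
   and in the region where [f] is bounded. *)
pose q := Num.min r d / 5.
have m0 : 0 < Num.min r d by rewrite lt_min r0.
have q0 : 0 < q by rewrite divr_gt0.
have qr : 4 * q < Num.min r d by rewrite /q; lra.
pose M := modC (f z) + 1; have M0 : 0 < M by rewrite ltr_wpDl.
have inU w : nr (w - z) <= 4 * q -> U w /\ modC (f w) <= M.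
 move=> h; have := le_lt_trans h qr; rewrite lt_min => /andP[/hr Uw /hd k].
 by split=> //; have := modCBr (f w) (f z); rewrite /M; lra.
have lip := @hol_lip U f z (2 * q) M _ hf.
pose L := 8 * M / (2 * q).
have L0 : 0 < L by rewrite divr_gt0 ?mulr_gt0.
pose K := 4 * L / q + 1; have K0 : 0 < K by rewrite /K ltr_wpDl// divr_ge0 ?(ltW q0)// mulr_ge0// ltW.
exists (Num.min q (e / K)) => [|w]; first by rewrite lt_min q0 divr_gt0.
rewrite lt_min => /andP[k1 k2']; have k2 : nr (w - z) * K < e by rewrite -ltr_pdivlMr.
pose u := w - z; have u0 := nr_ge0 u.
have dE : dir_deriv v (fun w => f (w + u) - f w) z = dir_deriv v f w - dir_deriv v f z.
 have Uw : U w by apply: (inU w _).1; lra.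
 apply: (proj2 (iffLR (dirP _ _ _ _) _)).
 have hw := iffRL (dirP f v w _) (conj (hol_dir v hf Uw) erefl).
 have hz := iffRL (dirP f v z _) (conj (hol_dir v hf Uz) erefl).
 apply: eq_cder (cderB hw hz) _ => s; congr (f _ - _).
 by rewrite addrAC /u [z + (w - z)]addrC subrK.
rewrite -dE; apply: le_lt_trans (_ : 4 * (L * nr u) / q * nr v < e).
 apply: cauchy_dir => // p hp.
 - apply: (hol_shift_sub (r := q) (z := z) hf) => // w' hw'.
  by apply: (inU w' _).1; rewrite /u in hw'; lra.
 - have := lip _ _ _ (p + u) p; rewrite addKl; apply.
  + by rewrite mulr_gt0.
  + by move=> w' hw'; apply: (inU w' _).1; lra.
  + by move=> w' hw'; apply: (inU w' _).2; lra.
  + rewrite (_ : p + u - z = (p - z) + u); last by rewrite addrAC.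
   by apply: le_trans (nrD _ _) _; rewrite /u; lra.
  + lra.
rewrite (nr_crd cv) mulr1.
have -> : 4 * (L * nr u) / q = (K - 1) * nr u by rewrite /K; ring.
rewrite /u in u0 *; nra.
Qed.

Lemma mx_norm_le_nr h : `|h| <= rc (nr h).
have [e|/mx_norm_neq0[i e]] := eqVneq (mx_norm h) 0.
 by rewrite [`|h|]e -RtoC0 /rc lecR.
rewrite [`|h|]e normC_modC /rc lecR ord1; exact: modC_coord.
Qed.

Lemma holomorphic_hol U f : holomorphic U f -> hol U f.
move=> hf z Uz;
exists (\row_j 'd f z (delta_mx 0 j)) => e e0.
have /eqaddoP hlo := diff_locally (hf z Uz).
have e0' : 0 < rc e by rewrite rc_gt0.
have /nbhs_nrP[d d0 hd] := hlo _ e0'.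
exists d => // h hh; have := hd h; rewrite subr0 => /(_ hh).
have -> : blin (\row_j 'd f z (delta_mx 0 j)) h = 'd f z h.
 rewrite {2}(row_sum_delta h) linear_sum; apply: eq_bigr => j _.
 by rewrite linearZ mxE mulrC.
move=> k; rewrite -lecR; apply: le_trans (_ : rc e * `|h| <= _); last first.
 by rewrite /rc rmorphM /= ler_wpM2l ?mx_norm_le_nr// -/(rc e) ltW.
apply: le_trans k; rewrite -/(rc _) -normC_modC le_eqVlt; apply/orP; left; apply/eqP.
congr (`| _ |); rewrite /= !fctE /cst /= [h + z]addrC opprD addrA.
by [].
Qed.

End Hol.

(** * Lebesgue measure on tuples is sigma-finite *)

Section LebTuple.
Variable R : realType.
Local Notation mR := (measurableTypeR R).
Local Notation lam := (@lebesgue_measure R).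
Local Open Scope ereal_scope.

Lemma leb_setX m (A : set (m.-tuple mR)) (B : set mR) : measurable A -> measurable B ->
 leb R m.+1 ((fun p : m.-tuple mR * mR => cons_pair p) @` (A `*` B)) = leb R m A * lam B.
move=> mA mB; rewrite /leb -/(leb R m) /leb_step /= /pushforward.
rewrite (_ : _ @^-1` _ = A `*` B); first exact: product_measure1E.
apply/seteqP; split => [[t h] /= [[t' h'] /= tB]|[t h] /= tB]; last by exists (t, h).
move/(congr1 val) => /= -[<- /val_inj <-]; exact: tB.
Qed.

Lemma leb_sigma_finite m : sigma_finite setT (leb R m).
elim: m => [|m IH].
 exists (fun=> setT); first by rewrite bigcup_const.
 move=> k; split; first exact: measurableT.
 by rewrite /= diracE mem_set// ltry.
have /sigma_finiteP[F [TF ndF Foo]] := IH.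
have /sigma_finiteP[G [TG ndG Goo]] := sigma_finiteT lam.
exists (fun k => [set t : m.+1.-tuple mR | F k (behead_tuple t) /\ G k (thead t)]).
 apply/seteqP; split => // t _.
 have : (\bigcup_i F i) (behead_tuple t) by rewrite -TF.
 have : (\bigcup_i G i) (thead t) by rewrite -TG.
 move=> [i _ Gi] [j _ Fj]; exists (maxn i j) => //; split.
 - by apply: (subsetPset _ _ (ndF _ _ (leq_maxr i j))).
 - by apply: (subsetPset _ _ (ndG _ _ (leq_maxl i j))).
move=> k; have [mF Fk] := Foo k; have [mG Gk] := Goo k.
have E : [set t : m.+1.-tuple mR | F k (behead_tuple t) /\ G k (thead t)] =
  (fun p : m.-tuple mR * mR => cons_pair p) @` (F k `*` G k).
 apply/seteqP; split => [t [Ft Gt]|t [[u h] [/= Fu Gh] <-]].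
  exists (behead_tuple t, thead t); first by split.
  by rewrite [RHS]tuple_eta; apply: val_inj.
 split; last by rewrite /cons_pair /= theadE.
 by move: Fu; congr (F k _); apply: val_inj.
split; last by rewrite E leb_setX// lte_mul_pinfty// ge0_fin_numE.
have m1 : mfun (fun t : m.+1.-tuple mR => behead_tuple t : m.-tuple mR).
 exact: measurable_behead.
have m2 : mfun (fun t : m.+1.-tuple mR => thead t : mR).
 exact: measurable_tnth.
by have := measurableI _ _ (m1 measurableT _ mF) (m2 measurableT _ mG); rewrite !setTI.
Qed.

End LebTuple.

(** An alias of [leb] that can carry the sigma-finite structure on which Tonelli's theorem
    depends. *)
Definition sleb (R : realType) (m : nat) : set (m.-tuple (measurableTypeR R)) -> \bar R := leb R m.
HB.instance Definition _ (R : realType) m := Measure.on (@sleb R m).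
HB.instance Definition _ (R : realType) m :=
 Measure_isSigmaFinite.Build _ _ _ (@sleb R m) (leb_sigma_finite R m).

(** * Fundamental theorem of calculus on segments and half-lines *)

Section FTC.
Variable R : realType.
Local Notation mR := (measurableTypeR R).
Local Notation lam := (@lebesgue_measure R).
Implicit Types f F : R -> R.

Lemma rder_cont f t d : rder f t d -> cont_at f t.
by move=> [h _]; apply: differentiable_continuous; exact/derivable1_diffP. Qed.
Lemma rder_derive1 f t d : rder f t d -> (f^`())%classic t = d.
by move=> [_ <-]; rewrite derive1E. Qed.
Lemma rder_ext f g t d d' : rder f t d -> (forall x, g x = f x) -> d = d' -> rder g t d'.
by move=> h fg <-; rewrite (_ : g = f)//; apply/funext. Qed.
Lemma rderN f t d : rder f t d -> rder (fun x => - f x) t (- d).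
by move=> h; apply: (rder_ext (rderZ (-1) h)) => [x|]; rewrite mulN1r. Qed.

Lemma rder_exp m t : rder (fun x : R => x ^+ m.+1) t (m.+1%:R * t ^+ m).
elim: m => [|m IH]; first by rewrite expr0 mulr1; exact: rder_ext (rder_id t) _ _.
apply: (rder_ext (rderM (rder_id t) IH)) => [x|]; first by rewrite exprS.
by rewrite mul1r mulrCA -exprS -[X in X + _]mul1r -mulrDl nat1r.
Qed.

Lemma rder_inv t : t != 0 -> rder (fun x : R => x^-1) t (- t ^- 2).
move=> t0; apply/is_deriveP => e e0; have at0 : 0 < `|t| by rewrite normr_gt0.
pose d := Num.min (`|t| / 2) (e * `|t| ^+ 3 / 2).
exists d => [|h hd].
 by rewrite lt_min !divr_gt0// mulr_gt0// exprn_gt0.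
have h1 : `|h| < `|t| / 2 by apply: lt_le_trans hd _; rewrite ge_min lexx.
have h2 : `|h| < e * `|t| ^+ 3 / 2 by apply: lt_le_trans hd _; rewrite ge_min lexx orbT.
have h3 : `|t| / 2 <= `|t + h|.
 by have := ler_normB (t + h) h; rewrite addrK => ?; lra.
have th : t + h != 0 by rewrite -normr_gt0; apply: lt_le_trans h3; rewrite divr_gt0.
rewrite (_ : _ - _ - _ = h ^+ 2 / ((t + h) * t ^+ 2)); last by field; rewrite t0 th.
rewrite normf_div [X in _ / X]normrM !normrX [X in X / _]expr2 -mulrA mulrC ler_wpM2r//.
have p0 : 0 < `|t| / 2 * `|t| ^+ 2 by rewrite mulr_gt0 ?divr_gt0 ?exprn_gt0.
apply: (@le_trans _ _ (`|h| / (`|t| / 2 * `|t| ^+ 2))).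
 by rewrite ler_wpM2l// lef_pV2 ?posrE ?ler_wpM2r ?exprn_ge0// mulr_gt0 ?exprn_gt0 ?normr_gt0.
rewrite ler_pdivrMr//; apply: le_trans (ltW h2) _.
by apply: eqle; field.
Qed.

Lemma rder_powRc p t : 0 < t -> rder (fun x : R => x `^ p) t (p * t `^ (p - 1)).
by move=> t0; exact: is_derive1_powR. Qed.

Lemma FTCcc f F (a b : R) : a < b -> (forall x, a <= x <= b -> rder F x (f x)) ->
 (forall x, a <= x <= b -> cont_at f x) ->
 (\int[lam]_(x in `[a, b]) (f x)%:E = (F b - F a)%:E)%E.
move=> ab dF cf; rewrite (@continuous_FTC2 _ f F a b ab); first by rewrite EFinB.
- by apply: continuous_in_subspaceT => x; rewrite inE /= in_itv /= => /cf.
- split.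
 + move=> x; rewrite in_itv /= => /andP[ax xb].
  by have [] := dF x; rewrite ?(ltW ax) ?(ltW xb).
 + by apply: cvg_at_right_filter; have := dF a; rewrite lexx ltW// => /(_ isT) /rder_cont.
 + by apply: cvg_at_left_filter; have := dF b; rewrite lexx ltW// => /(_ isT) /rder_cont.
- move=> x; rewrite in_itv /= => /andP[ax xb].
 by apply: rder_derive1; apply: dF; rewrite !ltW.
Qed.

Lemma FTCy f F (a l : R) : (forall x, a <= x -> 0 <= f x) ->
 (forall x, a <= x -> rder F x (f x)) -> (forall x, a <= x -> cont_at f x) ->
 F x @[x --> +oo] --> l ->
 (\int[lam]_(x in `[a, +oo[) (f x)%:E = (l - F a)%:E)%E.
move=> f0 dF cf Fl; rewrite (@ge0_continuous_FTC2y _ f F a l)//.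
- by apply: continuous_in_subspaceT => x; rewrite inE /= in_itv /= andbT => /cf.
- by move=> x /ltW /dF [].
- by apply: cvg_at_right_filter; exact: (rder_cont (dF a (lexx a))).
- by move=> x; rewrite in_itv /= andbT => /ltW /dF /rder_derive1.
Qed.

End FTC.

(** * Recursion on the dimension, affine maps and shears, polar coordinates *)

Section LebRec.
Variable R : realType.
Local Notation mR := (measurableTypeR R).
Local Notation lam := (@lebesgue_measure R).
Local Open Scope ereal_scope.

Definition mkt m (h : R) (t : m.-tuple mR) : m.+1.-tuple mR := [tuple of h :: t].
Lemma measurable_mkt m d (X : measurableType d) (f : X -> mR) (g : X -> m.-tuple mR) :
 mfun f -> mfun g -> mfun (fun x => mkt (f x) (g x)).
by move=> mf mg; exact: measurable_cons. Qed.
Lemma meas_mkt_comp m (G : m.+1.-tuple mR -> \bar R) : mfun G ->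
 mfun (fun p : m.-tuple mR * mR => G (mkt p.2 p.1)).
by move=> mG; apply: (measurableT_comp mG); apply: measurable_mkt.
Qed.

Lemma leb_rec1 m (G : m.+1.-tuple mR -> \bar R) : mfun G -> (forall t, 0 <= G t) ->
 \int[leb R m.+1]_t G t = \int[leb R m]_t \int[lam]_h G (mkt h t).
move=> mG G0; have := @fubini_tonelli1 _ _ _ _ _ (@sleb R m) lam
 (fun p => G (mkt p.2 p.1)) (meas_mkt_comp mG) (fun=> G0 _).
rewrite /fubini_F /= => <-.
rewrite /leb -/(leb R m) /leb_step /=.
by rewrite ge0_integral_pushforward //= ; exact: measurable_cons_pair.
Qed.

Lemma leb_rec2 m (G : m.+1.-tuple mR -> \bar R) : mfun G -> (forall t, 0 <= G t) ->
 \int[leb R m.+1]_t G t = \int[lam]_h \int[leb R m]_t G (mkt h t).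
move=> mG G0; have := @fubini_tonelli _ _ _ _ _ (@sleb R m) lam
 (fun p => G (mkt p.2 p.1)) (meas_mkt_comp mG) (fun=> G0 _).
by rewrite /= leb_rec1.
Qed.

(** The image measure, rescaled by [a], gives half-open intervals their length, and that determines
    Lebesgue measure. *)
Lemma lam_affine (a c : R) (g : mR -> \bar R) : (0 < a)%R -> mfun g ->
 (forall x, 0 <= g x) -> \int[lam]_x g (a * x + c)%R = (a^-1)%:E * \int[lam]_x g x.
move=> a0 mg g0.
have mA : mfun (fun x : mR => (a * x + c)%R : mR).
 by apply: measurable_funD => //; apply: measurable_funM.
have a1 : (0 <= a)%R by exact: ltW.
pose k : {nonneg R} := NngNum a1.
have E : forall A, measurable A -> lam A = mscale k (measure_function_pushforward__canonical__measure_function_Measure lam mA) A.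
 pose mu' := measure_function_mscale__canonical__measure_function_Measure k
   (measure_function_pushforward__canonical__measure_function_Measure lam mA).
 move=> A mA'; apply: (@lebesgue_measure_unique R mu') => // _ [[x y] _ <-].
 rewrite /mu' /= /mscale /= /pushforward.
 rewrite (_ : _ @^-1` _ = `]((x - c) / a)%R, ((y - c) / a)%R]%classic); last first.
  apply/seteqP; split => z /=; rewrite !in_itv /= ler_pdivlMr// ltr_pdivrMr// [(z * a)%R]mulrC ltrBlDr lerBrDr//.
 rewrite !lebesgue_measure_itv /= !lte_fin ltr_pM2r ?invr_gt0// ltrD2r.
 case: ifP => xy; last by rewrite mule0.
 rewrite -!EFinB -EFinM; congr (_%:E).
 by rewrite -mulrBl mulrCA divff ?gt_eqF// mulr1 opprB addrA subrK.
rewrite [X in _ = _ * X](eq_measure_integral _ (fun A mA _ => E A mA)).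
rewrite ge0_integral_mscale //=.
rewrite ge0_integral_pushforward //= muleA -EFinM mulVf ?gt_eqF// mul1e.
by [].
Qed.

Definition taff m (a : R) (v : 'I_m -> R) (t : m.-tuple mR) : m.-tuple mR :=
 [tuple (a * tnth t i + v i)%R | i < m].

Lemma measurable_mktuple m d (X : measurableType d) (f : 'I_m -> X -> mR) :
 (forall i, mfun (f i)) ->
 mfun (fun x => [tuple f i x | i < m] : m.-tuple mR).
move=> mf; apply/measurable_fun_tnthP => i.
by apply: eq_measurable_fun (mf i) => x _ /=; rewrite tnth_mktuple.
Qed.

Lemma meas_taff m a v : mfun (@taff m a v).
apply: measurable_mktuple => i; apply: measurable_funD => //.
by apply: measurable_funM => //; exact: measurable_tnth.
Qed.

Lemma mkt_taff m a v h (t : m.-tuple mR) :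
 taff a v (mkt h t) = mkt (a * h + v ord0)%R (taff a (fun i => v (lift ord0 i)) t).
apply: eq_from_tnth => i; rewrite tnth_mktuple.
case: (unliftP ord0 i) => [j ->|->]; last by [].
by rewrite !tnthS tnth_mktuple.
Qed.

Lemma leb_taff m a v (G : m.-tuple mR -> \bar R) : (0 < a)%R -> mfun G ->
 (forall t, 0 <= G t) ->
 \int[leb R m]_t G (taff a v t) = (a ^- m)%:E * \int[leb R m]_t G t.
move=> a0; elim: m v G => [|m IH] v G mG G0.
 rewrite expr0 invr1 mul1e; apply: eq_integral => t _; congr G.
 by rewrite [LHS]tuple0 [RHS]tuple0.
rewrite !leb_rec2//; last by apply: (measurableT_comp mG); exact: meas_taff.
under eq_integral => h _.
 under eq_integral do rewrite mkt_taff.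
 rewrite (IH _ (fun t => G (mkt _ t)))//; last first.
  by apply: (measurableT_comp mG); exact: measurable_mkt.
 over.
have m1 : mfun (fun h : mR => \int[leb R m]_t G (mkt h t)).
 exact: (@measurable_fun_fubini_tonelli_G _ _ _ _ _ (@sleb R m) _ (meas_mkt_comp mG) (fun=> G0 _)).
have p1 h : 0 <= \int[leb R m]_t G (mkt h t) by exact: integral_ge0.
have ai : 0 <= (a ^- m)%:E by rewrite lee_fin invr_ge0 exprn_ge0// ltW.
have m2 : mfun (fun h : mR => \int[leb R m]_t G (mkt (a * h + v ord0)%R t)).
 by apply: (measurableT_comp m1); apply: measurable_funD => //; apply: measurable_funM.
rewrite (ge0_integralZl _ measurableT m2 (fun x _ => p1 _) ai).
rewrite (lam_affine _ a0 m1 p1) muleA -EFinM; congr (_%:E * _).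
by rewrite exprS invfM mulrC.
Qed.

Definition tupd m (i : 'I_m) (t : m.-tuple mR) (x : R) : m.-tuple mR :=
 [tuple if j == i then x else tnth t j | j < m].

Lemma measurable_tupd m (i : 'I_m) d (X : measurableType d) (f : X -> m.-tuple mR) (c : X -> mR) :
 mfun f -> mfun c ->
 mfun (fun x => tupd i (f x) (c x)).
move=> mf mc; apply: measurable_mktuple => j; case: eqP => // _.
by move/measurable_fun_tnthP: mf => /(_ j).
Qed.

Lemma tupd_mkt0 m h (t : m.-tuple mR) x : tupd ord0 (mkt h t) x = mkt x t.
apply: eq_from_tnth => j; rewrite tnth_mktuple.
by case: (unliftP ord0 j) => [k ->|->]; rewrite ?tnthS.
Qed.

Lemma tupd_mktS m h (t : m.-tuple mR) i x : tupd (lift ord0 i) (mkt h t) x = mkt h (tupd i t x).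
apply: eq_from_tnth => j; rewrite tnth_mktuple.
case: (unliftP ord0 j) => [k ->|->]; last by [].
by rewrite !tnthS tnth_mktuple (inj_eq lift_inj).
Qed.

(** In the variable [i] it is a translation, whose length depends on the other variables only.
    Rotations will be products of such shears. *)
Lemma leb_shear m (i : 'I_m) (c : m.-tuple mR -> mR) (G : m.-tuple mR -> \bar R) :
 mfun c -> (forall t x, c (tupd i t x) = c t) ->
 mfun G -> (forall t, 0 <= G t) ->
 \int[leb R m]_t G (tupd i t (tnth t i + c t)%R) = \int[leb R m]_t G t.
elim: m i c G => [[]//|m IH] i c G mc ci mG G0.
have mGu : mfun (fun t => G (tupd i t (tnth t i + c t)%R)).
 apply: (measurableT_comp mG); apply: measurable_tupd => //.
 by apply: measurable_funD => //; exact: measurable_tnth.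
case: (unliftP ord0 i) ci mGu => [j ->|->] ci mGu; last first.
 rewrite (leb_rec1 mGu (fun=> G0 _)) (leb_rec1 mG G0); apply: eq_integral => t _.
 under eq_integral => h _.
  rewrite tupd_mkt0 tnth0 -(ci _ 0%R) tupd_mkt0 -[h in (h + _)%R]mul1r.
  over.
 rewrite (lam_affine (c (mkt 0%R t)) ltr01 (g := fun h => G (mkt h t))) ?invr1 ?mul1e//.
 by apply: (measurableT_comp mG); exact: measurable_mkt.
rewrite (leb_rec2 mGu (fun=> G0 _)) (leb_rec2 mG G0); apply: eq_integral => h _.
under eq_integral do rewrite tupd_mktS tnthS.
apply: (IH j (fun t => c (mkt h t)) (fun t => G (mkt h t))) => //.
- by apply: (measurableT_comp mc); exact: measurable_mkt.
- by move=> t x; rewrite -tupd_mktS ci.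
- by apply: (measurableT_comp mG); exact: measurable_mkt.
Qed.

Definition tn m (t : m.-tuple mR) : R := Num.sqrt (\sum_(i < m) tnth t i ^+ 2).
Lemma tn_ge0 m (t : m.-tuple mR) : (0 <= tn t)%R.
exact: sqrtr_ge0. Qed.
Definition tsc m (a : R) (t : m.-tuple mR) : m.-tuple mR := taff a (fun=> 0%R) t.

Lemma tsc_tn m a (t : m.-tuple mR) : (0 <= a)%R -> tn (tsc a t) = (a * tn t)%R.
move=> a0; rewrite /tn -{2}(ger0_norm a0) -(sqrtr_sqr a).
rewrite -sqrtrM ?sqr_ge0// mulr_sumr; congr Num.sqrt; apply: eq_bigr => i _.
by rewrite tnth_mktuple addr0 exprMn.
Qed.

Lemma meas_tn m : mfun (@tn m).
apply: measurableT_comp; first by apply: continuous_measurable_fun; exact: sqrt_continuous.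
by apply: measurable_sum => i; apply: measurable_funX; exact: measurable_tnth.
Qed.

Lemma measurable_invr d (X : measurableType d) (f : X -> mR) : mfun f ->
 mfun (fun x => (f x)^-1 : mR)%R.
(* [x^-1] is [x] times the power [-1] of [x^2], which stays in the range where real powers behave
   well; at 0 both sides take the value 0. *)
move=> mf; rewrite (_ : (fun x => _) = (fun x => f x * ((f x ^+ 2) `^ (- 1)))%R).
 apply: measurable_funM => //; apply: (measurableT_comp (measurable_powR _)).
 exact: measurable_funX.
apply/funext => x /=; have [->|y0] := eqVneq (f x) 0%R; first by rewrite invr0 mul0r.
by rewrite powR_inv1 ?sqr_ge0//; field.
Qed.

Lemma measurable_tsc m d (X : measurableType d) (a : X -> mR) (f : X -> m.-tuple mR) :
 mfun a -> mfun f ->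
 mfun (fun x => tsc (a x) (f x)).
move=> ma mf; apply: measurable_mktuple => i; apply: measurable_funD => //.
by apply: measurable_funM => //; move/measurable_fun_tnthP: mf => /(_ i).
Qed.

Lemma int_if d (X : measurableType d) (mu : {measure set X -> \bar R}) (D : set X) (b : X -> bool)
  (f : X -> \bar R) : (forall x, D x <-> b x) ->
 \int[mu]_(x in D) f x = \int[mu]_x (if b x then f x else 0).
move=> Db; rewrite integral_mkcond; apply: eq_integral => x _; rewrite patchE.
case: ifPn => [/set_mem/Db -> //|]; case: ifP => // /Db xD.
by move/negP; case; apply/mem_set.
Qed.

(** The integrand vanishes unless the first coordinate is 0, and a point is a null set of the
    line. *)
Lemma leb0 m (G : m.+1.-tuple mR -> \bar R) : mfun G -> (forall t, 0 <= G t) ->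
 \int[leb R m.+1]_t (if tn t == 0%R then G t else 0) = 0.
move=> mG G0; rewrite leb_rec1; last 2 first.
- apply: measurable_fun_ifT => //; apply: measurable_fun_eqr => //; exact: meas_tn.
- by move=> t; case: ifP.
rewrite integral0_eq// => t _.
transitivity (\int[lam]_h (if h == 0%R then (if tn (mkt 0%R t) == 0%R then G (mkt 0%R t) else 0) else 0)).
 apply: eq_integral => h _; have [->//|h0] := eqVneq h 0%R.
 rewrite (_ : (tn _ == _) = false)//; apply/negP; rewrite sqrtr_eq0 big_ord_recl tnth0.
 apply/negP; rewrite -ltNge ltr_wpDr ?sumr_ge0// => [i _|]; first exact: sqr_ge0.
 by rewrite exprn_even_gt0.
rewrite -(int_if lam (D := [set 0%R])).
 by rewrite integral_set1.
by move=> h /=; split => [->|/eqP].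
Qed.

Lemma int_inv_pow (m : nat) (a : R) : (0 < a)%R ->
 \int[lam]_v (if (a < v)%R then (m.+1%:R * v ^- m.+2)%:E else 0) = (a ^- m.+1)%:E.
move=> a0; rewrite -(int_if lam (D := `]a, +oo[%classic)); last first.
 by move=> x /=; rewrite in_itv /= andbT.
have dF x : (a <= x)%R -> rder (fun v => - (v ^- m.+1))%R x (m.+1%:R * x ^- m.+2)%R.
 move=> ax; have x0 : (x != 0)%R by rewrite gt_eqF// (lt_le_trans a0).
 have h2 : rder (fun y : R => y^-1)%R (x ^+ m.+1)%R (- (x ^+ m.+1) ^- 2)%R.
  by apply: rder_inv; rewrite expf_neq0.
 apply: (rder_ext (rderN (rder_comp (rder_exp m x) h2))) => //.
 by rewrite !exprS; field; rewrite x0 expf_neq0.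
have cf x : (a <= x)%R -> cont_at ((fun v : R => m.+1%:R * v ^- m.+2)%R) x.
 move=> ax; have x0 : (x != 0)%R by rewrite gt_eqF// (lt_le_trans a0).
 apply: cvgM; first exact: cvg_cst.
 by apply: cvgV; [rewrite expf_neq0|exact: exprn_continuous].
rewrite integral_itv_obnd_cbnd; last first.
 apply/measurable_EFinP; apply: open_continuous_measurable_fun; first exact: interval_open.
 by move=> x; rewrite inE /= in_itv /= andbT => /ltW /cf.
rewrite (@FTCy _ _ (fun v => - (v ^- m.+1))%R a 0) ?sub0r ?opprK//.
 move=> x ax; rewrite mulr_ge0// invr_ge0 exprn_ge0// (le_trans (ltW a0))//.
rewrite -oppr0; apply: cvgN.
apply/gtr0_cvgV0.
 near=> x; rewrite exprn_gt0//; near: x; exact: nbhs_pinfty_gt.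
apply: (@ger_cvgy _ _ _ _ id); last exact: cvg_id.
near=> x; rewrite exprS ler_peMr//; last first.
 apply: exprn_ege1; near: x; exact: nbhs_pinfty_ge.
Unshelve. all: by end_near.
Qed.

Lemma leb_ne0 m (f : m.+1.-tuple mR -> \bar R) : mfun f -> (forall t, 0 <= f t) ->
 \int[leb R m.+1]_t f t = \int[leb R m.+1]_t (if tn t == 0%R then 0 else f t).
move=> mf f0; rewrite -[RHS]add0e -[X in _ = X + _](leb0 mf f0).
have mt : mfun (fun t : m.+1.-tuple mR => tn t == 0%R).
 by apply: measurable_fun_eqr => //; exact: meas_tn.
rewrite -ge0_integralD//.
- by apply: eq_integral => t _; case: ifP => _; rewrite ?adde0 ?add0e.
- by move=> t _; case: ifP.
- exact: measurable_fun_ifT.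
- by move=> t _; case: ifP.
- exact: measurable_fun_ifT.
Qed.

(** Integrand of the radial integral through [t], with the density [m x^(m-1)] of the radius under
    normalized measure on the ball of dimension [m]. *)
Definition ray m (G : m.-tuple mR -> \bar R) t (x : R) : \bar R :=
 if (0 < x < 1)%R then (m%:R * x ^+ m.-1)%:E * G (tsc (x / tn t) t) else 0.
Lemma ray_ge0 m (G : m.-tuple mR -> \bar R) t x : (forall t, 0 <= G t) -> 0 <= ray G t x.
by move=> G0; rewrite /ray; case: ifP => // /andP[x0 _]; rewrite mule_ge0// lee_fin mulr_ge0// exprn_ge0// ltW.
Qed.

Lemma measurable_ray m (G : m.-tuple mR -> \bar R) : mfun G ->
 mfun (fun p : m.-tuple mR * mR => ray G p.1 p.2).
move=> mG; apply: measurable_fun_ifT => //; first by apply: measurable_and; exact: measurable_fun_ltr.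
apply: emeasurable_funM; first by apply/measurable_EFinP; apply: measurable_funM => //; exact: measurable_funX.
apply: (measurableT_comp mG); apply: measurable_tsc => //; apply: measurable_funM => //.
by apply: measurable_invr; apply: (measurableT_comp (@meas_tn _)).
Qed.

Lemma measurable_polar m (G : m.-tuple mR -> \bar R) : mfun G -> (forall t, 0 <= G t) ->
 mfun (fun t => if (tn t < 1)%R then \int[lam]_x ray G t x else 0).
move=> mG G0; apply: measurable_fun_ifT => //; first by apply: measurable_fun_ltr => //; exact: meas_tn.
exact: (@measurable_fun_fubini_tonelli_F _ _ _ _ _ lam _ (measurable_ray mG) (fun=> ray_ge0 _ _ G0)).
Qed.

(** Polar coordinates without a measure on the sphere: the direction [t / |t|] is averaged over the
    ball. The substitution [x = |t| v], Tonelli and [s = v t] turn the right side into an integral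
    over [v > |s|], computed by [int_inv_pow]. *)
Lemma polar m (G : m.+1.-tuple mR -> \bar R) : mfun G -> (forall t, 0 <= G t) ->
 \int[leb R m.+1]_t (if (tn t < 1)%R then G t else 0) =
 \int[leb R m.+1]_t (if (tn t < 1)%R then
   \int[lam]_x ray G t x else 0).
move=> mG G0; symmetry.
pose P (t : m.+1.-tuple mR) := (0 < tn t < 1)%R.
pose H (t : m.+1.-tuple mR) (v : mR) : \bar R :=
 if P t && (0 < v)%R && (v * tn t < 1)%R then (m.+1%:R * v ^+ m * tn t ^+ m.+1)%:E * G (tsc v t) else 0.
pose H' (v : mR) (s : m.+1.-tuple mR) : \bar R :=
 if P s && (tn s < v)%R then (m.+1%:R * v ^- m.+2)%:E * ((tn s ^+ m.+1)%:E * G s) else 0.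
have mtn d (X : measurableType d) (f : X -> m.+1.-tuple mR) : mfun f ->
  mfun (fun x => tn (f x) : mR).
 by move=> mf; apply: (measurableT_comp (@meas_tn _) mf).
have mP d (X : measurableType d) (f : X -> m.+1.-tuple mR) : mfun f ->
  mfun (fun x => P (f x)).
 by move=> mf; apply: measurable_and; apply: measurable_fun_ltr => //; exact: mtn.
pose X := (m.+1.-tuple mR * mR)%type.
have mH : mfun (fun p => H p.1 p.2).
 apply: measurable_fun_ifT => //.
  apply: measurable_and; first apply: measurable_and.
  - exact: mP.
  - exact: measurable_fun_ltr.
  - by apply: measurable_fun_ltr => //; apply: measurable_funM => //; exact: mtn.
 apply: emeasurable_funM; last by apply: (measurableT_comp mG); exact: measurable_tsc.
 apply/measurable_EFinP; apply: measurable_funM; first apply: measurable_funM => //.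
  exact: measurable_funX.
 by apply: measurable_funX; exact: mtn.
have H0 t v : 0 <= H t v.
 rewrite /H; case: ifP => // /andP[/andP[_ v0] _].
 by rewrite mule_ge0// lee_fin !mulr_ge0 ?exprn_ge0 ?tn_ge0// ltW.
have mH' : mfun (fun p => H' p.2 p.1).
 apply: measurable_fun_ifT => //.
  apply: measurable_and; first exact: mP.
  by apply: measurable_fun_ltr => //; exact: mtn.
 apply: emeasurable_funM.
  apply/measurable_EFinP; apply: measurable_funM => //.
  by apply: measurable_invr; exact: measurable_funX.
 apply: emeasurable_funM; last by apply: (measurableT_comp mG).
 by apply/measurable_EFinP; apply: measurable_funX; exact: mtn.
have H'0 t v : 0 <= H' v t.
 rewrite /H'; case: ifP => // /andP[_ v0].
 have v1 : (0 <= v)%R := le_trans (tn_ge0 _) (ltW v0).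
 by rewrite !mule_ge0// lee_fin ?mulr_ge0 ?invr_ge0 ?exprn_ge0// tn_ge0.
(* Substitution [x = |t| v] for fixed [t], the null set [t = 0] being set aside. *)
transitivity (\int[leb R m.+1]_t \int[lam]_v H t v).
 rewrite [LHS]leb_ne0; last 2 first.
 - exact: measurable_polar.
 - by move=> t; case: ifP => // _; apply: integral_ge0 => x _; exact: ray_ge0.
 apply: eq_integral => t _; have [t0|t0] := eqVneq (tn t) 0%R.
  by rewrite integral0_eq// => v _; rewrite /H /P t0 ltxx.
 have tp : (0 < tn t)%R by rewrite lt_def t0 tn_ge0.
 case: ifP => t1; last first.
  by rewrite integral0_eq// => v _; rewrite /H /P t1 andbF.
 have mIt : mfun (fun x : mR => ray G t x).
  exact: (measurableT_comp (measurable_ray mG) (@pair1_measurable _ _ _ _ t)).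
 have I0 x := ray_ge0 t x G0.
 have -> : \int[lam]_x ray G t x = (tn t)%:E * \int[lam]_x ray G t (tn t * x + 0)%R.
  by rewrite (lam_affine 0%R tp mIt I0) muleA -EFinM divff// mul1e.
 have mA : mfun (fun v : mR => (tn t * v + 0)%R : mR).
  by apply: measurable_funD => //; apply: measurable_funM.
 have t2 : 0 <= (tn t)%:E by rewrite lee_fin ltW.
 rewrite -(ge0_integralZl _ measurableT (measurableT_comp mIt mA) (fun x _ => I0 _) t2).
 apply: eq_integral => v _; rewrite /H /P /ray tp t1 /= addr0 pmulr_rgt0// [(v * _)%R]mulrC.
 case: ifP => // _; last by rewrite mule0.
 rewrite muleA -EFinM [(_ * v / _)%R]mulrAC divff// mul1r; congr (_%:E * _).
 by rewrite exprMn [in RHS]exprS; ring.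
transitivity (\int[lam]_v \int[leb R m.+1]_t H t v).
 exact: (@fubini_tonelli _ _ _ _ _ (@sleb R m.+1) lam (fun p => H p.1 p.2) mH (fun=> H0 _ _)).
(* Substitution [s = v t] for fixed [v > 0]; its Jacobian contributes [v^(-(m+1))]. *)
transitivity (\int[lam]_v \int[leb R m.+1]_s H' v s).
 apply: eq_integral => v _; have [v0|v0] := ltP 0%R v; last first.
  rewrite !integral0_eq// => t _.
   rewrite /H' (_ : (tn t < v)%R = false) ?andbF//.
   by apply/negbTE; rewrite -leNgt (le_trans v0)// tn_ge0.
  by rewrite /H ltNge v0 andbF.
 pose K (s : m.+1.-tuple mR) : \bar R :=
  if (0 < tn s < v)%R && (tn s < 1)%R then (m.+1%:R * v ^+ m * (tn s / v) ^+ m.+1)%:E * G s else 0.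
 have mK : mfun K.
  apply: measurable_fun_ifT => //.
   by apply: measurable_and; first apply: measurable_and; apply: measurable_fun_ltr => //; exact: mtn.
  apply: emeasurable_funM => //; apply/measurable_EFinP; apply: measurable_funM => //.
  by apply: measurable_funX; apply: measurable_funM => //; exact: mtn.
 have K0 s : 0 <= K s.
  rewrite /K; case: ifP => // _.
  by rewrite mule_ge0// lee_fin !mulr_ge0 ?exprn_ge0 ?divr_ge0 ?tn_ge0// ltW.
 transitivity (\int[leb R m.+1]_t K (tsc v t)).
  apply: eq_integral => t _; rewrite /H /K /P tsc_tn ?ltW// v0 andbT pmulr_rgt0//.
  by rewrite gtr_pMr// [(v * tn t / v)%R]mulrAC divff ?gt_eqF// mul1r.
 rewrite leb_taff// -ge0_integralZl//; last by rewrite lee_fin invr_ge0 exprn_ge0// ltW.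
 apply: eq_integral => s _; rewrite /K /H' /P.
 rewrite -[in RHS]andbA [(_ && (tn s < v)%R) in RHS]andbC andbA.
 case: ifP => _; last by rewrite mule0.
 rewrite !muleA -!EFinM; congr (_%:E * _).
 have v1 : v != 0%R by rewrite gt_eqF.
 by rewrite expr_div_n !exprS; field; rewrite v1 expf_neq0.
transitivity (\int[leb R m.+1]_s \int[lam]_v H' v s).
 by symmetry; exact: (@fubini_tonelli _ _ _ _ _ (@sleb R m.+1) lam (fun p => H' p.2 p.1) mH' (fun=> H'0 _ _)).
rewrite [RHS]leb_ne0; last 2 first.
- by apply: measurable_fun_ifT => //; apply: measurable_fun_ltr => //; exact: meas_tn.
- by move=> t; case: ifP.
apply: eq_integral => s _; have [s0|s0] := eqVneq (tn s) 0%R.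
 by rewrite integral0_eq// => v _; rewrite /H' /P s0 ltxx.
have sp : (0 < tn s)%R by rewrite lt_def s0 tn_ge0.
rewrite /H' /P sp /=; case: ifP => s1; last by rewrite integral0_eq.
transitivity (((tn s ^+ m.+1)%:E * G s) * \int[lam]_v (if (tn s < v)%R then (m.+1%:R * v ^- m.+2)%:E else 0)).
 rewrite -ge0_integralZl//; last 3 first.
 - apply: measurable_fun_ifT => //; first exact: measurable_fun_ltr.
  apply/measurable_EFinP; apply: measurable_funM => //.
  by apply: measurable_invr; exact: measurable_funX.
 - move=> v _; case: ifP => // sv; rewrite lee_fin mulr_ge0// invr_ge0 exprn_ge0//.
  exact: le_trans (ltW sp) (ltW sv).
 - by rewrite mule_ge0// lee_fin exprn_ge0// tn_ge0.
 by apply: eq_integral => v _; rewrite andTb; case: ifP => _; rewrite ?mule0// [RHS]muleC.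
rewrite int_inv_pow// muleC muleA -EFinM mulVf ?mul1e// expf_neq0//.
Qed.

End LebRec.

(** * Measurability on the ball; complex integrals and dominated convergence *)

Section Meas.
Variables (R : realType) (n : nat).
Local Notation C := (cplx R).
Local Notation V := (Cn R n).
Local Notation mR := (measurableTypeR R).
Local Notation T := ((n + n).-tuple mR).
Implicit Types (t : T) (g phi : V -> C) (U : set V).

Lemma re_toC t j : re (toC t 0 j) = tnth t (lshift n j).
by rewrite mxE. Qed.
Lemma im_toC t j : im (toC t 0 j) = tnth t (rshift n j).
by rewrite mxE. Qed.
Lemma nr_toC t : nr (toC t) = tn t.
rewrite /nr /tn; congr Num.sqrt; rewrite big_split_ord /sqnorm -[RHS]big_split /=.
by apply: eq_bigr => j _; rewrite modC_sqr re_toC im_toC.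
Qed.
Lemma toC_tsc a t : toC (tsc a t) = rc a *: toC t.
apply/rowP => j; rewrite mxE [in RHS]mxE; apply: cplxP.
 by rewrite /= !tnth_mktuple !ReImE re_toC mul0r subr0 addr0.
by rewrite /= !tnth_mktuple !ReImE im_toC mul0r !addr0.
Qed.
Definition grid (k : nat) (x : R) : R := (Num.floor (x * k.+1%:R))%:~R / k.+1%:R.
Definition gridT (k : nat) t : T := [tuple grid k (tnth t i) | i < n + n].

Lemma grid_near k x : `|grid k x - x| <= k.+1%:R^-1.
rewrite /grid distrC ger0_norm; last by rewrite subr_ge0 ler_pdivrMr// floor_le_tmp.
rewrite lerBlDl -[X in _ + X]mul1r -mulrDl ler_pdivlMr//.
by have := floorD1_gt (x * k.+1%:R); rewrite intrD => /ltW.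
Qed.

Lemma toC_grid k t : nr (toC (gridT k t) - toC t) <= (n + n)%:R / k.+1%:R.
apply: le_trans (nr_le_sum _) _; rewrite (@le_trans _ _ (\sum_(j < n) (2 / k.+1%:R)))//.
 apply: ler_sum => j _; rewrite !mxE /=; apply: le_trans (modC_le_ri _) _.
 rewrite !ReImE /= !tnth_mktuple.
 have := grid_near k (tnth t (lshift n j)); have := grid_near k (tnth t (rshift n j)).
 by move: (grid k _ - _) (grid k _ - _) (k.+1%:R^-1) => a b c; rewrite /re /im /=; lra.
by rewrite sumr_const card_ord -[_ *+ n]mulr_natl mulrA natrD mulr_natr mulr2n.
Qed.

(** Rounding takes countably many values, each on a half-open box, so that the preimage of any set
    is a countable union of boxes. *)
Lemma gridT_measurable k (Q : set T) : measurable (gridT k @^-1` Q).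
pose cT (c : (n + n).-tuple int) : T := [tuple (tnth c i)%:~R / k.+1%:R | i < n + n].
pose F m : set T := if unpickle m is Some c then
  (if `[< Q (cT c) >] then \bigcap_(i in [set: 'I_(n + n)])
   [set t | (tnth c i)%:~R <= tnth t i * k.+1%:R < (tnth c i + 1)%:~R] else set0) else set0.
rewrite (_ : _ @^-1` _ = \bigcup_m F m).
 apply: bigcupT_measurable => m; rewrite /F; case: unpickle => // c; case: ifP => // _.
 apply: fin_bigcap_measurable => // i _; rewrite -[X in measurable X]setTI.
 have mf : mfun (fun t : T => (tnth c i)%:~R <= tnth t i * k.+1%:R < (tnth c i + 1)%:~R).
  have m1 : mfun (fun t : T => tnth t i * k.+1%:R : mR).
   by apply: measurable_funM => //; exact: measurable_tnth.
  by apply: measurable_and; [exact: measurable_fun_ler|exact: measurable_fun_ltr].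
 rewrite (_ : [set t | _] = (fun t : T => (tnth c i)%:~R <= tnth t i * k.+1%:R < (tnth c i + 1)%:~R) @^-1` [set true])//.
 exact: mf.
apply/seteqP; split => t /=.
 move=> Qt; pose c := [tuple Num.floor (tnth t i * k.+1%:R) | i < n + n].
 exists (pickle c) => //; rewrite /F pickleK.
 have cE : cT c = gridT k t by apply: eq_from_tnth => i; rewrite !tnth_mktuple.
 rewrite cE; case: asboolP => // _ i _ /=; rewrite tnth_mktuple.
 by rewrite floor_le_tmp floorD1_gt.
move=> [m _]; rewrite /F; case: unpickle => // c; case: asboolP => // Qc h.
suff -> : gridT k t = cT c by [].
apply: eq_from_tnth => i; rewrite !tnth_mktuple /grid; congr (_%:~R / _).
exact/floor_def/(h i).
Qed.

(** The function evaluated at rounded points is measurable by [gridT_measurable], and continuity on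
    the open set [U] makes these functions converge pointwise. *)
Lemma cont_meas (U : set V) (g : V -> R) : openU U -> measurable (@toC R n @^-1` U) ->
 (forall z, U z -> forall e : R, 0 < e -> exists2 d : R, 0 < d &
  forall w, nr (w - z) < d -> `|g w - g z| < e) ->
 measurable_fun (@toC R n @^-1` U) (fun t => g (toC t) : mR).
move=> oU mU cg; apply: (@measurable_fun_cvg _ _ _ _ (fun k t => g (toC (gridT k t)))).
 move=> k mD Y mY; apply: measurableI => //.
 exact: (@gridT_measurable k [set t | Y (g (toC t))]).
move=> t Ut; apply/cvgrPdist_lt => e e0.
have [d d0 hd] := cg _ Ut e e0.
near=> k; rewrite distrC; apply: hd; apply: le_lt_trans (toC_grid k t) _.
rewrite ltr_pdivrMr// mulrC -ltr_pdivrMr//.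
near: k; exists (Num.truncn ((n + n)%:R / d)) => // k /= hk.
have := truncnS_gt ((n + n)%:R / d) => h; apply: lt_le_trans h _.
by rewrite ler_nat.
Unshelve. all: by end_near.
Qed.

Lemma contP_re phi z : cont_at phi z -> forall e : R, 0 < e -> exists2 d : R, 0 < d &
  forall w, nr (w - z) < d -> `|re (phi w) - re (phi z)| < e.
move=> /contP h e /h[d d0 hd]; exists d => // w /hd; apply: le_lt_trans.
by apply: le_trans (ler_Re_modC _); rewrite !ReImE.
Qed.

Lemma contP_im phi z : cont_at phi z -> forall e : R, 0 < e -> exists2 d : R, 0 < d &
  forall w, nr (w - z) < d -> `|im (phi w) - im (phi z)| < e.
move=> /contP h e /h[d d0 hd]; exists d => // w /hd; apply: le_lt_trans.
by apply: le_trans (ler_Im_modC _); rewrite !ReImE.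
Qed.

Lemma meas_nr_toC : mfun (fun t : T => nr (toC t) : mR).
by under eq_fun do rewrite nr_toC; exact: meas_tn. Qed.
Lemma ballTE t : @ballT R n t <-> nr (toC t) < 1.
by rewrite /ballT /= uballE. Qed.

Lemma meas_ballT : measurable (@ballT R n).
have mf : mfun (fun t : T => nr (toC t) < 1).
 by apply: measurable_fun_ltr => //; exact: meas_nr_toC.
rewrite -[X in measurable X]setTI.
rewrite (_ : @ballT R n = (fun t : T => nr (toC t) < 1) @^-1` [set true]); first exact: mf.
by apply/seteqP; split => t /ballTE.
Qed.

Definition cmeas g := measurable_fun (@ballT R n) (fun t => re (g (toC t)) : mR) /\
 measurable_fun (@ballT R n) (fun t => im (g (toC t)) : mR).

Lemma cmeas_cont g : (forB z, cont_at g z) -> cmeas g.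
move=> cg; split.
- apply: (@cont_meas (@uball R n) (fun z => re (g z))).
 + exact: openU_uball.
 + exact: meas_ballT.
 + by move=> z /cg /contP_re.
- apply: (@cont_meas (@uball R n) (fun z => im (g z))).
 + exact: openU_uball.
 + exact: meas_ballT.
 + by move=> z /cg /contP_im.
Qed.

Lemma cmeasD f g : cmeas f -> cmeas g -> cmeas (fun w => f w + g w).
move=> [f1 f2] [g1 g2]; split.
- by under eq_fun do rewrite !ReImE; exact: measurable_funD.
- by under eq_fun do rewrite !ReImE; exact: measurable_funD.
Qed.

Lemma cmeasM f g : cmeas f -> cmeas g -> cmeas (fun w => f w * g w).
move=> [f1 f2] [g1 g2]; split; under eq_fun do rewrite !ReImE.
- by apply: measurable_funB; exact: measurable_funM.
- by apply: measurable_funD; exact: measurable_funM.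
Qed.

Lemma cmeas_cst c : cmeas (fun=> c). by split; exact: measurable_cst. Qed.
Lemma cmeas_rc (g : V -> R) : measurable_fun (@ballT R n) (fun t => g (toC t) : mR) <->
 cmeas (fun w => rc (g w)).
by split => [h|[]//]; split => //; exact: measurable_cst. Qed.

Lemma cmeas_mod g : cmeas g -> measurable_fun (@ballT R n) (fun t => modC (g (toC t)) : mR).
move=> [h1 h2]; under eq_fun do rewrite modCE.
apply: (measurableT_comp (f := @Num.sqrt R)).
 by apply: continuous_measurable_fun; exact: sqrt_continuous.
by apply: measurable_funD; exact: measurable_funX.
Qed.

Lemma cmeas_ext f g : (forB w, f w = g w) -> cmeas f -> cmeas g.
by move=> fg [f1 f2]; split; [apply: eq_measurable_fun f1|apply: eq_measurable_fun f2];
 move=> t /set_mem tB; rewrite fg.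
Qed.

Local Notation B := (@ballT R n).
Local Notation mu := (nu R n).
Implicit Types f : V -> C.

(** The extended-real integral over the ball, in which the estimates are made; [modC_cintB] brings
    them back to complex integrals. *)
Definition Ie (g : V -> \bar R) : \bar R := (\int[mu]_(t in B) g (toC t))%E.
Definition emeas (g : V -> \bar R) := measurable_fun B (fun t => g (toC t)).

Lemma Ie_le (f g : V -> \bar R) : emeas f -> emeas g ->
 (forB w, (0 <= f w)%E) -> (forB w, (f w <= g w)%E) -> (Ie f <= Ie g)%E.
move=> mf mg f0 fg; apply: ge0_le_integral => //.
- exact: meas_ballT.
- by move=> t /f0.
- by move=> t /fg.
Qed.

Lemma Ie_ge0 (g : V -> \bar R) : (forB w, (0 <= g w)%E) -> (0 <= Ie g)%E.
by move=> g0; apply: integral_ge0 => t /g0. Qed.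
Lemma Ie_eq (f g : V -> \bar R) : (forB w, f w = g w) -> Ie f = Ie g.
by move=> fg; apply: eq_integral => t /set_mem /fg. Qed.
Lemma emeas_ext (f g : V -> \bar R) : (forB w, f w = g w) -> emeas f -> emeas g.
by move=> fg; apply: eq_measurable_fun => t /set_mem /fg. Qed.

Lemma IeD (f g : V -> \bar R) : emeas f -> emeas g -> (forB w, (0 <= f w)%E) ->
 (forB w, (0 <= g w)%E) -> (Ie (fun w => f w + g w) = Ie f + Ie g)%E.
move=> mf mg f0 g0; apply: ge0_integralD => //; first exact: meas_ballT.
- by move=> t /f0.
- by move=> t /g0.
Qed.

Lemma IeZ (g : V -> \bar R) (k : \bar R) : emeas g -> (forB w, (0 <= g w)%E) ->
 (0 <= k)%E -> (Ie (fun w => k * g w) = k * Ie g)%E.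
move=> mg g0 k0; apply: ge0_integralZl => //; first exact: meas_ballT.
by move=> t /g0.
Qed.

Lemma emeas_mod g : cmeas g -> emeas (fun w => (modC (g w))%:E).
by move=> mg; apply/measurable_EFinP; exact: cmeas_mod. Qed.
Lemma emeas_rc (g : V -> R) : cmeas (fun w => rc (g w)) <-> emeas (fun w => (g w)%:E).
by split => [/cmeas_rc h|/measurable_EFinP /cmeas_rc]; first exact/measurable_EFinP. Qed.
(** Integrability of a complex function: linearity of [cintB] holds only under this condition, since
    otherwise its value is a default. *)
Definition cok g := cmeas g /\ (Ie (fun w => (modC (g w))%:E) < +oo)%E.

Lemma cok_re g : cok g -> mu.-integrable B (EFin \o (fun t => re (g (toC t)))).
move=> [[m1 m2] h]; apply/integrableP; split; first exact/measurable_EFinP.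
apply: le_lt_trans h; apply: (@Ie_le (fun w => (`|re (g w)|)%:E)) => //.
- by apply/measurable_EFinP; apply: measurableT_comp.
- by apply: emeas_mod.
- by move=> w _; rewrite lee_fin ler_Re_modC.
Qed.

Lemma cok_im g : cok g -> mu.-integrable B (EFin \o (fun t => im (g (toC t)))).
move=> [[m1 m2] h]; apply/integrableP; split; first exact/measurable_EFinP.
apply: le_lt_trans h; apply: (@Ie_le (fun w => (`|im (g w)|)%:E)) => //.
- by apply/measurable_EFinP; apply: measurableT_comp.
- by apply: emeas_mod.
- by move=> w _; rewrite lee_fin ler_Im_modC.
Qed.

Lemma cok_le g (G : V -> \bar R) : cmeas g -> emeas G -> (Ie G < +oo)%E ->
 (forB w, ((modC (g w))%:E <= G w)%E) -> cok g.
move=> mg mG oo h; split => //; apply: le_lt_trans oo; apply: Ie_le => //; exact: emeas_mod.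
Qed.

Lemma cokD f g : cok f -> cok g -> cok (fun w => f w + g w).
move=> [mf f1] [mg g1].
apply: (@cok_le _ (fun w => (modC (f w))%:E + (modC (g w))%:E)%E); first exact: cmeasD.
- by apply: emeasurable_funD; exact: emeas_mod.
- rewrite IeD; first exact: lte_add_pinfty.
 + exact: emeas_mod.
 + exact: emeas_mod.
 + by move=> w _; rewrite lee_fin modC_ge0.
 + by move=> w _; rewrite lee_fin modC_ge0.
- by move=> w _; rewrite -EFinD lee_fin modCD.
Qed.

Lemma cokZ c g : cok g -> cok (fun w => c * g w).
move=> [mg g1]; split; first by apply: cmeasM => //; exact: cmeas_cst.
under [Ie _]Ie_eq => w _ do rewrite modCM EFinM.
rewrite IeZ//; first by apply: lte_mul_pinfty.
exact: emeas_mod.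
Qed.

Lemma cok_ext f g : (forB w, f w = g w) -> cok f -> cok g.
move=> fg [mf f1]; split; first exact: cmeas_ext fg mf.
by apply: le_lt_trans f1; apply: eqle; apply: Ie_eq => w wB; rewrite fg.
Qed.
Lemma cintB_eq f g : (forB w, f w = g w) -> cintB f = cintB g.
by move=> fg; rewrite /cintB; congr Complex; apply: eq_Rintegral => t /set_mem tB; rewrite fg.
Qed.
Lemma re_cintB g : re (cintB g) = \int[mu]_(t in B) re (g (toC t)). by []. Qed.
Lemma im_cintB g : im (cintB g) = \int[mu]_(t in B) im (g (toC t)). by []. Qed.

Lemma cintBD f g : cok f -> cok g -> cintB (fun w => f w + g w) = cintB f + cintB g.
have mB := meas_ballT.
move=> hf hg; apply: cplxP; rewrite !ReImE ?re_cintB ?im_cintB.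
 rewrite -RintegralD//; [|exact: cok_re|exact: cok_re].
 by apply: eq_Rintegral => t _; rewrite !ReImE.
rewrite -RintegralD//; [|exact: cok_im|exact: cok_im].
by apply: eq_Rintegral => t _; rewrite !ReImE.
Qed.

Lemma cintBZ c g : cok g -> cintB (fun w => c * g w) = c * cintB g.
have mB := meas_ballT.
move=> hg; have h1 := cok_re hg; have h2 := cok_im hg.
have zl (r : R) (f : T -> R) : mu.-integrable B (EFin \o f) ->
  mu.-integrable B (EFin \o (fun t => r * f t)).
 by move=> hf; exact: (@integrableZl _ _ _ _ _ mB r _ hf).
apply: cplxP; rewrite !ReImE ?re_cintB ?im_cintB -!RintegralZl//.
 rewrite -RintegralB//; [|exact: zl|exact: zl].
 by apply: eq_Rintegral => t _; rewrite !ReImE.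
rewrite -RintegralD//; [|exact: zl|exact: zl].
by apply: eq_Rintegral => t _; rewrite !ReImE.
Qed.

Lemma cintBB f g : cok f -> cok g -> cintB (fun w => f w - g w) = cintB f - cintB g.
move=> hf hg; rewrite -[X in _ = _ + X]mulN1r -cintBZ// -cintBD//; last exact: cokZ.
by apply: cintB_eq => w _; rewrite mulN1r.
Qed.

Lemma cintB_sum I (r : seq I) (F : I -> V -> C) : (forall i, cok (F i)) ->
 cok (fun w => \sum_(i <- r) F i w) /\
 cintB (fun w => \sum_(i <- r) F i w) = \sum_(i <- r) cintB (F i).
move=> h; elim: r => [|i r [IH1 IH2]].
 have c0 : cok (fun w => 0 * (0 : C)).
  split; first by rewrite mul0r; exact: cmeas_cst.
  by under Ie_eq => w _ do rewrite mul0r modC0; rewrite /Ie integral0.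
 split; first by apply: cok_ext c0 => w _; rewrite big_nil mul0r.
 rewrite big_nil; apply: cplxP; rewrite ?re_cintB ?im_cintB /Rintegral;
 by rewrite integral0_eq// => t _; rewrite big_nil.
split; first by apply: cok_ext (cokD (h i) IH1) => w _; rewrite big_cons.
rewrite big_cons -IH2 -cintBD//; apply: cintB_eq => w _; by rewrite big_cons.
Qed.

(** The factor 2 comes from treating real and imaginary parts separately; all later constants absorb
    it. *)
Lemma modC_cintB g : cmeas g -> ((modC (cintB g))%:E <= 2%:E * Ie (fun w => (modC (g w))%:E))%E.
move=> mg; have g0 : (0 <= Ie (fun w => (modC (g w))%:E))%E.
 by apply: Ie_ge0 => w _; rewrite lee_fin modC_ge0.
have [h|] := ltP (Ie (fun w => (modC (g w))%:E)) +oo%E; last first.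
 by rewrite leye_eq => /eqP ->; rewrite gt0_muley ?lte_fin// leey.
have ok : cok g by split.
have fi : (Ie (fun w => (modC (g w))%:E) \is a fin_num)%E by rewrite ge0_fin_numE.
rewrite -(fineK fi) -EFinM lee_fin; apply: le_trans (modC_le_ri _) _.
rewrite mulr_natl mulr2n; have mB := meas_ballT.
apply: lerD.
- rewrite -lee_fin fineK// re_cintB EFin_normr_Rintegral//; last exact: cok_re.
 apply: le_trans (le_abse_integral _ _ _) _ => //; first exact: (measurable_int _ (cok_re ok)).
 apply: (@Ie_le (fun w => (`|re (g w)|)%:E)) => //.
 + by apply/measurable_EFinP; apply: measurableT_comp => //; exact: mg.1.
 + exact: emeas_mod.
 + by move=> w _; rewrite lee_fin ler_Re_modC.
- rewrite -lee_fin fineK// im_cintB EFin_normr_Rintegral//; last exact: cok_im.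
 apply: le_trans (le_abse_integral _ _ _) _ => //; first exact: (measurable_int _ (cok_im ok)).
 apply: (@Ie_le (fun w => (`|im (g w)|)%:E)) => //.
 + by apply/measurable_EFinP; apply: measurableT_comp => //; exact: mg.2.
 + exact: emeas_mod.
 + by move=> w _; rewrite lee_fin ler_Im_modC.
Qed.

Lemma cintB_rc (g : V -> R) : cintB (fun w => rc (g w)) = rc (fine (Ie (fun w => (g w)%:E))).
by apply: cplxP; rewrite ?re_cintB ?im_cintB ?ReImE //= /Rintegral integral0_eq.
Qed.

Lemma cintB_dct (F : nat -> V -> C) g (G : V -> \bar R) : (forall k, cmeas (F k)) -> cmeas g ->
 emeas G -> (Ie G < +oo)%E -> (forB w, (0 <= G w)%E) ->
 (forall k w, uball w -> ((modC (F k w))%:E <= G w)%E) ->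
 (forB w, forall e : R, 0 < e -> exists K, forall k, (K <= k)%N -> modC (F k w - g w) < e) ->
 forall e : R, 0 < e -> exists K, forall k, (K <= k)%N -> modC (cintB (F k) - cintB g) < e.
move=> mF mg mG oo G0 FG Fg e e0; have mB := meas_ballT.
have iG : mu.-integrable B (fun t => G (toC t)).
 apply/integrableP; split => //; apply: le_lt_trans oo; rewrite le_eqVlt; apply/orP; left.
 by apply/eqP/eq_integral => t /set_mem /G0 h; rewrite gee0_abs.
have fin (a : nat -> \bar R) (l : \bar R) : a k @[k --> \oo] --> l -> l \is a fin_num ->
  exists K, forall k, (K <= k)%N -> `|fine (a k) - fine l| < e / 2.
 move=> al lf; rewrite -(fineK lf) in al.
 move/fine_cvgP: al => [_ /cvgrPdist_lt /(_ (e / 2))]; rewrite divr_gt0// => /(_ isT)[K _ hK].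
 by exists K => k /hK /=; rewrite distrC.
have okF k : cok (F k) by apply: (cok_le (mF k) mG) => // w; exact: FG.
(* [p] stands for the real part or the imaginary part. *)
have D (p : C -> R) : (forall c, `|p c| <= modC c) -> (forall a b, p (a - b) = p a - p b) ->
  (forall f, cmeas f -> measurable_fun B (fun t => p (f (toC t)))) -> exists K, forall k, (K <= k)%N ->
  `|Rintegral mu B (fun t => p (F k (toC t))) - Rintegral mu B (fun t => p (g (toC t)))| < e / 2.
 move=> ple pB mp; have [||||ig cg] := @dominated_convergence _ _ _ mu _ mB
  (fun k t => (p (F k (toC t)))%:E) (fun t => (p (g (toC t)))%:E) (fun t => G (toC t)) _ _ _ iG.
 - by move=> k; apply/measurable_EFinP; exact: mp.
 - by apply/measurable_EFinP; exact: mp.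
 - apply: aeW => t tB; apply: cvg_EFin; first exact: nearW.
  apply/cvgrPdist_lt => d d0; have [K hK] := Fg _ tB d d0.
  by exists K => // k /= /hK; apply: le_lt_trans; rewrite distrC -pB.
 - apply: aeW => t k tB; apply: le_trans (FG k _ tB); rewrite abse_EFin lee_fin; exact: ple.
 by move=> cv; apply: fin cv (integrable_fin_num mB ig).
have [Kr hr] := D _ (@ler_Re_modC R) (fun a b => raddfB _ a b) (fun f h => h.1).
have [Ki hi] := D _ (@ler_Im_modC R) (fun a b => raddfB _ a b) (fun f h => h.2).
exists (maxn Kr Ki) => k; rewrite geq_max => /andP[/hr h1 /hi h2].
apply: le_lt_trans (modC_le_ri _) _; rewrite !ReImE.
rewrite [e]splitr; apply: ltrD; [exact: h1|exact: h2].
Qed.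

End Meas.

(** * The normalized measure of the ball *)

Section NuFinite.
Variables (R : realType) (n : nat).
Local Notation mR := (measurableTypeR R).
Local Notation T := ((n + n).-tuple mR).
Local Open Scope ereal_scope.

Lemma nuE (A : set T) : nu R n A = (vol_inv R n)%:num%:E * leb R (n + n) A.
by []. Qed.

(** The normalizing factor is the inverse of [fine] of the volume. A null or infinite volume would
    make this factor 0, so the bound follows without computing the volume. *)
Lemma nu_ball_le1 : nu R n (@ballT R n) <= 1.
rewrite nuE; case E : (leb R (n + n) (@ballT R n)) => [r||].
- rewrite -EFinM lee_fin /vol_inv /= E /=.
 have r0 : (0 <= r)%R by rewrite -lee_fin -E measure_ge0.
 have [->|rn] := eqVneq r 0%R; first by rewrite mulr0 ler01.
 by rewrite ger0_norm ?invr_ge0// mulVf.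
- by rewrite /vol_inv /= E /= invr0 normr0 mul0e lee_fin ler01.
- have h : 0 <= leb R (n + n) (@ballT R n) by exact: measure_ge0.
 by move: h; rewrite E.
Qed.

Lemma nu_sigma_finite : sigma_finite setT (nu R n).
have [F TF Foo] := leb_sigma_finite R (n + n); exists F => // k.
have [mF Fk] := Foo k; split => //.
by rewrite nuE lte_mul_pinfty// lee_fin.
Qed.

End NuFinite.

Definition snu (R : realType) (n : nat) : set ((n + n).-tuple (measurableTypeR R)) -> \bar R := nu R n.
HB.instance Definition _ (R : realType) n := Measure.on (@snu R n).
HB.instance Definition _ (R : realType) n :=
 Measure_isSigmaFinite.Build _ _ _ (@snu R n) (nu_sigma_finite R n).

(** * Tonelli's theorem, dilations and polar coordinates on the ball *)

Section BallInt.
Variables (R : realType) (n : nat).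
Local Notation C := (cplx R).
Local Notation V := (Cn R n).
Local Notation mR := (measurableTypeR R).
Local Notation lam := (@lebesgue_measure R).
Local Notation T := ((n + n).-tuple mR).
Local Notation B := (@ballT R n).
Local Notation mu := (nu R n).
Implicit Types (t : T) (f g : V -> C).
Local Open Scope ereal_scope.

Lemma ballTtn t : B t <-> (tn t < 1)%R.
by rewrite ballTE nr_toC. Qed.

Lemma emeas_if (g : V -> \bar R) : emeas g <->
 mfun (fun t : T => if (tn t < 1)%R then g (toC t) else 0).
have mB := @meas_ballT R n.
have E : (fun t : T => if (tn t < 1)%R then g (toC t) else 0) = (fun t => g (toC t)) \_ B.
 apply/funext => t; rewrite patchE; case: ifPn => h.
  by rewrite mem_set//; exact/ballTtn.
 by rewrite memNset// => /ballTtn h'; rewrite h' in h.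
by rewrite E; split => [/(measurable_restrictT _ mB)|/(measurable_restrictT _ mB)].
Qed.

Lemma Ie_if (g : V -> \bar R) : Ie g = \int[mu]_t (if (tn t < 1)%R then g (toC t) else 0).
by apply: int_if => t; exact: ballTtn. Qed.

Lemma Ie_leb (g : V -> \bar R) : emeas g -> (forB w, 0 <= g w) ->
 Ie g = (vol_inv R n)%:num%:E * \int[leb R (n + n)]_t (if (tn t < 1)%R then g (toC t) else 0).
move=> mg g0; rewrite Ie_if ge0_integral_mscale//; first exact/emeas_if.
by move=> t _; case: ifP => // /ballTtn /g0.
Qed.

Lemma Ie_cst (c : R) : (0 <= c)%R -> Ie (fun _ : V => c%:E) <= c%:E.
move=> c0; have mB := @meas_ballT R n.
rewrite /Ie integral_cst// -[leRHS]mule1.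
by apply: lee_wpmul2l => //; exact: nu_ball_le1.
Qed.
Lemma emeas_cst c : emeas (fun _ : V => c). exact: measurable_cst. Qed.

Lemma cok_bnd g (M : R) : cmeas g -> (forB w, modC (g w) <= M)%R -> cok g.
move=> mg h; apply: (@cok_le _ _ _ (fun=> (Num.max M 0)%:E)) => //; first exact: emeas_cst.
 by apply: le_lt_trans (Ie_cst _) (ltry _); rewrite le_max lexx orbT.
by move=> w /h hw; rewrite lee_fin le_max hw.
Qed.

Definition meas2 (F : V -> V -> \bar R) := mfun (fun p : T * T =>
 if (tn p.1 < 1)%R && (tn p.2 < 1)%R then F (toC p.1) (toC p.2) else 0).

Section Tonelli.
Variable F : V -> V -> \bar R.
Hypothesis mF : meas2 F.
Hypothesis F0 : forall z w, uball z -> uball w -> 0 <= F z w.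

Let H (p : T * T) := if (tn p.1 < 1)%R && (tn p.2 < 1)%R then F (toC p.1) (toC p.2) else 0.
Let H0 p : 0 <= H p.
by rewrite /H; case: ifP => // /andP[/ballTtn h1 /ballTtn h2]; exact: F0. Qed.
Let IF z : (tn z < 1)%R -> Ie (F (toC z)) = \int[mu]_t H (z, t).
by move=> hz; rewrite Ie_if; apply: eq_integral => t _; rewrite /H /= hz. Qed.
Let IG w : (tn w < 1)%R -> Ie (fun z => F z (toC w)) = \int[mu]_t H (t, w).
by move=> hz; rewrite Ie_if; apply: eq_integral => t _; rewrite /H /= hz andbT. Qed.

Lemma tonelli_emeas1 : emeas (fun z => Ie (F z)).
apply/emeas_if; have := @measurable_fun_fubini_tonelli_F _ _ _ _ _ (@snu R n) H mF H0.
apply: eq_measurable_fun => t _; case: ifP => h; first by rewrite IF.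
by rewrite /fubini_F integral0_eq// => s _; rewrite /H /= h.
Qed.

Lemma tonelli_emeas2 : emeas (fun w => Ie (fun z => F z w)).
apply/emeas_if; have := @measurable_fun_fubini_tonelli_G _ _ _ _ _ (@snu R n) H mF H0.
apply: eq_measurable_fun => t _; case: ifP => h; first by rewrite IG.
by rewrite /fubini_G integral0_eq// => s _; rewrite /H /= h andbF.
Qed.

Lemma tonelli_ball : Ie (fun z => Ie (F z)) = Ie (fun w => Ie (fun z => F z w)).
have := @fubini_tonelli _ _ _ _ _ (@snu R n) (@snu R n) H mF H0.
rewrite !Ie_if => E; transitivity (\int[mu]_t \int[mu]_s H (t, s)).
 apply: eq_integral => t _; case: ifP => h; first by rewrite IF.
 by rewrite integral0_eq => [//|s _]; rewrite /H /= h.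
rewrite [LHS]E; apply: eq_integral => t _; case: ifP => h; last first.
 by rewrite integral0_eq// => s _; rewrite /H /= h andbF.
by rewrite IG.
Qed.

End Tonelli.

Lemma dilation_ball (G : V -> \bar R) (r : R) : (0 < r < 1)%R -> emeas G ->
 (forB w, 0 <= G w) ->
 Ie (fun w => G (rc r *: w)) = (r ^- (n + n))%:E * Ie (fun w => if (nr w < r)%R then G w else 0).
move=> /andP[r0 r1] mG G0.
pose H t := if (tn t < r)%R then (if (tn t < 1)%R then G (toC t) else 0) else 0.
have mH : mfun H.
 apply: measurable_fun_ifT; last exact: measurable_cst.
  by apply: measurable_fun_ltr => //; exact: meas_tn.
 exact/emeas_if.
have H0 t : 0 <= H t by rewrite /H; do 2 case: ifP => //; move=> /ballTtn /G0.
have E1 t : (if (tn t < 1)%R then G (rc r *: toC t) else 0) = H (tsc r t).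
 rewrite /H tsc_tn ?ltW// gtr_pMr// toC_tsc; case: ifP => // h.
 by rewrite mulr_ilt1// ?tn_ge0// ltW.
have E2 t : (if (tn t < 1)%R then (if (nr (toC t) < r)%R then G (toC t) else 0) else 0) = H t.
 by rewrite /H nr_toC; case: ifP => h; case: ifP.
rewrite !Ie_leb.
- under eq_integral do rewrite E1.
 rewrite leb_taff//; under [in RHS]eq_integral do rewrite E2.
 by rewrite muleCA.
- by apply/emeas_if; apply: eq_measurable_fun mH => t _; rewrite E2.
- by move=> w /G0; case: ifP.
- apply/emeas_if.
 have : mfun (fun t => H (tsc r t)).
  by apply: (measurableT_comp mH); exact: meas_taff.
 by apply: eq_measurable_fun => t _; rewrite E1.
- move=> w wB; apply: G0; move: wB; rewrite !uballE nrZR ger0_norm ?ltW// => wB.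
 by rewrite mulr_ilt1// ?nr_ge0// ltW.
Qed.

Lemma sphproj_tsc x t : rc x *: sphproj (toC t) = toC (tsc (x / tn t) t).
by rewrite toC_tsc RtoCM -scalerA /sphproj -/(nr _) nr_toC.
Qed.
Lemma nr_sphproj (w : V) : nr w != 0%R -> nr (sphproj w) = 1%R.
by move=> w0; rewrite /sphproj -/(nr _) nrZR ger0_norm ?invr_ge0// mulVf.
Qed.
Lemma nr_sphproj_le (w : V) : (nr (sphproj w) <= 1)%R.
have [w0|/nr_sphproj -> //] := eqVneq (nr w) 0%R.
by rewrite /sphproj -/(nr _) nrZR w0 mulr0.
Qed.
Lemma uball_sphproj x (w : V) : (0 < x < 1)%R -> uball (rc x *: sphproj w).
move=> /andP[x0 x1]; rewrite uballE nrZR ger0_norm ?ltW//.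
by apply: le_lt_trans x1; rewrite ler_piMr ?nr_sphproj_le// ltW.
Qed.
(** Radial integral with density [2n x^(2n-1)], the law of [|w|] under normalized measure on the
    ball. *)
Definition rint (h : R -> \bar R) : \bar R :=
 \int[lam]_x (if (0 < x < 1)%R then ((n + n)%:R * x ^+ (n + n).-1)%:E * h x else 0).

Lemma rint_ge0 h : (forall x, (0 < x < 1)%R -> 0 <= h x) -> 0 <= rint h.
move=> h0; apply: integral_ge0 => x _; case: ifP => // hx; apply: mule_ge0 (h0 _ hx).
by case/andP: hx => x0 x1; rewrite lee_fin mulr_ge0 ?exprn_ge0// ltW.
Qed.

Section Polar.
Variable G : V -> \bar R.
Hypothesis n0 : (0 < n)%N.
Hypothesis mG : emeas G.
Hypothesis G0 : forB w, 0 <= G w.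

Let H t := if (tn t < 1)%R then G (toC t) else 0.
Let mH : mfun H. exact/emeas_if. Qed.
Let H0 t : 0 <= H t. by rewrite /H; case: ifP => // /ballTtn /G0. Qed.

Let E t : rint (fun x => G (rc x *: sphproj (toC t))) =
 \int[lam]_x ray H t x.
apply: eq_integral => x _; rewrite /ray; case: ifP => // /andP[x0 x1]; rewrite sphproj_tsc /H.
rewrite (_ : (tn _ < 1)%R)// tsc_tn; last by rewrite divr_ge0 ?tn_ge0// ltW.
have [->|t0] := eqVneq (tn t) 0%R; first by rewrite mulr0.
by rewrite divfK.
Qed.

Let P1 : \int[leb R (n + n)]_t (if (tn t < 1)%R then H t else 0) =
 \int[leb R (n + n)]_t (if (tn t < 1)%R then \int[lam]_x ray H t x else 0).
have np : (n + n = (n + n).-1.+1)%N by rewrite prednK// addn_gt0 n0.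
by move: (H) mH H0; move: (n + n)%N np => m -> K mK K0; exact: polar.
Qed.

Lemma emeas_rint : emeas (fun w => rint (fun x => G (rc x *: sphproj w))).
by apply/emeas_if; apply: eq_measurable_fun (measurable_polar mH H0) => t _; rewrite E. Qed.

Lemma polar_ball : Ie G = Ie (fun w => rint (fun x => G (rc x *: sphproj w))).
rewrite !Ie_leb//.
- congr (_ * _); transitivity (\int[leb R (n + n)]_t (if (tn t < 1)%R then H t else 0)).
  by apply: eq_integral => t _; rewrite /H; case: ifP.
 by rewrite P1; apply: eq_integral => t _; rewrite E.
- exact: emeas_rint.
- by move=> w wB; apply: rint_ge0 => x hx; apply: G0; exact: uball_sphproj.
Qed.

End Polar.

End BallInt.

(** * Fundamental theorem of calculus on an open interval, with possibly infinite integrals *)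

Section FTCopen.
Variable R : realType.
Local Notation mR := (measurableTypeR R).
Local Notation lam := (@lebesgue_measure R).
Implicit Types A H f : R -> R.

(** Distance to the ends of the interval. The shift by 3 makes [[shr k, 1 - shr k]] nondegenerate
    already for [k = 0]. *)
Definition shr (k : nat) : R := k.+3%:R^-1.
Definition ins (k : nat) (x : R) : bool := shr k <= x <= 1 - shr k.
Lemma shr_gt0 k : 0 < shr k. by rewrite invr_gt0. Qed.
Lemma shr_lt k : shr k < 1 - shr k.
rewrite ltrBrDr -mulr2n -[X in X < _]mulr_natr /shr mulrC -ltr_pdivlMr ?invr_gt0//.
by rewrite mul1r invrK ltr_nat.
Qed.
Lemma shr_mono k l : (k <= l)%N -> shr l <= shr k.
by move=> kl; rewrite /shr lef_pV2 ?posrE// ler_nat. Qed.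

Lemma shr_small (e : R) : 0 < e -> exists K, forall k, (K <= k)%N -> shr k < e.
move=> e0; exists (Num.truncn e^-1) => k hk; rewrite /shr invf_plt ?posrE//.
by apply: lt_trans (truncnS_gt _) _; rewrite ltr_nat !ltnS; exact: leqW.
Qed.

Lemma ins_sub k x : ins k x -> 0 < x < 1.
by have := shr_gt0 k; rewrite /ins => ? /andP[? ?]; lra. Qed.

Lemma ins_ex x : 0 < x < 1 -> exists K, forall k, (K <= k)%N -> ins k x.
move=> /andP[x0 x1]; have [K1 h1] := shr_small x0.
have x2 : 0 < 1 - x by lra.
have [K2 h2] := shr_small x2.
exists (maxn K1 K2) => k; rewrite geq_max => /andP[/h1 ? /h2 ?]; rewrite /ins; lra.
Qed.

Lemma ins_meas k : mfun (fun x : mR => ins k x).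
by apply: measurable_and; exact: measurable_fun_ler. Qed.

Lemma cont01_meas A (k : nat) : (forall x, 0 < x < 1 -> cont_at A x) ->
 mfun (fun x : mR => if ins k x then (A x)%:E else 0%E).
move=> cA; apply: measurable_fun_if => //; first exact: ins_meas.
rewrite setTI; apply/measurable_EFinP.
apply: (@measurable_funS _ _ (mR) mR (`]0, 1[%classic : set mR)).
- exact: measurable_itv.
- by move=> x /= /ins_sub; rewrite in_itv.
apply: open_continuous_measurable_fun; first exact: interval_open.
by move=> x; rewrite inE /= in_itv /= => /cA.
Qed.

Lemma cvg_ins A : (forall x, 0 < x < 1 -> 0 <= A x) -> (forall x, 0 < x < 1 -> cont_at A x) ->
 (\int[lam]_x (if ins k x then (A x)%:E else 0))%E @[k --> \oo] -->
 (\int[lam]_x (if (0 < x < 1)%R then (A x)%:E else 0))%E.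
move=> A0 cA.
have := @cvg_monotone_convergence _ _ _ lam _ measurableT
 (fun k x => if ins k x then (A x)%:E else 0%E) (fun k => cont01_meas k cA).
set L := (X in _ -> _ -> _ --> X); rewrite (_ : L = (\int[lam]_x (if (0 < x < 1)%R then (A x)%:E else 0))%E).
 apply=> [k x _|x _ k l kl].
  by case: ifP => // /ins_sub /A0; rewrite lee_fin.
 case: ifP => [h|_]; last by case: ifP => // /ins_sub /A0; rewrite lee_fin.
 rewrite (_ : ins l x)//; have := shr_mono kl; move: h; rewrite /ins => /andP[? ?] ?; lra.
apply: eq_integral => x _; apply/cvg_lim => //; case: ifP => h.
 have [K hK] := ins_ex h; apply: cvg_near_cst.
 by exists K => // k /= /hK ->.
apply: cvg_near_cst; apply: nearW => k.
by case: ifP => // /ins_sub; rewrite h.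
Qed.

(** Written as an equality of sums in the extended reals, because finiteness of the integrals is not
    known in advance. It is the usual theorem on [[shr k, 1 - shr k]], followed by monotone
    convergence. *)
Lemma FTC_open A (Bf : R -> R) H (h0 h1 : R) : (forall x, 0 < x < 1 -> 0 <= A x) ->
 (forall x, 0 < x < 1 -> 0 <= Bf x) -> (forall x, 0 < x < 1 -> cont_at A x) ->
 (forall x, 0 < x < 1 -> cont_at Bf x) ->
 (forall x, 0 < x < 1 -> rder H x (A x - Bf x)) ->
 H (shr k) @[k --> \oo] --> h0 -> H (1 - shr k) @[k --> \oo] --> h1 ->
 (\int[lam]_x (if (0 < x < 1)%R then (A x)%:E else 0) + h0%:E =
  \int[lam]_x (if (0 < x < 1)%R then (Bf x)%:E else 0) + h1%:E)%E.
move=> A0 B0 cA cB dH H0 H1.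
have E k : (\int[lam]_x (if ins k x then (A x)%:E else 0) + (H (shr k))%:E =
  \int[lam]_x (if ins k x then (Bf x)%:E else 0) + (H (1 - shr k))%:E)%E.
 have sub x : shr k <= x <= 1 - shr k -> 0 < x < 1 by exact: ins_sub.
 have int f : (forall x, 0 < x < 1 -> cont_at f x) ->
   lam.-integrable `[shr k, 1 - shr k] (EFin \o f).
  move=> cf; apply: continuous_compact_integrable; first exact: segment_compact.
  by apply: continuous_in_subspaceT => x; rewrite inE /= in_itv /= => /sub /cf.
 have ifE f : (\int[lam]_x (if ins k x then (f x)%:E else 0) = \int[lam]_(x in `[(shr k)%R, (1 - shr k)%R]) (f x)%:E)%E.
  by symmetry; apply: int_if => x /=; rewrite in_itv.
 have F := FTCcc (shr_lt k) (fun x hx => dH x (sub x hx)) (fun x hx => continuousB (cA _ (sub x hx)) (cB _ (sub x hx))).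
 move: F; under eq_integral do rewrite EFinB.
 rewrite !ifE integralB//; [move=> F|exact: int|exact: int].
 have fin f : (forall x, 0 < x < 1 -> cont_at f x) ->
   (\int[lam]_(x in `[(shr k)%R, (1 - shr k)%R]) (f x)%:E)%E \is a fin_num.
  by move=> cf; apply: integrable_fin_num => //; exact: int.
 move: F; rewrite -(fineK (fin _ cA)) -(fineK (fin _ cB)) /= -EFinB => -[F].
 by rewrite -!EFinD; congr EFin; lra.
have LA : (\int[lam]_x (if ins k x then (A x)%:E else 0) + (H (shr k))%:E)%E @[k --> \oo] -->
  (\int[lam]_x (if (0 < x < 1)%R then (A x)%:E else 0) + h0%:E)%E.
 apply: cvgeD; [by rewrite fin_num_adde_defl|exact: cvg_ins|].
 by apply: cvg_EFin; [exact: nearW|].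
have LB : (\int[lam]_x (if ins k x then (Bf x)%:E else 0) + (H (1 - shr k))%:E)%E @[k --> \oo] -->
  (\int[lam]_x (if (0 < x < 1)%R then (Bf x)%:E else 0) + h1%:E)%E.
 apply: cvgeD; [by rewrite fin_num_adde_defl|exact: cvg_ins|].
 by apply: cvg_EFin; [exact: nearW|].
move: LA; under eq_cvg do rewrite E.
by move=> LA; exact: (cvg_unique _ LA LB).
Qed.

End FTCopen.

(** * Integration by parts on the ball along rays *)

Section IBP.
Variables (R : realType) (n : nat).
Local Notation C := (cplx R).
Local Notation V := (Cn R n).
Local Notation mR := (measurableTypeR R).
Local Notation lam := (@lebesgue_measure R).
Local Notation T := ((n + n).-tuple mR).
Local Notation B := (@ballT R n).
Implicit Types (t : T) (f g : V -> C) (p q : V -> R).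

Definition rcont p (z : V) := forall e : R, 0 < e -> exists2 d : R, 0 < d &
 forall w, nr (w - z) < d -> `|p w - p z| < e.
Lemma rcont_cmeas p : (forB z, rcont p z) -> cmeas (fun w => rc (p w)).
move=> cp; apply/cmeas_rc; apply: cont_meas cp; first exact: openU_uball.
exact: meas_ballT.
Qed.

Lemma cmeas_pow a : cmeas (fun w : V => wtp a w).
apply/cmeas_rc; apply: (@measurable_funTS _ _ T); apply: (measurableT_comp (measurable_powR _)).
rewrite (_ : (fun t => _) = (fun t => 1 - tn t ^+ 2)).
 by apply: measurable_funB => //; apply: measurable_funX; exact: meas_tn.
by apply/funext => t; rewrite /weight -nr_sqr nr_toC.
Qed.

Lemma rcont_ray p (w : V) x : rcont p (rc x *: w) -> cont_at (fun s : R => p (rc s *: w)) x.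
move=> h; apply/cvgrPdist_lt => e e0; have [d d0 hd] := h e e0.
have w1 : 0 < nr w + 1 by have := nr_ge0 w; lra.
near=> s; rewrite distrC; apply: hd; rewrite -scalerBl -RtoCB nrZR.
apply: (@le_lt_trans _ _ (`|s - x| * (nr w + 1))); first by rewrite ler_wpM2l//; lra.
rewrite -ltr_pdivlMr// distrC; near: s.
apply: cvgr_dist_lt; last by rewrite divr_gt0.
exact: cvg_id.
Unshelve. all: by end_near.
Qed.

Lemma sphproj_lip (w z : V) : 0 < nr z -> nr (sphproj w - sphproj z) <= 2 / nr z * nr (w - z).
move=> z0; have [w0|w0] := eqVneq (nr w) 0.
 have -> : w = 0 by apply/eqP; rewrite -nr_eq0; apply/eqP.
 rewrite /sphproj scaler0 !sub0r !nrN -!/(nr _) -mulrA mulVf ?gt_eqF// mulr1.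
 by apply: le_trans (nr_sphproj_le _) _; lra.
have wp : 0 < nr w by rewrite lt_def w0 nr_ge0.
rewrite (_ : sphproj w - sphproj z = rc (nr z)^-1 *: (w - z) + rc ((nr w)^-1 - (nr z)^-1) *: w).
 apply: le_trans (nrD _ _) _; rewrite !nrZR ger0_norm ?invr_ge0//.
 have -> : `|(nr w)^-1 - (nr z)^-1| * nr w = `|nr z - nr w| / nr z.
  rewrite -[X in _ * X](ger0_norm (nr_ge0 w)) -normrM -[X in _ / X](ger0_norm (nr_ge0 z)) -normf_div.
  by congr `|_|; field; rewrite !gt_eqF.
 have h : `|nr z - nr w| <= nr (w - z).
  by rewrite ler_norml; have := nrBr w z; have := nrBr z w; rewrite (nr_distC z w) => ? ?; apply/andP; split; lra.
 have zi : 0 < (nr z)^-1 by rewrite invr_gt0.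
 move: (nr (w - z)) (`|_|) ((nr z)^-1) h zi => a b c; nra.
by rewrite /sphproj -!/(nr _) RtoCB scalerBl scalerBr [RHS]addrC addrA subrK.
Qed.

(** Outside the origin the projection to the sphere is continuous, and at the origin it takes one
    default value. *)
Lemma sph_cmeas p : (forall z, nr z = 1 -> rcont p z) -> cmeas (fun w => rc (p (sphproj w))).
move=> cp; apply/cmeas_rc; pose U := [set w : V | nr w != 0].
have mU : measurable (@toC R n @^-1` U).
 rewrite (_ : _ @^-1` _ = (fun t : T => nr (toC t) == 0) @^-1` [set false]).
  rewrite -[X in measurable X]setTI; have : mfun (fun t : T => nr (toC t) == 0).
   by apply: measurable_fun_eqr => //; exact: meas_nr_toC.
  exact.
 by apply/seteqP; split => t; rewrite /U /=; case: eqP.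
have m1 : measurable_fun (@toC R n @^-1` U) (fun t => p (sphproj (toC t)) : mR).
 apply: (@cont_meas _ _ U (fun w => p (sphproj w))) => //.
  move=> z z0; have zp : 0 < nr z by rewrite lt_def z0 nr_ge0.
  exists (nr z) => // w h; rewrite /U /=; apply/eqP => w0.
  by have := nrBr z w; rewrite nr_distC w0 => ?; lra.
 move=> z z0 e e0; have zp : 0 < nr z by rewrite lt_def z0 nr_ge0.
 have [d d0 hd] := cp _ (nr_sphproj z0) e e0.
 exists (d * nr z / 2); first by rewrite divr_gt0// mulr_gt0.
 move=> w h; apply: hd; apply: le_lt_trans (sphproj_lip _ zp) _.
 by rewrite mulrAC ltr_pdivrMr// mulrC -ltr_pdivlMr.
have m2 : mfun (fun t : T => nr (toC t) == 0).
 by apply: measurable_fun_eqr => //; exact: meas_nr_toC.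
have : measurable_fun (@ballT R n) (fun t => if nr (toC t) == 0 then p (sphproj 0) else p (sphproj (toC t)) : mR).
 apply: measurable_fun_if; [exact: meas_ballT|exact: measurable_funTS|exact: measurable_cst|].
 apply: measurable_funS mU _ m1 => t /= [_ h]; rewrite /U /=; exact/negbT.
apply: eq_measurable_fun => t _; case: eqP => // h; congr (p (sphproj _)).
by apply/esym/eqP; rewrite -nr_eq0 h.
Qed.

Lemma weight_ray (w : V) x : nr w = 1 -> weight (rc x *: w) = 1 - x ^+ 2.
by move=> w1; rewrite /weight -nr_sqr nrZR w1 mulr1 real_normK// num_real. Qed.
Lemma rder_1mX2 (x : R) : rder (fun x : R => 1 - x ^+ 2) x (- (2 * x)).
by apply: (rder_ext (rderB (rder_cst 1 x) (rder_exp 1 x))) => //; rewrite sub0r expr1. Qed.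

Lemma rder_1mX2p N (x : R) : -1 < x < 1 ->
 rder (fun x : R => (1 - x ^+ 2) `^ N) x (- (2 * x) * (N * (1 - x ^+ 2) `^ (N - 1))).
move=> /andP[x0 x1]; have h : 0 < 1 - x ^+ 2 by nra.
by apply: rder_eq (rder_comp (rder_1mX2 x) (rder_powRc N h)) _; rewrite mulrC.
Qed.

Lemma powR_pred (y N : R) : 0 < y -> y `^ N = y * y `^ (N - 1).
move=> y0; rewrite -[X in _ = X * _]powRr1 ?ltW// -powRD ?(gt_eqF y0) ?implybT//.
by congr (_ `^ _); ring.
Qed.

Lemma Ie_ne0 (g : V -> \bar R) : (0 < n)%N -> emeas g -> (forB w, (0 <= g w)%E) ->
 Ie g = Ie (fun w => if nr w == 0 then 0%E else g w).
move=> n0 mg g0; have mg1 := (emeas_if g).1 mg.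
have np : (n + n = (n + n).-1.+1)%N by rewrite prednK// addn_gt0 n0.
pose H t := (if (tn t < 1)%R then g (toC t) else 0)%E.
have H0 t : (0 <= H t)%E by rewrite /H; case: ifP => // /ballTtn /g0.
have E t : (if (tn t < 1)%R then (if nr (toC t) == 0%R then 0 else g (toC t)) else 0)%E =
  (if tn t == 0%R then 0 else H t)%E.
 by rewrite nr_toC /H; case: ifP => //; case: ifP.
have mt : mfun (fun t : T => tn t == 0).
 by apply: measurable_fun_eqr => //; exact: meas_tn.
have mH : mfun (fun t => (if tn t == 0%R then 0 else H t)%E).
 exact: measurable_fun_ifT.
rewrite !Ie_leb//.
- congr (_ * _)%E; rewrite -/(H _); under [RHS]eq_integral do rewrite E.
 transitivity (\int[leb R (n + n)]_t H t)%E; first by [].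
 move: (H) (mg1 : mfun H) H0; move: (n + n)%N np => m -> K mK K0.
 exact: leb_ne0.
- by apply/emeas_if; apply: eq_measurable_fun mH => t _; rewrite E.
- by move=> w /g0; case: ifP.
Qed.

Section Real.
(** [q] is the radial derivative [x d/dx p]. The sign conditions make both densities [Af] and [Bf]
    nonnegative, so that the identity can be proved in [[0, +oo]]. *)
Variables (p q : V -> R) (N : R).
Hypothesis n0 : (0 < n)%N.
Hypothesis N0 : 0 <= N.
Hypothesis cp : forall z, nr z <= 1 -> rcont p z.
Hypothesis cq : forall z, nr z <= 1 -> rcont q z.
Hypothesis p0 : forall z, nr z <= 1 -> 0 <= p z.
Hypothesis pq0 : forall z, nr z <= 1 -> 0 <= 2 * (n%:R + N) * p z + q z.
Hypothesis dp : forall w x, nr w = 1 -> 0 < x < 1 ->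
 rder (fun s : R => p (rc s *: w)) x (q (rc x *: w) / x).

Let Af (w : V) := (2 * (n%:R + N) * p w + q w) * weight w `^ N.
Let Bf (w : V) := 2 * N * p w * weight w `^ (N - 1).
Let Af0 w : uball w -> 0 <= Af w.
by move=> /uball_le w1; rewrite mulr_ge0 ?pq0. Qed.
Let Bf0 w : uball w -> 0 <= Bf w.
by move=> /uball_le w1; rewrite !mulr_ge0 ?p0. Qed.
Let mp : cmeas (fun w => rc (p w)).
by apply: rcont_cmeas => z /uball_le; exact: cp. Qed.
Let mq : cmeas (fun w => rc (q w)).
by apply: rcont_cmeas => z /uball_le; exact: cq. Qed.
Lemma emeas_Af : emeas (fun w => (Af w)%:E).
apply/emeas_rc; apply: cmeas_ext (cmeasM (cmeasD (cmeasM (cmeas_cst _ (rc (2 * (n%:R + N)))) mp) mq) (cmeas_pow N)).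
by move=> w _; rewrite -RtoCM -RtoCD -RtoCM.
Qed.
Lemma emeas_Bf : emeas (fun w => (Bf w)%:E).
apply/emeas_rc; apply: cmeas_ext (cmeasM (cmeasM (cmeas_cst _ (rc (2 * N))) mp) (cmeas_pow (N - 1))).
by move=> w _; rewrite -!RtoCM.
Qed.

(** [H] is [2n x^(2n) p(x w) (1 - x^2)^N]; with [x^2 = 1 - (1 - x^2)] its derivative splits into the
    two nonnegative densities. At [x = 1] it vanishes unless [N = 0], when the power is 1 and a
    boundary term remains. *)
Lemma ibp_ray w : nr w = 1 ->
 (rint n (fun x => (Af (rc x *: w))%:E) =
  rint n (fun x => (Bf (rc x *: w))%:E) + (if N == 0 then 2 * n%:R * p w else 0)%:E)%E.
move=> w1; pose m := (n + n).-1; have mE : m.+1 = (n + n)%N by rewrite /m prednK// addn_gt0 n0.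
pose k : R := (n + n)%:R.
pose H (x : R) : R := k * (x ^+ m.+1 * p (rc x *: w) * (1 - x ^+ 2) `^ N).
pose A x := k * x ^+ m * Af (rc x *: w); pose Bb x := k * x ^+ m * Bf (rc x *: w).
have rE (F : V -> R) : rint n (fun x => (F (rc x *: w))%:E) =
 (\int[lam]_x (if (0 < x < 1)%R then (k * x ^+ m * F (rc x *: w))%:E else 0))%E.
 by apply: eq_integral => x _; case: ifP => // _; rewrite EFinM.
have xb x : 0 < x < 1 -> nr (rc x *: w) <= 1.
 by move=> /andP[x0 x1]; rewrite nrZR w1 mulr1 ger0_norm ltW.
have ub x : 0 < x < 1 -> uball (rc x *: w).
 by move=> /andP[x0 x1]; rewrite uballE nrZR w1 mulr1 ger0_norm// ltW.
have hy (x : R) : 0 < x < 1 -> -1 < x < 1 by move=> /andP[? ?]; lra.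
have s0 : shr R k' @[k' --> \oo] --> (0 : R).
 apply/cvgrPdist_lt => e e0; have [K hK] := shr_small e0.
 by exists K => // l /hK; rewrite sub0r normrN ger0_norm// ltW// shr_gt0.
rewrite !rE -[LHS]adde0; apply: (@FTC_open _ A Bb H 0).
- by move=> x hx; apply: mulr_ge0; [apply: mulr_ge0 => //; apply: exprn_ge0; case/andP: hx => /ltW|exact: Af0 (ub x hx)].
- by move=> x hx; apply: mulr_ge0; [apply: mulr_ge0 => //; apply: exprn_ge0; case/andP: hx => /ltW|exact: Bf0 (ub x hx)].
- move=> x hx; have cw := rder_cont (rder_1mX2p N (hy x hx)).
 rewrite (_ : A = fun x => k * x ^+ m * ((2 * (n%:R + N) * p (rc x *: w) + q (rc x *: w)) * (1 - x ^+ 2) `^ N)).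
  2: by apply/funext => y; rewrite /A /Af weight_ray.
 apply: cvgM; first by apply: cvgM; [exact: cvg_cst|exact: exprn_continuous].
 apply: cvgM => //; apply: cvgD; last exact: (rcont_ray (cq (xb x hx))).
 by apply: cvgM; [exact: cvg_cst|exact: (rcont_ray (cp (xb x hx)))].
- move=> x hx; have cw := rder_cont (rder_1mX2p (N - 1) (hy x hx)).
 rewrite (_ : Bb = fun x => k * x ^+ m * (2 * N * p (rc x *: w) * (1 - x ^+ 2) `^ (N - 1))).
  2: by apply/funext => y; rewrite /Bb /Bf weight_ray.
 apply: cvgM; first by apply: cvgM; [exact: cvg_cst|exact: exprn_continuous].
 apply: cvgM => //.
 by apply: cvgM; [exact: cvg_cst|exact: (rcont_ray (cp (xb x hx)))].
- move=> x hx; apply: rder_eq (rderZ k (rderM (rderM (rder_exp m x) (dp w1 hx)) (rder_1mX2p N (hy x hx)))) _.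
 have mR : m.+1%:R = n%:R + n%:R :> R by rewrite mE natrD.
 rewrite /A /Bb /Af /Bf weight_ray// mR [x ^+ m.+1]exprS.
 case/andP: hx => x0 x1; have y0 : 0 < 1 - x ^+ 2 by nra.
 have -> : (1 - x ^+ 2) `^ N = (1 - x ^+ 2) * (1 - x ^+ 2) `^ (N - 1).
  exact: powR_pred.
 clearbody k; rewrite expr2; move: (p _) (q _) (_ `^ _) (x ^+ m) => P Q W X.
 by field; rewrite gt_eqF.
- have -> : 0 = H 0 by rewrite /H exprS !mul0r mulr0.
 apply: (@continuous_cvg _ _ _ _ _ _ H) => //.
 apply: cvgM; first exact: cvg_cst.
 apply: cvgM; last by apply: (rder_cont (rder_1mX2p N _)); lra.
 apply: cvgM; first exact: exprn_continuous.
 by apply: (rcont_ray (cp _)); rewrite nrZR normr0 mul0r.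
- have s1 : (1 - shr R k') @[k' --> \oo] --> (1 : R) by rewrite -[X in _ --> X]subr0; apply: cvgB => //; exact: cvg_cst.
 rewrite /H (_ : (if N == 0 then _ else _) = k * (1 ^+ m.+1 * p (rc 1 *: w) * (N == 0)%:R)); last first.
  by rewrite expr1n mul1r scale1r /k natrD; case: eqP => _; rewrite ?mulr1 ?mulr0//; ring.
 apply: cvgM; first exact: cvg_cst.
 apply: cvgM; first apply: cvgM.
 + by apply: (@continuous_cvg _ _ _ _ _ _ (fun x : R => x ^+ m.+1)) => //; exact: exprn_continuous.
 + apply: (@continuous_cvg _ _ _ _ _ _ (fun x : R => p (rc x *: w))) => //.
  by apply: (rcont_ray (cp _)); rewrite nrZR normr1 w1 mul1r.
 + have [->|Nn] := eqVneq N 0; first by under eq_fun do rewrite powRr0; exact: cvg_cst.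
  have Np : 0 < N by rewrite lt_def Nn.
  have /cvg_at_rightP := powR_cvg0 Np; apply; split.
   move=> l; have := shr_gt0 R l; have := shr_lt R l; nra.
  have -> : 0 = 1 - 1 ^+ 2 :> R by rewrite expr1n subrr.
  apply: cvgB; first exact: cvg_cst.
  by apply: (@continuous_cvg _ _ _ _ _ _ (fun x : R => x ^+ 2)) => //; exact: exprn_continuous.
Qed.

Definition Sf (w : V) := if N == 0 then 2 * n%:R * p (sphproj w) else 0.
Lemma Sf_ge0 w : 0 <= Sf w.
by rewrite /Sf; case: ifP => // _; rewrite !mulr_ge0// p0// nr_sphproj_le. Qed.

Lemma Sf_meas : cmeas (fun w => rc (Sf w)).
rewrite /Sf; case: eqP => _; last exact: cmeas_cst.
by apply: cmeas_ext (cmeasM (cmeas_cst _ (rc (2 * n%:R))) (sph_cmeas (fun z (h : nr z = 1) => cp (eqle h)))) => w _; rewrite -RtoCM.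
Qed.

Lemma ibp_Ie : (Ie (fun w => (Af w)%:E) =
 Ie (fun w => (Bf w)%:E) + (if N == 0%R then Ie (fun w => (2 * n%:R * p (sphproj w))%:E) else 0))%E.
have eS := (emeas_rc _).1 Sf_meas; have S0 := Sf_ge0.
have -> : (if N == 0%R then Ie (fun w => (2 * n%:R * p (sphproj w))%:E) else 0)%E =
  Ie (fun w => (Sf w)%:E).
 by rewrite /Sf; case: eqP => // _; rewrite /Ie integral0.
rewrite (polar_ball n0 emeas_Af); last by move=> w /Af0; rewrite lee_fin.
rewrite (polar_ball n0 emeas_Bf); last by move=> w /Bf0; rewrite lee_fin.
have mA := emeas_rint emeas_Af (fun w h => Af0 h : (0 <= (Af w)%:E)%E).
have mB := emeas_rint emeas_Bf (fun w h => Bf0 h : (0 <= (Bf w)%:E)%E).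
have rA w : (0 <= rint n (fun x => (Af (rc x *: sphproj w))%:E))%E.
 by apply: rint_ge0 => x hx; apply: Af0; exact: uball_sphproj.
have rB w : (0 <= rint n (fun x => (Bf (rc x *: sphproj w))%:E))%E.
 by apply: rint_ge0 => x hx; apply: Bf0; exact: uball_sphproj.
rewrite -IeD//; last by move=> w _; rewrite lee_fin.
rewrite Ie_ne0// [RHS]Ie_ne0//.
- apply: Ie_eq => w _; rewrite /Sf; case: eqP => // /eqP w0; exact: ibp_ray (nr_sphproj w0).
- exact: emeasurable_funD.
- by move=> w _; apply: adde_ge0 => //; rewrite lee_fin.
Qed.

(** [Af] and [Sf] are bounded, and the identity itself then shows that [Bf] is integrable although
    its weight exponent [N - 1] may be negative. *)
Lemma ibp_pos M : (forall z, nr z <= 1 -> p z <= M) -> (forall z, nr z <= 1 -> q z <= M) ->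
 [/\ cok (fun w => rc (Af w)), cok (fun w => rc (Bf w)), cok (fun w => rc (Sf w)) &
  cintB (fun w => rc (Af w)) = cintB (fun w => rc (Bf w)) + cintB (fun w => rc (Sf w))].
move=> pM qM.
have nz : nr (0 : V) <= 1 by rewrite nr0.
have M0 : 0 <= M by apply: le_trans (p0 nz) (pM _ nz).
have nN : 0 <= 2 * (n%:R + N) by rewrite mulr_ge0// addr_ge0.
have S0 := Sf_ge0; have mS := Sf_meas.
have okA : cok (fun w => rc (Af w)).
 apply: (@cok_bnd _ _ _ (2 * (n%:R + N) * M + M)); first by apply/emeas_rc; exact: emeas_Af.
 move=> w wB; rewrite modCR ger0_norm ?Af0//.
 have w1 := uball_le wB.
 have h1 := weight_powR_le1 N0 wB.
 have h2 : 2 * (n%:R + N) * p w + q w <= 2 * (n%:R + N) * M + M.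
  by apply: lerD; [apply: ler_wpM2l => //; exact: pM|exact: qM].
 rewrite /Af -[leRHS]mulr1; apply: ler_pM => //; exact: pq0.
have okS : cok (fun w => rc (Sf w)).
 apply: (@cok_bnd _ _ _ (2 * n%:R * M)) => // w _; rewrite modCR ger0_norm//.
 rewrite /Sf; case: ifP => _; last by rewrite !mulr_ge0.
 by rewrite ler_wpM2l ?mulr_ge0// pM// nr_sphproj_le.
have IS : (Ie (fun w => (Sf w)%:E) = if N == 0%R then Ie (fun w => (2 * n%:R * p (sphproj w))%:E) else 0)%E.
 by rewrite /Sf; case: eqP => // _; rewrite /Ie integral0.
have E := ibp_Ie; rewrite -IS in E.
have modE (F : V -> R) : (forB w, 0 <= F w) ->
  Ie (fun w => (modC (rc (F w)))%:E) = Ie (fun w => (F w)%:E).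
 by move=> F0; apply: Ie_eq => w /F0 h; rewrite modCR ger0_norm.
have fA : (Ie (fun w => (Af w)%:E) < +oo)%E by rewrite -modE//; exact: okA.2.
have fS : (Ie (fun w => (Sf w)%:E) < +oo)%E by rewrite -modE//; exact: okS.2.
have pB : (0 <= Ie (fun w => (Bf w)%:E))%E by apply: Ie_ge0 => w /Bf0; rewrite lee_fin.
have pS : (0 <= Ie (fun w => (Sf w)%:E))%E by apply: Ie_ge0 => w _; rewrite lee_fin.
have fB : (Ie (fun w => (Bf w)%:E) < +oo)%E.
 by apply: le_lt_trans fA; rewrite E leeDl.
have okB : cok (fun w => rc (Bf w)).
 by split; [apply/emeas_rc; exact: emeas_Bf|rewrite modE].
split=> //; rewrite !cintB_rc -RtoCD E fineD//; rewrite ge0_fin_numE//.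
Qed.

End Real.

Definition Af p q N (w : V) := (2 * (n%:R + N) * p w + q w) * weight w `^ N.
Definition Bf p N (w : V) := 2 * N * p w * weight w `^ (N - 1).

Lemma rcontD p q z : rcont p z -> rcont q z -> rcont (fun w => p w + q w) z.
move=> hp hq e e0; have e2 : 0 < e / 2 by rewrite divr_gt0.
have [d1 d10 h1] := hp _ e2; have [d2 d20 h2] := hq _ e2.
exists (Num.min d1 d2) => [|w]; rewrite lt_min ?d10// => /andP[/h1 k1 /h2 k2].
rewrite (_ : _ - _ = (p w - p z) + (q w - q z)); last by ring.
by apply: le_lt_trans (ler_normD _ _) _; lra.
Qed.

Lemma rcont_cst c z : rcont (fun=> c) z.
by move=> e e0; exists 1 => // w _; rewrite subrr normr0. Qed.
Lemma ReMrcV (c : C) (x : R) : re (c / rc x) = re c / x.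
by rewrite -RtoCV !ReImE mulr0 subr0. Qed.
Lemma ImMrcV (c : C) (x : R) : im (c / rc x) = im c / x.
by rewrite -RtoCV !ReImE mulr0 add0r. Qed.
Lemma cokB f g : cok f -> cok g -> cok (fun w => f w - g w).
by move=> hf hg; apply: cok_ext (cokD hf (cokZ (-1) hg)) => w _; rewrite mulN1r.
Qed.

(** Adding [2 M] to [p] gives the required signs, because [2 (n + N) >= 2]; the identity for the
    constant [2 M] is subtracted afterwards. *)
Lemma ibp_signed p q N M : (0 < n)%N -> 0 <= N ->
 (forall z, nr z <= 1 -> rcont p z) -> (forall z, nr z <= 1 -> rcont q z) ->
 (forall z, nr z <= 1 -> `|p z| <= M) -> (forall z, nr z <= 1 -> `|q z| <= M) ->
 (forall w x, nr w = 1 -> 0 < x < 1 -> rder (fun s : R => p (rc s *: w)) x (q (rc x *: w) / x)) ->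
 [/\ cok (fun w => rc (Af p q N w)), cok (fun w => rc (Bf p N w)), cok (fun w => rc (Sf p N w)) &
  cintB (fun w => rc (Af p q N w)) = cintB (fun w => rc (Bf p N w)) + cintB (fun w => rc (Sf p N w))].
move=> n0 N0 cp cq pM qM dp.
have nz : nr (0 : V) <= 1 by rewrite nr0.
have M0 : 0 <= M by apply: le_trans (pM _ nz).
pose K := M + M; have n1 : 1 <= n%:R :> R by rewrite ler1n.
have h1 z : nr z <= 1 -> 0 <= p z + K by move=> /pM; rewrite ler_norml /K => /andP[? ?]; lra.
have h2 z : nr z <= 1 -> 0 <= 2 * (n%:R + N) * (p z + K) + q z.
 move=> zl; have := pM _ zl; have := qM _ zl; rewrite !ler_norml /K => /andP[a b] /andP[c d].
 by move: (p z) (q z) a b c d => P Q a b c d; nra.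
have K0 : 0 <= K by rewrite addr_ge0.
have [||||A1 B1 S1 E1] := @ibp_pos (fun w => p w + K) q N n0 N0 _ cq h1 h2 _ (M + K).
 - by move=> z h; apply: rcontD (cp z h) _; exact: rcont_cst.
 - move=> w x w1 hx; apply: (rder_ext (rderD (dp w x w1 hx) (rder_cst K x))) => //.
  by rewrite addr0.
 - by move=> z h; rewrite lerD2r; apply: le_trans (ler_norm _) (pM z h).
 - by move=> z h; apply: le_trans (ler_norm _) (le_trans (qM z h) _); rewrite lerDl.
have [|||||||A2 B2 S2 E2] := @ibp_pos (fun w => K) (fun _ => 0) N n0 N0 _ _ _ _ _ K.
 - by move=> z h; exact: rcont_cst.
 - by move=> z h; exact: rcont_cst.
 - by [].
 - by move=> z h; rewrite addr0 !mulr_ge0// addr_ge0.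
 - by move=> w x w1 hx; rewrite mul0r; exact: rder_cst.
 - by [].
 - by [].
have AE w : rc (Af (fun w => p w + K) q N w) - rc (Af (fun w => K) (fun _ => 0) N w) = rc (Af p q N w) :> C.
 by rewrite -RtoCB /Af; congr rc; ring.
have BE w : rc (Bf (fun w => p w + K) N w) - rc (Bf (fun w => K) N w) = rc (Bf p N w) :> C.
 by rewrite -RtoCB /Bf; congr rc; ring.
have SE w : rc (Sf (fun w => p w + K) N w) - rc (Sf (fun w => K) N w) = rc (Sf p N w) :> C.
 by rewrite -RtoCB /Sf; congr rc; case: ifP => _; ring.
split.
- by apply: cok_ext (cokB A1 A2) => w _; rewrite AE.
- by apply: cok_ext (cokB B1 B2) => w _; rewrite BE.
- by apply: cok_ext (cokB S1 S2) => w _; rewrite SE.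
rewrite -(cintB_eq (fun w _ => AE w)) -(cintB_eq (fun w _ => BE w)) -(cintB_eq (fun w _ => SE w)).
by rewrite !cintBB// E1 E2; ring.
Qed.

(** One notation for the term of lowest weight: a sphere integral for [N = 0], an integral with
    weight [N - 1] otherwise. Up to a constant, [P^N] has this form. *)
Definition ENc (N : R) (Th : V -> C) : C :=
 if N == 0 then rc (2 * n%:R) * cintS Th else rc (2 * N) * cintB (fun w => Th w * wtp (N - 1) w).

(* Obtained by integrating along rays, with [DTh] the radial derivative [x d/dx Th]. *)
Lemma ibp_cplx (Th DTh : V -> C) N M : (0 < n)%N -> 0 <= N ->
 (forall z, nr z <= 1 -> cont_at Th z) -> (forall z, nr z <= 1 -> cont_at DTh z) ->
 (forall z, nr z <= 1 -> modC (Th z) <= M) -> (forall z, nr z <= 1 -> modC (DTh z) <= M) ->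
 (forall w x, nr w = 1 -> 0 < x < 1 -> cder (fun s : R => Th (rc s *: w)) x (DTh (rc x *: w) / rc x)) ->
 [/\ 0 < N -> cok (fun w => Th w * wtp (N - 1) w),
   cok (fun w => (rc (2 * (n%:R + N)) * Th w + DTh w) * wtp N w) &
   ENc N Th = cintB (fun w => (rc (2 * (n%:R + N)) * Th w + DTh w) * wtp N w)].
move=> n0 N0 cT cD TM DM dT.
have [A1 B1 S1 E1] := @ibp_signed (fun w => re (Th w)) (fun w => re (DTh w)) N M n0 N0
 (fun z h => contP_re (cT z h)) (fun z h => contP_re (cD z h))
 (fun z h => le_trans (ler_Re_modC _) (TM z h)) (fun z h => le_trans (ler_Re_modC _) (DM z h)) (fun w x w1 hx =>
  rder_eq ((cderP _ _ _).1 (dT w x w1 hx)).1 (ReMrcV _ _)).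
have [A2 B2 S2 E2] := @ibp_signed (fun w => im (Th w)) (fun w => im (DTh w)) N M n0 N0
 (fun z h => contP_im (cT z h)) (fun z h => contP_im (cD z h))
 (fun z h => le_trans (ler_Im_modC _) (TM z h)) (fun z h => le_trans (ler_Im_modC _) (DM z h)) (fun w x w1 hx =>
  rder_eq ((cderP _ _ _).1 (dT w x w1 hx)).2 (ImMrcV _ _)).
have AE w : rc (Af (fun w => re (Th w)) (fun w => re (DTh w)) N w) +
  ii R * rc (Af (fun w => im (Th w)) (fun w => im (DTh w)) N w) =
  (rc (2 * (n%:R + N)) * Th w + DTh w) * wtp N w.
 by apply: cplxP; rewrite !ReImE /Af; ring.
have BE w : rc (Bf (fun w => re (Th w)) N w) + ii R * rc (Bf (fun w => im (Th w)) N w) =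
  rc (2 * N) * (Th w * wtp (N - 1) w).
 by apply: cplxP; rewrite !ReImE /Bf; ring.
have SE w : rc (Sf (fun w => re (Th w)) N w) + ii R * rc (Sf (fun w => im (Th w)) N w) =
  (if N == 0 then rc (2 * n%:R) * Th (sphproj w) else 0).
 by rewrite /Sf; case: eqP => _; apply: cplxP; rewrite !ReImE; ring.
have okB := cokD B1 (cokZ (ii R) B2);
have ok1 : 0 < N -> cok (fun w => Th w * wtp (N - 1) w).
 move=> Np; have h : cok (fun w => (rc (2 * N))^-1 * (rc (2 * N) * (Th w * wtp (N - 1) w))).
  by apply: cokZ; apply: cok_ext okB => w _; rewrite BE.
 apply: cok_ext h => w _; rewrite mulKf//.
 by rewrite rc_neq0 ?mulf_neq0// gt_eqF.
split=> //.
- by apply: cok_ext (cokD A1 (cokZ (ii R) A2)) => w _; rewrite AE.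
have {}E1 : cintB (fun w => (rc (2 * (n%:R + N)) * Th w + DTh w) * wtp N w) =
 cintB (fun w => rc (2 * N) * (Th w * wtp (N - 1) w)) +
 cintB (fun w => if N == 0 then rc (2 * n%:R) * Th (sphproj w) else 0).
 rewrite -(cintB_eq (fun w _ => AE w)) -(cintB_eq (fun w _ => BE w)) -(cintB_eq (fun w _ => SE w)).
 rewrite (cintBD A1 (cokZ _ A2)) (cintBD B1 (cokZ _ B2)) (cintBD S1 (cokZ _ S2)).
 rewrite (cintBZ _ A2) (cintBZ _ B2) (cintBZ _ S2) E1 E2.
 by ring.
have z0 : cintB (fun _ : V => 0) = 0.
 by apply: cplxP; rewrite ?re_cintB ?im_cintB /Rintegral integral0_eq.
rewrite E1 /ENc; case: eqP => Nz.
 rewrite (cintB_eq (g := fun=> 0)); last by move=> w _; rewrite Nz mulr0 mul0r.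
 rewrite z0 add0r -cintBZ//.
 have h : cok (fun w => (rc (2 * n%:R))^-1 * (rc (2 * n%:R) * Th (sphproj w))).
  by apply: cokZ; apply: cok_ext (cokD S1 (cokZ (ii R) S2)) => w _; rewrite SE Nz eqxx.
 apply: cok_ext h => w _; rewrite mulKf//.
 by rewrite rc_neq0 ?mulf_neq0// pnatr_eq0 -lt0n.
rewrite z0 addr0 cintBZ//.
have h : cok (fun w => (rc (2 * N))^-1 * (rc (2 * N) * (Th w * wtp (N - 1) w))).
 by apply: cokZ; apply: cok_ext okB => w _; rewrite BE.
apply: cok_ext h => w _; rewrite mulKf//.
by rewrite rc_neq0 ?mulf_neq0//; exact/eqP.
Qed.

(** * Rotations of one coordinate; holomorphic and antiholomorphic radial derivatives *)

Definition rotv (j : 'I_n) (u : C) (w : V) : V := \row_i (if i == j then u * w 0 i else w 0 i).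
Lemma nr_rotv j u w : modC u = 1 -> nr (rotv j u w) = nr w.
move=> u1; rewrite /nr; congr Num.sqrt; apply: eq_bigr => i _; rewrite mxE.
by case: eqP => // _; rewrite modCM u1 mul1r.
Qed.
(** Rational parametrization of the unit circle, [s] being the tangent of half the angle. *)
Definition urot (s : R) : C := (1 + ii R * rc s) ^+ 2 / rc (1 + s ^+ 2).
Lemma urotE s : re (urot s) = (1 - s ^+ 2) / (1 + s ^+ 2) /\ im (urot s) = 2 * s / (1 + s ^+ 2).
by rewrite /urot expr2 -RtoCV; split; rewrite !ReImE; ring. Qed.
Lemma modC_urot s : modC (urot s) = 1.
have s1 : 0 < 1 + s ^+ 2 by have := sqr_ge0 s; lra.
apply/eqP; rewrite -(@eqrXn2 _ 2)// expr1n modC_sqr; have [-> ->] := urotE s.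
by apply/eqP; field; rewrite gt_eqF.
Qed.
Definition shear (i k : 'I_(n + n)) (a : R) t : T := tupd i t (tnth t i + a * tnth t k).
Lemma shear_tnth i k a t l : tnth (shear i k a t) l = if l == i then tnth t i + a * tnth t k else tnth t l.
by rewrite tnth_mktuple. Qed.
Lemma meas_shear i k a : mfun (shear i k a).
apply: measurable_tupd => //; apply: measurable_funD; first exact: measurable_tnth.
by apply: measurable_funM => //; exact: measurable_tnth.
Qed.

Lemma int_shear i k a (H : T -> \bar R) : i != k -> mfun H -> (forall t, (0 <= H t)%E) ->
 (\int[leb R (n + n)]_t H (shear i k a t) = \int[leb R (n + n)]_t H t)%E.
move=> ik mH H0; apply: (@leb_shear _ _ i (fun t => a * tnth t k)) => //.
 by apply: measurable_funM => //; exact: measurable_tnth.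
by move=> t x; rewrite tnth_mktuple eq_sym (negbTE ik).
Qed.

(** A plane rotation as three shears, with coefficients [- tan (theta/2)], [sin theta],
    [- tan (theta/2)]; invariance of the measure thus reduces to [leb_shear]. *)
Definition rotT (j : 'I_n) (s : R) t : T :=
 shear (lshift n j) (rshift n j) (- s) (shear (rshift n j) (lshift n j) (2 * s / (1 + s ^+ 2))
  (shear (lshift n j) (rshift n j) (- s) t)).
Lemma lr_neq (j k : 'I_n) : (lshift n j == rshift n k :> 'I_(n + n)) = false.
by apply/eqP => /(congr1 val) /=; have := ltn_ord j; lia. Qed.
Lemma rl_neq (j k : 'I_n) : (rshift n j == lshift n k :> 'I_(n + n)) = false.
by rewrite eq_sym lr_neq. Qed.

Lemma toC_rotT j s t : toC (rotT j s t) = rotv j (urot s) (toC t).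
have s1 : 1 + s ^+ 2 != 0 by rewrite gt_eqF//; have := sqr_ge0 s; lra.
have [ur ui] := urotE s.
apply/rowP => i; rewrite [RHS]mxE; apply: cplxP.
 rewrite re_toC /rotT !shear_tnth !eqxx ?lr_neq ?rl_neq (inj_eq (@lshift_inj _ _)).
 case: eqP => [->|_]; last by rewrite re_toC.
 by move: (urot s) ur ui => u ur ui; rewrite !ReImE ur ui re_toC im_toC; field.
rewrite im_toC /rotT !shear_tnth !eqxx ?lr_neq ?rl_neq (inj_eq (@rshift_inj _ _)).
case: eqP => [->|_]; last by rewrite im_toC.
by move: (urot s) ur ui => u ur ui; rewrite !ReImE ur ui re_toC im_toC; field.
Qed.

Lemma tn_rotT j s t : tn (rotT j s t) = tn t.
by rewrite -!nr_toC toC_rotT nr_rotv ?modC_urot. Qed.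
Lemma measurable_rotT j s : mfun (rotT j s).
apply: (measurableT_comp (@meas_shear _ _ _)); apply: (measurableT_comp (@meas_shear _ _ _)).
exact: meas_shear.
Qed.

Lemma emeas_rot j s (G : V -> \bar R) : emeas G -> emeas (fun w => G (rotv j (urot s) w)).
move/emeas_if => mG; apply/emeas_if.
have : mfun (fun t => (fun t : T => if (tn t < 1)%R then G (toC t) else 0%E) (rotT j s t)).
 by apply: (measurableT_comp mG); exact: measurable_rotT.
by apply: eq_measurable_fun => t _; rewrite tn_rotT toC_rotT.
Qed.

Lemma Ie_rot j s (G : V -> \bar R) : emeas G -> (forB w, (0 <= G w)%E) ->
 Ie (fun w => G (rotv j (urot s) w)) = Ie G.
move=> mG G0; have mH := (emeas_if _).1 mG.
pose H t : \bar R := if (tn t < 1)%R then G (toC t) else 0%E.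
have H0 t : (0 <= H t)%E by rewrite /H; case: ifP => // /ballTtn /G0.
rewrite !Ie_leb//; last 2 first.
- exact: emeas_rot.
- by move=> w; rewrite uballE => w1; apply: G0; rewrite uballE nr_rotv ?modC_urot.
congr (_ * _)%E; transitivity (\int[leb R (n + n)]_t H (rotT j s t))%E.
 by apply: eq_integral => t _; rewrite /H tn_rotT toC_rotT.
have lr : lshift n j != rshift n j :> 'I_(n + n) by rewrite lr_neq.
have rl : rshift n j != lshift n j :> 'I_(n + n) by rewrite rl_neq.
have m1 : mfun (fun t => H (shear (lshift n j) (rshift n j) (- s) t)).
 by apply: (measurableT_comp mH); exact: meas_shear.
have m2 : mfun (fun t => H (shear (lshift n j) (rshift n j) (- s)
  (shear (rshift n j) (lshift n j) (2 * s / (1 + s ^+ 2)) t))).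
 by apply: (measurableT_comp m1); exact: meas_shear.
by rewrite (int_shear (- s) lr m2 (fun=> H0 _)) (int_shear _ rl m1 (fun=> H0 _)) (int_shear _ lr mH H0).
Qed.

Lemma cmeasE g : cmeas g <-> emeas (fun w => (re (g w))%:E) /\ emeas (fun w => (im (g w))%:E).
by split => -[h1 h2]; split; exact/measurable_EFinP. Qed.
Lemma cmeas_rot j s g : cmeas g -> cmeas (fun w => g (rotv j (urot s) w)).
by move=> /cmeasE[h1 h2]; apply/cmeasE; split; exact: (emeas_rot j s h1) || exact: (emeas_rot j s h2). Qed.

Lemma cok_rot j s g : cok g -> cok (fun w => g (rotv j (urot s) w)).
move=> [mg fg]; split; first exact: cmeas_rot.
suff -> : Ie (fun w => (modC (g (rotv j (urot s) w)))%:E) = Ie (fun w => (modC (g w))%:E) by [].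
apply: (@Ie_rot j s (fun w => (modC (g w))%:E)); first exact: emeas_mod.
by move=> w _; rewrite lee_fin modC_ge0.
Qed.

Lemma Ie_rot_signed j s (f : V -> R) : emeas (fun w => (f w)%:E) ->
 Ie (fun w => (f (rotv j (urot s) w))%:E) = Ie (fun w => (f w)%:E).
move=> mf; rewrite /Ie [LHS]integralE [RHS]integralE.
have mp : emeas (fun w => (Num.max (f w) 0)%:E).
 have := measurable_funepos mf; apply: eq_measurable_fun => t _.
 by rewrite funeposE EFin_max.
have mn : emeas (fun w => (Num.max (- f w) 0)%:E).
 have := measurable_funeneg mf; apply: eq_measurable_fun => t _.
 by rewrite funenegE EFin_max EFinN.
have p0 (x : R) : (0 <= (Num.max x 0)%:E)%E by rewrite lee_fin le_max lexx orbT.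
have := @Ie_rot j s _ mp (fun w _ => p0 _); have := @Ie_rot j s _ mn (fun w _ => p0 _).
rewrite /Ie => E1 E2; congr (_ - _)%E.
 under eq_integral do rewrite funeposE -EFin_max.
 rewrite E2; apply: eq_integral => t _; by rewrite funeposE EFin_max.
under eq_integral do rewrite funenegE -EFinN -EFin_max.
rewrite E1; apply: eq_integral => t _; by rewrite funenegE EFin_max EFinN.
Qed.

Lemma cintB_rot j s g : cmeas g -> cintB (fun w => g (rotv j (urot s) w)) = cintB g.
move=> /cmeasE[h1 h2]; apply: cplxP; rewrite ?re_cintB ?im_cintB /Rintegral.
 by congr fine; exact: (Ie_rot_signed j s h1).
by congr fine; exact: (Ie_rot_signed j s h2).
Qed.

Lemma nr_rot_sub j s (w : V) : nr (rotv j (urot s) w - w) <= 2 * `|s| * nr w.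
have s1 : 0 < 1 + s ^+ 2 by have := sqr_ge0 s; lra.
apply: le_trans (nr_le_sum _) _; rewrite (bigD1 j) //= big1 => [|i ij]; last first.
 by rewrite !mxE (negbTE ij) subrr modC0.
rewrite addr0 !mxE eqxx -[X in _ - X]mul1r -mulrBl modCM.
apply: ler_pM; rewrite ?modC_coord//.
have -> : urot s - 1 = ii R * rc (2 * s) * (1 + ii R * rc s) / rc (1 + s ^+ 2).
 have [ur ui] := urotE s; rewrite -RtoCV; move: (urot s) ur ui => u ur ui; apply: cplxP.
  by rewrite !ReImE ur; field; rewrite gt_eqF.
 by rewrite !ReImE ui; field; rewrite gt_eqF.
rewrite !modCM modCV modCi modCR mul1r modCR (ger0_norm (ltW s1)) normrM (ger0_norm (_ : 0 <= 2))//.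
rewrite -mulrA ler_piMr// ler_pdivrMr// mul1r.
rewrite -(@ler_pXn2r _ 2) ?nnegrE// modC_sqr !ReImE.
by have := sqr_ge0 s; have := sqr_ge0 (s ^+ 2); nra.
Qed.

Lemma rotv0 j w : rotv j (urot 0) w = w.
apply/rowP => i; rewrite mxE; case: eqP => // _; rewrite /urot mulr0 addr0 expr1n.
by rewrite expr0n addr0 divr1 mul1r.
Qed.

(** By rotation invariance the difference quotients of [Th] along the rotation have integral 0
    against the radial weight; the Lipschitz condition bounds them by [2 L], and dominated
    convergence passes to the derivative. *)
Lemma rot_mean j (Th LT : V -> C) N L : 0 <= N -> (forB z, cont_at Th z) ->
 (forB z, cont_at LT z) -> 0 <= L ->
 (forall z w, uball z -> uball w -> modC (Th z - Th w) <= L * nr (z - w)) ->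
 (forB w, cder (fun s => Th (rotv j (urot s) w)) 0 (LT w)) ->
 cok (fun w => LT w * wtp N w) /\ cintB (fun w => LT w * wtp N w) = 0.
move=> N0 cT cL L0 lip dT.
have mT : cmeas Th by exact: cmeas_cont.
have mL : cmeas LT by exact: cmeas_cont.
have w1 (w : V) : uball w -> 0 <= weight w `^ N <= 1.
 by move=> wB; rewrite powR_ge0 weight_powR_le1.
pose s k : R := shr R k.
pose F k w := (Th (rotv j (urot (s k)) w) - Th w) / rc (s k) * wtp N w.
have rB k w : uball w -> uball (rotv j (urot (s k)) w) by rewrite !uballE nr_rotv ?modC_urot.
have okT : cok (fun w => Th w * wtp N w).
 have z0 : uball (0 : V) by rewrite uballE nr0.
 apply: (@cok_bnd _ _ _ (modC (Th 0) + L)); first by apply: cmeasM => //; exact: cmeas_pow.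
 move=> w wB; have /andP[p0 p1] := w1 w wB.
 rewrite modCM modCR (ger0_norm p0) -[leRHS]mulr1; apply: ler_pM; rewrite//.
 rewrite -[Th w](subrK (Th 0)); apply: le_trans (modCD _ _) _; rewrite addrC lerD2l.
 apply: le_trans (lip _ _ wB z0) _; rewrite subr0 -[leRHS]mulr1 ler_wpM2l//.
 exact: uball_le.
have FE k w : F k w = (rc (s k))^-1 * ((fun w => Th w * wtp N w) (rotv j (urot (s k)) w) - Th w * wtp N w).
 by rewrite /F /= /weight -!nr_sqr nr_rotv ?modC_urot// -mulrBl mulrAC mulrC.
have okF k : cok (F k).
 apply: cok_ext (cokZ (rc (s k))^-1 (cokB (cok_rot j (s k) okT) okT)) => w _.
 by rewrite FE.
have F0 k : cintB (F k) = 0.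
 rewrite (cintB_eq (fun w _ => FE k w)) cintBZ; last exact: cokB (cok_rot j (s k) okT) okT.
 rewrite (cintBB (cok_rot j (s k) okT) okT).
 by rewrite (cintB_rot j (s k) okT.1) subrr mulr0.
have Fbd k w : uball w -> modC (F k w) <= 2 * L.
 move=> wB; have /andP[p0 p1] := w1 w wB; have sk := shr_gt0 R k.
 rewrite /F modCM modCR (ger0_norm p0) -[leRHS]mulr1; apply: ler_pM; rewrite//.
 rewrite modCM modCV modCR gtr0_norm// ler_pdivrMr//.
 apply: le_trans (lip _ _ (rB k _ wB) wB) _; rewrite mulrAC [2 * _]mulrC -mulrA.
 have h := nr_rot_sub j (s k) w; rewrite gtr0_norm// in h.
 have h2 := uball_le wB.
 have h3 : nr (rotv j (urot (s k)) w - w) <= 2 * s k.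
  by apply: le_trans h _; rewrite ler_piMr// mulr_ge0// ltW.
 by rewrite mulrA [_ * L]mulrC [s k * 2]mulrC; apply: ler_wpM2l.
have mLN : cmeas (fun w => LT w * wtp N w) by apply: cmeasM => //; exact: cmeas_pow.
have cv w : uball w -> forall e : R, 0 < e -> exists K, forall k, (K <= k)%N ->
  modC (F k w - LT w * wtp N w) < e.
 move=> wB e e0; have e2 : 0 < e / 2 by rewrite divr_gt0.
 have [d d0 hd] := dT w wB _ e2; have [K hK] := shr_small d0.
 exists K => k /hK sd; have sk := shr_gt0 R k; have /andP[p0 p1] := w1 w wB.
 have := hd (s k); rewrite gtr0_norm// => /(_ sd).
 rewrite add0r rotv0 => h; rewrite /F -mulrBl modCM modCR (ger0_norm p0).
 have skC : rc (s k) != 0 :> C by rewrite rc_neq0 ?gt_eqF.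
 rewrite (_ : _ / _ - _ = (Th (rotv j (urot (s k)) w) - Th w - rc (s k) * LT w) / rc (s k)).
  rewrite modCM modCV modCR (gtr0_norm sk).
  have : modC (Th (rotv j (urot (s k)) w) - Th w - rc (s k) * LT w) / s k <= e / 2.
   by rewrite ler_pdivrMr.
  move=> h2; apply: (@le_lt_trans _ _ (e / 2)); last by lra.
  rewrite -[leRHS]mulr1; apply: ler_pM => //; apply: divr_ge0; rewrite ?modC_ge0//; exact: ltW.
 by rewrite [RHS]mulrBl [rc _ * _ / _]mulrAC divff// mul1r.
have okL : cok (fun w => LT w * wtp N w).
 apply: (@cok_bnd _ _ _ (2 * L)) => // w wB.
 rewrite leNgt; apply/negP => h.
 have e0 : 0 < modC (LT w * wtp N w) - 2 * L by rewrite subr_gt0.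
 have [K /(_ K (leqnn _)) hK] := cv w wB _ e0.
 have := modCBr (LT w * wtp N w) (F K w); rewrite modC_distC => h1.
 by have := Fbd K w wB => ?; lra.
split=> //; apply/eqP; rewrite -modC_eq0; apply/eqP/le_anti.
rewrite modC_ge0 andbT; apply/ler_addgt0Pr => e e0; rewrite add0r.
have [K /(_ K (leqnn _))] := @cintB_dct _ _ F (fun w => LT w * wtp N w) (fun=> (2 * L)%:E)
  (fun k => (okF k).1) okL.1 (emeas_cst _) (le_lt_trans (Ie_cst _ (mulr_ge0 (ler0n _ 2) L0)) (ltry _))
  (fun w _ => mulr_ge0 (ler0n _ 2) L0 : (0 <= (2 * L)%:E)%E) (fun k w h => Fbd k w h) cv e e0.
by rewrite F0 sub0r modCN => /ltW.
Qed.

Lemma cball_compact : compact [set z : V | nr z <= 1].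
pose seg : set R := `[(-1)%R, 1%R]%classic.
pose sq : set C := (fun p : R * R => mkC p.1 p.2) @` (seg `*` seg).
have csq : compact sq.
 apply: continuous_compact; last by apply: compact_setX; exact: segment_compact.
 apply: continuous_subspaceT => -[x y] A /nbhs_CP[e e0 h].
 have e2 : 0 < e / 2 by rewrite divr_gt0.
 exists (ball x (e / 2), ball y (e / 2)); first by split; exact: nbhsx_ballx.
 move=> [u v] /= [h1 h2]; apply: h; apply: le_lt_trans (modC_le_ri _) _.
 rewrite !ReImE /= distrC; rewrite /ball /= distrC in h1; rewrite /ball /= in h2.
 by rewrite [`|v - y|]distrC [`|x - u|]distrC [e]splitr ltrD.
apply: (@subclosed_compact _ _ [set v : V | forall i, sq (v ord0 i)]); last 2 first.
- exact: (@rV_compact _ _ (fun=> sq)).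
- move=> z /= z1 i; exists (re (z 0 i), im (z 0 i)) => /=; last by case: (z 0 i).
 have h := le_trans (modC_coord z i) z1.
 by split; rewrite /seg /= in_itv /= -ler_norml; [apply: le_trans (ler_Re_modC _) h|apply: le_trans (ler_Im_modC _) h].
- move=> z cz /=; rewrite leNgt; apply/negP => z1.
 have : nbhs z [set w : V | nr (w - z) < nr z - 1].
  by apply/nbhs_nrP; exists (nr z - 1) => //; rewrite subr_gt0.
 by move=> /cz [w [/= w1 w2]]; have := nrBr z w; rewrite nr_distC; lra.
Qed.

Lemma compact_rbnd (S : set V) (p : V -> R) : compact S ->
 (forall z, S z -> forall e : R, 0 < e -> exists2 d : R, 0 < d &
   forall w, S w -> nr (w - z) < d -> `|p w - p z| < e) ->
 exists M : R, forall z, S z -> p z <= M.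
move=> cS cp; have : compact (p @` S).
 apply: continuous_compact cS; apply/subspace_continuousP => z Sz.
 apply/cvgrPdist_lt => e e0; have [d d0 hd] := cp z Sz e e0.
 by apply/nbhs_nrP; exists d => // w wz Sw; rewrite distrC; exact: hd.
move=> /compact_bounded [M [_ hM]]; exists (M + 1) => z Sz.
apply: le_trans (ler_norm _) _; apply: (hM (M + 1)); first by rewrite ltrDl.
by exists z.
Qed.

Lemma cball_bnd (g : V -> C) : (forall z, nr z <= 1 -> cont_at g z) ->
 exists M : R, forall z, nr z <= 1 -> modC (g z) <= M.
move=> cg; apply: (compact_rbnd cball_compact) => z z1 e e0.
have [d d0 hd] := (contP g z).1 (cg z z1) e e0; exists d => // w _ /hd; apply: le_lt_trans.
have h1 := modCBr (g w) (g z); have h2 := modCBr (g z) (g w).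
by rewrite modC_distC in h2; rewrite ler_norml; apply/andP; split; lra.
Qed.

Implicit Types (Th phi : V -> C) (z v w : V).

Definition bigb (r : R) : set V := [set z : V | nr z < r].
Lemma openU_bigb r : openU (bigb r).
move=> z zr; exists (r - nr z); first by rewrite subr_gt0.
by move=> w; rewrite /bigb /= => h; have := nrBr w z; lra.
Qed.
(** With [Rb], the holomorphic and antiholomorphic halves of the radial derivative. *)
Definition Rz phi z : C := \sum_j z 0 j * dz j phi z.
Definition Rb phi z : C := \sum_j cj (z 0 j) * dbar j phi z.
Lemma Dlin_Rz phi z : Dlin phi z z = Rz phi z + Rb phi z.
by rewrite /Dlin big_split. Qed.
Lemma Ck_Rz k U phi : openU U -> Ck k.+1 U phi -> Ck k U (Rz phi).
move=> oU h; apply: Ck_sum => // j; apply: Ck_mul => //; first exact: Ck_coord.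
exact: Ck_dz.
Qed.
Lemma Ck_Rb k U phi : openU U -> Ck k.+1 U phi -> Ck k U (Rb phi).
move=> oU h; apply: Ck_sum => // j; apply: Ck_mul => //; last exact: Ck_dbar.
by apply: Ck_cj => //; exact: Ck_coord.
Qed.

Lemma dir_dil (s : R) phi z v : dir_derivable v phi (rc s *: z) ->
 dir_derivable v (fun w => phi (rc s *: w)) z /\
 dir_deriv v (fun w => phi (rc s *: w)) z = rc s * dir_deriv v phi (rc s *: z).
move=> h; apply/dirP.
have h2 := (dirP phi v (rc s *: z) (dir_deriv v phi (rc s *: z))).2 (conj h erefl).
have := @cder_comp R (fun x => phi (rc s *: z + rc x *: v)) (fun x => s * x) 0 (dir_deriv v phi (rc s *: z)) s.
rewrite mulr0 => H; have {H} := H ^~ h2.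
have hs : rder (fun x : R => s * x) 0 s by apply: rder_eq (rderZ s (rder_id 0)) _; rewrite mulr1.
by move=> /(_ hs) h3; apply: eq_cder h3 _ => x; rewrite scalerDr scalerA -RtoCM.
Qed.

Lemma cont_dil (s : R) phi z : cont_at phi (rc s *: z) -> cont_at (fun w => phi (rc s *: w)) z.
move=> /contP h; apply/contP => e e0; have [d d0 hd] := h e e0.
have s1 : 0 < `|s| + 1 by rewrite ltr_pwDr.
exists (d / (`|s| + 1)) => [|w]; first by rewrite divr_gt0.
rewrite ltr_pdivlMr// => hw; apply: hd; rewrite -scalerBr nrZR; apply: le_lt_trans hw.
by rewrite mulrC ler_wpM2l ?nr_ge0// lerDl.
Qed.

Lemma Ck_dil k (s r : R) phi : 0 < s -> Ck k (bigb r) phi -> Ck k (bigb (r / s)) (fun w => phi (rc s *: w)).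
move=> s0; have sub z : bigb (r / s) z -> bigb r (rc s *: z).
 by rewrite /bigb /= nrZR (gtr0_norm s0) ltr_pdivlMr// mulrC.
elim: k phi => [|k ih] phi h.
 by split => // z /sub zU; apply: cont_dil; exact: Ck_cont h _ zU.
apply: CkS_intro => [z /sub zU|v cv]; first by apply: cont_dil; exact: Ck_cont h _ zU.
split=> [z /sub zU|]; first by have [] := dir_dil (Ck_der h cv zU).
apply: (@Ck_ext _ _ k _ (fun w => rc s * dir_deriv v phi (rc s *: w))).
- exact: openU_bigb.
- by move=> w /sub wU; have [_ ->] := dir_dil (Ck_der h cv wU).
- by apply: Ck_scale; [exact: openU_bigb|apply: ih; exact: Ck_dir].
Qed.

Lemma uball_bigb : @uball R n = bigb 1.
by apply/funext => z; rewrite uballE. Qed.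
(** Class C^k across the sphere. Dilates [g (s .)] with [s < 1] have it, and it makes every boundary
    value and bound on the closed ball available. *)
Definition smb k Th := exists2 r : R, 1 < r & Ck k (bigb r) Th.

Lemma Ck_sub k (U W : set V) phi : (forall z, W z -> U z) -> Ck k U phi -> Ck k W phi.
move=> WU; elim: k phi => [|k ih] phi h; first by split => // z /WU; exact: Ck_cont h _.
apply: CkS_intro => [z /WU zU|v cv]; first exact: Ck_cont h _ zU.
by split=> [z /WU zU|]; [exact: Ck_der h cv zU|apply: ih; exact: Ck_dir].
Qed.

Lemma smbM k f g : smb k f -> smb k g -> smb k (fun w => f w * g w).
move=> [r1 r11 h1] [r2 r21 h2]; exists (Num.min r1 r2); first by rewrite lt_min r11.
apply: Ck_mul; first exact: openU_bigb.
- by apply: Ck_sub h1 => z; rewrite /bigb /= lt_min => /andP[].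
- by apply: Ck_sub h2 => z; rewrite /bigb /= lt_min => /andP[].
Qed.

Lemma smb_dil k (s : R) phi : 0 < s < 1 -> Ck k (@uball R n) phi -> smb k (fun w => phi (rc s *: w)).
move=> /andP[s0 s1]; rewrite uball_bigb => h; exists (1 / s); last exact: Ck_dil.
by rewrite ltr_pdivlMr// mul1r.
Qed.

Lemma ball_shrink z : uball z -> exists2 s : R, 0 < s < 1 & nr (rc s^-1 *: z) <= 1.
rewrite uballE => z1; exists ((1 + nr z) / 2); have := nr_ge0 z; first lra.
move=> z0; rewrite nrZR ger0_norm ?invr_ge0 => [|]; last lra.
by rewrite mulrC ler_pdivrMr; lra.
Qed.

(** With [|z| / s <= 1] and [s < 1], the kernel at [(w, z)] is the kernel at [(s w, z / s)], a
    dilate of a smooth function on the open ball. *)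
Lemma smb_ker k a z : 0 <= a -> uball z -> smb k (fun w => ker a w z).
move=> a0 /ball_shrink[s s01 h]; have := smb_dil s01 (@Ck_kerl _ _ k a _ a0 h).
rewrite (_ : (fun w => _) = (fun w => ker a w z))//; apply/funext => w; have /andP[s0 _] := s01.
by rewrite /ker hermZl hermZr /rc conjCR mulrA -RtoCM divff ?gt_eqF// mul1r.
Qed.

Lemma smb_cont k Th : smb k Th -> forall z, nr z <= 1 -> cont_at Th z.
by move=> [r r1 h] z z1; apply: (Ck_cont h); exact: le_lt_trans r1. Qed.
Lemma smb_bnd k Th : smb k Th -> exists M : R, forall z, nr z <= 1 -> modC (Th z) <= M.
by move=> /smb_cont; exact: cball_bnd. Qed.

Lemma smb_Rz k Th : smb k.+1 Th -> smb k (Rz Th).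
by move=> [r r1 h]; exists r => //; apply: Ck_Rz => //; exact: openU_bigb. Qed.
Lemma smb_Rb k Th : smb k.+1 Th -> smb k (Rb Th).
by move=> [r r1 h]; exists r => //; apply: Ck_Rb => //; exact: openU_bigb. Qed.
Lemma smb_dz k Th j : smb k.+1 Th -> smb k (dz j Th).
by move=> [r r1 h]; exists r => //; apply: Ck_dz => //; exact: openU_bigb. Qed.
Lemma smb_dbar k Th j : smb k.+1 Th -> smb k (dbar j Th).
by move=> [r r1 h]; exists r => //; apply: Ck_dbar => //; exact: openU_bigb. Qed.

Lemma cder_line1 U phi z v (t : R) : openU U -> Ck 1 U phi -> U (z + rc t *: v) ->
 cder (fun s => phi (z + rc s *: v)) t (Dlin phi (z + rc t *: v) v).
by move=> oU h zU; have [h1 h2] := dir_Dlin v oU h zU; exact: dir_line h1 h2. Qed.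

Lemma convex_nr z w (t r : R) : 0 <= t <= 1 -> nr z <= r -> nr w <= r -> nr (z + rc t *: (w - z)) <= r.
move=> /andP[t0 t1] zr wr.
rewrite (_ : _ + _ = rc (1 - t) *: z + rc t *: w); last first.
 by rewrite RtoCB scalerBl scale1r scalerBr -addrA [- _ + _]addrC.
apply: le_trans (nrD _ _) _; rewrite !nrZR !ger0_norm//; last by lra.
by move: (nr z) (nr w) zr wr => a b; nra.
Qed.

Lemma smb_lip Th : smb 1 Th -> exists2 L : R, 0 <= L &
 forall z w, nr z <= 1 -> nr w <= 1 -> modC (Th z - Th w) <= L * nr (z - w).
move=> h; have [r r1 hr] := h.
have hj j : exists M : R, forall z, nr z <= 1 -> modC (dz j Th z) + modC (dbar j Th z) <= M.
 have [M1 h1] := smb_bnd (smb_dz j h); have [M2 h2] := smb_bnd (smb_dbar j h).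
 by exists (M1 + M2) => z z1; apply: lerD; [exact: h1|exact: h2].
have [M hM] := choice hj.
exists (2 * \sum_j M j).
 rewrite mulr_ge0// sumr_ge0// => j _.
 by have := hM j 0; rewrite nr0 => /(_ ler01); apply: le_trans; rewrite addr_ge0 ?modC_ge0.
move=> z w z1 w1.
have := @cder_lip R (fun s => Th (w + rc s *: (z - w))) (fun s => Dlin Th (w + rc s *: (z - w)) (z - w))
 ((\sum_j M j) * nr (z - w)) 0 1 ler01.
rewrite (_ : w + rc 1 *: (z - w) = z); last by rewrite scale1r addrC subrK.
rewrite (_ : w + rc 0 *: (z - w) = w); last by rewrite scale0r addr0.
rewrite subr0 mulr1 mulrA; apply.
- move=> t t01; apply: cder_line1 hr _; first exact: openU_bigb.
 exact: le_lt_trans (convex_nr t01 w1 z1) r1.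
- move=> t t01; apply: le_trans (modC_Dlin _ _ _) _; rewrite ler_wpM2r ?nr_ge0//.
 by apply: ler_sum => j _; apply: hM; exact: convex_nr.
Qed.

Lemma vder_rot j (w : V) : vder (fun s => rotv j (urot s) w) 0 (\row_i (if i == j then 2 * ii R * w 0 i else 0)).
move=> i; rewrite mxE; case: (eqVneq i j) => [->|ij]; last first.
 by apply: eq_cder (cder_cst (w 0 i) 0) _ => s; rewrite mxE (negbTE ij).
have h1 : rder (fun s : R => 1 + s ^+ 2) 0 0.
 by apply: rder_ext (rderD (rder_cst 1 0) (rder_exp 1 0)) _ _ => //; rewrite expr1 mulr0 addr0.
have h2 : cder (fun s => 1 + ii R * rc s) 0 (ii R).
 by have := cderD (cder_cst 1 0) (cderZ (ii R) (cder_rc (rder_id 0))); rewrite mulr1 add0r.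
have h3 : cder (fun s : R => (rc (1 + s ^+ 2))^-1) 0 0.
 have k : 1 + 0 ^+ 2 != 0 :> R by rewrite expr0n addr0 oner_neq0.
 have := cder_rc (rder_comp h1 (rder_inv k)); rewrite ?mulr0 ?mul0r => h.
 by apply: eq_cder h _ => s; rewrite RtoCV.
have h4 := cderM (cderM h2 h2) h3.
have := cderZ (w 0 j) h4; rewrite !mulr0 !addr0.
have -> : w 0 j * ((ii R * 1 + 1 * ii R) / rc (1 + 0 ^+ 2)) = 2 * ii R * w 0 j.
 by rewrite expr0n addr0 divr1; ring.
by move=> h5; apply: eq_cder h5 _ => s; rewrite mxE eqxx /urot expr2 mulrC.
Qed.

(** Sum over the coordinates [j] of the mean value property [rot_mean]: rotating one coordinate
    differentiates along [2 i (w_j d_j - conj(w_j) dbar_j)]. *)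
Lemma IBP_balance Th N : 0 <= N -> smb 1 Th ->
 cok (fun w => (Rz Th w - Rb Th w) * wtp N w) /\
 cintB (fun w => (Rz Th w - Rb Th w) * wtp N w) = 0.
move=> N0 h; have [r r1 hr] := h; have [L L0 hL] := smb_lip h.
(* The derivative along the rotation of coordinate [j]; [urot] has speed [2 i] at 0. *)
pose LT j w : C := 2 * ii R * (w 0 j * dz j Th w - cj (w 0 j) * dbar j Th w).
have sub := @uball_le R n.
have cd j z : nr z <= 1 -> cont_at (dz j Th) z by exact: (smb_cont (smb_dz j h)).
have cdb j z : nr z <= 1 -> cont_at (dbar j Th) z by exact: (smb_cont (smb_dbar j h)).
have cc j z : cont_at (fun w : V => w 0 j) z.
 by apply: (@Ck_cont _ _ 0 setT) => //; exact: Ck_coord.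
have hj j : cok (fun w => LT j w * wtp N w) /\ cintB (fun w => LT j w * wtp N w) = 0.
 apply: (@rot_mean j Th (LT j) N L N0 _ _ L0).
 - by move=> z /sub; exact: (smb_cont h).
 - move=> z /sub z1; apply: cont_mul; first exact: cst_continuous.
  apply: (@cont_add _ _ _ (fun w => - (cj (w 0 j) * dbar j Th w))); first by apply: cont_mul => //; exact: cd.
  have : cont_at (fun w => (-1) * (cj (w 0 j) * dbar j Th w)) z.
   apply: cont_mul; first exact: cst_continuous.
   by apply: cont_mul; [exact: cont_cj|exact: cdb].
  by rewrite (_ : (fun w => _) = (fun w => - (cj (w 0 j) * dbar j Th w)))//; apply/funext => w; rewrite mulN1r.
 - by move=> z w /sub z1 /sub w1; exact: hL.
 - move=> w /sub w1.
  have := chain (@openU_bigb r) hr _ (vder_rot j w); rewrite rotv0.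
  move=> /(_ (le_lt_trans w1 r1)); rewrite (_ : Dlin _ _ _ = LT j w)//.
  rewrite /Dlin (bigD1 j) //= big1 ?addr0 => [|i ij]; last by rewrite mxE (negbTE ij) conjC0 !mul0r addr0.
  rewrite mxE eqxx /LT; have -> : cj (2 * ii R * w 0 j) = - (2 * ii R * cj (w 0 j)) by apply: cplxP; rewrite !ReImE; ring.
  by ring.
have [h1 h2] := cintB_sum (enum 'I_n) (fun j => (hj j).1).
have E w : (2 * ii R)^-1 * (\sum_(j <- enum 'I_n) LT j w * wtp N w) = (Rz Th w - Rb Th w) * wtp N w.
 rewrite -mulr_suml mulrA; congr (_ * _); rewrite /LT -mulr_sumr mulKf.
  by rewrite /Rz /Rb -sumrB big_enum.
 by rewrite mulf_neq0// -modC_eq0 modCi oner_neq0.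
split; first by apply: cok_ext (cokZ (2 * ii R)^-1 h1) => w _; rewrite E.
rewrite -(cintB_eq (fun w _ => E w)) cintBZ// h2 big1 ?mulr0// => j _; exact: (hj j).2.
Qed.

(** The radial derivative is [Rz + Rb], and both halves have the same weighted integral by
    [IBP_balance]; their sum may be replaced by twice either one. *)
Lemma IBP_RzRb Th N : (0 < n)%N -> 0 <= N -> smb 1 Th ->
 [/\ 0 < N -> cok (fun w => Th w * wtp (N - 1) w),
  cok (fun w => (rc (n%:R + N) * Th w + Rz Th w) * wtp N w),
  cok (fun w => (rc (n%:R + N) * Th w + Rb Th w) * wtp N w),
  ENc N Th = 2 * cintB (fun w => (rc (n%:R + N) * Th w + Rz Th w) * wtp N w) &
  ENc N Th = 2 * cintB (fun w => (rc (n%:R + N) * Th w + Rb Th w) * wtp N w)].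
move=> n0 N0 h; have [r r1 hr] := h.
have [M1 hM1] := smb_bnd h; have [M2 hM2] := smb_bnd (smb_Rz h); have [M3 hM3] := smb_bnd (smb_Rb h).
pose M := Num.max M1 (M2 + M3).
have := @ibp_cplx Th (fun w => Rz Th w + Rb Th w) N M n0 N0.
case.
- exact: smb_cont h.
- by move=> z z1; apply: cont_add; [exact: (smb_cont (smb_Rz h))|exact: (smb_cont (smb_Rb h))].
- by move=> z /hM1 h1; rewrite le_max h1.
- move=> z z1; rewrite le_max; apply/orP; right.
 by apply: le_trans (modCD _ _) _; apply: lerD; [exact: hM2|exact: hM3].
- move=> w x w1 /andP[x0 x1]; have xU : bigb r (0 + rc x *: w).
  by rewrite add0r /bigb /= nrZR w1 mulr1 gtr0_norm// (lt_trans x1).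
 have := cder_line1 (@openU_bigb r) hr xU; rewrite add0r.
 have -> : Dlin Th (rc x *: w) w = (Rz Th (rc x *: w) + Rb Th (rc x *: w)) / rc x.
  rewrite -Dlin_Rz DlinZ mulrAC divff ?mul1r//.
  by rewrite rc_neq0 ?gt_eqF.
 by move=> h5; apply: eq_cder h5 _ => s; rewrite add0r.
move=> A1 A2 A3; have [B1 B2] := IBP_balance N0 h.
have half : 2 * 2^-1 = 1 :> C by rewrite divff.
have E1 w : 2^-1 * ((rc (2 * (n%:R + N)) * Th w + (Rz Th w + Rb Th w)) * wtp N w) +
  2^-1 * ((Rz Th w - Rb Th w) * wtp N w) = (rc (n%:R + N) * Th w + Rz Th w) * wtp N w.
 rewrite RtoCM (_ : rc 2 = 2 :> C); last exact: RtoC_nat.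
 by move: (Rz _ _) (Rb _ _) (rc (_ `^ _)) (Th w) (rc _) => a b c d e; field.
have E2 w : 2^-1 * ((rc (2 * (n%:R + N)) * Th w + (Rz Th w + Rb Th w)) * wtp N w) +
  - 2^-1 * ((Rz Th w - Rb Th w) * wtp N w) = (rc (n%:R + N) * Th w + Rb Th w) * wtp N w.
 rewrite RtoCM (_ : rc 2 = 2 :> C); last exact: RtoC_nat.
 by move: (Rz _ _) (Rb _ _) (rc (_ `^ _)) (Th w) (rc _) => a b c d e; field.
split => //.
- by apply: cok_ext (cokD (cokZ _ A2) (cokZ _ B1)) => w _; exact: E1.
- by apply: cok_ext (cokD (cokZ _ A2) (cokZ _ B1)) => w _; exact: E2.
- rewrite -(cintB_eq (fun w _ => E1 w)) (cintBD (cokZ _ A2) (cokZ _ B1)) (cintBZ _ A2) (cintBZ _ B1).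
 by rewrite B2 mulr0 addr0 mulrA half mul1r.
- rewrite -(cintB_eq (fun w _ => E2 w)) (cintBD (cokZ _ A2) (cokZ _ B1)) (cintBZ _ A2) (cintBZ _ B1).
 by rewrite B2 mulr0 addr0 mulrA half mul1r.
Qed.

Implicit Types psi : V -> C.

Lemma kerS a w z : nr w * nr z < 1 -> ker a w z = ker (a + 1) w z * (1 - herm w z).
move=> h; have h1 := Re_herm_lt h; rewrite /ker -[X in _ = _ * X]cpow1// -cpowD//.
by congr (cpow _ _); ring.
Qed.

Lemma Rz_mul U f g z : U z -> Ck 1 U f -> Ck 1 U g ->
 Rz (fun w => f w * g w) z = Rz f z * g z + f z * Rz g z.
move=> zU hf hg; rewrite /Rz mulr_suml mulr_sumr -big_split; apply: eq_bigr => j _ /=.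
by rewrite (dz_mul j zU hf hg); ring.
Qed.

Lemma Rb_mul U f g z : U z -> Ck 1 U f -> Ck 1 U g ->
 Rb (fun w => f w * g w) z = Rb f z * g z + f z * Rb g z.
move=> zU hf hg; rewrite /Rb mulr_suml mulr_sumr -big_split; apply: eq_bigr => j _ /=.
by rewrite (dbar_mul j zU hf hg); ring.
Qed.

Lemma Rz_kerl a w z : nr w * nr z < 1 -> Rz (fun w => ker a w z) w = 0.
by move=> h; rewrite /Rz big1// => j _; have [-> _] := ker_dzl a j h; rewrite mulr0. Qed.
Lemma Rb_kerl a w z : nr w * nr z < 1 ->
 Rb (fun w => ker a w z) w = rc a * herm w z * ker (a + 1) w z.
move=> h; rewrite /Rb hermE mulr_sumr mulr_suml; apply: eq_bigr => j _.
by have [_ ->] := ker_dzl a j h; ring.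
Qed.
Lemma Rz_kerr a w z : nr w * nr z < 1 ->
 Rz (fun z => ker a w z) z = rc a * herm w z * ker (a + 1) w z.
move=> h; rewrite /Rz hermE mulr_sumr mulr_suml; apply: eq_bigr => j _.
by have [-> _] := ker_dzr a j h; ring.
Qed.
Lemma mul_nr_lt w z : nr w <= 1 -> uball z -> nr w * nr z < 1.
by rewrite uballE => w1 z1; apply: le_lt_trans z1; rewrite ler_piMl ?nr_ge0. Qed.

Lemma distB_gt0 w z : uball w -> uball z -> 0 < dist w z.
by rewrite !uballE => /ltW; exact: dist_gt0. Qed.

Lemma ENcE (N : R) Th : 0 < N ->
 ENc N Th = rc (2 * N) * cintB (fun w : V => Th w * wtp (N - 1) w).
by move=> h; rewrite /ENc (gt_eqF h). Qed.
(** The effect on a function of one integration by parts with the field [Rz], up to a constant. *)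
Definition Xop a g z : C := g z + rc a^-1 * Rz g z.

Lemma cballE : @cball R n = [set z | nr z <= 1].
apply/funext => z; rewrite /cball /=; congr is_true; rewrite -nr_sqr.
by rewrite -[X in _ <= X](expr1n _ 2) ler_pXn2r// ?nnegrE ?nr_ge0// expr1n.
Qed.

Lemma smb_C1cball psi : smb 1 psi -> C1_cball psi.
move=> h; have [r r1 hr] := h.
have w S g : (forall z, S z -> cont_at g z) -> {within S, continuous g}.
 move=> cg; apply/within_contP => z Sz e e0; have [d d0 hd] := (contP g z).1 (cg z Sz) e e0.
 by exists d => // u _; exact: hd.
split.
- by apply: Ck_sub hr => z; rewrite uballE => z1; exact: lt_trans r1.
- by apply: w => z; rewrite cballE => /(smb_cont h).
- move=> j v hv; exists (dir_deriv v psi) => //.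
 apply: w => z; rewrite cballE => z1.
 have cv : crd v by exists j.
 by apply: (Ck_cont (Ck_dir hr cv)); exact: le_lt_trans r1.
Qed.

End IBP.

Opaque cintB.
Lemma powR_split (R : realType) (x e p q : R) : 0 < x -> e = p + q -> x `^ e = x `^ p * x `^ q.
by move=> x0 ->; rewrite powRD ?(gt_eqF x0) ?implybT. Qed.

Lemma two_powR_lt1 (R : realType) (t : R) : t < 0 -> 2 `^ t < 1.
have l2 : 0 < ln (2 : R) by rewrite ln_gt0 ?ltr1n.
by move=> t0; rewrite /powR pnatr_eq0 /= expR_lt1 nmulr_rlt0.
Qed.
Lemma two_powR_gt1 (R : realType) (t : R) : 0 < t -> 1 < 2 `^ t.
have l2 : 0 < ln (2 : R) by rewrite ln_gt0 ?ltr1n.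
by move=> t0; rewrite /powR pnatr_eq0 /= expR_gt1 mulr_gt0.
Qed.
Lemma le_eqs (R : realType) (x y x' y' : R) : x <= y -> x' = x -> y = y' -> x' <= y'.
by move=> h -> <-. Qed.

Lemma mul3_le (R : realType) (f P W M V : R) : 0 <= f -> 0 <= P -> P <= M -> 0 <= W -> W <= V ->
 f * P * W <= M * (f * V).
move=> f0 P0 PM W0 WV; rewrite [leRHS](_ : _ = f * M * V); last by ring.
by apply: ler_pM => //; exact: ler_wpM2l.
Qed.

Lemma mul4_le (R : realType) (f P W M U V : R) : 0 <= f -> 0 <= M -> P <= M * U -> 0 <= W -> U * W <= V ->
 f * P * W <= M * (f * V).
move=> f0 M0 PM W0 UW; apply: (@le_trans _ _ (f * (M * U) * W)).
 by rewrite ler_wpM2r// ler_wpM2l.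
by apply: (le_eqs (ler_wpM2l (mulr_ge0 M0 f0) UW)); ring.
Qed.

Section Charpentier.
Variables (R : realType) (n : nat) (N : R).
Local Notation C := (cplx R).
Local Notation V := (Cn R n).
Local Notation UB := (@uball R n).
Local Notation T := ((n + n).-tuple (measurableTypeR R)).
Local Notation mR := (measurableTypeR R).
Local Notation B := (@ballT R n).
Local Notation "'const' D , P" := (exists2 D : R, 0 <= D & P) (at level 200, D name, P at level 200).
Local Notation dN := (n%:R + N).
Variable K : V -> V -> V.
Hypothesis n0 : (0 < n)%N.
Hypothesis N0 : 0 <= N.
Hypothesis HK : charpentier_kernel N K.
Let nN0 : 0 <= dN.
by rewrite addr_ge0. Qed.
Let oUB := @openU_uball R n.

(** * The operator [P^N] after integration by parts *)

Section Repr.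
Implicit Types (psi f g : V -> C) (z w : V).

Let nN : 0 < dN.
by apply: ltr_wpDr => //; rewrite ltr0n. Qed.
(** Normalization of [P^N] relative to [ENc], for which the cases [N = 0] and [N > 0] become one. *)
Definition pconst : R := if N == 0 then (2 * n%:R)^-1
 else Gamma dN / (n`!%:R * Gamma N) / (2 * N).

Lemma Pop_EN psi z : smb 1 psi -> uball z ->
 Pop N psi z = rc pconst * ENc N (fun w => psi w * ker dN w z).
move=> h zB; rewrite /Pop /ENc /pconst; case: eqP => NE.
 rewrite mulrA -RtoCM mulVf ?mul1r ?mulf_neq0 ?pnatr_eq0 -?lt0n//.
 apply: cintB_eq => w _; rewrite NE addr0 ker_nat//.
 exact: mul_nr_lt (nr_sphproj_le _) zB.
have Np : 0 < N by rewrite lt_def; apply/andP; split => //; exact/eqP.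
have [/(_ Np) ok _ _ _ _] := IBP_RzRb n0 N0 (smbM h (@smb_ker _ _ 1 dN z (ltW nN) zB)).
rewrite mulrA -RtoCM divfK ?mulf_neq0//; last exact/eqP.
rewrite -cintBZ//; apply: cintB_eq => w wB.
rewrite kerV; last exact: mul_nr_lt (uball_le wB) zB.
by rewrite /nuN_density RtoCM; ring.
Qed.

(** Constant in front of the integral after [j.+1] integrations by parts: each of them multiplies by
    a ratio of the dimensionally shifted exponent to the weight exponent. *)
Definition kap (j : nat) : R :=
 iteri j (fun i x => x * (dN + i.+1%:R) / (N + i.+1%:R)) (2 * pconst * dN).
Lemma kapS j : kap j.+1 = kap j * (dN + j.+1%:R) / (N + j.+1%:R).
by []. Qed.

Lemma smb2 k f g w : smb k f -> smb k g -> uball w -> exists2 U : set V, U w & Ck k U f /\ Ck k U g.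
move=> [r r1 hr] [s s1 hs] /uball_le wB; exists (bigb r `&` bigb s).
 by split; apply: le_lt_trans wB _.
by split; [apply: Ck_sub hr => u []|apply: Ck_sub hs => u []].
Qed.

(** [Rb] of the kernel is [dN <w,z>] times the next kernel, and [ker dN = ker (dN + 1) (1 - <w,z>)].
    So the terms with [psi] undifferentiated add up to [dN psi ker (dN + 1)]. *)
Lemma Pop_Rb psi z : smb 1 psi -> uball z ->
 [/\ cok (fun w => psi w * ker (dN + 1) w z * wtp N w),
  cok (fun w => Rb psi w * ker dN w z * wtp N w) &
  Pop N psi z = rc (kap 0) * (cintB (fun w => psi w * ker (dN + 1) w z * wtp N w) +
   rc dN^-1 * cintB (fun w => Rb psi w * ker dN w z * wtp N w))].
move=> h zB; have sK := @smb_ker _ _ 1 dN z (ltW nN) zB.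
have [_ _ ok _ E] := IBP_RzRb n0 N0 (smbM h sK); have [r r1 hr] := h.
have bnd F : smb 0 F -> cok (fun w => F w * wtp N w).
 move=> sF; have [M hM] := smb_bnd sF.
 have M0 : 0 <= M by have := hM 0; rewrite nr0 => /(_ ler01); apply: le_trans; by [].
 apply: (@cok_bnd _ _ _ M).
  apply: cmeasM; last exact: cmeas_pow.
  by apply: cmeas_cont => w /uball_le; exact: (smb_cont sF).
 move=> w wB; rewrite modCM modCR ger0_norm// -[leRHS]mulr1.
 apply: ler_pM; rewrite ?powR_ge0 ?hM ?uball_le//.
 exact: weight_powR_le1.
have ok1 : cok (fun w => psi w * ker (dN + 1) w z * wtp N w).
 apply: (bnd (fun w => psi w * ker (dN + 1) w z)); apply: smbM.
  by exists r => //; exact: Ck_le hr.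
 by apply: smb_ker => //; rewrite addr_ge0// ltW.
have ok2 : cok (fun w => Rb psi w * ker dN w z * wtp N w).
 apply: (bnd (fun w => Rb psi w * ker dN w z)); apply: smbM; first exact: smb_Rb.
 by apply: smb_ker => //; by [].
split => //; rewrite (Pop_EN h zB) E mulrA -(cintBZ _ ok2) -(cintBD ok1 (cokZ _ ok2)).
rewrite (cintB_eq (g := fun w => rc dN * (psi w * ker (dN + 1) w z * wtp N w +
  rc dN^-1 * (Rb psi w * ker dN w z * wtp N w)))).
 rewrite (cintBZ _ (cokD ok1 (cokZ _ ok2))).
 by rewrite mulrA; congr (_ * _); rewrite /kap /= !RtoCM (RtoC_nat R 2); ring.
move=> w wB; have hwz := mul_nr_lt (uball_le wB) zB.
have [U wU [hb1 hb2]] := smb2 h sK wB; rewrite (Rb_mul wU hb1 hb2).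
rewrite Rb_kerl// [ker dN w z](kerS _ hwz) RtoCV.
have := rc_neq0 (lt0r_neq0 nN).
by move: (rc _) (psi w) (Rb psi w) (herm w z) (ker _ w z) (rc _) => a b c d e e' ae; field.
Qed.

Lemma kap_step j Th : smb 1 Th ->
 [/\ cok (fun w => Th w * wtp (N + j%:R) w),
  cok (fun w => Xop (dN + j.+1%:R) Th w * wtp (N + j.+1%:R) w) &
  rc (kap j) * cintB (fun w => Th w * wtp (N + j%:R) w) =
  rc (kap j.+1) * cintB (fun w => Xop (dN + j.+1%:R) Th w * wtp (N + j.+1%:R) w)].
move=> h; have Nj : 0 < N + j.+1%:R by apply: ltr_wpDl.
have nNj : dN + j.+1%:R != 0 by rewrite gt_eqF// addr_gt0.
have [/(_ Nj) ok1 ok2 _ E _] := IBP_RzRb n0 (ltW Nj) h.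
have jE : N + j.+1%:R - 1 = N + j%:R by rewrite -natr1 addrA addrK.
rewrite jE in ok1.
have XE w : rc (dN + j.+1%:R)^-1 * ((rc (n%:R + (N + j.+1%:R)) * Th w + Rz Th w) * wtp (N + j.+1%:R) w) =
  Xop (dN + j.+1%:R) Th w * wtp (N + j.+1%:R) w.
 rewrite /Xop addrA mulrA; congr (_ * _); rewrite mulrDr mulrA -RtoCM mulVf// mul1r//.
have ok3 : cok (fun w => Xop (dN + j.+1%:R) Th w * wtp (N + j.+1%:R) w).
 by apply: cok_ext (cokZ _ ok2) => w _; exact: XE.
split; [exact: ok1|exact: ok3|].
rewrite -(cintB_eq (fun w _ => XE w)) (cintBZ _ ok2) kapS.
rewrite (ENcE _ Nj) jE in E.
have {E}E : rc (N + j.+1%:R) * cintB (fun w => Th w * wtp (N + j%:R) w) =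
  cintB (fun w => (rc (n%:R + (N + j.+1%:R)) * Th w + Rz Th w) * wtp (N + j.+1%:R) w).
 apply: (@mulfI _ 2); first by rewrite pnatr_eq0.
 by move: E; move: (cintB _) (cintB _) => a b <-; rewrite RtoCM (RtoC_nat R 2) mulrA.
rewrite -E mulrA mulrA; congr (_ * _); rewrite -!RtoCM; congr rc.
move: (lt0r_neq0 Nj) nNj; move: (N + j.+1%:R) (dN + j.+1%:R) => b a b0 a0.
by field; rewrite a0.
Qed.

Fixpoint TL (k : nat) g : V -> C := if k is k'.+1 then Xop (dN + k'%:R) (TL k' g) else g.

Lemma smb_Xop k a g : smb k.+1 g -> smb k (Xop a g).
move=> [r r1 h]; exists r => //; apply: Ck_add; [exact: openU_bigb|exact: Ck_le1|].
by apply: Ck_scale; [exact: openU_bigb|apply: Ck_Rz => //; exact: openU_bigb].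
Qed.
Lemma smb_TL k l g : smb (k + l) g -> smb l (TL k g).
elim: k l => [//|k IH] l h /=; apply: smb_Xop; apply: IH; by rewrite addnS.
Qed.
Lemma smbW k l g : (l <= k)%N -> smb k g -> smb l g.
by move=> lk [r r1 h]; exists r => //; exact: Ck_le h. Qed.

(** The kernel is antiholomorphic in [w], hence a constant for [Rz]. *)
Lemma Xop_mulker a b g z : smb 1 g -> 0 <= b -> uball z -> forB w, 
 Xop a (fun w => g w * ker b w z) w = Xop a g w * ker b w z.
move=> h b0 zB w wB; have [U wU [hb1 hb2]] := smb2 h (@smb_ker _ _ 1 b z b0 zB) wB.
rewrite /Xop (Rz_mul wU hb1 hb2) Rz_kerl; last exact: mul_nr_lt (uball_le wB) zB.
by rewrite mulr0 addr0 mulrDl mulrA.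
Qed.

(** With the holomorphic field the kernel exponent stays and all derivatives fall on [psi], while
    the weight rises. There are [k.+1] steps for the weight [N + k], the first one leading from
    [ENc] to weight [N]. *)
Lemma Pop_TL k psi z : smb k.+1 psi -> uball z ->
 cok (fun w => TL k.+1 psi w * ker dN w z * wtp (N + k%:R) w) /\
 Pop N psi z = rc (kap k) * cintB (fun w => TL k.+1 psi w * ker dN w z * wtp (N + k%:R) w).
elim: k psi => [|k IH] psi h zB.
 have [_ ok _ E _] := IBP_RzRb n0 N0 (smbM h (@smb_ker _ _ 1 dN z (ltW nN) zB)).
 have XE w : uball w -> rc dN^-1 * ((rc dN * (psi w * ker dN w z) +
   Rz (fun w => psi w * ker dN w z) w) * wtp N w) =
   TL 1 psi w * ker dN w z * wtp (N + 0%:R) w.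
  move=> wB; rewrite /TL addr0 addr0 -(Xop_mulker _ h (ltW nN) zB wB) mulrA; congr (_ * _).
  by rewrite /Xop mulrDr mulrA -RtoCM mulVf ?mul1r// gt_eqF.
 split; first exact: cok_ext XE (cokZ _ ok).
 rewrite -(etrans (esym (cintBZ (rc dN^-1) ok)) (cintB_eq XE)) (Pop_EN h zB) E.
 have -> : kap 0 = 2 * pconst * dN by [].
 move: (cintB _) => c; rewrite !RtoCM (RtoC_nat R 2) RtoCV.
 by have := rc_neq0 (lt0r_neq0 nN); move: (rc _) (rc _) => a b b0; field.
have hk : smb k.+1 psi by apply: smbW h.
have [ok E] := IH psi hk zB.
have sT : smb 1 (TL k.+1 psi) by apply: smb_TL; rewrite addn1.
have [_ ok2 E2] := kap_step k (smbM sT (@smb_ker _ _ 1 dN z (ltW nN) zB)).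
have XE w : uball w -> Xop (dN + k.+1%:R) (fun w => TL k.+1 psi w * ker dN w z) w *
  wtp (N + k.+1%:R) w = TL k.+2 psi w * ker dN w z * wtp (N + k.+1%:R) w.
 by move=> wB; rewrite (Xop_mulker _ sT (ltW nN) zB wB).
split; first exact: cok_ext XE ok2.
exact: (etrans E (etrans E2 (congr1 (fun x => rc (kap k.+1) * x) (cintB_eq XE)))).
Qed.

Lemma Kop_hol psi z : (forall w j, uball w -> dbar j psi w = 0) -> Kop K (dbarv psi) z = 0.
move=> h; rewrite /Kop (cintB_eq (g := fun=> 0)).
 by apply: cplxP; rewrite ?re_cintB ?im_cintB /Rintegral integral0_eq.
move=> w wB; rewrite /wedge big1// => j _; by rewrite mxE h// mulr0.
Qed.

Lemma repr_hol0 g z : smb 1 g -> (forall w j, uball w -> dbar j g w = 0) -> uball z -> g z = Pop N g z.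
by move=> h hd zB; have [_ H _] := HK; rewrite [LHS](H _ (smb_C1cball h) z zB) Kop_hol// addr0.
Qed.

(** For holomorphic [g] the term with [Rb g] vanishes, so each antiholomorphic integration by parts
    raises the kernel exponent and the weight by one. *)
Lemma repr_hol j g z : smb 1 g -> (forall w j, uball w -> dbar j g w = 0) -> uball z ->
 cok (fun w => g w * ker (dN + j.+1%:R) w z * wtp (N + j%:R) w) /\
 g z = rc (kap j) * cintB (fun w => g w * ker (dN + j.+1%:R) w z * wtp (N + j%:R) w).
move=> h hd zB; elim: j => [|j [ok IH]].
 have [ok1 ok2 E] := Pop_Rb h zB.
 split; first by apply: cok_ext ok1 => w _; rewrite addr0.
 rewrite repr_hol0// E [X in _ + _ * X](cintB_eq (g := fun=> 0)); last first.
  by move=> w wB; rewrite /Rb big1 ?mul0r// => i _; rewrite hd// mulr0.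
 rewrite (_ : cintB (fun=> 0) = 0); last first.
  by apply: cplxP; rewrite ?re_cintB ?im_cintB /Rintegral integral0_eq.
 have F : cintB (fun w => g w * ker (dN + 1%:R) w z * wtp (N + 0%:R) w) =
   cintB (fun w => g w * ker (dN + 1) w z * wtp N w).
  by apply: cintB_eq => w _; rewrite addr0.
 by rewrite mulr0 addr0 F.
have b0 : 0 <= dN + j.+1%:R by [].
have Nj : 0 < N + j.+1%:R by apply: ltr_wpDl.
have sK := @smb_ker _ _ 1 (dN + j.+1%:R) z b0 zB;
have [_ _ ok2 _ E2] := IBP_RzRb n0 (ltW Nj) (smbM h sK).
have XE w : uball w -> (rc (n%:R + (N + j.+1%:R)) * (g w * ker (dN + j.+1%:R) w z) +
   Rb (fun w => g w * ker (dN + j.+1%:R) w z) w) * wtp (N + j.+1%:R) w =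
  rc (dN + j.+1%:R) * (g w * ker (dN + j.+2%:R) w z * wtp (N + j.+1%:R) w).
 move=> wB; have hwz := mul_nr_lt (uball_le wB) zB.
 have [U wU [hb1 hb2]] := smb2 h sK wB; rewrite (Rb_mul wU hb1 hb2) Rb_kerl//.
 rewrite (_ : Rb g w = 0); last by rewrite /Rb big1// => i _; rewrite hd// mulr0.
 rewrite kerS// -[j.+2%:R]natr1 !addrA.
 by move: (rc _) (g w) (herm w z) (ker _ w z) (rc _) => a b c d e; ring.
have bn : dN + j.+1%:R != 0 by rewrite gt_eqF// addr_gt0.
have ok3 : cok (fun w => g w * ker (dN + j.+2%:R) w z * wtp (N + j.+1%:R) w).
 apply: cok_ext (cokZ (rc (dN + j.+1%:R))^-1 (cok_ext XE ok2)) => w _.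
 by rewrite mulKf// rc_neq0.
split; first exact: ok3.
have jE : N + j.+1%:R - 1 = N + j%:R by rewrite -natr1 addrA addrK.
rewrite (ENcE _ Nj) jE (cintB_eq XE) (cintBZ _ ok3) in E2.
rewrite IH kapS; move: E2; move: (cintB _) (cintB _) => a b.
rewrite !RtoCM RtoCV (RtoC_nat R 2) => E2.
have := rc_neq0 (lt0r_neq0 Nj); move: E2; move: (rc _) (rc _) (rc _) => x y u E2 x0.
have E3 : u * b = y * a by apply: (@mulfI _ 2); rewrite ?pnatr_eq0// mulrA.
have -> : b = y * a / u by rewrite -E3; field.
by field.
Qed.

(** Reproducing the constant 1 at the origin gives [1 = kap j] times a nonnegative integral, which
    settles the sign without evaluating [Gamma]. *)
Lemma kap_gt0 j : 0 < kap j.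
have h1 : smb 1 (fun _ : V => 1 : C) by exists 2; [rewrite ltr1n|exact: Ck_cst].
have hd (w : V) (i : 'I_n) : uball w -> dbar i (fun _ : V => 1 : C) w = 0.
 move=> _; have hc v : dir_deriv v (fun _ : V => 1 : C) w = 0.
  by have [_ ->] := (dirP (fun _ : V => 1 : C) v w 0).1 (cder_cst 1 0).
 by rewrite dbarE !hc mulr0 addr0 mul0r.
have z0 : uball (0 : V) by rewrite uballE nr0.
have [ok E] := repr_hol j h1 hd z0.
rewrite (cintB_eq (g := fun w => wtp (N + j%:R) w)) in E; last first.
 by move=> w _; rewrite /ker herm0r subr0 (_ : 1 = rc 1)// cpow_real// powR1 !mul1r.
move: E; rewrite cintB_rc -RtoCM => /RtoC_inj E.
have f0 : 0 <= fine (Ie (fun w : V => (weight w `^ (N + j%:R))%:E)).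
 by apply: fine_ge0; apply: Ie_ge0 => w _; rewrite lee_fin powR_ge0.
rewrite ltNge; apply/negP => k0.
by have := mulr_le0_ge0 k0 f0; rewrite -E leNgt ltr01.
Qed.

End Repr.

(** * Forelli-Rudin integrals: raising the weight, dyadic decomposition *)

Section FRpre.
Implicit Types (w z : V).

Lemma smb_kerr k a z : 0 <= a -> uball z -> smb k (fun w => ker a z w).
move=> a0 /ball_shrink[s s01 h]; have := smb_dil s01 (@Ck_kerr _ _ k a _ a0 h).
rewrite (_ : (fun w => _) = (fun w => ker a z w))//; apply/funext => w; have /andP[s0 _] := s01.
by rewrite /ker hermZl hermZr /rc conjCR mulrA -RtoCM mulVf ?gt_eqF// mul1r.
Qed.

Lemma kerker a w z : nr w * nr z < 1 -> ker a w z * ker a z w = rc (dist w z `^ (- (a + a))).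
move=> h; rewrite -(cj_ker _ h); have d0 : dist w z != 0.
 by rewrite gt_eqF// (lt_le_trans _ (dist_ge w z))// subr_gt0.
rewrite opprD powRD ?d0 ?implybT// -(modC_ker _ h) -expr2 modC_sqr.
by apply: cplxP; rewrite !ReImE; move: (re _) (im _) => x y; ring.
Qed.

Lemma emeas_dist q c z : uball z ->
 emeas (fun w => (dist w z `^ q * weight w `^ c)%:E).
move=> zB; apply/emeas_rc; have h : cmeas (fun w => rc (dist w z `^ q)).
 have mk : cmeas (fun w => ker 1 w z) by apply: cmeas_cont => w /uball_le; exact: smb_cont (smb_ker 0 ler01 zB) w.
 have hm : cmeas (fun w => rc (modC (ker 1 w z) `^ (- q))).
  by apply/cmeas_rc; exact: measurableT_comp (@measurable_powR R (- q)) (cmeas_mod mk).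
 apply: cmeas_ext _ hm => w wB; rewrite modC_ker; last exact: mul_nr_lt (uball_le wB) zB.
 by rewrite -powRrM mulN1r opprK.
by apply: cmeas_ext _ (cmeasM h (@cmeas_pow _ _ c)) => w _; rewrite -RtoCM.
Qed.

Lemma Ie_dist_ge0 q c z : (0 <= Ie (fun w => (dist w z `^ q * weight w `^ c)%:E))%E.
by apply: Ie_ge0 => w _; rewrite lee_fin mulr_ge0. Qed.

Lemma weight_dist (c s : R) w z : 0 <= s -> uball w -> uball z ->
 weight w `^ (c + s) <= 2 `^ s * (dist w z `^ s * weight w `^ c).
move=> s0 wB zB; have w0 := weight_gt0 wB.
rewrite powRD ?(gt_eqF w0) ?implybT// mulrC mulrA ler_wpM2r//.
rewrite -powRM////; apply: ge0_ler_powR; rewrite ?nnegrE ?(ltW w0)//.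
by apply: weight_le_dist; exact: uball_le.
Qed.

Lemma dist_pow_up (p q : R) w z : p <= q -> uball w -> uball z ->
 dist w z `^ (- p) <= 2 `^ (q - p) * dist w z `^ (- q).
move=> pq wB zB;
have -> : dist w z `^ (- p) = dist w z `^ ((q - p) + - q) by congr (_ `^ _); ring.
rewrite powRD ?(gt_eqF (distB_gt0 wB zB)) ?implybT// ler_wpM2r//.
by apply: ge0_ler_powR; rewrite ?nnegrE ?subr_ge0//// dist_le2//; exact: uball_le.
Qed.

(** Integrate [dist^(-q) = ker p w z * ker p z w], [p = q / 2], by parts with [Rz]. The derivative
    hits only the second factor and costs one power of [dist], in exchange for one power of the
    weight. *)
Lemma FR_lower (c q : R) : 0 < c -> 0 <= q -> const D, forB z, 
 (Ie (fun w => (dist w z `^ (- q) * weight w `^ (c - 1))%:E) <=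
  D%:E * Ie (fun w => (dist w z `^ (- (q + 1)) * weight w `^ c)%:E))%E.
move=> c0 q0; pose p := q / 2; pose M := 2 * (n%:R + c) + p.
have p0 : 0 <= p by rewrite /p; lra.
have M0 : 0 <= M by rewrite /M addr_ge0// mulr_ge0// addr_ge0// ltW.
exists (2 / c * M) => [|z zB]; first by rewrite !mulr_ge0// invr_ge0 ltW.
pose Th w := ker p w z * ker p z w.
have h : smb 1 Th by apply: smbM; [exact: smb_ker|exact: smb_kerr].
have [/(_ c0) h1 h2 _ h3 _] := IBP_RzRb n0 (ltW c0) h.
have hm w : uball w -> nr w * nr z < 1 by move=> wB; exact: mul_nr_lt (uball_le wB) zB.
have E1 w : uball w -> Th w * wtp (c - 1) w = rc (dist w z `^ (- q) * weight w `^ (c - 1)).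
 move=> wB; rewrite /Th kerker; last exact: hm.
 by rewrite -RtoCM /p; congr (rc (_ `^ _ * _)); field.
have E2 w : uball w -> modC ((rc (n%:R + c) * Th w + Rz Th w) * wtp c w) <=
  M * (dist w z `^ (- (q + 1)) * weight w `^ c).
 move=> wB;
 rewrite modCM modCR (ger0_norm (powR_ge0 _ _)) mulrA ler_wpM2r//.
 rewrite (le_trans (modCD _ _))// /M mulrDl lerD//.
  rewrite /Th kerker; last exact: hm.
  rewrite -RtoCM modCR ger0_norm; last by rewrite mulr_ge0 ?powR_ge0// addr_ge0// ltW.
  rewrite [2 * _]mulrC -mulrA ler_wpM2l ?addr_ge0 ?(ltW c0)//.
  rewrite (le_trans (dist_pow_up (q := q + 1) _ wB zB))//; first by rewrite /p; lra.
  rewrite (_ : p + p = q); last by rewrite /p; field.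
  by rewrite (_ : q + 1 - q = 1) ?powRr1//; ring.
 have -> : Rz Th w = ker p w z * (rc p * herm z w * ker (p + 1) z w).
  have [U wU [C1 C2]] := smb2 (smb_ker 1 p0 zB) (smb_kerr 1 p0 zB) wB.
  have zw : nr z * nr w < 1 by rewrite mulrC; exact: hm.
  rewrite (Rz_mul wU C1 C2) (Rz_kerl _ (hm _ wB)) (Rz_kerr _ zw).
  by rewrite mul0r add0r.
 rewrite [X in X <= _]modCM modCM modCM modCR (ger0_norm p0) modC_ker; last exact: hm.
 rewrite modC_ker; last by rewrite mulrC; exact: hm.
 rewrite [dist z w]distC (_ : - (q + 1) = - p + - (p + 1)); last by rewrite /p; field.
 rewrite powRD ?(gt_eqF (distB_gt0 wB zB)) ?implybT//.
 have : modC (herm z w) <= 1.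
  by rewrite (le_trans (herm_le _ _))// mulrC ltW// hm.
 have := modC_ge0 (herm z w); have := powR_ge0 (dist w z) (- p).
 have := powR_ge0 (dist w z) (- (p + 1)).
 move: (modC _) (_ `^ _) (_ `^ _) p0 => x y u; clear; move=> p0 y0 u0 x0 x1.
 rewrite [leRHS](_ : _ = p * u * y * 1); last by ring.
 rewrite [leLHS](_ : _ = p * u * y * x); last by ring.
 by rewrite ler_wpM2l// (mulr_ge0 (mulr_ge0 p0 _)).
have m1 := emeas_dist (- q) (c - 1) zB; have m2 := emeas_dist (- (q + 1)) c zB.
have [_ f1] := h1.
pose I1 := Ie (fun w => (dist w z `^ (- q) * weight w `^ (c - 1))%:E).
have f2 : I1 \is a fin_num.
 rewrite ge0_fin_numE ?Ie_dist_ge0// (le_lt_trans _ f1)//; apply: Ie_le => //.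
 - by apply: emeas_mod; case: h1.
 - by move=> w wB; rewrite lee_fin E1// modCR ler_norm.
have E3 : I1 = (modC (rc c^-1 * cintB (fun w => (rc (n%:R + c) * Th w + Rz Th w) * wtp c w)))%:E.
 have := h3; rewrite (ENcE _ c0) (cintB_eq E1) cintB_rc -/I1.
 move=> /(congr1 (fun x => rc (2 * c)^-1 * x)); rewrite !mulrA -!RtoCM mulVf; last first.
  by rewrite mulf_neq0 ?pnatr_eq0// gt_eqF.
 rewrite mul1r => /(congr1 (@modC R)); rewrite modCR ger0_norm; last by rewrite fine_ge0// Ie_dist_ge0.
 rewrite (_ : rc (2 * c)^-1 * 2 = rc c^-1); last first.
  by rewrite -(RtoC_nat R 2) -RtoCM; congr rc; field; rewrite gt_eqF.
 by move=> <-; rewrite fineK.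
rewrite -/I1 E3 modCM modCR ger0_norm ?invr_ge0 ?(ltW c0)// EFinM.
apply: (@le_trans _ _ ((c^-1)%:E * (2%:E * (M%:E * Ie (fun w => (dist w z `^ (- (q + 1)) * weight w `^ c)%:E)))))%E.
 rewrite lee_pmul2l ?lte_fin ?invr_gt0//.
 apply: (le_trans (modC_cintB _)); first by case: h2.
 rewrite lee_pmul2l ?lte_fin// -IeZ//.
 apply: Ie_le.
 - by apply: emeas_mod; case: h2.
 - by apply: measurable_funeM.
 - by move=> w _; rewrite lee_fin modC_ge0.
 - by move=> w wB; rewrite -EFinM lee_fin E2.
by rewrite !muleA -!EFinM; rewrite (_ : c^-1 * 2 * M = 2 / c * M)//; ring.
Qed.

(** The Forelli-Rudin integral of [dist^(-q) weight^c]. *)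
Definition Id (q c : R) z : \bar R := Ie (fun w => (dist w z `^ (- q) * weight w `^ c)%:E).
Lemma Id_ge0 q c z : (0 <= Id q c z)%E.
exact: Ie_dist_ge0. Qed.

Lemma Id_le q c q' c' D z : 0 <= D -> uball z ->
 (forB w, dist w z `^ (- q) * weight w `^ c <= D * (dist w z `^ (- q') * weight w `^ c')) ->
 (Id q c z <= D%:E * Id q' c' z)%E.
move=> D0 zB h; rewrite /Id -IeZ//; last exact: emeas_dist.
apply: Ie_le => [||w _|w wB].
- exact: emeas_dist.
- by apply: measurable_funeM; exact: emeas_dist.
- by [].
- by rewrite -EFinM lee_fin h.
Qed.

Lemma FR_lowers (M : nat) (c q : R) : 0 < c -> 0 <= q -> const D,
 forB z, (Id q (c - 1) z <= D%:E * Id (q + M%:R) (c - 1 + M%:R) z)%E.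
elim: M c q => [|M ih] c q c0 q0.
 by exists 1 => // z _; rewrite mul1e !addr0.
have [D D0 hD] := FR_lower c0 q0.
have [E E0 hE] := ih (c + 1) (q + 1) (addr_gt0 c0 ltr01) (addr_ge0 q0 ler01).
exists (D * E) => [|z zB]; first exact: mulr_ge0.
have := hE z zB; rewrite [c + 1 - 1](_ : _ = c); last by ring.
move=> h; apply: (le_trans (hD z zB)); rewrite EFinM -muleA.
have -> : (q + M.+1%:R = q + 1 + M%:R) by rewrite -natr1; ring.
have -> : (c - 1 + M.+1%:R = c + M%:R) by rewrite -natr1; ring.
by apply: lee_pmul => //; exact: Id_ge0.
Qed.

Lemma half_small (x : R) : 0 < x -> exists J, 2^-1 ^+ J <= x.
move=> x0; exists (Num.bound x^-1); rewrite exprVn -[leRHS]invrK lef_pV2 ?posrE ?invr_gt0 ?exprn_gt0//.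
have h1 : 0 <= x^-1 by rewrite invr_ge0 ltW.
apply: (le_trans (ltW (archi_boundP h1))); rewrite -natrX ler_nat; exact/ltnW/ltn_expl.
Qed.

Lemma dyadic_pick (x : R) J : 2^-1 ^+ J <= x -> x <= 2 ->
 exists2 j, (j <= J)%N & 2^-1 ^+ j <= x <= 2 * 2^-1 ^+ j.
elim: J => [|J ih] h x2; first by exists 0%N => //; rewrite h expr0 mulr1 x2.
have [h1|/ltW h1] := leP (2^-1 ^+ J) x; first by have [j jJ hj] := ih h1 x2; exists j => //; exact: leqW.
by exists J.+1 => //; rewrite h exprS mulrA divff ?mul1r ?h1// pnatr_eq0.
Qed.

Lemma half_powR (th : R) j : (2^-1 ^+ j) `^ th = (2 `^ (- th)) ^+ j.
rewrite exprVn -[X in X^-1]powR_mulrn// -powR_inv1// -!powRrM -powR_mulrn// -powRrM.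
by congr (_ `^ _); ring.
Qed.
(** The point [z] pulled inwards by [2^(-j)]; its weight is at least [2^(-j)]. *)
Definition zdy (j : nat) z : V := rc (1 - 2^-1 ^+ j) *: z.
Lemma half01 j : 0 < (2^-1 : R) ^+ j <= 1.
by rewrite exprn_gt0 ?invr_gt0// exprn_ile1// ?invr_ge0// invf_le1// ler1n. Qed.

Lemma zdy_weight j z : uball z -> uball (zdy j z) /\ 2^-1 ^+ j <= weight (zdy j z).
move=> zB; have /andP[h0 h1] := half01 j; rewrite uballE in zB.
have E : nr (zdy j z) = (1 - 2^-1 ^+ j) * nr z by rewrite nrZR ger0_norm// subr_ge0.
have b : uball (zdy j z) by rewrite uballE E; nra.
by split => //; apply: le_trans (weight_ge (uball_le b)); rewrite E; nra.
Qed.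

(** If [dist w z] is comparable to [2^(-j)], then [dist w (zdy j z) <= 2 dist w z], and [M] powers
    of [dist] can be traded for [2^(-j M)]. Scales beyond [J] do not occur because
    [dist w z >= weight z / 2]. A large [M] brings the exponent into the range where the integral is
    known. *)
Lemma dist_dyadic q M w z J : 0 <= M -> 0 <= q + M -> uball w -> uball z -> 2^-1 ^+ J <= weight z / 2 ->
 dist w z `^ (- q) <= 2 `^ (q + M + M) *
  \sum_(j < J.+1) (2^-1 ^+ j) `^ M * dist w (zdy j z) `^ (- (q + M)).
move=> M0 qM wB zB hJ; have wz := uball_le wB; have zz := uball_le zB.
have d0 : 0 < dist w z by apply: dist_gt0 => //; rewrite -uballE.
have h1 : 2^-1 ^+ J <= dist w z.
 by apply: (le_trans hJ); rewrite ler_pdivrMr// mulrC weight_le_distr.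
have [j jJ /andP[j1 j2]] := dyadic_pick h1 (dist_le2 wz zz).
have /andP[p0 p1] := half01 j.
have [zj _] := zdy_weight j zB.
have dj : dist w (zdy j z) <= 2 * dist w z.
 have := @dist_scale_le _ _ (1 - 2^-1 ^+ j) w z; rewrite subr_ge0 => /(_ p1).
 by rewrite gerBl (ltW p0) => /(_ isT wz zz); rewrite /zdy; lra.
have dj0 : 0 < dist w (zdy j z) by apply: dist_gt0 => //; rewrite -uballE.
apply: (@le_trans _ _ (2 `^ (q + M + M) * ((2^-1 ^+ j) `^ M * dist w (zdy j z) `^ (- (q + M))))); last first.
 rewrite ler_wpM2l//; have jJ' : (j < J.+1)%N by [].
 by rewrite (bigD1 (Ordinal jJ')) //= lerDl sumr_ge0.
rewrite (@powR_split _ (dist w z) (- q) M (- (q + M)) d0); last by ring.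
have a1 : dist w z `^ M <= 2 `^ M * (2^-1 ^+ j) `^ M.
 have b0 : 0 <= 2 * (2^-1 : R) ^+ j by rewrite mulr_ge0 ?(ltW p0).
 by rewrite -powRM ?(ltW p0)//; apply: ge0_ler_powR; rewrite ?nnegrE.
have a2 : dist w z `^ (- (q + M)) <= 2 `^ (q + M) * dist w (zdy j z) `^ (- (q + M)).
 apply: (@le_trans _ _ (2 `^ (q + M) * (2 * dist w z) `^ (- (q + M)))); last first.
  by rewrite ler_wpM2l ?powR_ge0//; apply: powRN_le.
 rewrite powRM// mulrA -powRD ?pnatr_eq0 ?implybT// subrr powRr0 mul1r//.
apply: (le_trans (ler_pM (powR_ge0 _ _) (powR_ge0 _ _) a1 a2)).
rewrite (@powR_split _ 2 (q + M + M) (q + M) M)//.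
by apply: eqle; move: (dist w _ `^ _) (2 `^ _) (2 `^ _) ((2^-1 ^+ j) `^ _) => a b c d; ring.
Qed.

Lemma geo_sum_lt1 (y : R) J : 0 <= y -> y < 1 -> \sum_(j < J) y ^+ j <= (1 - y)^-1.
move=> y0 y1; have y2 : 0 < 1 - y by rewrite subr_gt0.
rewrite -[leRHS]mul1r ler_pdivlMr//; have := subrX1 y J.
by have := exprn_ge0 J y0; move: (\sum_(i < J) _) (y ^+ J) => S Y Y0 E; nra.
Qed.

Lemma geo_sum_gt1 (y : R) J : 1 < y -> \sum_(j < J) y ^+ j <= y ^+ J / (y - 1).
move=> y1; have y2 : 0 < y - 1 by rewrite subr_gt0.
by rewrite ler_pdivlMr// mulrC -subrX1 gerBl.
Qed.

End FRpre.

(** * The Forelli-Rudin estimates *)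

Section FR.
Implicit Types (w z : V).
(** The critical exponent for the weight [N]: below it the integral is bounded, above it the
    integral grows like [weight^(a - q)]. *)
Let a := dN + 1.
Let a0 : 0 < a.
by rewrite /a ltr_wpDl// addr_ge0. Qed.

(* Reproduce [w |-> ker a z w] at [z]. *)
Lemma FR_base : const D, forB z, (Id (a + a) N z <= (D * weight z `^ (- a))%:E)%E.
have k0 := kap_gt0 0.
exists (kap 0)^-1; first by rewrite invr_ge0 ltW.
move=> z zB; pose g w := ker a z w.
have sg : smb 1 g by apply: smb_kerr => //; exact: ltW.
have hm w : uball w -> nr w * nr z < 1 by move=> wB; exact: mul_nr_lt (uball_le wB) zB.
have hg w j : uball w -> dbar j g w = 0.
 by move=> wB; have [] := @ker_dzr R n a z w j; rewrite// mulrC; exact: hm.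
have [[_ c1] c2] := repr_hol 0 sg hg zB.
have E w : uball w -> g w * ker (dN + 1) w z * wtp (N + 0%:R) w =
  rc (dist w z `^ (- (a + a)) * weight w `^ N).
 by move=> wB; rewrite addr0 /g [ker _ z w * _]mulrC kerker ?hm// -RtoCM.
have f2 : Id (a + a) N z \is a fin_num.
 rewrite ge0_fin_numE ?Id_ge0// (le_lt_trans _ c1)//; apply: Ie_le => //.
 - exact: emeas_dist.
 - apply: emeas_mod; apply: (cmeas_ext (fun w wB => esym (E w wB))).
  by apply/emeas_rc; exact: emeas_dist.
 - by move=> w wB; rewrite lee_fin (E w wB) modCR ler_norm.
move: c2; rewrite (cintB_eq E) cintB_rc -/(Id (a + a) N z) /g ker_diag// -RtoCM => /(@RtoC_inj R) ->.
by rewrite mulrA mulVf ?gt_eqF// mul1r fineK.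
Qed.

(** The excess over the exponent [2 a] of [FR_base] is paid by [dist w z >= weight z / 2]. *)
Lemma FR_big q : a + a <= q -> const D,
 forB z, (Id q N z <= (D * weight z `^ (a - q))%:E)%E.
move=> aq; have [D D0 hD] := FR_base; have s0 : 0 <= q - (a + a) by rewrite subr_ge0.
exists (2 `^ (q - (a + a)) * D) => // z zB.
have z0 := weight_gt0 zB.
pose E := (weight z / 2) `^ (- (q - (a + a))).
have E0 : 0 <= E by exact: powR_ge0.
apply: (@le_trans _ _ (E%:E * Id (a + a) N z)%E).
 apply: Id_le => // w wB; rewrite mulrA ler_wpM2r//.
 have -> : dist w z `^ (- q) = dist w z `^ (- (q - (a + a)) + - (a + a)) by congr (_ `^ _); ring.
 rewrite powRD ?(gt_eqF (distB_gt0 wB zB)) ?implybT// ler_wpM2r//; apply: powRN_le => //.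
  by rewrite divr_gt0.
 by rewrite ler_pdivrMr// mulrC weight_le_distr ?uball_le.
apply: (@le_trans _ _ (E%:E * (D * weight z `^ (- a))%:E)%E).
 by apply: lee_pmul => //; [exact: Id_ge0|exact: hD].
rewrite -EFinM lee_fin; apply: eqle; rewrite /E powRM ?invr_ge0 ?(ltW z0)//.
rewrite (@powR_split _ (weight z) (a - q) (- (q - (a + a))) (- a) z0); last by ring.
have -> : (2^-1 : R) `^ (- (q - (a + a))) = 2 `^ (q - (a + a)).
 by rewrite -(@powR_inv1 _ 2)// -powRrM mulN1r opprK.
by move: (_ `^ _) (_ `^ _) (_ `^ _) => x y u; ring.
Qed.

(** Integrate [dist_dyadic] term by term with [FR_big] at the points [zdy j z]; the powers of
    [2^(-j)] combine to the exponent [a - q], independent of the auxiliary [M]. *)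
Lemma FR_sum q : const D, forall z J, uball z -> 2^-1 ^+ J <= weight z / 2 ->
 (Id q N z <= (D * \sum_(j < J.+1) (2 `^ (q - a)) ^+ j)%:E)%E.
(* Large enough for [q + M >= 2 a], for [q] of any sign. *)
pose M := a + a + `|q|; have M0 : 0 <= M by rewrite /M !addr_ge0// ltW.
have qM : a + a <= q + M by rewrite /M; have := ler_norm (- q); rewrite normrN; lra.
have qM0 : 0 <= q + M by apply: le_trans qM; rewrite addr_ge0// ltW.
have [D D0 hD] := FR_big qM.
exists (2 `^ (q + M + M) * D) => // z J zB hJ.
pose E := 2 `^ (q + M + M);
pose t (j : 'I_J.+1) w := (2^-1 ^+ j) `^ M * (dist w (zdy j z) `^ (- (q + M)) * weight w `^ N).
have t0 j w : 0 <= t j w by rewrite !mulr_ge0 ?powR_ge0.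
have tE j : (fun w => (t j w)%:E) = (fun w => ((2^-1 ^+ j) `^ M)%:E * (dist w (zdy j z) `^ (- (q + M)) * weight w `^ N)%:E)%E.
 by apply/funext => w; rewrite -EFinM.
have mt j : emeas (fun w => (t j w)%:E).
 by rewrite tE; apply: measurable_funeM; apply: emeas_dist; have [] := zdy_weight j zB.
apply: (@le_trans _ _ (E%:E * \sum_(j < J.+1) Ie (fun w => (t j w)%:E))%E).
 have -> : (\sum_(j < J.+1) Ie (fun w => (t j w)%:E) = Ie (fun w => \sum_(j < J.+1) (t j w)%:E))%E.
  rewrite /Ie ge0_integral_sum//; first exact: meas_ballT.
 rewrite -IeZ//; last first.
 - by move=> w _; apply: sume_ge0 => j _; rewrite lee_fin.
 - by apply: emeasurable_sum => j; exact: mt.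
 apply: Ie_le.
 - exact: emeas_dist.
 - by apply: measurable_funeM; apply: emeasurable_sum => j; exact: mt.
 - by move=> w _; rewrite lee_fin mulr_ge0.
 - move=> w wB; rewrite sumEFin -EFinM lee_fin.
  rewrite [\sum_(j < J.+1) _](_ : _ = (\sum_(j < J.+1) (2^-1 ^+ j) `^ M * dist w (zdy j z) `^ (- (q + M))) * weight w `^ N).
   by rewrite mulrA ler_wpM2r ?powR_ge0// dist_dyadic.
  by rewrite mulr_suml; apply: eq_bigr => j _; rewrite /t mulrA.
rewrite -mulrA EFinM lee_wpmul2l// mulr_sumr -sumEFin; apply: lee_sum => j _.
have [zj hj] := zdy_weight j zB.
rewrite tE (IeZ (emeas_dist _ _ zj))//.
apply: (@le_trans _ _ (((2^-1 ^+ j) `^ M)%:E * (D * weight (zdy j z) `^ (a - (q + M)))%:E)%E).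
 by apply: lee_wpmul2l; [rewrite lee_fin powR_ge0|exact: hD].
have /andP[p0 p1] := half01 j.
rewrite -EFinM lee_fin mulrCA ler_wpM2l// -(opprB a q) -half_powR.
rewrite (@powR_split _ (2^-1 ^+ j) (a - q) M (- (q + M - a)) p0); last by ring.
rewrite ler_wpM2l ?powR_ge0// -(opprB (q + M) a).
by apply: powRN_le => //; rewrite subr_ge0; apply: le_trans qM; rewrite lerDl ltW.
Qed.

Lemma weight_dyadic z : uball z -> exists J, 2^-1 ^+ J <= weight z / 2 <= 2 * 2^-1 ^+ J.
move=> zB; have z0 := weight_gt0 zB; have z1 := weight_le1 z.
have w0 : 0 < weight z / 2 by rewrite divr_gt0.
have [J hJ] := half_small w0.
have w2 : weight z / 2 <= 2 by lra.
by have [j _ hj] := dyadic_pick hJ w2; exists j.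
Qed.

(** A convergent geometric series, bounded independently of the number of scales. *)
Lemma FRN_bnd q : q < a -> const D, forB z, (Id q N z <= D%:E)%E.
move=> qa; have [D D0 hD] := FR_sum q; pose y : R := 2 `^ (q - a).
have y1 : y < 1.
 by apply: two_powR_lt1; rewrite subr_lt0.
exists (D * (1 - y)^-1) => [|z zB]; first by rewrite mulr_ge0// invr_ge0 subr_ge0 ltW.
have [J /andP[hJ _]] := weight_dyadic zB.
by apply: (le_trans (hD z J zB hJ)); rewrite lee_fin ler_wpM2l// geo_sum_lt1.
Qed.

(** The last scale dominates the geometric sum, and [J] is chosen with [2^(-J)] comparable to the
    weight of [z]. *)
Lemma FRN_gr q : a < q -> const D, forB z, (Id q N z <= (D * weight z `^ (a - q))%:E)%E.
move=> qa; have [D D0 hD] := FR_sum q; pose y : R := 2 `^ (q - a).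
have y1 : 1 < y.
 by apply: two_powR_gt1; rewrite subr_gt0.
have y2 : 0 < y - 1 by rewrite subr_gt0.
have y0 : 0 < y by lra.
(* The factor with [4^-1] comes from [2^(-J) >= weight z / 4]. *)
exists (D * (y / (y - 1) * (4^-1) `^ (a - q))) => [|z zB].
 by rewrite !mulr_ge0 ?powR_ge0// ?invr_ge0 ltW.
have [J /andP[hJ hJ2]] := weight_dyadic zB; have z0 := weight_gt0 zB.
apply: (le_trans (hD z J zB hJ)); rewrite lee_fin -mulrA ler_wpM2l//.
apply: (le_trans (geo_sum_gt1 _ y1)); rewrite exprS mulrAC -[leRHS]mulrA ler_wpM2l//.
 by rewrite divr_ge0// ltW.
rewrite -powRM ?invr_ge0 ?(ltW z0)// /y -(opprB a q) -half_powR -(opprB q a).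
apply: powRN_le; rewrite ?subr_ge0 ?(ltW qa)//; first by rewrite mulr_gt0.
by move: hJ2; move: (_ ^+ J) (weight z) => x u h; lra.
Qed.

(** Raise the weight past [N] with [FR_lowers], then turn the surplus [s] of weight back into powers
    of [dist]; the number [M] of steps drops out of the exponent. *)
Lemma FR_toN c q p : 0 < c -> 0 <= p -> q <= p -> const D, forB z, 
 (Id q (c - 1) z <= D%:E * Id (p + N + 1 - c) N z)%E.
move=> c0 p0 qp; suff [D D0 hD] : const D, forB z, 
  (Id p (c - 1) z <= D%:E * Id (p + N + 1 - c) N z)%E.
 exists (2 `^ (p - q) * D) => // z zB; rewrite EFinM -muleA.
 apply: (@le_trans _ _ ((2 `^ (p - q))%:E * Id p (c - 1) z)%E); last by rewrite lee_wpmul2l ?hD.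
 apply: Id_le (powR_ge0 _ _) (zB) _ => w wB.
 by rewrite mulrA ler_wpM2r ?powR_ge0// dist_pow_up.
move: p p0 {qp} => {}q q0.
pose M := Num.bound (N + 1); have hM : N + 1 < M%:R by apply: archi_boundP; rewrite addr_ge0.
have [D D0 hD] := FR_lowers M c0 q0.
pose s := c - 1 + M%:R - N; have s0 : 0 <= s by rewrite /s; lra.
exists (D * 2 `^ s) => [|z zB]; first by rewrite mulr_ge0 ?powR_ge0.
apply: (le_trans (hD z zB)); rewrite EFinM -muleA lee_wpmul2l//.
apply: Id_le (powR_ge0 _ _) (zB) _ => w wB.
have -> : weight w `^ (c - 1 + M%:R) = weight w `^ (N + s) by congr (_ `^ _); rewrite /s; ring.
apply: (le_trans (ler_wpM2l (powR_ge0 _ _) (weight_dist N s0 wB zB))).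
rewrite (@powR_split _ (dist w z) (- (q + N + 1 - c)) (- (q + M%:R)) s (distB_gt0 wB zB)); last by rewrite /s; ring.
by apply: eqle; move: (_ `^ _) (_ `^ _) (_ `^ _) (_ `^ _) => x y u v; ring.
Qed.

(* Forelli-Rudin: [FR_toN] shifts [c - 1] to [N], where the dyadic bounds apply. *)
Lemma FR_bnd c q : 0 < c -> q < n%:R + c -> const D, forB z, (Id q (c - 1) z <= D%:E)%E.
move=> c0 qc; pose p := Num.max q 0.
have p0 : 0 <= p by rewrite le_max lexx orbT.
have pc : p + N + 1 - c < a.
 have : p < n%:R + c by rewrite gt_max qc ltr_wpDl.
 by rewrite /a; move: (n%:R : R) => t; lra.
have qp : q <= p by rewrite le_max lexx.
have [D D0 hD] := FR_toN c0 p0 qp; have [E E0 hE] := FRN_bnd pc.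
exists (D * E) => // z zB; rewrite EFinM (le_trans (hD z zB))// lee_wpmul2l//; exact: hE.
Qed.

Lemma FR_gr c q s : 0 < c -> 0 < s -> q <= n%:R + c + s ->
 const D, forB z, (Id q (c - 1) z <= (D * weight z `^ (- s))%:E)%E.
move=> c0 s0 qc; pose p := n%:R + c + s.
have p0 : 0 <= p by rewrite !addr_ge0// ltW.
have pc : a < p + N + 1 - c by rewrite /p /a; move: (n%:R : R) => t; lra.
have [D D0 hD] := FR_toN c0 p0 qc; have [E E0 hE] := FRN_gr pc.
exists (D * E) => // z zB; rewrite -mulrA EFinM (le_trans (hD z zB))// lee_wpmul2l//.
apply: (le_trans (hE z zB)); rewrite lee_fin.
by apply: eqle; congr (_ * _ `^ _); rewrite /p /a; ring.
Qed.

End FR.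

(** * Iterated derivatives along words of indices and their multi-indices *)

Section Words.
Implicit Types (U : set V) (w z : V) (J : seq 'I_n) (phi psi f g : V -> C).

(** Words rather than multi-indices: an induction can then peel off one derivative at either end,
    and [dzl_perm] recovers the symmetry. *)
Definition dzl J phi : V -> C := foldr (fun j g => dz j g) phi J.
Lemma Ck_dzl k U J phi : openU U -> Ck (size J + k) U phi -> Ck k U (dzl J phi).
move=> oU; elim: J k => [|j J ih] k //= h; apply: (Ck_dz j oU); apply: ih.
by rewrite addnS.
Qed.
Lemma dz_eq U j phi psi z : openU U -> Ck 1 U phi -> (forall w, U w -> phi w = psi w) -> U z ->
 dz j psi z = dz j phi z.
by move=> oU h e Uz; have [] := dz_loc j oU e Uz h. Qed.

Lemma dzl_loc U J phi psi : openU U -> Ck (size J) U phi -> (forall w, U w -> phi w = psi w) ->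
 forall z, U z -> dzl J psi z = dzl J phi z.
move=> oU; elim: J => [|j J ih] h e z Uz /=; first by rewrite e.
have h1 : Ck 1 U (dzl J phi) by apply: Ck_dzl => //; rewrite addn1.
by apply: (dz_eq j oU h1) => // w Uw; rewrite (ih (Ck_le1 h) e w Uw).
Qed.

Lemma dz_scale U c phi z j : openU U -> Ck 1 U phi -> U z -> dz j (fun w => c * phi w) z = c * dz j phi z.
move=> oU h Uz; have hc : Ck 1 U (fun=> c : C) by exact: Ck_cst.
by rewrite (dz_mul j Uz hc h) dz_cst mul0r add0r.
Qed.

Lemma dzl_lin U J c phi psi : openU U -> Ck (size J) U phi -> Ck (size J) U psi ->
 forall z, U z -> dzl J (fun w => c * phi w + psi w) z = c * dzl J phi z + dzl J psi z.
move=> oU; elim: J => [|j J ih] h1 h2 z Uz //=.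
have k1 : Ck 1 U (dzl J phi) by apply: Ck_dzl => //; rewrite addn1.
have k2 : Ck 1 U (dzl J psi) by apply: Ck_dzl => //; rewrite addn1.
have k3 : Ck 1 U (fun w => c * dzl J phi w) by exact: Ck_scale.
have k4 : Ck 1 U (fun w => c * dzl J phi w + dzl J psi w) by exact: Ck_add.
rewrite (dz_eq j oU k4 _ Uz); last by move=> w Uw; rewrite (ih (Ck_le1 h1) (Ck_le1 h2) w Uw).
by rewrite (dz_add j Uz k3 k2) (dz_scale c j oU k1 Uz).
Qed.

Lemma dzl_rem U J j phi : openU U -> j \in J -> Ck (size J) U phi ->
 forall z, U z -> dzl J phi z = dzl (j :: rem j J) phi z.
move=> oU; elim: J => [//|i J ih] /=; rewrite inE => jJ h z Uz.
have [->|ij] := eqVneq i j; first by [].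
have jJ' : j \in J by move: jJ; rewrite eq_sym (negPf ij).
have s1 : size J = (size (rem j J)).+1.
 by rewrite size_rem//; move: jJ'; case: (J).
have k0 : Ck 2 U (dzl (rem j J) phi) by apply: Ck_dzl => //; move: h; rewrite s1 addn2.
have k1 : Ck 1 U (dzl (j :: rem j J) phi) by exact: (Ck_dz j oU k0).
rewrite (dz_eq i oU k1 _ Uz); last by move=> w Uw; rewrite (ih jJ' (Ck_le1 h) w Uw).
exact: (dz_comm i j oU k0 Uz).
Qed.

Lemma dzl_perm U J J' phi : openU U -> perm_eq J J' -> Ck (size J) U phi ->
 forall z, U z -> dzl J phi z = dzl J' phi z.
move=> oU; elim: J J' => [|j J ih] J' pJ h z Uz.
 by have /perm_size := pJ; case: J' pJ.
have jJ' : j \in J' by rewrite -(perm_mem pJ) mem_head.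
have h' : Ck (size J') U phi by rewrite -(perm_size pJ).
rewrite (dzl_rem oU jJ' h' Uz).
have pJ' : perm_eq J (rem j J').
 by rewrite -(perm_cons j) (perm_trans pJ)// perm_to_rem.
have h1 : Ck 1 U (dzl J phi) by apply: Ck_dzl => //; rewrite addn1.
apply/esym; apply: (dz_eq j oU h1 _ Uz) => w Uw.
by rewrite (ih _ pJ' (Ck_le1 h) w Uw).
Qed.

Definition wrd (a : 'I_n -> nat) : seq 'I_n := flatten [seq nseq (a j) j | j <- enum 'I_n].
Lemma dzsE a phi : dzs a phi = dzl (wrd a) phi.
rewrite /dzs /wrd; elim: (enum 'I_n) => //= j s ->.
by rewrite /dzl foldr_cat; elim: (a j) => [//|k IH]; rewrite /= IH.
Qed.
Lemma size_wrd a : size (wrd a) = \sum_i a i.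
rewrite /wrd size_flatten /shape -map_comp sumnE big_map -[in RHS]big_enum /=.
by apply: eq_bigr => i _; rewrite size_nseq.
Qed.

Lemma perm_wrd J : perm_eq J (wrd (fun i => count_mem i J)).
apply/allP => x _; apply/eqP; rewrite /wrd count_flatten -map_comp sumnE big_map /=.
rewrite big_enum /= (bigD1 x) //= count_nseq /= eqxx mul1n big1 ?addn0// => i ix.
by rewrite count_nseq /= (negPf ix).
Qed.

Lemma sum_count J : \sum_i count_mem i J = size J.
by rewrite (perm_size (perm_wrd J)) size_wrd. Qed.

(** Derivatives commute, so the word can be sorted into [wrd] of its letter counts, and this is one
    of the terms of the sum. *)
Lemma abs_dz_ge j phi z J : size J = j -> Ck j UB phi -> uball z -> modC (dzl J phi z) <= abs_dz j phi z.
move=> sJ h zB; rewrite (dzl_perm oUB (perm_wrd J) _ zB) ?sJ// -dzsE /abs_dz.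
have cJ i : (count_mem i J < j.+1)%N by rewrite ltnS -sJ count_size.
pose a : {ffun 'I_n -> 'I_j.+1} := [ffun i => Ordinal (cJ i)].
have -> : dzs (fun i => count_mem i J) phi z = dzs (fun i => a i : nat) phi z.
 by congr (dzs _ phi z); apply/funext => i; rewrite ffunE.
rewrite (bigD1 a) /=; last first.
 by apply/eqP; apply: etrans (etrans (sum_count J) sJ); apply: eq_bigr => i _; rewrite ffunE.
by rewrite lerDl sumr_ge0// => i _; by [].
Qed.

Definition dbarl J phi : V -> C := foldr (fun j g => dbar j g) phi J.
Lemma dbarsE a phi : dbars a phi = dbarl (wrd a) phi.
rewrite /dbars /wrd; elim: (enum 'I_n) => //= j s ->.
by rewrite /dbarl foldr_cat; elim: (a j) => [//|k IH]; rewrite /= IH.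
Qed.
Lemma dbarl_cat J J' phi : dbarl (J ++ J') phi = dbarl J (dbarl J' phi).
by rewrite /dbarl foldr_cat. Qed.

Lemma dbar_zero j phi : (forall w, UB w -> phi w = 0) -> forall z, UB z -> dbar j phi z = 0.
move=> h z zB; have h0 : Ck 1 UB (fun=> 0 : C) by exact: Ck_cst.
have [_ ->] := @dz_loc _ _ UB (fun=> 0) phi z j oUB (fun w wB => esym (h w wB)) zB h0.
have hC : hol UB (fun=> 0 : C).
 by move=> w _; exists 0 => e e0; exists 1 => // k _; rewrite /blin big1 ?subrr ?modC0 ?mulr_ge0 ?nr_ge0 ?ltW// => i _; rewrite mxE mul0r.
exact: hol_dbar hC zB.
Qed.

Lemma dbarl_hol J phi : hol UB phi -> (0 < size J)%N -> forall z, UB z -> dbarl J phi z = 0.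
move=> hf; case/lastP: J => // J j _ z zB; rewrite -cats1 dbarl_cat.
have h : forall w, UB w -> dbarl [:: j] phi w = 0 by move=> w wB /=; rewrite (hol_dbar j hf wB).
elim: J z zB => [|i J ih] z zB; first exact: h.
exact: dbar_zero.
Qed.

Lemma dzl_zero J phi : (forall w, UB w -> phi w = 0) -> forall z, UB z -> dzl J phi z = 0.
move=> h z zB; have h0 k : Ck k UB (fun=> 0 : C) by exact: Ck_cst.
rewrite (dzl_loc oUB (h0 (size J)) (fun w wB => esym (h w wB)) zB) {h zB}.
by elim: J z => [|j J ih] //= z; rewrite (_ : dzl J _ = fun=> 0) ?dz_cst//; exact/funext.
Qed.

(* On holomorphic functions only the terms without antiholomorphic derivatives survive. *)
Lemma abs_d_hol_le j phi z (B : R) : hol UB phi -> UB z -> 0 <= B ->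
 (forall J, size J = j -> modC (dzl J phi z) <= B) ->
 abs_d j phi z <= B *+ #|{: {ffun 'I_n -> 'I_j.+1} * {ffun 'I_n -> 'I_j.+1}}|.
move=> hf zB B0 h; rewrite /abs_d.
apply: (@le_trans _ _ (\sum_(ab : {ffun 'I_n -> 'I_j.+1} * {ffun 'I_n -> 'I_j.+1}) B)).
 rewrite big_mkcond; apply: ler_sum => -[a b] _ /=.
 case: ifP => // /eqP ab; rewrite dzsE dbarsE.
 have [s0|s0] := posnP (size (wrd (fun i => b i : nat))).
  rewrite (size0nil s0) /=; apply: h; move: s0; rewrite !size_wrd => s0.
  by move: ab; rewrite s0 addn0.
 by rewrite (dzl_zero _ (dbarl_hol hf s0) zB) modC0.
by rewrite sumr_const.
Qed.

Lemma abs_d_ge j phi z J : size J = j -> Ck j UB phi -> uball z -> modC (dzl J phi z) <= abs_d j phi z.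
move=> sJ h zB; rewrite (dzl_perm oUB (perm_wrd J) _ zB) ?sJ// -dzsE /abs_d.
have cJ i : (count_mem i J < j.+1)%N by rewrite ltnS -sJ count_size.
pose a : {ffun 'I_n -> 'I_j.+1} := [ffun i => Ordinal (cJ i)].
pose b : {ffun 'I_n -> 'I_j.+1} := [ffun=> ord0].
have b0 : (\sum_i (b i : nat) = 0)%N by rewrite big1// => i _; rewrite ffunE.
have -> : dzs (fun i => count_mem i J) phi z = dzs (fun i => a i : nat) (dbars (fun i => b i : nat) phi) z.
 have -> : dbars (fun i => b i : nat) phi = phi.
  by rewrite dbarsE (_ : wrd _ = [::])//; apply: size0nil; rewrite size_wrd.
 by congr (dzs _ phi z); apply/funext => i; rewrite ffunE.
rewrite (bigD1 (a, b)) /=; last first.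
 rewrite b0 addn0; apply/eqP; apply: etrans (etrans (sum_count J) sJ).
 by apply: eq_bigr => i _; rewrite ffunE.
by rewrite lerDl sumr_ge0// => i _; by [].
Qed.

Lemma cat_dzl J J' phi : dzl (J ++ J') phi = dzl J (dzl J' phi).
by rewrite /dzl foldr_cat. Qed.

End Words.

(** * Integrals against the kernel are holomorphic; their derivatives *)

Section HolWords.
Implicit Types (U : set V) (w z : V) (J : seq 'I_n) (f g : V -> C).

(** For a holomorphic function every directional derivative is a combination of the [dz j], so the
    induction stays among the derivatives [dzl J f]. *)
Lemma Ck_of_hol U f : openU U -> (forall J, hol U (dzl J f)) -> forall k, Ck k U f.
move=> oU h k; elim: k f h => [|k ih] f h.
 by split=> // z Uz; exact: hol_cont (h [::]) Uz.
apply: CkS_intro => [z Uz|v cv]; first exact: hol_cont (h [::]) Uz.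
split=> [z Uz|]; first exact: hol_dir v (h [::]) Uz.
have hj j : Ck k U (fun z => v 0 j * dz j f z).
 apply: (Ck_scale (v 0 j) oU); apply: ih => J.
 by have := h (rcons J j); rewrite -cats1 cat_dzl.
apply: Ck_ext oU _ (Ck_sum (enum 'I_n) oU hj) => z Uz.
rewrite (hol_dirE v (h [::]) Uz) big_enum /=; apply: eq_bigr => j _.
by rewrite mulrC.
Qed.

Definition Ik (c : V -> C) (a : R) z : C := cintB (fun w => c w * ker a w z).

Lemma cok_Ik c a z : cok c -> 0 <= a -> uball z -> cok (fun w => c w * ker a w z).
move=> [mc oc] a0 zB; have [M hM] := smb_bnd (smb_ker 0 a0 zB).
have mk : cmeas (fun w => ker a w z).
 by apply: cmeas_cont => w /uball_le; exact: smb_cont (smb_ker 0 a0 zB) w.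
pose M' := Num.max M 0.
have M0 : (0 <= M'%:E)%E by rewrite lee_fin le_max lexx orbT.
have m1 : emeas (fun w => M'%:E * (modC (c w))%:E)%E by apply: measurable_funeM; exact: emeas_mod.
apply: (cok_le (cmeasM mc mk) m1).
 rewrite (IeZ (emeas_mod mc) _ M0); last by move=> w _; rewrite lee_fin modC_ge0.
 by rewrite lte_mul_pinfty.
move=> w wB; rewrite -EFinM lee_fin modCM mulrC ler_wpM2r//.
by rewrite le_max hM// uball_le.
Qed.

Lemma cok_coordJ j c : cok c -> cok (fun w => cj (w 0 j) * c w).
move=> [mc oc]; have mj : cmeas (fun w : V => cj (w 0 j)).
 apply: cmeas_cont => w _; apply: cont_cj; apply: (Ck_cont (k := 0) (U := setT) _ I); exact: Ck_coord.
apply: (cok_le (cmeasM mj mc) (emeas_mod mc) oc) => w wB.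
rewrite lee_fin modCM modCJ ler_piMl//.
by rewrite (le_trans (modC_coord w j))// uball_le.
Qed.

(** Differentiation under the integral: the remainder bound of [ker_taylor] is uniform in [w] and
    quadratic in [h], so it survives integration against [|c|]. *)
Lemma fder_Ik c a z : cok c -> 0 <= a -> uball z ->
 fder (Ik c a) z (\row_j Ik (fun w => rc a * (cj (w 0 j) * c w)) (a + 1) z).
move=> okc a0 zB; have [mc oc] := okc; have z1 := zB; rewrite uballE in z1.
pose L : R := 4 * a * (a + 1) * ((1 - nr z) / 2) `^ (- (a + 2)).
have L0 : 0 <= L by rewrite !mulr_ge0// powR_ge0.
pose S := fine (Ie (fun w => (modC (c w))%:E)).
have IS : Ie (fun w => (modC (c w))%:E) = S%:E.
 by rewrite fineK// ge0_fin_numE//; apply: Ie_ge0 => w _; rewrite lee_fin modC_ge0.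
have S0 : 0 <= S by rewrite -lee_fin -IS; apply: Ie_ge0 => w _; rewrite lee_fin modC_ge0.
have H h : nr h < (1 - nr z) / 2 ->
 modC (Ik c a (z + h) - Ik c a z - blin (\row_j Ik (fun w => rc a * (cj (w 0 j) * c w)) (a + 1) z) h) <=
 2 * (L * S) * nr h ^+ 2.
 move=> hh; have zh : uball (z + h).
  by rewrite uballE; have := nrD z h; lra.
 have k1 := cok_Ik okc a0 zB; have k2 := cok_Ik okc a0 zh.
 have k3 j : cok (fun w => (h 0 j * rc a) * ((cj (w 0 j) * c w) * ker (a + 1) w z)).
  by apply: cokZ; apply: cok_Ik => //; exact: cok_coordJ.
 have [k4 E4] := cintB_sum (enum 'I_n) k3.
 have -> : blin (\row_j Ik (fun w => rc a * (cj (w 0 j) * c w)) (a + 1) z) h =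
   cintB (fun w => \sum_(j <- enum 'I_n) (h 0 j * rc a) * ((cj (w 0 j) * c w) * ker (a + 1) w z)).
  rewrite E4 /blin big_enum; apply: eq_bigr => j _; rewrite mxE /Ik.
  have k5 : cok (fun w => (cj (w 0 j) * c w) * ker (a + 1) w z) by apply: cok_Ik => //; exact: cok_coordJ.
  have -> : cintB (fun w => rc a * (cj (w 0 j) * c w) * ker (a + 1) w z) =
    rc a * cintB (fun w => (cj (w 0 j) * c w) * ker (a + 1) w z).
   by rewrite -(cintBZ (rc a) k5); apply: cintB_eq => w _; rewrite !mulrA.
  rewrite (cintBZ (h 0 j * rc a) k5); move: (cintB _) (h 0 j) (rc a) => X y x; ring.
 rewrite /Ik -(cintBB k2 k1) -(cintBB (cokB k2 k1) k4) -lee_fin.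
 have [m5 _] := cokB (cokB k2 k1) k4.
 apply: (le_trans (modC_cintB m5)); rewrite -[X in (_ <= X%:E)%E]mulrA EFinM lee_wpmul2l//.
 apply: (@le_trans _ _ (Ie (fun w => (L * nr h ^+ 2)%:E * (modC (c w))%:E)%E)).
  apply: Ie_le.
  - exact: emeas_mod.
  - by apply: measurable_funeM; exact: emeas_mod.
  - by move=> w _; rewrite lee_fin modC_ge0.
  move=> w wB; rewrite -EFinM lee_fin.
  have -> : \sum_(j <- enum 'I_n) h 0 j * rc a * (cj (w 0 j) * c w * ker (a + 1) w z) =
    c w * (rc a * herm w h * ker (a + 1) w z).
   rewrite hermE big_enum !mulr_sumr mulr_suml mulr_sumr; apply: eq_bigr => j _ /=.
   by move: (h 0 j) (rc a) (cj _) (c w) (ker _ _ _) => x1 x2 x3 x4 x5; ring.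
  rewrite -!mulrBr modCM mulrC ler_wpM2r//.
  exact: ker_taylor (uball_le wB) z1 hh.
 rewrite (IeZ (emeas_mod mc)); first last.
 - by [].
 - by move=> w _; rewrite lee_fin modC_ge0.
 - by rewrite IS -EFinM lee_fin; apply: eqle; ring.
move=> e e0; pose M := 2 * (L * S) + 1.
have M0 : 0 < M by have := mulr_ge0 L0 S0; rewrite /M; lra.
exists (Num.min ((1 - nr z) / 2) (e / M)) => [|h]; rewrite lt_min ?divr_gt0 ?subr_gt0//.
move=> /andP[/H h1 h2]; apply: (le_trans h1); rewrite ltr_pdivlMr// in h2.
rewrite expr2 mulrA; apply: ler_wpM2r; first exact: nr_ge0.
have := nr_ge0 h; move: h2; rewrite /M.
by move: (nr h) (2 * (L * S)) => x y; rewrite mulrDr mulr1 mulrC; lra.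
Qed.

Lemma hol_Ik c a : cok c -> 0 <= a -> hol UB (Ik c a).
by move=> okc a0 z zB; eexists; exact: fder_Ik. Qed.

(** Coefficient of [ker (a + |J|)] in the derivative of [ker a] along [J]: a rising factorial times
    a monomial in the conjugate coordinates. *)
Fixpoint mu (a : R) J w : C :=
 if J is j :: J' then rc (a + (size J')%:R) * (cj (w 0 j) * mu a J' w) else 1.

Lemma cok_mu c a J : cok c -> cok (fun w => mu a J w * c w).
move=> okc; elim: J => [|j J ih] /=; first by apply: cok_ext okc => w _; rewrite mul1r.
by apply: cok_ext _ (cokZ (rc (a + (size J)%:R)) (cok_coordJ j ih)) => w _; rewrite !mulrA.
Qed.

Lemma mu_bnd a l : 0 <= a -> const D,
 forall J w, size J = l -> uball w -> modC (mu a J w) <= D.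
move=> a0; elim: l => [|l [D D0 hD]].
 by exists 1 => // -[|//] w _ _; rewrite modC1.
exists ((a + l%:R) * D) => [|[//|j J] w [sJ] wB]; first by rewrite mulr_ge0// addr_ge0.
rewrite /= sJ modCM modCR ger0_norm ?addr_ge0// ler_wpM2l ?addr_ge0//.
rewrite modCM -[leRHS]mul1r ler_pM ?modC_ge0 ?hD// modCJ.
by rewrite (le_trans (modC_coord w j))// uball_le.
Qed.

Lemma dzl_Ik c a J z : cok c -> 0 <= a -> uball z ->
 dzl J (Ik c a) z = Ik (fun w => mu a J w * c w) (a + (size J)%:R) z.
move=> okc a0;
elim: J z => [|j J ih] z zB /=.
 by rewrite addr0; apply: cintB_eq => w _; rewrite mul1r.
have a1 : 0 <= a + (size J)%:R by rewrite addr_ge0.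
have okJ := cok_mu a J okc.
have C1 : Ck 1 UB (Ik (fun w => mu a J w * c w) (a + (size J)%:R)) by apply: hol_C1 => //; exact: hol_Ik.
rewrite (dz_eq j oUB C1 _ zB); last by move=> w wB; rewrite (ih w wB).
have [-> _] := fder_dz j (fder_Ik okJ a1 zB).
rewrite mxE -natr1 addrA; apply: cintB_eq => w _; by rewrite !mulrA.
Qed.

Lemma fder_dil g (s : R) z a : 0 < s -> fder g (rc s *: z) a -> fder (fun w => g (rc s *: w)) z (rc s *: a).
move=> s0 h e e0; have [d d0 hd] := h _ (divr_gt0 e0 s0).
exists (d / s) => [|k]; first exact: divr_gt0.
rewrite ltr_pdivlMr// => hk; have := hd (rc s *: k); rewrite nrZR (gtr0_norm s0) mulrC => /(_ hk).
have -> : blin (rc s *: a) k = blin a (rc s *: k).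
 by rewrite /blin; apply: eq_bigr => j _; rewrite !mxE mulrCA mulrA.
move=> /le_trans h2; rewrite scalerDr; apply: h2.
by apply: eqle; move: (nr k) => x; field; rewrite gt_eqF.
Qed.

End HolWords.

(** * Potentials of a function and their composition *)

Section Measures.
Implicit Types (w z u : V) (f g : V -> C).

Lemma emeas_nrlt (G : V -> \bar R) (r : R) : emeas G -> emeas (fun w => if nr w < r then G w else 0%E).
move=> /emeas_if mG; apply/emeas_if.
have : mfun (fun t : T => if tn t < r then (if tn t < 1 then G (toC t) else 0%E) else 0%E).
 apply: measurable_fun_ifT => //.
 by apply: measurable_fun_ltr => //; exact: meas_tn.
by apply: eq_measurable_fun => t _; rewrite nr_toC; case: ifP; case: ifP.
Qed.

Lemma dilation_le (G : V -> \bar R) (r : R) : 0 < r < 1 -> emeas G -> (forB w, (0 <= G w)%E) ->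
 (Ie (fun w => G (rc r *: w)) <= (r ^- (n + n))%:E * Ie G)%E.
move=> r01 mG G0; have /andP[r0 r1] := r01; rewrite (dilation_ball r01 mG G0); apply: lee_wpmul2l.
 by rewrite lee_fin invr_ge0 exprn_ge0// ltW.
apply: Ie_le => //; first exact: emeas_nrlt.
- by move=> w /G0; case: ifP.
- by move=> w /G0; case: ifP.
Qed.

Lemma emeas_dil (G : V -> \bar R) (r : R) : 0 < r < 1 -> emeas G -> emeas (fun w => G (rc r *: w)).
move=> /andP[r0 r1] /(emeas_nrlt r) /emeas_if mG; apply/emeas_if.
have := measurableT_comp mG (@meas_taff R _ r (fun=> 0%R)).
apply: eq_measurable_fun => t _ /=; rewrite -/(tsc r t) tsc_tn ?(ltW r0)// toC_tsc nrZR (gtr0_norm r0) nr_toC.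
rewrite gtr_pMr//; case: ifP => h1; case: ifP => h2//.
by rewrite mulr_ilt1 ?tn_ge0 ?(ltW r0) in h1.
Qed.

Lemma cmeas_hol f : hol UB f -> cmeas f.
by move=> h; apply: cmeas_cont => z zB; exact: hol_cont h zB. Qed.

Lemma meas2_fst (g : V -> \bar R) : emeas g -> meas2 (fun z w => g z).
move=> /emeas_if mg; rewrite /meas2.
have : mfun (fun p : T * T => if (tn p.2 < 1)%R then (if (tn p.1 < 1)%R then g (toC p.1) else 0%E) else 0%E).
 apply: measurable_fun_ifT => //.
  by apply: measurable_fun_ltr => //; apply: measurableT_comp measurable_snd => //; exact: meas_tn.
 exact: measurableT_comp mg measurable_fst.
by apply: eq_measurable_fun => p _; case: (tn p.1 < 1)%R; case: (tn p.2 < 1)%R.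
Qed.

Lemma meas2_snd (g : V -> \bar R) : emeas g -> meas2 (fun z w => g w).
move=> /emeas_if mg; rewrite /meas2.
have : mfun (fun p : T * T => if (tn p.1 < 1)%R then (if (tn p.2 < 1)%R then g (toC p.2) else 0%E) else 0%E).
 apply: measurable_fun_ifT => //.
  by apply: measurable_fun_ltr => //; apply: measurableT_comp measurable_fst => //; exact: meas_tn.
 exact: measurableT_comp mg measurable_snd.
by apply: eq_measurable_fun => p _; case: (tn p.1 < 1)%R; case: (tn p.2 < 1)%R.
Qed.

Lemma meas2M (F G : V -> V -> \bar R) : meas2 F -> meas2 G -> meas2 (fun z w => F z w * G z w)%E.
move=> mF mG; have := emeasurable_funM mF mG.
by apply: eq_measurable_fun => p _; case: ifP => //; rewrite mule0.
Qed.

Lemma meas2_dist (q : R) : meas2 (fun z w => (dist z w `^ q)%:E).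
pose re2 (p : T * T) := \sum_(j < n) (tnth p.1 (lshift n j) * tnth p.2 (lshift n j) + tnth p.1 (rshift n j) * tnth p.2 (rshift n j)).
pose im2 (p : T * T) := \sum_(j < n) (tnth p.1 (lshift n j) * tnth p.2 (rshift n j) - tnth p.1 (rshift n j) * tnth p.2 (lshift n j)).
have m1 i : mfun (fun p : T * T => tnth p.1 i : measurableTypeR R).
 by apply: (measurableT_comp (measurable_tnth i)); exact: measurable_fst.
have m2 i : mfun (fun p : T * T => tnth p.2 i : measurableTypeR R).
 by apply: (measurableT_comp (measurable_tnth i)); exact: measurable_snd.
have mre : mfun (re2 : _ -> measurableTypeR R).
 by rewrite /re2; apply: measurable_sum => j; apply: measurable_funD; apply: measurable_funM; [exact: m1|exact: m2|exact: m1|exact: m2].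
have mim : mfun (im2 : _ -> measurableTypeR R).
 by rewrite /im2; apply: measurable_sum => j; apply: measurable_funB; apply: measurable_funM; [exact: m1|exact: m2|exact: m1|exact: m2].
have E p : dist (toC p.1) (toC p.2) = Num.sqrt ((1 - re2 p) ^+ 2 + (im2 p) ^+ 2).
 rewrite /dist modCE hermE; congr (Num.sqrt (_ ^+ 2 + _)).
  by rewrite !ReImE [re (\sum_j _)]Re_sum; congr (_ - _); apply: eq_bigr => j _; rewrite !ReImE !re_toC !im_toC mulNr opprK.
 rewrite !ReImE sub0r sqrrN [im (\sum_j _)]Im_sum; congr (_ ^+ 2); apply: eq_bigr => j _.
 by rewrite !ReImE !re_toC !im_toC mulNr.
have m0 : mfun (fun p : T * T => dist (toC p.1) (toC p.2) : measurableTypeR R).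
 rewrite (_ : (fun p => _) = fun p => Num.sqrt ((1 - re2 p) ^+ 2 + (im2 p) ^+ 2)); last exact/funext.
 apply: (measurableT_comp (f := @Num.sqrt R)).
  by apply: continuous_measurable_fun; exact: sqrt_continuous.
 by apply: measurable_funD; apply: measurable_funX => //; apply: measurable_funB.
have m3 : mfun (fun p : T * T => dist (toC p.1) (toC p.2) `^ q : measurableTypeR R).
 exact: (measurableT_comp (@measurable_powR R q) m0).
apply: measurable_fun_ifT => //; last exact/measurable_EFinP.
by apply: measurable_and; apply: measurable_fun_ltr => //; apply: (measurableT_comp (@meas_tn _ _)); [exact: measurable_fst|exact: measurable_snd].
Qed.

(** The potential of [|f|] with kernel [dist^(-q)] and weight [c]. *)
Definition Jf f (q c : R) z : \bar R := Ie (fun u => (modC (f u) * (dist u z `^ (- q) * weight u `^ c))%:E).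
Lemma Jf_ge0 f q c z : (0 <= Jf f q c z)%E.
by apply: Ie_ge0 => w _; rewrite lee_fin. Qed.

Lemma emeas_Jf0 f q c z : cmeas f -> uball z ->
 emeas (fun u => (modC (f u) * (dist u z `^ (- q) * weight u `^ c))%:E).
move=> mf zB.
have mm : emeas (fun w => (modC (f w))%:E * (dist w z `^ (- q) * weight w `^ c)%:E)%E.
 exact: emeasurable_funM (emeas_mod mf) (emeas_dist (- q) c zB).
by apply: emeas_ext _ mm => w _; rewrite -EFinM.
Qed.

Lemma emeas_pow c : emeas (fun w : V => (weight w `^ c)%:E).
by apply/emeas_rc; exact: cmeas_pow. Qed.

Lemma meas2_Jf f q c : cmeas f -> meas2 (fun z u => (modC (f u) * (dist u z `^ (- q) * weight u `^ c))%:E).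
move=> mf; have := meas2M (meas2M (meas2_dist (- q)) (meas2_snd (emeas_mod mf))) (meas2_snd (emeas_pow c)).
rewrite /meas2; apply: eq_measurable_fun => p _; case: ifP => // _.
by rewrite -!EFinM distC; congr (_%:E); ring.
Qed.

Lemma emeas_Jf f q c : cmeas f -> emeas (fun z => Jf f q c z).
move=> mf; apply: tonelli_emeas1 (meas2_Jf q c mf) _ => z w _ _.
by [].
Qed.

Lemma Jf_tonelli f q c (g : V -> R) : cmeas f -> emeas (fun z => (g z)%:E) -> (forB z, 0 <= g z) ->
 Ie (fun z => ((g z)%:E * Jf f q c z)%E) =
 Ie (fun u => ((modC (f u) * weight u `^ c)%:E * Ie (fun z => (g z * dist u z `^ (- q))%:E))%E).
move=> mf mg g0.
pose F z u : \bar R := ((g z)%:E * (modC (f u) * (dist u z `^ (- q) * weight u `^ c))%:E)%E.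
have mF : meas2 F by apply: meas2M (meas2_fst mg) (meas2_Jf q c mf).
have F0 z u : uball z -> uball u -> (0 <= F z u)%E.
 by move=> /g0 h _; rewrite /F -EFinM lee_fin.
have := tonelli_ball mF F0; rewrite /F => E.
transitivity (Ie (fun z => Ie (F z))).
 apply: Ie_eq => z zB; rewrite /F; apply/esym; apply: (IeZ (emeas_Jf0 q c mf zB)).
 - by move=> w _; rewrite lee_fin !mulr_ge0.
 - by rewrite lee_fin g0.
rewrite E; apply: Ie_eq => u uB; rewrite -IeZ; first last.
- by rewrite lee_fin mulr_ge0 ?modC_ge0 ?powR_ge0.
- by move=> z /g0 h; rewrite lee_fin mulr_ge0 ?powR_ge0.
- have mm : emeas (fun w => (g w)%:E * (dist w u `^ (- q) * weight w `^ 0)%:E)%E.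
  exact: emeasurable_funM mg (emeas_dist (- q) 0 uB).
 by apply: emeas_ext _ mm => z _; rewrite -EFinM powRr0 mulr1 distC.
- by apply: Ie_eq => z _; rewrite -!EFinM; congr (_%:E); ring.
Qed.

Lemma emeasM_fin (p q : V -> R) : emeas (fun w => (p w)%:E) -> emeas (fun w => (q w)%:E) ->
 emeas (fun w => (p w * q w)%:E).
move=> mp mq; have mm : emeas (fun w => (p w)%:E * (q w)%:E)%E by exact: emeasurable_funM.
exact: (emeas_ext (fun w _ => esym (EFinM (p w) (q w))) mm).
Qed.

(** Integrating a potential against [g] means, by Tonelli, integrating [|f|] against the potential
    of [g]; a bound [H] for the latter suffices. *)
Lemma Jf_comp f q c (g H : V -> R) : cmeas f -> emeas (fun z => (g z)%:E) -> (forB z, 0 <= g z) ->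
 emeas (fun u => (H u)%:E) ->
 (forB u, (Ie (fun z => (g z * dist u z `^ (- q))%:E) <= (H u)%:E)%E) ->
 (Ie (fun z => (g z)%:E * Jf f q c z) <= Ie (fun u => (modC (f u) * weight u `^ c * H u)%:E))%E.
move=> mf mg g0 mH hH; rewrite (Jf_tonelli q c mf mg g0).
have mL : emeas (fun u => (modC (f u) * weight u `^ c)%:E) by exact: emeasM_fin (emeas_mod mf) (emeas_pow c).
have I0 u z : uball z -> (0 <= (g z * dist u z `^ (- q))%:E)%E by move=> zB; rewrite lee_fin mulr_ge0 ?g0.
have mI : emeas (fun u => Ie (fun z => (g z * dist u z `^ (- q))%:E)).
 apply: (tonelli_emeas2 (F := fun z u => (g z * dist u z `^ (- q))%:E)) => [|z u zB _]; last exact: I0.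
 have := meas2M (meas2_fst mg) (meas2_dist (- q)).
 by rewrite /meas2; apply: eq_measurable_fun => p _; rewrite -EFinM [dist (toC p.1) _]distC.
apply: Ie_le.
- exact: emeasurable_funM.
- exact: emeasM_fin mL mH.
- by move=> u _; rewrite mule_ge0// Ie_ge0// => z; exact: I0.
- by move=> u uB; rewrite [leRHS]EFinM; apply: lee_wpmul2l => //; exact: hH.
Qed.

End Measures.

(** * Smoothness of holomorphic functions; pointwise control of dilates *)

Section Maximal.
Implicit Types (w z u : V) (f g : V -> C).

Let a := dN + 1.
Let a0 : 0 <= a.
by rewrite !addr_ge0. Qed.
Lemma uball_dil (r : R) z : 0 < r < 1 -> uball z -> uball (rc r *: z).
move=> /andP[r0 r1]; rewrite !uballE nrZR gtr0_norm// => z1.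
by rewrite mulr_ilt1 ?nr_ge0// ltW.
Qed.
Lemma hol_dil f (r : R) : 0 < r < 1 -> hol UB f -> hol UB (fun w => f (rc r *: w)).
move=> r01 hf z /(uball_dil r01) /hf [b hb]; eexists; apply: fder_dil hb; by case/andP: r01.
Qed.

Lemma repr_dil f (r : R) z : 0 < r < 1 -> hol UB f -> uball z ->
 cok (fun w => f (rc r *: w) * wtp N w) /\
 f (rc r *: z) = rc (kap 0) * Ik (fun w => f (rc r *: w) * wtp N w) a z.
move=> r01 hf zB; have sg : smb 1 (fun w => f (rc r *: w)) by apply: smb_dil => //; apply: hol_C1 => //; exact: openU_uball.
have [_ E] := repr_hol 0 sg (fun w j wB => hol_dbar j (hol_dil r01 hf) wB) zB.
have [M hM] := smb_bnd sg.
split; last first.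
 rewrite E /Ik; congr (_ * _); apply: cintB_eq => w _; rewrite addr0 /a mulrAC.
 by [].
apply: (@cok_bnd R n _ (Num.max M 0)).
 have mf : cmeas (fun w => f (rc r *: w)) by apply: cmeas_cont => w /uball_le; exact: smb_cont sg w.
 exact: (cmeasM mf (@cmeas_pow R n N)).
move=> w wB; rewrite modCM modCR ger0_norm//.
apply: (@le_trans _ _ (modC (f (rc r *: w)) * 1)).
 by rewrite ler_wpM2l ?modC_ge0// weight_powR_le1.
by rewrite mulr1 le_max hM// uball_le.
Qed.

(** For [|w| < r] the reproducing formula for [f (r .)] writes [f w] as [Ik c a (w / r)], and the
    partial derivatives of [Ik] are again integrals of this kind, hence holomorphic. This lifts
    class C^1 to all orders. *)
Lemma hol_dz f j : hol UB f -> hol UB (dz j f).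
move=> hf z zB; rewrite uballE in zB; have z0 := nr_ge0 z.
pose r := (1 + nr z) / 2; have r01 : 0 < r < 1 by rewrite /r; apply/andP; split; lra.
have r0 : 0 < r by case/andP: r01.
have zr : nr z < r by rewrite /r; lra.
have z0B : uball (0 : V) by rewrite uballE nr0.
pose c w := rc (kap 0) * (f (rc r *: w) * wtp N w).
have okc : cok c by apply: cokZ; have [] := repr_dil r01 hf z0B.
have s0 : 0 < r^-1 by rewrite invr_gt0.
have E w : bigb r w -> f w = Ik c a (rc r^-1 *: w).
 move=> wr; have wB : uball (rc r^-1 *: w).
  by rewrite uballE nrZR gtr0_norm// mulrC ltr_pdivrMr// mul1r.
 have [k2 E2] := repr_dil r01 hf wB.
 have -> : f w = f (rc r *: (rc r^-1 *: w)) by rewrite scalerA -RtoCM divff ?gt_eqF// scale1r.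
 rewrite E2 /Ik -(cintBZ (rc (kap 0)) (cok_Ik k2 a0 wB)).
 by apply: cintB_eq => u _; rewrite /c !mulrA.
pose g := Ik (fun w => rc a * (cj (w 0 j) * c w)) (a + 1).
have hg : hol UB g by apply: hol_Ik; [apply: cokZ; exact: cok_coordJ|by []].
have E1 w : bigb r w -> dz j f w = rc r^-1 * g (rc r^-1 *: w).
 move=> wr; have wB : uball (rc r^-1 *: w).
  by rewrite uballE nrZR gtr0_norm// mulrC ltr_pdivrMr// mul1r.
 have [e1 _] := fder_dz j (fder_dil s0 (fder_Ik okc a0 wB)); rewrite !mxE in e1; rewrite -e1.
 have wB' : uball w by move: wr; rewrite /bigb /= uballE => /lt_trans; apply; case/andP: r01.
 apply/esym; apply: (dz_eq j (@openU_bigb R n r)) E _ => //.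
 apply: Ck_sub (hol_C1 oUB hf) => u; rewrite /bigb /= uballE => /lt_trans; apply.
 by case/andP: r01.
have zB' : uball (rc r^-1 *: z) by rewrite uballE nrZR gtr0_norm// mulrC ltr_pdivrMr// mul1r.
have [b hb] := hg _ zB'.
have hb' := fder_dil s0 hb.
exists (rc r^-1 *: (rc r^-1 *: b)) => e e0.
have [d d0 hd] := hb' _ (mulr_gt0 r0 e0); exists (Num.min d (r - nr z)) => [|h].
 by rewrite lt_min d0 subr_gt0.
rewrite lt_min => /andP[h1 h2]; have h3 : bigb r (z + h).
 by rewrite /bigb /=; have := nrD z h; lra.
rewrite (E1 _ h3) (E1 _ zr) /blin.
have -> : \sum_j (rc r^-1 *: (rc r^-1 *: b)) 0 j * h 0 j = rc r^-1 * \sum_j (rc r^-1 *: b) 0 j * h 0 j.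
 by rewrite mulr_sumr; apply: eq_bigr => i _; rewrite !mxE !mulrA.
rewrite -!mulrBr modCM modCR gtr0_norm// mulrC ler_pdivrMr//.
by apply: (le_trans (hd _ h1)); apply: eqle; ring.
Qed.

Lemma hol_dzl f J : hol UB f -> hol UB (dzl J f).
by move=> hf; elim: J => [|j J ih] //=; exact: hol_dz. Qed.
Lemma hol_Ck f k : hol UB f -> Ck k UB f.
by move=> hf; apply: Ck_of_hol => [|J]; [exact: openU_uball|exact: hol_dzl]. Qed.
Lemma kap0_gt0 : 0 < kap 0.
exact: (kap_gt0 0). Qed.

(* Apply the reproducing formula to [f (rho .)], [rho = sqrt r], at [rho z]. *)
Lemma dil_maximal : const D, forall f (r : R) z, hol UB f -> 4^-1 <= r < 1 -> uball z ->
 ((modC (f (rc r *: z)))%:E <= D%:E * Jf f a N z)%E.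
have k0 := kap0_gt0.
(* One factor 2 is that of [modC_cintB]; the power undoes a dilation by [s >= 1/2] in real dimension
   [2n], which is what [r >= 1/4] is for. *)
exists (kap 0 * (2 * 2 ^+ (n + n))) => [|f r z hf /andP[r4 r1] zB].
 by [].
pose s := Num.sqrt r; have r0 : 0 < r by apply: lt_le_trans r4; rewrite invr_gt0.
have s0 : 0 < s by rewrite sqrtr_gt0.
have ss : s * s = r by rewrite -expr2 sqr_sqrtr// ltW.
have s1 : s < 1 by nra.
have s2 : 2^-1 <= s by rewrite leNgt; apply/negP => h; move: r4; rewrite -ss; nra.
have s01 : 0 < s < 1 by rewrite s0 s1.
have szB := uball_dil s01 zB.
have [ok E] := repr_dil s01 hf szB.
have -> : rc r *: z = rc s *: (rc s *: z) by rewrite scalerA -RtoCM ss.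
rewrite E modCM modCR (gtr0_norm k0); move: (kap 0) k0 => kk k0.
rewrite !EFinM -!muleA; apply: lee_pmul => //.
have [mi _] := cok_Ik ok a0 szB.
apply: (le_trans (modC_cintB mi)); rewrite lee_wpmul2l//.
have mG := emeas_Jf0 a N (cmeas_hol hf) zB.
have G0 w : uball w -> (0 <= (modC (f w) * (dist w z `^ (- a) * weight w `^ N))%:E)%E.
 by [].
apply: (@le_trans _ _ (Ie (fun w => (modC (f (rc s *: w)) * (dist (rc s *: w) z `^ (- a) * weight (rc s *: w) `^ N))%:E))).
 apply: Ie_le.
 - exact: emeas_mod.
 - exact: (emeas_dil s01 mG).
 - by move=> w _; rewrite lee_fin modC_ge0.
 move=> w wB; rewrite lee_fin 2!modCM modC_ker; last exact: mul_nr_lt (uball_le wB) szB.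
 rewrite modCR ger0_norm ?powR_ge0//.
 have -> : dist (rc s *: w) z = dist w (rc s *: z) by rewrite /dist hermZr hermZl /rc conjCR.
 rewrite -mulrA ler_wpM2l ?modC_ge0// mulrC ler_wpM2l ?powR_ge0//.
 apply: ge0_ler_powR => //; rewrite ?nnegrE ?(ltW (weight_gt0 _))//; first exact: uball_dil.
 by rewrite /weight sqnormZ modCR (gtr0_norm s0) lerD2l lerN2 ler_piMl ?sqnorm_ge0// exprn_ile1// ltW.
apply: (le_trans (dilation_le s01 mG G0)); rewrite lee_wpmul2r ?Jf_ge0// lee_fin.
rewrite -exprVn; apply: lerXn2r; rewrite ?nnegrE ?invr_ge0 ?(ltW s0)//.
by rewrite -[leRHS]invrK lef_pV2 ?posrE ?invr_gt0.
Qed.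

End Maximal.

Lemma uball0 : UB 0. by rewrite uballE nr0. Qed.

(** * Limits of complex sequences, and the dilations along which they are taken *)

Section Slim.
Implicit Types (u v : nat -> C) (l m : C) (w z : V).

Definition slim u l := forall e : R, 0 < e -> exists i0, forall k, (i0 <= k)%N -> modC (u k - l) < e.
Lemma slim_cst l : slim (fun=> l) l.
by move=> e e0; exists 0%N => k _; rewrite subrr modC0. Qed.

Lemma slimD u v l m : slim u l -> slim v m -> slim (fun k => u k + v k) (l + m).
move=> hu hv e e0; have e2 : 0 < e / 2 by rewrite divr_gt0.
have [K1 h1] := hu _ e2; have [K2 h2] := hv _ e2; exists (maxn K1 K2) => k; rewrite geq_max => /andP[/h1 k1 /h2 k2].
have -> : u k + v k - (l + m) = (u k - l) + (v k - m) by ring.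
by have := modCD (u k - l) (v k - m); lra.
Qed.

Lemma slimM u v l m : slim u l -> slim v m -> slim (fun k => u k * v k) (l * m).
move=> hu hv e e0; pose L := 1 + modC l + modC m.
have L1 : 1 <= L by rewrite /L; have := modC_ge0 l; have := modC_ge0 m; lra.
have L0 : 0 < L by lra.
pose e' := Num.min 1 (e / (2 * L)); have e'0 : 0 < e' by rewrite lt_min ltr01 divr_gt0// mulr_gt0.
have [K1 h1] := hu _ e'0; have [K2 h2] := hv _ e'0; exists (maxn K1 K2) => k; rewrite geq_max => /andP[/h1 k1 /h2 k2].
have -> : u k * v k - l * m = (u k - l) * (v k - m) + (l * (v k - m) + m * (u k - l)) by ring.
have a1 := modCD ((u k - l) * (v k - m)) (l * (v k - m) + m * (u k - l)).
have a2 := modCD (l * (v k - m)) (m * (u k - l)).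
rewrite !modCM in a1 a2; move: k1 k2; rewrite !lt_min => /andP[k1 k1'] /andP[k2 k2'].
rewrite ltr_pdivlMr ?mulr_gt0// in k1'; rewrite ltr_pdivlMr ?mulr_gt0// in k2'.
have := modC_ge0 (u k - l); have := modC_ge0 (v k - m).
move: a1 a2 k1 k2 k1' k2' (modC_ge0 l) (modC_ge0 m) L0; rewrite /L.
move: (modC (u k - l)) (modC (v k - m)) (modC l) (modC m) (modC (_ + _)) (modC (_ + _)) => a b c d s t.
clear; move=> *; nra.
Qed.

Lemma slim_sum I (r : seq I) (u : I -> nat -> C) (l : I -> C) : (forall i, slim (u i) (l i)) ->
 slim (fun k => \sum_(i <- r) u i k) (\sum_(i <- r) l i).
move=> h; elim: r => [|i r ih].
 by move=> e e0; exists 0%N => k _; rewrite !big_nil subrr modC0.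
by move=> e e0; have [i0 hK] := slimD (h i) ih e0; exists i0 => k /hK; rewrite !big_cons.
Qed.

Lemma slim_unique u l m : slim u l -> slim u m -> l = m.
move=> h1 h2; apply/subr0_eq/eqP; rewrite -modC_eq0; apply/eqP/le_anti; rewrite modC_ge0 andbT.
rewrite leNgt; apply/negP => h; have e2 : 0 < modC (l - m) / 2 by rewrite divr_gt0.
have [K1 k1] := h1 _ e2; have [K2 k2] := h2 _ e2.
have := k1 _ (leq_maxl K1 K2); have := k2 _ (leq_maxr K1 K2).
have := modC_distD (u (maxn K1 K2)) l m; rewrite (modC_distC l (u _)); lra.
Qed.

Lemma slim_ext u v l : (forall k, u k = v k) -> slim u l -> slim v l.
by move=> e h x x0; have [i0 hK] := h x x0; exists i0 => k /hK; rewrite e. Qed.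

Lemma slim_le u l (M : R) : slim u l -> (forall k, modC (u k) <= M) -> modC l <= M.
move=> h hM; rewrite leNgt; apply/negP => h1; have e0 : 0 < modC l - M by rewrite subr_gt0.
have [i0 hK] := h _ e0; have := hK i0 (leqnn i0); have := hM i0; have := modCBr l (u i0).
rewrite (modC_distC l); lra.
Qed.

(** Dilation factors increasing to 1, all at least [2/3] and thus in the range of [dil_maximal]. *)
Definition rr (i : nat) : R := 1 - shr R i.
Lemma rr_bnd i : 4^-1 <= rr i < 1.
have h1 := shr_gt0 R i; have h2 : shr R i <= 3^-1.
 by rewrite /shr lef_pV2 ?posrE// ler_nat.
by rewrite /rr; apply/andP; split; lra.
Qed.
Lemma rr01 i : 0 < rr i < 1.
by have /andP[h ->] := rr_bnd i; rewrite andbT (lt_le_trans _ h)// invr_gt0. Qed.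
Lemma slim_rr : slim (fun i => rc (rr i)) 1.
move=> e e0; have [i0 hK] := shr_small e0; exists i0 => k /hK h.
by rewrite -RtoC1 -RtoCB modCR /rr addrC addKr normrN gtr0_norm// shr_gt0.
Qed.

Lemma slim_dil (g : V -> C) w : cont_at g w -> slim (fun i => g (rc (rr i) *: w)) (g w).
move=> /contP hg e e0; have [d d0 hd] := hg e e0; have dn : 0 < d / (1 + nr w) by rewrite divr_gt0// ltr_pwDl// nr_ge0.
have [i0 hK] := shr_small dn; exists i0 => k /hK h; apply: hd.
have -> : rc (rr k) *: w - w = rc (- shr R k) *: w.
 by rewrite -[w in _ - w]scale1r -scalerBl -RtoC1 -RtoCB; congr (rc _ *: w); rewrite /rr; ring.
rewrite nrZR normrN gtr0_norm ?shr_gt0//; move: h; rewrite ltr_pdivlMr; last by rewrite ltr_pwDl// nr_ge0.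
have := nr_ge0 w; have := shr_gt0 R k; move: (nr w) (shr R k) => a b; nra.
Qed.

End Slim.

(** * Integrable point singularities and null points *)

Section Singular.
Implicit Types (w z u : V).

Definition crdT z (i : 'I_(n + n)) : R := match fintype.split i with inl j => re (z 0 j) | inr j => im (z 0 j) end.

Lemma toC_taff (a : R) z t : toC (taff a (crdT z) t) = rc a *: toC t + z.
apply/matrixP => i j; rewrite ord1 !mxE !tnth_mktuple /crdT.
rewrite (unsplitK (inl j : 'I_n + 'I_n)) (unsplitK (inr j : 'I_n + 'I_n)).
by apply: cplxP; rewrite !ReImE /re /im /= ?mul0r ?subr0 ?addr0//.
Qed.

(** The map [w -> (w - z) / 2]: the contraction keeps the translated ball inside the ball. *)
Definition hz z w : V := rc 2^-1 *: w + rc 2^-1 *: (- z).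

(** A change of variables that moves a singularity from the origin to [z] within integrals over the
    ball; [2^(2n)] is the inverse Jacobian. *)
Lemma trans_half (g : V -> \bar R) z : uball z -> emeas g -> (forB w, (0 <= g w)%E) ->
 emeas (fun w => g (hz z w)) /\
 (Ie (fun w => g (hz z w)) <= (2 ^+ (n + n))%:E * Ie g)%E.
move=> zB mg g0; pose v : V := rc 2^-1 *: (- z); pose H t : \bar R := if tn t < 1 then g (toC t) else 0%E.
have mH : mfun H by apply/emeas_if.
have H0 t : (0 <= H t)%E by rewrite /H; case: ifP => // /ballTtn /g0.
have hb t : B t -> tn (taff 2^-1 (crdT v) t) < 1.
 move=> /ballTE tB; rewrite -nr_toC toC_taff; rewrite uballE in zB.
 apply: (le_lt_trans (nrD _ _)); rewrite /v !nrZR nrN ger0_norm ?invr_ge0//; lra.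
have mHt : mfun (fun t => H (taff 2^-1 (crdT v) t)).
 by apply: (measurableT_comp mH); exact: meas_taff.
have E (t : T) : (if tn t < 1 then g (hz z (toC t)) else 0%E) = (if tn t < 1 then H (taff 2^-1 (crdT v) t) else 0%E).
 by case: ifP => // /ballTtn /hb h; rewrite /H h toC_taff -/(hz z (toC t)).
have m1 : emeas (fun w => g (hz z w)).
 apply/emeas_if; have : mfun (fun t : T => if tn t < 1 then H (taff 2^-1 (crdT v) t) else 0%E).
  by apply: measurable_fun_ifT => //; apply: measurable_fun_ltr => //; exact: meas_tn.
 by apply: eq_measurable_fun => t _; rewrite E.
split => //; have g0' w : uball w -> (0 <= g (hz z w))%E.
 have z1 := zB; rewrite uballE in z1; rewrite uballE => wB; apply: g0; rewrite uballE /hz.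
 apply: (le_lt_trans (nrD _ _)); rewrite /v !nrZR nrN ger0_norm ?invr_ge0//; lra.
rewrite !Ie_leb// muleCA lee_wpmul2l//.
apply: (@le_trans _ _ (\int[leb R (n + n)]_t H (taff 2^-1 (crdT v) t))%E).
 apply: ge0_le_integral => //.
 - by move=> t _; case: ifP => // h; apply: g0'; rewrite uballE nr_toC.
 - exact: (proj1 (emeas_if (fun w => g (hz z w))) m1).
 - by move=> t _; rewrite E; case: ifP.
by rewrite leb_taff ?invr_gt0// exprVn invrK.
Qed.

Lemma nr_half z w : nr (hz z w) = nr (w - z) / 2.
by rewrite /hz -scalerDr nrZR ger0_norm ?invr_ge0// mulrC. Qed.
Let p : R := ((n + n).-1)%:R.
Lemma emeas_nrpow (q : R) : emeas (fun w : V => (nr w `^ q)%:E).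
apply/measurable_EFinP; apply: (measurableT_comp (@measurable_powR R q)).
exact: (@measurable_funTS _ _ _ _ _ _ (@meas_nr_toC R n)).
Qed.
Lemma p_gt0 : 0 < p.
by rewrite ltr0n; case: (n) n0 => // m _; rewrite addSn addnS. Qed.

(** In polar coordinates [|w|^(1 - 2n)] cancels the radial density exactly. *)
Lemma nrpow_int : (Ie (fun w : V => (nr w `^ (- p))%:E) <= (n + n)%:R%:E)%E.
have mG := emeas_nrpow (- p).
have G0 w : uball w -> (0 <= (nr w `^ (- p))%:E)%E by [].
rewrite (polar_ball n0 mG G0); apply: (le_trans _ (@Ie_cst R n (n + n)%:R _)) => //.
have E0 w : (rint n (fun x => (nr (rc x *: sphproj w) `^ (- p))%:E) <= (n + n)%:R%:E)%E.
 have [w0|w0] := eqVneq (nr w) 0.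
  (* At the origin [sphproj] has the default value 0, and a power of 0 with nonzero exponent is
     0. *)
  rewrite /rint integral0_eq// => x _; case: ifP => // /andP[x0 _].
  have -> : sphproj w = 0 by rewrite /sphproj -/(nr w) w0 invr0; exact: scale0r.
  by rewrite scaler0 nr0 powR0 ?mule0// oppr_eq0 gt_eqF// p_gt0.
 rewrite /rint (_ : (\int[_]_x _)%E = (\int[@lebesgue_measure R]_(x in `]0%R, 1%R[) (n + n)%:R%:E)%E).
  by rewrite integral_cst //= lebesgue_measure_itv /= lte_fin ltr01 sube0 mule1.
 transitivity (\int[@lebesgue_measure R]_x (if (0 < x < 1)%R then (n + n)%:R%:E else 0))%E; last first.
  by symmetry; apply: int_if => x /=; rewrite in_itv.
 apply: eq_integral => x _; case: ifP => // /andP[x0 x1].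
 rewrite nrZR nr_sphproj// mulr1 gtr0_norm// -EFinM powRN /p powR_mulrn ?(ltW x0)//.
 by rewrite mulfK// expf_neq0// gt_eqF.
apply: Ie_le => //.
- exact: (emeas_rint mG G0).
- exact: emeas_cst.
- by move=> w _; apply: rint_ge0 => x _; rewrite lee_fin powR_ge0.
Qed.

Lemma sing_int z : uball z -> emeas (fun w => (nr (w - z) `^ (- p))%:E) /\ (Ie (fun w => (nr (w - z) `^ (- p))%:E) < +oo)%E.
move=> zB; have G0 w : uball w -> (0 <= (nr w `^ (- p))%:E)%E by [].
have [m1 h1] := trans_half zB (emeas_nrpow (- p)) G0.
have E w : ((nr (w - z) `^ (- p))%:E = (2^-1 `^ p)%:E * (nr (hz z w) `^ (- p))%:E)%E.
 rewrite nr_half powRM ?invr_ge0// -EFinM; congr (_%:E).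
 by rewrite mulrCA (powRN 2^-1) mulfV ?mulr1// gt_eqF// powR_gt0// invr_gt0.
have m2 : emeas (fun w => (2^-1 `^ p)%:E * (nr (hz z w) `^ (- p))%:E)%E.
 exact: measurable_funeM.
split; first exact: (emeas_ext (fun w _ => esym (E w)) m2).
have K0 : (0 <= (2^-1 `^ p)%:E)%E by rewrite lee_fin powR_ge0.
rewrite (Ie_eq (fun w _ => E w)) (IeZ m1 _ K0); last by move=> w _; rewrite lee_fin powR_ge0.
apply: lte_mul_pinfty; rewrite//.
apply: (le_lt_trans h1); apply: lte_mul_pinfty; rewrite//.
exact: (le_lt_trans nrpow_int (ltry _)).
Qed.

Lemma measurable_eqz z : mfun (fun t : T => toC t == z).
have : mfun (fun t : T => tn (taff 1 (crdT (- z)) t) == 0).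
 apply: measurable_fun_eqr => //; apply: (measurableT_comp (@meas_tn _ _)); exact: meas_taff.
apply: eq_measurable_fun => t _; rewrite -nr_toC toC_taff RtoC1 scale1r nr_eq0.
by rewrite subr_eq0.
Qed.

(** [trans_half] moves the point to the origin, a null set by [Ie_ne0]. Kernels may therefore be
    redefined on the diagonal, where nothing is known about them. *)
Lemma cok_point z (c : C) : uball z -> cok (fun w => if w == z then c else 0) /\ cintB (fun w => if w == z then c else 0) = 0.
move=> zB; set e := (fun w => _).
have me : cmeas e.
 have h (r : R) : mfun (fun t : T => if toC t == z then r else 0 : mR).
  by apply: measurable_fun_ifT => //; exact: measurable_eqz.
 split; apply: measurable_funTS; [apply: eq_measurable_fun (h (re c))|apply: eq_measurable_fun (h (im c))] => t _.
  by rewrite /e; case: ifP.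
 by rewrite /e; case: ifP.
pose g u : \bar R := if nr u == 0 then (modC c)%:E else 0%E.
have mg : emeas g.
 apply: measurable_funTS; apply: measurable_fun_ifT => //.
 by apply: measurable_fun_eqr => //; exact: meas_nr_toC.
have g0 w : uball w -> (0 <= g w)%E by rewrite /g; case: ifP => //; rewrite lee_fin modC_ge0.
have Ig : Ie g = 0%E.
 rewrite (Ie_ne0 n0 mg g0); rewrite (Ie_eq (g := fun=> 0%E)); last first.
  by move=> w _; rewrite /g; case: (nr w == 0).
 by rewrite /Ie integral0.
have [_ h1] := trans_half zB mg g0; rewrite Ig mule0 in h1.
have I0 : (Ie (fun w => (modC (e w))%:E) <= 0)%E.
 apply: le_trans h1; apply: eqle; apply: Ie_eq => w _.
 rewrite /g /e nr_half mulf_eq0 invr_eq0 pnatr_eq0 orbF nr_eq0 subr_eq0.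
 by case: ifP => //; rewrite modC0.
split; first by split => //; apply: le_lt_trans I0 _.
have h := modC_cintB me; apply/eqP; rewrite -modC_eq0; apply/eqP/le_anti; rewrite modC_ge0 andbT -lee_fin.
by apply: (le_trans h); rewrite mule_ge0_le0.
Qed.

Lemma cintB_except z (g g' : V -> C) : uball z -> cok g' -> (forB w, w != z -> g w = g' w) ->
 cok g /\ cintB g = cintB g'.
move=> zB ok h; have [k1 k2] := cok_point (g z - g' z) zB.
have E w : uball w -> g' w + (if w == z then g z - g' z else 0) = g w.
 by move=> wB; case: eqVneq => [->|wz]; [rewrite addrC subrK|rewrite addr0 h].
split; first exact: cok_ext E (cokD ok k1).
by rewrite -(cintB_eq E) (cintBD ok k1) k2 addr0.
Qed.

Lemma openU_off z : openU [set w : V | uball w /\ w != z].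
move=> w [wB wz]; have [r r0 hr] := @oUB w wB.
have d0 : 0 < nr (w - z) by rewrite lt_neqAle eq_sym nr_eq0 subr_eq0 wz nr_ge0.
exists (Num.min r (nr (w - z))) => [|u]; rewrite lt_min ?r0// => /andP[h1 h2].
split; first exact: hr.
by apply/eqP => uz; move: h2; rewrite uz nr_distC ltxx.
Qed.

Lemma cmeas_offpoint z (g : V -> C) : (forB w, w != z -> cont_at g w) ->
 cmeas (fun w => if w == z then 0 else g w).
move=> hg; pose U : set V := [set w | uball w /\ w != z].
have oU : openU U by exact: openU_off.
have mB := @meas_ballT R n.
have ES : B `&` ((fun t : T => toC t == z) @^-1` [set false]) = @toC R n @^-1` U.
 by apply/seteqP; split => t /= [h1 h2]; split => //; [apply/negbT|exact: negbTE].
have mf : measurable_fun B (fun t : T => toC t == z).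
 by apply: measurable_funTS; exact: measurable_eqz.
have mU : measurable (@toC R n @^-1` U) by rewrite -ES; exact: mf.
have hr w : U w -> cont_at g w by case; exact: hg.
split.
 have : measurable_fun B (fun t : T => if toC t == z then 0 else re (g (toC t)) : mR).
  apply: measurable_fun_if => //; rewrite ES; apply: (cont_meas (g := fun w => re (g w))) => // w /hr.
  exact: contP_re.
 by apply: eq_measurable_fun => t _; case: ifP.
have : measurable_fun B (fun t : T => if toC t == z then 0 else im (g (toC t)) : mR).
 apply: measurable_fun_if => //; rewrite ES; apply: (cont_meas (g := fun w => im (g w))) => // w /hr.
 exact: contP_im.
by apply: eq_measurable_fun => t _; case: ifP.
Qed.

End Singular.

(** * Dominated convergence; derivatives and bounds of dilates *)

Section Dct.
Implicit Types (w z : V) (f g phi psi : V -> C).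

Lemma slim_dct (F : nat -> V -> C) g (G : V -> \bar R) : (forall k, cmeas (F k)) -> cmeas g ->
 emeas G -> (Ie G < +oo)%E -> (forB w, (0 <= G w)%E) ->
 (forall k w, uball w -> ((modC (F k w))%:E <= G w)%E) ->
 (forB w, slim (fun k => F k w) (g w)) ->
 [/\ forall k, cok (F k), cok g & slim (fun k => cintB (F k)) (cintB g)].
move=> mF mg mG oo G0 FG Fg; split.
- by move=> k; apply: cok_le (FG k).
- apply: (cok_le mg mG oo) => w wB; have := G0 w wB; case E : (G w) => [x| |]// _; last by rewrite leey.
 rewrite lee_fin; apply: slim_le (Fg w wB) _ => k.
 by have := FG k w wB; rewrite E lee_fin.
- exact: cintB_dct oo G0 FG Fg.
Qed.

Lemma dir_deriv_dil (s : R) phi w v : Ck 1 UB phi -> crd v -> uball (rc s *: w) ->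
 dir_deriv v (fun u => phi (rc s *: u)) w = rc s * dir_deriv v phi (rc s *: w).
by move=> hC cv wB; have [] := dir_dil (Ck_der hC cv wB). Qed.

Lemma dz_dil (s : R) phi w j : Ck 1 UB phi -> uball (rc s *: w) ->
 dz j (fun u => phi (rc s *: u)) w = rc s * dz j phi (rc s *: w).
move=> hC wB; rewrite !dzE !dir_deriv_dil//; try exact: crd_x; try exact: crd_y.
have E (x y t i : C) : (t * x - i * (t * y)) / 2 = t * ((x - i * y) / 2) by field.
exact: E.
Qed.

Lemma dbar_dil (s : R) phi w j : Ck 1 UB phi -> uball (rc s *: w) ->
 dbar j (fun u => phi (rc s *: u)) w = rc s * dbar j phi (rc s *: w).
move=> hC wB; rewrite !dbarE !dir_deriv_dil//; try exact: crd_x; try exact: crd_y.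
have E (x y t i : C) : (t * x + i * (t * y)) / 2 = t * ((x + i * y) / 2) by field.
exact: E.
Qed.

Lemma Ck_dilB k (s : R) phi : 0 < s < 1 -> Ck k UB phi -> Ck k UB (fun w => phi (rc s *: w)).
move=> s01 h; have [r r1 hr] := smb_dil s01 h.
by apply: Ck_sub hr => u /uball_le h1; exact: le_lt_trans h1 r1.
Qed.

Lemma dbar_prod_dil (s : R) phi f w j : 0 < s < 1 -> Ck 1 UB phi -> hol UB f -> uball w ->
 dbar j (fun u => phi (rc s *: u) * f (rc s *: u)) w = rc s * dbar j phi (rc s *: w) * f (rc s *: w).
move=> s01 hC hf wB; have sB := uball_dil s01 wB.
rewrite (dbar_mul j wB (Ck_dilB s01 hC) (Ck_dilB s01 (hol_C1 oUB hf))) dbar_dil// (hol_dbar j (hol_dil s01 hf) wB).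
by rewrite mulr0 addr0.
Qed.

Lemma weight_dil (s : R) w : 0 < s < 1 -> weight w <= weight (rc s *: w).
move=> /andP[s0 s1]; rewrite /weight sqnormZ modCR (gtr0_norm s0) lerD2l lerN2.
by rewrite ler_piMl ?sqnorm_ge0// exprn_ile1// ltW.
Qed.

Lemma weight_dil_pow (s e : R) w : 0 < s < 1 -> uball w -> e <= 0 -> weight (rc s *: w) `^ e <= weight w `^ e.
move=> s01 wB e0; rewrite -[e]opprK; apply: powRN_le; first by rewrite oppr_ge0.
- exact: weight_gt0.
- exact: weight_dil.
Qed.

Lemma ker_bnd (a : R) z : uball z -> const M, forB w, dist w z `^ a <= M.
move=> zB; rewrite uballE in zB;
have q0 : 0 < 1 - nr z by rewrite subr_gt0.
exists (2 `^ `|a| + (1 - nr z) `^ (- `|a|)) => // w wB.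
have w1 := uball_le wB;
have [a0|a0] := leP 0 a.
 rewrite ger0_norm// ler_wpDr//; apply: ge0_ler_powR; rewrite ?nnegrE//.
 by apply: dist_le2 => //; exact: ltW.
rewrite ltr0_norm// opprK ler_wpDl// -[a]opprK; apply: powRN_le; rewrite ?oppr_ge0 ?(ltW a0)//.
by apply: le_trans (dist_ge w z); rewrite lerD2l lerN2 ler_piMl.
Qed.

Lemma cmeas_ker (a : R) z : 0 <= a -> uball z -> cmeas (fun w => ker a w z).
by move=> a0 zB; apply: cmeas_cont => w /uball_le; exact: smb_cont (smb_ker 0 a0 zB) w.
Qed.
Lemma cmeas_dil (s : R) g : 0 < s < 1 -> (forB w, cont_at g w) -> cmeas (fun w => g (rc s *: w)).
by move=> s01 h; apply: cmeas_cont => w wB; apply: cont_dil; apply: h; exact: uball_dil. Qed.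

Lemma Rb_dil (s : R) phi w : Ck 1 UB phi -> uball (rc s *: w) ->
 Rb (fun u => phi (rc s *: u)) w = Rb phi (rc s *: w).
move=> hC wB; apply: eq_bigr => j _; rewrite dbar_dil// mxE conjCM conjCR.
by rewrite mulrA [X in X * _]mulrC.
Qed.

Lemma Rz_dil (s : R) phi w : Ck 1 UB phi -> uball (rc s *: w) ->
 Rz (fun u => phi (rc s *: u)) w = Rz phi (rc s *: w).
by move=> hC wB; apply: eq_bigr => j _; rewrite dz_dil// mxE mulrA [X in X * _]mulrC. Qed.

End Dct.

(** * Growth bounds for all derivatives: products, radial operators, commutators *)

Section WordBounds.
Implicit Types (A B : R) (e : nat -> R) (w z : V) (f g phi : V -> C).

(* All words of length [p <= m] in the [dz j], applied to [g], are [<= A weight^(- e p)]; the derivatives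
  are only known up to equality on the ball. *)
Fixpoint wb m e A g : Prop :=
 [/\ Ck m UB g, forB w, modC (g w) <= A * weight w `^ (- e 0%N) &
  if m is m'.+1 then forall j, exists2 g', (forB w, g' w = dz j g w) & wb m' (fun p => e p.+1) A g'
  else True].

Lemma wb_Ck m e A g : wb m e A g -> Ck m UB g. by case: m => [|m] []. Qed.
Lemma wb0 m e A g w : wb m e A g -> uball w -> modC (g w) <= A * weight w `^ (- e 0%N).
by case: m => [|m] [_ h _]; exact: h. Qed.
Lemma wb_ge0 m e A g : wb m e A g -> 0 <= A.
move=> h; have := le_trans (modC_ge0 _) (wb0 h (uball0)).
by rewrite pmulr_lge0// powR_gt0// weight_gt0//; exact: uball0.
Qed.

Lemma wb_ext m e A g g' : (forB w, g w = g' w) -> wb m e A g -> wb m e A g'.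
move=> E h; have hC := Ck_ext oUB E (wb_Ck h).
have h0 w : uball w -> modC (g' w) <= A * weight w `^ (- e 0%N) by move=> wB; rewrite -E// (wb0 h).
case: m h hC => [|m] h hC; split => // j; have [hC' _ /(_ j)[d Ed hd]] := h.
exists d => [w wB|]; last exact: hd.
by rewrite (Ed w wB) (dz_eq j oUB (Ck_le (ltn0Sn m) hC') E wB).
Qed.

Lemma wb_le m m' e e' A A' g : (m' <= m)%N -> (forall p, (p <= m')%N -> e p <= e' p) -> A <= A' ->
 wb m e A g -> wb m' e' A' g.
elim: m' m e e' g => [|m' ih] m e e' g mm ee AA h; have A0 := wb_ge0 h.
all: have hC := Ck_le mm (wb_Ck h).
all: have h0 w : uball w -> modC (g w) <= A' * weight w `^ (- e' 0%N) by
 move=> wB; apply: (le_trans (wb0 h wB)); apply: ler_pM; rewrite//; apply: weight_mono => //; rewrite lerN2 ee.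
 by split.
case: m mm h hC => // m mm [_ _ hd] hC; split=> // j; have [d Ed h] := hd j; exists d => //.
by apply: ih h => // p pm; exact: ee.
Qed.

Lemma wbD m e A B f g : wb m e A f -> wb m e B g -> wb m e (A + B) (fun w => f w + g w).
elim: m e f g => [|m ih] e f g hf hg; have hC := Ck_add oUB (wb_Ck hf) (wb_Ck hg).
all: have h0 w : uball w -> modC (f w + g w) <= (A + B) * weight w `^ (- e 0%N) by
 move=> wB; apply: (le_trans (modCD _ _)); rewrite mulrDl lerD// ?(wb0 hf) ?(wb0 hg).
 by split.
have [hCf _ hdf] := hf; have [hCg _ hdg] := hg; split => // j.
have [f' Ef hf'] := hdf j; have [g' Eg hg'] := hdg j; exists (fun w => f' w + g' w); last exact: ih.
by move=> w wB; rewrite (dz_add j wB (Ck_le _ hCf) (Ck_le _ hCg))// Ef// Eg.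
Qed.

(** Leibniz rule: each derivative doubles the number of terms, whence [2^m], and the exponents need
    only be compatible for orders [i + j <= m]. *)
Lemma wbM m e1 e2 e3 A B f g : (forall i j, (i + j <= m)%N -> e1 i + e2 j <= e3 (i + j)%N) ->
 wb m e1 A f -> wb m e2 B g -> wb m e3 (2 ^+ m * (A * B)) (fun w => f w * g w).
elim: m e1 e2 e3 f g => [|m ih] e1 e2 e3 f g he hf hg; have B0 := wb_ge0 hg.
all: have hC := Ck_mul oUB (wb_Ck hf) (wb_Ck hg); have AB0 := mulr_ge0 (wb_ge0 hf) B0.
all: have h0 w : uball w -> modC (f w * g w) <= A * B * weight w `^ (- e3 0%N) by
 move=> wB; rewrite modCM; apply: (le_trans (ler_pM (modC_ge0 _) (modC_ge0 _) (wb0 hf wB) (wb0 hg wB)));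
 rewrite mulrACA -(@powR_split _ (weight w) _ _ _ (weight_gt0 wB) erefl) ler_wpM2l//;
 apply: weight_mono => //; have := he 0%N 0%N isT; rewrite addn0; lra.
 by rewrite expr0 mul1r; split.
have [hCf _ hdf] := hf; have [hCg _ hdg] := hg; split => // [w wB|j].
 apply: (le_trans (h0 w wB)); rewrite ler_wpM2r// ler_peMl// exprn_ege1//; lra.
have [f' Ef hf'] := hdf j; have [g' Eg hg'] := hdg j; exists (fun w => f' w * g w + f w * g' w).
 by move=> w wB; rewrite (dz_mul j wB (Ck_le _ hCf) (Ck_le _ hCg))// Ef// Eg.
rewrite exprS -mulrA mulr_natl mulr2n; apply: wbD; first by apply: ih hf' (wb_le (leqnSn m) _ _ hg) => // i j' ij; exact: he.
apply: ih (wb_le (leqnSn m) (fun p _ => lexx (e1 p)) (lexx A) hf) hg' => i j' ij.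
by rewrite -addnS; apply: he; rewrite addnS.
Qed.

Lemma wb_cst m (e : nat -> R) c : (forall p, 0 <= e p) -> wb m e (modC c) (fun=> c).
elim: m e c => [|m ih] e c e0; (have h0 w : uball w -> modC c <= modC c * weight w `^ (- e 0%N) by
 move=> wB; apply: ler_peMr => //; apply: weight_powR_ge1 => //; rewrite oppr_le0).
 by split => //; exact: Ck_cst.
split=> //; first exact: (Ck_cst m.+1).
move=> j; exists (fun=> 0) => [w wB|]; first by rewrite dz_cst.
by apply: wb_le (ih (fun p => e p.+1) 0 _) => //; rewrite modC0 modC_ge0.
Qed.

Lemma wb_coord m i : wb m (fun=> 0) 1 (fun w => w 0 i).
have h0 w : uball w -> modC (w 0 i) <= 1 * weight w `^ (- 0).
 by move=> wB; rewrite oppr0 powRr0 mulr1 (le_trans (modC_coord w i))// uball_le.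
case: m => [|m]; first by split=> //; exact: Ck_coord.
split=> //; first exact: (Ck_coord m.+1).
move=> j; exists (fun=> (i == j)%:R) => [w _|]; first by rewrite dz_coord.
by apply: wb_le (wb_cst m (e := fun=> 0) (i == j)%:R _) => //; case: eqP; rewrite ?modC1 ?modC0.
Qed.

Lemma wbZ m e A c g : (forall p, e p <= e p.+1) -> wb m e A g -> wb m e (2 ^+ m * (modC c * A)) (fun w => c * g w).
move=> he; apply: wbM (wb_cst m (e := fun=> 0) c _) => // i j _.
by rewrite add0r; elim: i => // i ih; exact: le_trans ih (he _).
Qed.

Lemma wb_Rz m e A g : 0 <= e 0%N -> (forall p, e p <= e p.+1) -> wb m.+1 e A g ->
 wb m (fun p => e p.+1) (n%:R * (2 ^+ m * A)) (Rz g).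
move=> e0 he h; have [_ _ hd] := h; have he' i j : e j <= e (i + j)%N by elim: i => // i ih; exact: le_trans ih (he _).
have h1 j : wb m (fun p => e p.+1) (2 ^+ m * A) (fun w => w 0 j * dz j g w).
 have [d Ed hdj] := hd j; rewrite -[A in _ * A]mul1r; apply: wbM (wb_coord m j) (wb_ext Ed hdj) => i l _.
 by rewrite add0r -addnS he'.
suff hs (r : seq 'I_n) : wb m (fun p => e p.+1) ((size r)%:R * (2 ^+ m * A)) (fun w => \sum_(j <- r) w 0 j * dz j g w).
 by have := hs (enum 'I_n); rewrite size_enum_ord; apply: wb_ext => w wB; rewrite /Rz big_enum.
elim: r => [|j r ih].
 have := @wb_cst m (fun p => e p.+1) 0; rewrite modC0 mul0r => h0; apply: wb_ext (h0 _) => [w _|p]; first by rewrite big_nil.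
 by rewrite (le_trans e0)// -[p.+1]addn0.
by apply: wb_ext (wb_le _ _ _ (wbD (h1 j) ih)) => // [w _|]; [rewrite big_cons|rewrite /= -natr1; apply: eqle; ring].
Qed.

Lemma wb_words m e A g : Ck m UB g ->
 (forall J w, (size J <= m)%N -> uball w -> modC (dzl J g w) <= A * weight w `^ (- e (size J))) -> wb m e A g.
elim: m e g => [|m ih] e g hC h; have h0 w := h [::] w isT; split=> // j; exists (dz j g) => //.
apply: ih => [|J w sJ]; first exact: Ck_dz.
by have := h (rcons J j) w; rewrite size_rcons /dzl foldr_rcons; apply.
Qed.

Section TLBounds.

(** Each factor [Xop] uses up one available derivative and shifts the exponents by one order. *)
Lemma wb_TL m l : const D, forall e A g, 0 <= e 0%N -> (forall p, e p <= e p.+1) -> wb (m + l) e A g ->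
 wb l (fun p => e (p + m)%N) (D * A) (TL m g).
elim: m l => [|m ih] l.
 by exists 1 => // e A g _ _ h; apply: wb_le h => // [p _|]; rewrite ?addn0 ?mul1r.
have [D D0 hD] := ih l.+1; pose c := rc (dN + m%:R)^-1.
pose D' := 2 ^+ l * (modC c * (n%:R * (2 ^+ l * D))).
have D'0 : 0 <= D' by rewrite mulr_ge0 ?exprn_ge0// mulr_ge0 ?modC_ge0// mulr_ge0// mulr_ge0 ?exprn_ge0.
exists (D + D') => // e A g e0 he h.
rewrite addSnnS in h; have h1 := hD e A g e0 he h.
have he' p : e (p + m)%N <= e (p.+1 + m)%N by rewrite addSn.
have em : 0 <= e m by have := e0; elim: (m) => // i ih' /ih'/le_trans; apply.
have h2 := wbZ c (fun p => he' p.+1) (wb_Rz (e := fun p => e (p + m)%N) em he' h1).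
apply: wb_le (wbD (wb_le (leqnSn l) (fun p _ => he' p) (lexx _) h1) h2) => // [p _|]; first by rewrite -addSnnS.
by rewrite /D'; apply: eqle; move: (2 ^+ l) (modC c) => x y; ring.
Qed.

(* [S] collects the terms in which [phi] is differentiated, so [e1 0] does not enter. *)
Lemma TL_comm k m phi A e1 : wb k e1 A phi -> (forall p, e1 p <= e1 p.+1) -> 0 <= e1 0%N -> (m <= k)%N ->
 const D, forall f B e2 (E : R), wb k e2 B f -> (forall p, e2 p <= e2 p.+1) -> 0 <= e2 0%N -> 0 <= E ->
 (forall i j, (i.+1 + j <= k)%N -> e1 i.+1 + e2 j <= E) ->
 exists S, (forB w, TL m (fun u => phi u * f u) w = phi w * TL m f w + S w) /\
  wb (k - m) (fun=> E) (D * B) S.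
move=> hp he1 e10; elim: m => [|m ih] mk.
 exists 1 => // f B e2 E hf he2 e20 E0 hE; exists (fun=> 0); split=> [w wB|]; first by rewrite addr0.
 by apply: wb_le (@wb_cst _ (fun=> E) 0 _) => //; rewrite modC0 mul1r (wb_ge0 hf).
have [D D0 hD] := ih (ltnW mk); have [l kl] : exists l, (k = l + m.+1)%N by exists (k - m.+1)%N; rewrite subnK.
have [T T0 hT] := wb_TL m l.+1; pose c := rc (dN + m%:R)^-1.
have l1 : (k - m = l.+1)%N by rewrite kl addnS -addSn addnK.
have l2 : (k - m.+1 = l)%N by rewrite kl addnK.
have k1 : (k = (l + m).+1)%N by rewrite kl addnS.
have A0 := wb_ge0 hp;
pose q1 := 2 ^+ l * (modC c * (n%:R * (2 ^+ l * D))).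
pose q2 := 2 ^+ l * (modC c * (2 ^+ l * (n%:R * (2 ^+ (l + m) * A) * T))).
have q10 : 0 <= q1 by do ?[rewrite mulr_ge0 ?modC_ge0//]; rewrite !mulr_ge0.
have q20 : 0 <= q2 by rewrite !(mulr_ge0, modC_ge0, exprn_ge0).
exists (D + q1 + q2) => // f B e2 E hf he2 e20 E0 hE.
have [S [ES hS]] := hD f B e2 E hf he2 e20 E0 hE.
rewrite l1 in hS; rewrite l2.
have hp' := hp; rewrite k1 in hp';
have hf' : wb (m + l.+1) e2 B f by rewrite addnS addnC -k1.
have hTf := hT e2 B f e20 he2 hf'.
have hM := wbZ c (e := fun=> E) (fun=> lexx E) (wbM (e3 := fun=> E) (m := l) _ (wb_le (leq_addr m l) (fun p _ => lexx _) (lexx _) (wb_Rz e10 he1 hp')) (wb_le (leqnSn l) (fun p _ => lexx _) (lexx _) hTf)).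
exists (fun w => S w + (c * Rz S w + c * (Rz phi w * TL m f w))); split; last first.
 apply: wb_le (wbD (wb_le (leqnSn l) (fun p _ => lexx _) (lexx _) hS) (wbD (wbZ c (e := fun=> E) (fun=> lexx E) (wb_Rz (e := fun=> E) E0 (fun=> lexx E) hS)) (hM _))) => // [|i j ij].
  by rewrite /q1 /q2; apply: eqle; move: (2 ^+ l) (2 ^+ (l + m)) (modC c) => x y t; ring.
 by apply: hE; rewrite k1 addSn addnA ltnS leq_add2r.
move=> w wB /=; rewrite /Xop ES//; have C1 : Ck 1 UB phi by apply: Ck_le (wb_Ck hp); rewrite k1.
have C2 : Ck 1 UB (TL m f) by apply: Ck_le (wb_Ck hTf).
have C3 : Ck 1 UB S by apply: Ck_le (wb_Ck hS).
have C4 := Ck_mul oUB C1 C2.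
have -> : Rz (TL m (fun u => phi u * f u)) w = Rz phi w * TL m f w + phi w * Rz (TL m f) w + Rz S w.
 rewrite -(Rz_mul wB C1 C2) /Rz -big_split; apply: eq_bigr => j _.
 by rewrite (dz_eq j oUB (Ck_add oUB C4 C3) (fun u uB => esym (ES u uB)) wB) (dz_add j wB C4 C3) mulrDr.
by rewrite /c; move: (rc _) (Rz _ _) (Rz _ _) (Rz _ _) => x y t u; ring.
Qed.

Lemma Ck_TL l k g : Ck (l + k) UB g -> Ck k UB (TL l g).
elim: l k => // l ih k h; apply: (Ck_add oUB); first by apply: Ck_le1; apply: ih; rewrite addnS.
by apply: (Ck_scale _ oUB); apply: (Ck_Rz oUB); apply: ih; rewrite addnS.
Qed.

Lemma TL_dil m (s : R) g : 0 < s < 1 -> Ck m UB g -> forB w, 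
 TL m (fun u => g (rc s *: u)) w = TL m g (rc s *: w).
move=> s01; elim: m => [//|m ih] hC w wB /=;
have CT : Ck 1 UB (TL m g) by apply: Ck_TL; rewrite addn1.
rewrite /Xop (ih (Ck_le1 hC) w wB); congr (_ + _ * _); rewrite -(Rz_dil CT (uball_dil s01 wB)); apply: eq_bigr => j _.
by rewrite (dz_eq j oUB (Ck_dilB s01 CT) (fun u uB => esym (ih (Ck_le1 hC) u uB)) wB).
Qed.
End TLBounds.
End WordBounds.

Variables (k : nat) (tau0 tau : R) (phi : V -> C).
Hypothesis tau00 : 0 < tau0.
Hypothesis tau0h : tau0 < 1 / 2.
Hypothesis tau0t : tau0 <= tau.
Hypothesis tauk : tau < k%:R.
Hypothesis hG : inG tau0 tau k phi.
Let tau01 : tau0 < 1.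
by have := tau0h; lra. Qed.

(** * Size, gradient, Hoelder continuity and lower bound of [phi] *)

Section Symbol.
Implicit Types (w z u v : V).

Lemma supB_ge (g : V -> R) z : uball z -> ((g z)%:E <= supB g)%E.
by move=> zB; apply: ereal_sup_ubound; exists z. Qed.
Lemma supB_ge0 (g : V -> R) : (forB z, 0 <= g z) -> (0 <= supB g)%E.
by move=> h; apply: le_trans (supB_ge g uball0); rewrite lee_fin h//; exact: uball0. Qed.
Lemma omega_gt0 t z : uball z -> 0 < omega t z.
move=> zB; have w0 := weight_gt0 zB; rewrite /omega; case: ifP => _; last exact: powR_gt0.
rewrite ln_div ?posrE ?expR_gt0// expRK.
have := ln_le0 (weight_le1 z); lra.
Qed.
Lemma abs_dz_ge0 j (g : V -> C) z : 0 <= abs_dz j g z.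
by apply: sumr_ge0 => *; exact: modC_ge0. Qed.
Lemma tilde_ge0 g z : uball z -> 0 <= tilde g z.
move=> zB; rewrite addr_ge0// mulr_ge0 ?(ltW (weight_gt0 zB))//; last first.
 by apply: sumr_ge0 => i _; apply: sumr_ge0 => *; by [].
by apply: sumr_ge0 => *; by [].
Qed.

Lemma normG_bnd : const G,
 (forall j z, (j <= k)%N -> uball z -> abs_dz j phi z <= G * omega (tau - j%:R) z) /\
 (forB z, tilde phi z <= G * weight z `^ tau0).
have [_ _ hn] := hG; rewrite /normG in hn.
pose F (j : 'I_k.+1) := supB (fun z => abs_dz j phi z / omega (tau - j%:R) z).
pose H := supB (fun z => tilde phi z / weight z `^ tau0).
have F0 j : (0 <= F j)%E.
 by apply: supB_ge0 => z zB; rewrite divr_ge0 ?abs_dz_ge0 ?(ltW (omega_gt0 _ zB)).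
have H0 : (0 <= H)%E by apply: supB_ge0 => z zB; rewrite divr_ge0 ?tilde_ge0.
have S0 : (0 <= \sum_j F j)%E by exact: sume_ge0.
rewrite -/H -/(F) in hn; have hf : (\sum_j F j + H)%E \is a fin_num.
 by rewrite ge0_fin_numE// adde_ge0.
have FG j : (F j <= \sum_j F j + H)%E.
 apply: (@le_trans _ _ (\sum_j F j)%E); last by rewrite leeDl.
 by rewrite (bigD1 j) //= leeDl// sume_ge0.
exists (fine (\sum_j F j + H)%E); first by rewrite fine_ge0// adde_ge0.
split=> [j z jk zB|z zB].
 rewrite -ler_pdivrMr ?omega_gt0// -lee_fin fineK//.
 by apply: le_trans (FG (Ordinal (jk : (j < k.+1)%N))); exact: (supB_ge (fun z => abs_dz j phi z / omega (tau - j%:R) z)).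
rewrite -ler_pdivrMr ?powR_gt0 ?weight_gt0// -lee_fin fineK//.
apply: (@le_trans _ _ H); last by rewrite leeDr.
exact: (supB_ge (fun z => tilde phi z / weight z `^ tau0)).
Qed.

(** The logarithm at order [j = tau] is at most a constant times the power [- eta] of the weight;
    for [j < tau] the same floor [eta] is only a loss. *)
Lemma omega_le (eta : R) j z : 0 < eta -> uball z ->
 omega (tau - j%:R) z <= (1 + eta^-1) * weight z `^ (- Num.max (j%:R - tau) eta).
move=> e0 zB; have w0 := weight_gt0 zB;
have i0 : 0 < eta^-1 by rewrite invr_gt0.
pose y := weight z `^ (- Num.max (j%:R - tau) eta).
have ye : weight z `^ (- eta) <= y by apply: weight_mono => //; rewrite lerN2 le_max lexx orbT.
have y1 : 1 <= weight z `^ (- eta).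
 by apply: weight_powR_ge1 => //; rewrite oppr_le0 ltW.
rewrite -/y /omega; case: ifP => _; last first.
 apply: (@le_trans _ _ (1 * y)); last by rewrite ler_wpM2r ?powR_ge0//; lra.
 rewrite mul1r; apply: weight_mono => //.
 by rewrite le_min -(opprB j%:R tau) lerN2 oppr_le0 !le_max lexx (ltW e0) orbT.
rewrite ln_div ?posrE ?expR_gt0// expRK.
have h : - ln (weight z) <= eta^-1 * weight z `^ (- eta).
 rewrite -ler_pdivrMl// invrK mulrN -mulNr -ln_powR.
 by apply/ltW/ln_sublinear; exact: powR_gt0.
have : eta^-1 * weight z `^ (- eta) <= eta^-1 * y by rewrite ler_wpM2l// ltW.
by move: h y1 ye; move: (ln _) (weight z `^ _) y eta^-1 => a b c d; lra.
Qed.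

Lemma phi_words (eta : R) : 0 < eta -> const D, forall J z, (size J <= k)%N -> uball z ->
 modC (dzl J phi z) <= D * weight z `^ (- Num.max ((size J)%:R - tau) eta).
move=> e0; have [G G0 [h _]] := normG_bnd; have [hC _ _] := hG.
exists (G * (1 + eta^-1)) => [|J z sJ zB]; first by rewrite mulr_ge0// addr_ge0// invr_ge0 ltW.
apply: (le_trans (abs_dz_ge erefl (Ck_le sJ hC) zB)).
by apply: (le_trans (h _ _ sJ zB)); rewrite -mulrA ler_wpM2l// omega_le.
Qed.

Lemma kge1 : (0 < k)%N.
by rewrite -(ltr0n R); apply: lt_trans tauk; exact: lt_le_trans tau0t. Qed.

(** The holomorphic part comes from [phi_words] at order 1 with exponent [1/2], admissible since
    [tau0 < 1/2]; the antiholomorphic part comes from the first term of [tilde]. *)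
Lemma phi_grad : const D, forall j z, uball z ->
 modC (dz j phi z) <= D * weight z `^ (tau0 - 1) /\ modC (dbar j phi z) <= D * weight z `^ (tau0 - 1).
have e0 : 0 < 1 / 2 :> R by rewrite divr_gt0.
have [D D0 hD] := phi_words e0; have [G G0 [_ hT]] := normG_bnd.
exists (Num.max D G) => [|j z zB]; first by rewrite le_max D0.
have w0 := weight_gt0 zB; split.
 apply: (le_trans (hD [:: j] z kge1 zB)); rewrite ler_pM ?le_max ?lexx//.
 apply: weight_mono => //; have -> : (size [:: j])%:R = 1 :> R by [].
 by have := tau0h; have := tau0t; rewrite lerNr ge_max => *; apply/andP; split; lra.
have h : weight z * modC (dbar j phi z) <= tilde phi z.
 rewrite /tilde; have : weight z * modC (dbar j phi z) <= weight z * abs_dbar phi z.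
  rewrite ler_pM2l// /abs_dbar (bigD1 j) //= lerDl sumr_ge0// => *; by [].
 have : 0 <= weight z `^ (1 / 2) * abs_dbarT phi z.
  rewrite mulr_ge0//; apply: sumr_ge0 => i _; apply: sumr_ge0 => *; by [].
 lra.
have := le_trans h (hT z zB); rewrite mulrC -ler_pdivlMr//.
move=> /le_trans; apply; rewrite -mulrA (@powR_split _ (weight z) (tau0 - 1) tau0 (- 1) w0)//.
by rewrite (powR_inv1 (ltW w0)) ler_wpM2r ?mulr_ge0 ?powR_ge0 ?invr_ge0 ?(ltW w0)// le_max lexx orbT.
Qed.

Lemma phi_Dlin : const D, forall z v, uball z -> modC (Dlin phi z v) <= D * weight z `^ (tau0 - 1) * nr v.
have [D D0 hD] := phi_grad.
exists (n%:R * (D + D)) => [|z v zB]; first by rewrite mulr_ge0// addr_ge0.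
apply: (le_trans (modC_Dlin _ _ _)); rewrite ler_wpM2r//.
rewrite -mulrA -[n in n%:R]card_ord -sum1_card natr_sum mulr_suml; apply: ler_sum => j _.
by rewrite mul1r mulrDl; have [] := hD j z zB; exact: lerD.
Qed.

Lemma powR_subadd (a b t : R) : 0 <= a -> 0 <= b -> 0 < t -> t <= 1 -> (a + b) `^ t <= a `^ t + b `^ t.
move=> a0 b0 t0 t1; have [s0|s0] := eqVneq (a + b) 0.
 by rewrite s0 powR0 ?gt_eqF// addr_ge0 ?powR_ge0.
have s1 : 0 < a + b by rewrite lt_neqAle eq_sym s0 addr_ge0.
have h x : 0 <= x -> x <= a + b -> x / (a + b) * (a + b) `^ t <= x `^ t.
 rewrite le_eqVlt => /orP[/eqP <-|x0] xs; first by rewrite mul0r mul0r powR_ge0.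
 have q : 0 < x / (a + b) <= 1 by rewrite divr_gt0 //= ler_pdivrMr// mul1r.
 have <- : (x / (a + b)) `^ t * (a + b) `^ t = x `^ t.
  by rewrite -powRM ?(ltW s1) ?divr_ge0 ?(ltW x0) ?(ltW s1)// divfK.
 by rewrite ler_wpM2r ?powR_ge0// ger1_powR.
have := lerD (h a a0 _) (h b b0 _); rewrite -mulrDl -mulrDl divff// mul1r.
by apply; rewrite ?lerDl ?lerDr.
Qed.

(** Integrate the gradient bound [weight^(tau0 - 1)] along the radius. The primitive is a power
    [tau0] of [1 - |z| + s |z|], whose increment is at most [t^tau0] by subadditivity. *)
Lemma phi_radial : const D, forall z (t : R), uball z -> 0 <= t <= 1 ->
 modC (phi (rc (1 - t) *: z) - phi z) <= D * t `^ tau0.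
have [D D0 hD] := phi_Dlin; have [hC _ _] := hG;
exists (2 * (D / tau0)) => [|z t zB /andP[t0 t1]]; first by rewrite !mulr_ge0// invr_ge0 ltW.
have z1 := zB; rewrite uballE in z1; have z0 := nr_ge0 z.
have E s : z + rc s *: (- z) = rc (1 - s) *: z.
 by rewrite scalerN -[z in z - _]scale1r -scalerBl -RtoC1 -RtoCB.
have inB s : 0 <= s <= t -> uball (z + rc s *: (- z)).
 move=> /andP[s0 st]; rewrite E uballE nrZR ger0_norm; last by lra.
 by nra.
have H1 s : 0 <= s <= t -> cder (fun s => phi (z + rc s *: (- z))) s (Dlin phi (z + rc s *: (- z)) (- z)).
 by move=> /inB sB; apply: (cder_line1 oUB (Ck_le kge1 hC) sB).
have y0 s : 0 <= s -> 0 < 1 - nr z + s * nr z by move=> s0; have := mulr_ge0 s0 z0; lra.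
have H2 s : 0 <= s <= t -> rder (fun s => D / tau0 * (1 - nr z + s * nr z) `^ tau0) s
  (D / tau0 * (tau0 * (1 - nr z + s * nr z) `^ (tau0 - 1) * nr z)).
 move=> /andP[s0 _]; apply: rderZ.
 have d1 : rder (fun s => 1 - nr z + s * nr z) s (nr z).
  apply: rder_eq (rderD (rder_cst (1 - nr z) s) (rderM (rder_id s) (rder_cst (nr z) s))) _.
  by rewrite mulr0 mul1r; ring.
 by apply: rder_eq (rder_comp d1 (rder_powRc tau0 (y0 s s0))) _; ring.
have H3 s : 0 <= s <= t -> modC (Dlin phi (z + rc s *: (- z)) (- z)) <=
  D / tau0 * (tau0 * (1 - nr z + s * nr z) `^ (tau0 - 1) * nr z).
 move=> h; have sB := inB s h; apply: (le_trans (hD _ _ sB)).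
 have -> : D / tau0 * (tau0 * (1 - nr z + s * nr z) `^ (tau0 - 1) * nr z) = D * (1 - nr z + s * nr z) `^ (tau0 - 1) * nr z.
  by move: (_ `^ _) => y; field; rewrite gt_eqF.
 rewrite nrN ler_wpM2r// ler_wpM2l//; rewrite -(opprB 1 tau0).
 case/andP: h => s0 st.
 apply: powRN_le; [by have := tau0h; lra|exact: y0|].
 by apply: le_trans (weight_ge (uball_le sB)); rewrite E nrZR ger0_norm; lra.
have := cder_le t0 H1 H2 H3; rewrite E RtoC0 scale0r addr0 mul0r addr0 => /le_trans; apply.
rewrite -mulrBr -[leRHS]mulrA ler_wpM2l// ler_wpM2l ?mulr_ge0 ?invr_ge0 ?(ltW tau00)//.
rewrite lerBlDl; apply: (le_trans (powR_subadd _ _ tau00 _)); rewrite//; try (have := tau0h; lra).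
rewrite lerD2l; apply: ge0_ler_powR; rewrite ?nnegrE ?(ltW tau00)//.
by rewrite ler_piMr// ltW.
Qed.

(* Go from [z] to [w] through the points [(1 - t) z], [(1 - t) w], [t = min(1, |z - w|)]. *)
Lemma phi_holder : const D, forall z w, uball z -> uball w ->
 modC (phi w - phi z) <= D * dist w z `^ (tau0 / 2).
have [D D0 hD] := phi_radial; have [E E0 hE] := phi_Dlin; have [hC _ _] := hG;
exists ((D + D + 2 * E) * 2 `^ (tau0 / 2)) => // z w zB wB.
pose t := Num.min 1 (nr (w - z)).
have t01 : 0 <= t <= 1 by rewrite le_min ler01 nr_ge0 ge_min lexx.
have /andP[t0 t1] := t01.
have tw : t <= nr (w - z) by rewrite ge_min lexx orbT.
have d2 : t `^ tau0 <= 2 `^ (tau0 / 2) * dist w z `^ (tau0 / 2).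
 rewrite -powRM//.
 apply: (@le_trans _ _ ((nr (w - z) ^+ 2) `^ (tau0 / 2))).
  rewrite -powR_mulrn ?nr_ge0// -powRrM (_ : 2%:R * (tau0 / 2) = tau0); last by field.
  by apply: ge0_ler_powR; rewrite ?nnegrE ?(ltW tau00) ?nr_ge0.
 apply: ge0_ler_powR; rewrite ?nnegrE ?sqr_ge0 ?mulr_ge0 ?dist_ge0 ?divr_ge0 ?(ltW tau00)//.
 by apply: sqdist_le; exact: uball_le.
have M : modC (phi (rc (1 - t) *: w) - phi (rc (1 - t) *: z)) <= 2 * E * t `^ tau0.
 have [tlt1|tge1] := ltP t 1; last first.
  have -> : t = 1 by apply/eqP; rewrite eq_le t1.
  by rewrite subrr RtoC0 !scale0r subrr modC0 !mulr_ge0 ?powR_ge0.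
 have tE : t = nr (w - z) by move: tlt1; rewrite /t minEle; case: ifP; rewrite ?ltxx.
 have [t00|tn0] := eqVneq t 0.
  have wz : w = z by apply/subr0_eq/eqP; rewrite -nr_eq0 -tE t00.
  by rewrite wz subrr modC0 !mulr_ge0 ?powR_ge0.
 have tp : 0 < t by rewrite lt_neqAle eq_sym tn0.
 pose z' := rc (1 - t) *: z; pose w' := rc (1 - t) *: w.
 have nr' u : uball u -> nr (rc (1 - t) *: u) <= 1 - t.
  by rewrite uballE nrZR ger0_norm ?subr_ge0// => /ltW h; rewrite ler_piMr ?subr_ge0.
 have seg (s : R) : 0 <= s <= 1 -> nr (z' + rc s *: (w' - z')) <= 1 - t.
  by move=> s01; apply: convex_nr => //; exact: nr'.
 have segB (s : R) : 0 <= s <= 1 -> uball (z' + rc s *: (w' - z')).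
  by move=> /seg h; rewrite uballE (le_lt_trans h)//; lra.
 have H1 s : 0 <= s <= 1 -> cder (fun s => phi (z' + rc s *: (w' - z'))) s (Dlin phi (z' + rc s *: (w' - z')) (w' - z')).
  by move=> /segB sB; apply: (cder_line1 oUB (Ck_le kge1 hC) sB).
 have H2 s : 0 <= s <= 1 -> rder (fun s => E * t `^ tau0 * s) s (E * t `^ tau0 * 1).
  by move=> _; apply: rderZ; exact: rder_id.
 have H3 s : 0 <= s <= 1 -> modC (Dlin phi (z' + rc s *: (w' - z')) (w' - z')) <= E * t `^ tau0 * 1.
  move=> h; have sB := segB s h; apply: (le_trans (hE _ _ sB)).
  rewrite mulr1 -mulrA ler_wpM2l// (@powR_split _ t tau0 (tau0 - 1) 1 tp); last by ring.
  rewrite powRr1//; apply: ler_pM; rewrite ?powR_ge0 ?nr_ge0//.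
   rewrite -(opprB 1 tau0); apply: powRN_le => //; first by have := tau0h; lra.
   by apply: le_trans (weight_ge (uball_le sB)); have := seg s h; lra.
  rewrite -scalerBr nrZR ger0_norm ?subr_ge0// tE ler_piMl ?nr_ge0//; lra.
 have := @cder_le _ _ _ _ _ 0 1 ler01 H1 H2 H3.
 have W1 : z' + rc 1 *: (w' - z') = w' by rewrite RtoC1 scale1r addrC subrK.
 have W0 : z' + rc 0 *: (w' - z') = z' by rewrite RtoC0 scale0r addr0.
 by rewrite W1 W0 mulr1 mulr0 subr0 mulrA.
have h1 := hD z t zB t01; have h2 := hD w t wB t01.
rewrite modC_distC in h2.
have h3 := modC_distD (phi (rc (1 - t) *: w)) (phi w) (phi z).
have h4 := modC_distD (phi (rc (1 - t) *: z)) (phi (rc (1 - t) *: w)) (phi z).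
have c0 : 0 <= D + D + 2 * E by rewrite !addr_ge0// mulr_ge0.
have := ler_wpM2l c0 d2; rewrite mulrA; move: h1 h2 h3 h4 M.
move: (modC _) (modC _) (modC _) (modC _) (modC _) (t `^ _) => *; lra.
Qed.

Lemma phi_bnd : const M, forB z, modC (phi z) <= M.
have [D D0 hD] := phi_radial; exists (modC (phi 0) + D) => // z zB.
have := hD z 1 zB; rewrite ler01 lexx subrr RtoC0 scale0r powR1 mulr1 => /(_ isT).
have := modCBr (phi z) (phi 0); rewrite modC_distC; lra.
Qed.

(* [|phi z| + (1 - |z|)] is positive on the closed ball, hence bounded below. *)
Lemma phi_lower : (forall zeta, usphere zeta -> phi zeta <> 0) ->
 exists2 c : R, 0 < c & forB z, weight z <= c -> c <= modC (phi z).
move=> hS; have [_ /within_contP hc _] := hG.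
pose q z := modC (phi z) + (1 - nr z).
have q0 z : nr z <= 1 -> 0 < q z.
 move=> z1; rewrite /q; have [/eqP e|e] := boolP (nr z == 1); last first.
  by rewrite ltr_wpDl ?modC_ge0// subr_gt0 lt_neqAle e.
 rewrite e subrr addr0 modC_gt0; apply/eqP; apply: hS.
 by rewrite /usphere /= -nr_sqr e expr1n.
have qc z : nr z <= 1 -> forall e : R, 0 < e -> exists2 d : R, 0 < d &
  forall w, nr w <= 1 -> nr (w - z) < d -> `|q w - q z| < e.
 move=> z1 e e0; have zC : cball z by rewrite cballE.
 have e2 : 0 < e / 2 by rewrite divr_gt0.
 have [d d0 hd] := hc z zC _ e2; exists (Num.min d (e / 2)) => [|w w1]; rewrite lt_min ?d0//.
 move=> /andP[h1 h2]; have wC : cball w by rewrite cballE.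
 have := hd w wC h1; have := modCBr (phi w) (phi z); have := modCBr (phi z) (phi w).
 rewrite (modC_distC (phi z)); have := nrBr w z; have := nrBr z w; rewrite (nr_distC z).
 rewrite /q ltr_norml => *; apply/andP; split; lra.
have ic z : nr z <= 1 -> forall e : R, 0 < e -> exists2 d : R, 0 < d &
  forall w, nr w <= 1 -> nr (w - z) < d -> `|(q w)^-1 - (q z)^-1| < e.
 move=> z1 e e0.
 have qz := q0 z z1; pose e' := Num.min (q z / 2) (e * (q z * q z) / 2 / 2).
 have e'0 : 0 < e' by rewrite lt_min !divr_gt0// !mulr_gt0.
 have [d d0 hd] := qc z z1 e' e'0; exists d => // w w1 /(hd w w1).
 rewrite lt_min => /andP[h1 h2]; have qw := q0 w w1.
 have -> : (q w)^-1 - (q z)^-1 = (q z - q w) / (q w * q z) by field; rewrite !gt_eqF.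
 rewrite normrM normfV (gtr0_norm (mulr_gt0 qw qz)) ltr_pdivrMr ?mulr_gt0// distrC.
 have h3 : q z / 2 < q w by move: h1; rewrite ltr_norml => /andP[]; lra.
 apply: (lt_le_trans h2); rewrite -!mulrA ler_pM2l// mulrC -mulrA.
 by have := mulr_gt0 qz qz; have := mulr_gt0 qw qz; move: qz qw h3; move: (q z) (q w) => x y; nra.
have [M hM] := @compact_rbnd R n _ (fun z => (q z)^-1) (@cball_compact R n) ic.
have M0 : 0 < M.
 by apply: lt_le_trans (hM 0 _); rewrite /= ?nr0 ?ler01// invr_gt0 q0// nr0 ler01.
exists ((2 * M)^-1) => [|z zB hz]; first by rewrite invr_gt0 mulr_gt0.
have z1 := uball_le zB; have := hM z z1; rewrite -[leRHS]invrK lef_pV2 ?posrE ?invr_gt0 ?q0//.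
have := weight_ge z1; move: hz; rewrite /q invfM => h1 h2 h3.
have : 0 < M^-1 by rewrite invr_gt0.
move: h1 h2 h3; move: (M^-1) (modC _) (weight z) (nr z) => a b c d; lra.
Qed.

End Symbol.

Variable b : R.
Hypothesis b0 : 0 < b.
Hypothesis bt : b < N + tau0.
Let bN : b < N + 1.
by have := bt; have := tau01; lra. Qed.

(** * An integrable majorant for all dilates of [f] *)

Section Star.
Implicit Types (w z : V) (f g phi psi : V -> C).
Let a := dN + 1.
Let a0 : 0 <= a.
by rewrite !addr_ge0. Qed.

Definition L1 f : \bar R := Ie (fun u => (modC (f u) * weight u `^ (b - 1))%:E).
Lemma L1_ge0 f : (0 <= L1 f)%E.
by apply: Ie_ge0 => w _; rewrite lee_fin mulr_ge0. Qed.
Lemma emeas_L1 f : cmeas f -> emeas (fun u => (modC (f u) * weight u `^ (b - 1))%:E).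
by move=> mf; exact: (emeasM_fin (p := fun w => modC (f w)) (emeas_mod mf) (emeas_pow (b - 1))). Qed.
(** By [dil_maximal], a constant multiple of it dominates [weight^(b - 1) |f (r .)|] simultaneously
    for all [r] in [[1/4, 1[]. *)
Definition star f w : \bar R := ((weight w `^ (b - 1))%:E * Jf f a N w)%E.
Lemma star_ge0 f w : (0 <= star f w)%E.
by rewrite mule_ge0 ?Jf_ge0// lee_fin powR_ge0. Qed.
Lemma emeas_star f : cmeas f -> emeas (star f).
by move=> mf; exact: emeasurable_funM (emeas_pow (b - 1)) (emeas_Jf a N mf). Qed.

(** By Tonelli, the weight [b - 1] integrated against [dist^(-(dN + 1))] is at most a constant times
    [weight^(b - N - 1)]; multiplied by the weight [N] of the potential this is again [b - 1]. Here
    [b < N + 1] is used. *)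
Lemma star_int : const D, forall f, cmeas f -> (Ie (star f) <= D%:E * L1 f)%E.
have s0 : 0 < N + 1 - b by rewrite subr_gt0.
have qs : a <= n%:R + b + (N + 1 - b) by rewrite /a; move: (n%:R : R) => t; lra.
have [D D0 hD] := FR_gr b0 s0 qs; exists D => // f mf.
have mH : emeas (fun u : V => (D * weight u `^ (- (N + 1 - b)))%:E) by exact: emeasM_fin (emeas_cst D%:E) (emeas_pow _).
apply: (le_trans (Jf_comp N mf (emeas_pow (b - 1)) (fun _ _ => powR_ge0 _ _) mH _)) => [u uB|].
 apply: le_trans (hD u uB); apply: eqle.
 by apply: Ie_eq => z _; rewrite distC mulrC.
rewrite /L1 -IeZ//; last exact: emeas_L1.
apply: eqle; apply: Ie_eq => w wB; rewrite -EFinM; congr (_%:E).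
rewrite (@powR_split _ (weight w) (b - 1) N (- (N + 1 - b)) (weight_gt0 wB)); last by ring.
by move: (weight w `^ _) (weight w `^ _) => x y; ring.
Qed.

Lemma star_fin f : cmeas f -> (L1 f < +oo)%E -> (Ie (star f) < +oo)%E.
move=> mf hf; have [D D0 hD] := star_int; apply: (le_lt_trans (hD f mf)).
by apply: lte_mul_pinfty; rewrite ?lee_fin.
Qed.

Lemma star_dct f (F : nat -> V -> C) g (A : R) : hol UB f -> (L1 f < +oo)%E -> 0 <= A ->
 (forall i, cmeas (F i)) -> cmeas g ->
 (forall i w, uball w -> modC (F i w) <= A * (weight w `^ (b - 1) * modC (f (rc (rr i) *: w)))) ->
 (forB w, slim (fun i => F i w) (g w)) ->
 [/\ forall i, cok (F i), cok g & slim (fun i => cintB (F i)) (cintB g)].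
move=> hf f1 A0 mF mg hF hlim; have [D D0 hD] := dil_maximal.
have mf := cmeas_hol hf; have mS := emeas_star mf.
apply: (slim_dct (G := fun w => ((A * D)%:E * star f w)%E)) => //.
- exact: measurable_funeM.
- rewrite (IeZ mS)//; last by move=> w _; exact: star_ge0.
 by apply: lte_mul_pinfty; rewrite//; exact: star_fin.
- by move=> w _; rewrite mule_ge0 ?star_ge0// lee_fin mulr_ge0.
move=> i w wB; have ri := rr_bnd i.
apply: (@le_trans _ _ ((A * weight w `^ (b - 1))%:E * (modC (f (rc (rr i) *: w)))%:E)%E).
 by rewrite -EFinM lee_fin -mulrA hF.
apply: (@le_trans _ _ ((A * weight w `^ (b - 1))%:E * (D%:E * Jf f a N w))%E).
 by apply: lee_wpmul2l; [rewrite lee_fin mulr_ge0 ?powR_ge0|exact: hD].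
rewrite /star muleA -EFinM muleA -EFinM; apply: eqle.
by congr (_%:E * _)%E; ring.
Qed.

End Star.

(** * Passage to the limit in Charpentier's formula *)

Section KLimit.
Implicit Types (w z : V) (f g psi : V -> C).

Let hC1 : Ck 1 UB phi.
by have [h _ _] := hG; apply: Ck_le h; exact: kge1. Qed.
Let p : R := ((n + n).-1)%:R.
Definition prd (g : V -> C) (s : R) f w : C := g (rc s *: w) * f (rc s *: w).

(** Since [f (s .)] is holomorphic, only [phi (s .)] is differentiated. The exponents [tau0 - 1] and
    [tau0 - 1/2] that occur at [s w] are negative, by [tau0 < 1/2], so the weight there may be
    replaced by the smaller one at [w]. *)
Lemma tilde_prd : const G, forall f (s : R) w, hol UB f -> 0 < s < 1 -> uball w ->
 tilde (prd phi s f) w <= G * (modC (f (rc s *: w)) * weight w `^ tau0).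
have [G G0 [_ hT]] := normG_bnd.
exists (G + G) => // f s w hf s01 wB.
have /andP[s0 s1] := s01; have sB := uball_dil s01 wB; have w0 := weight_gt0 wB; have sw0 := weight_gt0 sB.
set F := modC (f (rc s *: w)).
have F0 : 0 <= F by exact: modC_ge0.
have D0 j : 0 <= modC (dbar j phi (rc s *: w)) by exact: modC_ge0.
have A0 : 0 <= abs_dbar phi (rc s *: w) by apply: sumr_ge0 => *; exact: modC_ge0.
have T0 : 0 <= abs_dbarT phi (rc s *: w).
 by apply: sumr_ge0 => i _; apply: sumr_ge0 => *; exact: modC_ge0.
have h1 : abs_dbar (prd phi s f) w <= F * abs_dbar phi (rc s *: w).
 rewrite /abs_dbar mulr_sumr; apply: ler_sum => j _.
 rewrite (dbar_prod_dil j s01 hC1 hf wB) 2!modCM modCR (gtr0_norm s0) mulrC -/F ler_wpM2l//.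
 by rewrite ler_piMl// ltW.
have h2 : abs_dbarT (prd phi s f) w = F * abs_dbarT phi (rc s *: w).
 rewrite /abs_dbarT mulr_sumr; apply: eq_bigr => i _; rewrite mulr_sumr; apply: eq_bigr => j _.
 rewrite !(dbar_prod_dil _ s01 hC1 hf wB) !mxE -/F /F -modCM; congr modC.
 have E (x y t v c d : C) : c * (t * x * v) - d * (t * y * v) = v * (t * c * x - t * d * y) by ring.
 exact: E.
have g1 := hT _ sB; rewrite /tilde in g1.
have e1 : abs_dbar phi (rc s *: w) <= G * weight (rc s *: w) `^ (tau0 - 1).
 rewrite (@powR_split _ (weight (rc s *: w)) (tau0 - 1) tau0 (- 1) sw0)// (powR_inv1 (ltW sw0)) mulrA.
 rewrite ler_pdivlMr// mulrC (le_trans _ g1)// lerDl mulr_ge0 ?powR_ge0//.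
have e2 : abs_dbarT phi (rc s *: w) <= G * weight (rc s *: w) `^ (tau0 - 1 / 2).
 rewrite (@powR_split _ (weight (rc s *: w)) (tau0 - 1 / 2) tau0 (- (1 / 2)) sw0)// powRN mulrA.
 rewrite ler_pdivlMr ?powR_gt0// mulrC (le_trans _ g1)// lerDr mulr_ge0 ?(ltW sw0)//.
have t1 : tau0 - 1 <= 0 by have := tau0h; lra.
have t2 : tau0 - 1 / 2 <= 0 by have := tau0h; lra.
have e1' := le_trans e1 (ler_wpM2l G0 (weight_dil_pow s01 wB t1)).
have e2' := le_trans e2 (ler_wpM2l G0 (weight_dil_pow s01 wB t2)).
rewrite /tilde h2.
have E1 : weight w `^ tau0 = weight w * weight w `^ (tau0 - 1).
 by rewrite -{2}(powRr1 (ltW w0)); apply: powR_split => //; ring.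
have E2 : weight w `^ tau0 = weight w `^ (1 / 2) * weight w `^ (tau0 - 1 / 2).
 by apply: powR_split => //; ring.
have f1 : weight w * abs_dbar (prd phi s f) w <= G * (F * weight w `^ tau0).
 rewrite E1; apply: (le_trans (ler_wpM2l (ltW w0) h1)).
 by have := ler_wpM2l (mulr_ge0 (ltW w0) F0) e1'; move: (weight w) (weight w `^ _) (abs_dbar _ _) => x y u; lra.
have f2 : weight w `^ (1 / 2) * (F * abs_dbarT phi (rc s *: w)) <= G * (F * weight w `^ tau0).
 rewrite E2; have := ler_wpM2l (mulr_ge0 (powR_ge0 (weight w) (1 / 2)) F0) e2'.
 by move: (weight w `^ (1 / 2)) (weight w `^ (tau0 - 1 / 2)) (abs_dbarT _ _) => x y u; rewrite [X in _ <= X -> _](_ : _ = G * (F * (x * y))); [rewrite -mulrA|ring].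
by rewrite [leRHS]mulrDl; exact: (lerD f1 f2).
Qed.

(** For [z] fixed, [Ddist_ge] leaves the singularity [|w - z|^(1 - 2n)], and powers of [dist w z]
    are bounded whatever the sign of the exponent. *)
Lemma kern_bound z : uball z -> const A, forB w, w != z ->
 weight w `^ (N - 1) / (modC (1 - herm w z) `^ (N - n%:R + 1) * Ddist w z `^ (n%:R - 1 / 2)) <=
 A * (weight w `^ (N - 1) * nr (w - z) `^ (- p)).
move=> zB; have [M M0 hM] := ker_bnd (- (N - n%:R + 1)) zB; have z0 := weight_gt0 zB.
have n12 : 0 <= (n%:R - 1 / 2 : R).
 have : 1 <= n%:R :> R by rewrite ler1n.
 by move: (n%:R : R) => x; lra.
exists (M * weight z `^ (- (n%:R - 1 / 2))) => [|w wB wz]; first by rewrite mulr_ge0 ?powR_ge0.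
have wz0 : 0 < nr (w - z) by rewrite lt_neqAle eq_sym nr_eq0 subr_eq0 wz nr_ge0.
rewrite invfM -!powRN -/(dist w z) [leRHS]mulrCA ler_wpM2l ?powR_ge0//.
have h : Ddist w z `^ (- (n%:R - 1 / 2)) <= weight z `^ (- (n%:R - 1 / 2)) * nr (w - z) `^ (- p).
 have <- : (nr (w - z) ^+ 2 * weight z) `^ (- (n%:R - 1 / 2)) = weight z `^ (- (n%:R - 1 / 2)) * nr (w - z) `^ (- p).
  rewrite powRM ?sqr_ge0 ?(ltW z0)// mulrC -(@powR_mulrn _ (nr (w - z)) 2) ?nr_ge0// -powRrM; congr (_ * _ `^ _).
  by rewrite /p -subn1 natrB ?addn_gt0 ?n0// natrD; move: (n%:R : R) => x; field.
 apply: powRN_le => //; first by rewrite mulr_gt0// exprn_gt0.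
 by apply: Ddist_ge; exact: uball_le.
apply: (le_trans (ler_pM (powR_ge0 _ _) (powR_ge0 _ _) (hM w wB) h)).
by rewrite mulrA.
Qed.

Lemma nr_row_mx (w z : V) : nr (row_mx w z) ^+ 2 = nr w ^+ 2 + nr z ^+ 2.
rewrite !nr_sqr /sqnorm big_split_ord /=; congr (_ + _); apply: eq_bigr => j _.
 by rewrite row_mxEl.
by rewrite row_mxEr.
Qed.

(** The kernel is smooth jointly off the diagonal; [row_mx w z] restricts this to the slice of fixed
    [z]. *)
Lemma K_cont z w j : uball z -> uball w -> w != z -> cont_at (fun w => K w z 0 j) w.
move=> zB wB wz; have [hK _ _] := HK; have [hc _] := hK j 0%N.
have hx : offdiag (row_mx w z) by split; rewrite ?row_mxKl ?row_mxKr//; apply/eqP.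
apply/contP => e e0; have [d d0 hd] := (contP _ _).1 (hc _ hx) e e0.
exists d => // u hu; have := hd (row_mx u z); rewrite !row_mxKl !row_mxKr; apply.
rewrite opp_row_mx add_row_mx subrr; have := nr_row_mx (u - w) 0; rewrite nr0 expr0n addr0.
by move=> /eqP; rewrite eqrXn2// => /eqP ->.
Qed.

(* Charpentier's formula for [phi (r .) f (r .)], [r -> 1]. *)
Lemma Pop_limit f z : hol UB f -> (L1 f < +oo)%E -> uball z ->
 slim (fun i => Pop N (prd phi (rr i) f) z) (phi z * f z - Kop K (fun w => f w *: dbarv phi w) z).
move=> hf f1 zB; have [_ hrep [c hc]] := HK; have z1 := zB; rewrite uballE in z1; have z0 := nr_ge0 z.
have hf1 := hol_C1 oUB hf; have mf := cmeas_hol hf.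
pose F i w := if w == z then 0 else wedge (K w z) (dbarv (prd phi (rr i) f) w).
pose g w := if w == z then 0 else wedge (K w z) (f w *: dbarv phi w).
have sm i : smb 1 (prd phi (rr i) f).
 by have r01 := rr01 i; apply: smbM; exact: smb_dil.
have cdb j w : uball w -> cont_at (dbar j phi) w.
 by move=> wB; exact: (Ck_cont (Ck_dbar j oUB hC1) wB).
have cwedge (th : V -> V) : (forall j w, uball w -> cont_at (fun w => th w 0 j) w) ->
  cmeas (fun w => if w == z then 0 else wedge (K w z) (th w)).
 move=> hth; apply: cmeas_offpoint => w wB wz; rewrite /wedge.
 have oU := @openU_off z.
 have cs j : Ck 0 [set w : V | uball w /\ w != z] (fun w => K w z 0 j * th w 0 j).
  apply: (Ck_mul oU (phi := fun w => K w z 0 j) (psi := fun w => th w 0 j)); split => // u [uB uz].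
   exact: K_cont.
  exact: hth.
 exact: (Ck_cont (Ck_sum (index_enum 'I_n) oU cs) (conj wB wz)).
have mF i : cmeas (F i).
 apply: cwedge => j w wB; have -> : (fun w => dbarv (prd phi (rr i) f) w 0 j) = dbar j (prd phi (rr i) f).
  by apply/funext => u; rewrite mxE.
 exact: smb_cont (smb_dbar j (sm i)) _ (uball_le wB).
have mg : cmeas g.
 apply: cwedge => j w wB; have -> : (fun w => (f w *: dbarv phi w) 0 j) = (fun w => f w * dbar j phi w).
  by apply/funext => u; rewrite !mxE.
 by apply: cont_mul; [exact: hol_cont hf wB|exact: cdb].
have [G G0 hT] := tilde_prd; have [A A0 hA] := kern_bound zB.
pose A1 := `|c| * A * G; have A10 : 0 <= A1 by rewrite !mulr_ge0.
have hF i w : uball w -> w != z -> modC (F i w) <=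
  A1 * (weight w `^ (N + tau0 - 1) * modC (f (rc (rr i) *: w)) * nr (w - z) `^ (- p)).
 move=> wB wz; have r01 := rr01 i; rewrite /F (negPf wz).
 have [r r1 hr] := sm i; have C1 : Ck 1 UB (prd phi (rr i) f).
  by apply: Ck_sub hr => u /uball_le h; exact: le_lt_trans h r1.
 apply: (le_trans (hc _ C1 w z wB zB (elimN eqP wz))).
 have t0 : 0 <= tilde (prd phi (rr i) f) w by exact: tilde_ge0.
 set Q := (X in c * X * _).
 have Q0 : 0 <= Q by rewrite mulr_ge0 ?powR_ge0// invr_ge0 mulr_ge0 ?powR_ge0.
 apply: (le_trans (ler_wpM2r t0 (ler_wpM2r Q0 (ler_norm c)))).
 apply: (le_trans (ler_pM (mulr_ge0 (normr_ge0 c) Q0) t0 (ler_wpM2l (normr_ge0 c) (hA w wB wz)) (hT _ _ _ hf r01 wB))).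
 apply: eqle; rewrite (@powR_split _ (weight w) (N + tau0 - 1) (N - 1) tau0 (weight_gt0 wB)); last by ring.
 rewrite /A1; move: (weight w `^ _) (weight w `^ _) (nr _ `^ _) (modC _) => x y u v; ring.
(* Points within [rho] of [z] have norm at most [s < 1], so there the dilates of [f] have a common
   bound [M]. *)
clearbody A1; pose rho := (1 - nr z) / 2; have rho0 : 0 < rho by rewrite divr_gt0// subr_gt0.
pose s := (1 + nr z) / 2; have s01 : 0 < s < 1 by rewrite /s; apply/andP; split; lra.
have s0 : 0 < s by case/andP: s01.
have [M hM] := smb_bnd (smb_dil s01 hf1).
have fM i w : nr (w - z) < rho -> modC (f (rc (rr i) *: w)) <= M.
 move=> h; have /andP[r0 r1] := rr01 i.
 have ws : nr w <= s by have := nrD (w - z) z; rewrite subrK /s /rho in h *; lra.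
 have -> : rc (rr i) *: w = rc s *: (rc (rr i / s) *: w).
  by rewrite scalerA -RtoCM mulrCA divff ?mulr1// gt_eqF.
 have rs : 0 < rr i / s by exact: divr_gt0.
 apply: hM; rewrite nrZR (gtr0_norm rs) -[_ / s * _]mulrAC ler_pdivrMr// mul1r.
 by apply: le_trans ws; rewrite ler_piMl ?nr_ge0// ltW.
have M0 : 0 <= M by apply: le_trans (hM 0 _); rewrite ?modC_ge0// nr0.
have [D D0 hD] := dil_maximal.
pose B1 := A1 * (rho^-1 * M); pose B2 := A1 * rho `^ (- p) * D.
have B10 : 0 <= B1 by rewrite !mulr_ge0// invr_ge0 ltW.
have B20 : 0 <= B2 by rewrite !mulr_ge0// powR_ge0.
(* Near [z] the dilates are bounded and the singularity is integrable; away from [z] the singular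
   factor is bounded and [star f] takes over. *)
pose G' w := (B1%:E * (nr (w - z) `^ (- p))%:E + B2%:E * star f w)%E.
have G1 w : (0 <= B1%:E * (nr (w - z) `^ (- p))%:E)%E by rewrite mule_ge0// lee_fin powR_ge0.
have G2 w : (0 <= B2%:E * star f w)%E by rewrite mule_ge0 ?star_ge0.
have [ms is0] := sing_int zB; have mst := emeas_star mf.
have m1 : emeas (fun w => B1%:E * (nr (w - z) `^ (- p))%:E)%E by apply: measurable_funeM.
have m2 : emeas (fun w => B2%:E * star f w)%E by apply: measurable_funeM.
have H1 : emeas G' by apply: emeasurable_funD.
have H2 : (Ie G' < +oo)%E.
 rewrite /G' IeD// (IeZ ms) ?(IeZ mst)//.
 - by apply: lte_add_pinfty; apply: lte_mul_pinfty => //; exact: star_fin mf f1.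
 - by move=> w _; exact: star_ge0.
have H3 i w : uball w -> ((modC (F i w))%:E <= G' w)%E.
 move=> wB; have [->|wz] := eqVneq w z.
  by rewrite /F eqxx modC0 /G' adde_ge0.
 have ri := rr_bnd i; have w0 := weight_gt0 wB; have := hF i w wB wz.
 have [far|near] := leP rho (nr (w - z)).
  move=> h; apply: (@le_trans _ _ (B2%:E * star f w)%E); last by rewrite /G' leeDr.
  apply: (@le_trans _ _ ((A1 * rho `^ (- p) * weight w `^ (b - 1))%:E * (modC (f (rc (rr i) *: w)))%:E)%E).
   rewrite -EFinM lee_fin; apply: (le_trans h); rewrite -!mulrA ler_wpM2l//.
   rewrite [leRHS]mulrC -mulrA; apply: ler_pM; rewrite ?mulr_ge0 ?modC_ge0 ?powR_ge0//.
    by apply: weight_mono => //; have := bt; lra.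
   by rewrite ler_wpM2l ?modC_ge0//; apply: powRN_le => //; rewrite ltW// p_gt0.
  apply: (@le_trans _ _ ((A1 * rho `^ (- p) * weight w `^ (b - 1))%:E * (D%:E * Jf f (dN + 1) N w))%E).
   by apply: lee_wpmul2l; [rewrite lee_fin !mulr_ge0 ?powR_ge0|exact: hD].
  rewrite /star muleA -EFinM muleA -EFinM; apply: eqle.
  by congr (_%:E * _)%E; rewrite /B2; ring.
 move=> h; apply: (@le_trans _ _ (B1%:E * (nr (w - z) `^ (- p))%:E)%E); last by rewrite /G' leeDl.
 rewrite -EFinM lee_fin; apply: (le_trans h); rewrite /B1 -[leRHS]mulrA ler_wpM2l//.
 rewrite ler_wpM2r ?powR_ge0//; apply: ler_pM; rewrite ?powR_ge0 ?modC_ge0//; last exact: fM.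
 apply: (@le_trans _ _ (weight w `^ (- 1))).
  by apply: weight_mono => //; have := N0; have := tau00; lra.
 rewrite (powR_inv1 (ltW w0)) lef_pV2 ?posrE//.
 apply: le_trans (weight_ge (uball_le wB)).
 by have := nrD (w - z) z; rewrite subrK /rho in near *; lra.
have H4 w : uball w -> slim (fun i => F i w) (g w).
 move=> wB; rewrite /F /g; case: ifP => [_|wz]; first exact: slim_cst.
 rewrite /wedge; apply: slim_sum => j; apply: slimM; first exact: slim_cst.
 apply: (slim_ext (u := fun i => rc (rr i) * dbar j phi (rc (rr i) *: w) * f (rc (rr i) *: w))).
  by move=> i; have r01 := rr01 i; rewrite mxE (dbar_prod_dil j r01 hC1 hf wB).
 rewrite !mxE [f w * _]mulrC -[dbar j phi w]mul1r; apply: slimM; first apply: slimM.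
 - exact: slim_rr.
 - by apply: slim_dil; exact: cdb.
 - by apply: slim_dil; exact: hol_cont hf wB.
have [kF kg lim] := slim_dct mF mg H1 H2 (fun w _ => adde_ge0 (G1 w) (G2 w)) H3 H4.
have EF i : Kop K (dbarv (prd phi (rr i) f)) z = cintB (F i).
 apply: (proj2 (cintB_except (g := fun w => wedge (K w z) (dbarv (prd phi (rr i) f) w)) zB (kF i) _)) => w wB wz.
 by rewrite /F (negPf wz).
have Eg : Kop K (fun w => f w *: dbarv phi w) z = cintB g.
 apply: (proj2 (cintB_except (g := fun w => wedge (K w z) (f w *: dbarv phi w)) zB kg _)) => w wB wz.
 by rewrite /g (negPf wz).
rewrite Eg; apply: (slim_ext (u := fun i => prd phi (rr i) f z + (-1) * cintB (F i))).
 by move=> i; rewrite -EF (hrep _ (smb_C1cball (sm i)) z zB) mulN1r addrK.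
rewrite -[- cintB g]mulN1r; apply: slimD; last by apply: slimM => //; exact: slim_cst.
apply: slimM; apply: slim_dil; first exact: (Ck_cont hC1).
exact: hol_cont hf zB.
Qed.
End KLimit.

(** * Limit of [P^N] after one antiholomorphic integration by parts *)

Section RbLimit.
(** To be used with [phi], which represents [h], and with the constant 1, which represents [f]. *)
Variables (Phi : V -> C) (M : R).
Hypothesis PhiC : Ck 1 UB Phi.
Hypothesis M0 : 0 <= M.
Hypothesis PhiM : forB z, modC (Phi z) <= M.
Hypothesis PhiR : forB z, modC (Rb Phi z) <= M * weight z `^ (tau0 - 1).
Implicit Types (w z : V) (f g psi : V -> C).
Let a := dN + 1.
Let a0 : 0 <= a.
by rewrite !addr_ge0. Qed.

Definition cP f w := f w * Phi w * wtp N w.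
Definition cR f w := f w * Rb Phi w * wtp N w.
Lemma cP_le f w : uball w -> modC (cP f w) <= M * (modC (f w) * weight w `^ (b - 1)).
move=> wB; rewrite /cP 2!modCM modCR ger0_norm//; apply: mul3_le; rewrite ?PhiM//.
by apply: weight_mono => //; have := bN; lra.
Qed.

(** The weight [N] times [weight^(tau0 - 1)] still dominates the exponent [b - 1]: this is where
    [b < N + tau0] enters. *)
Lemma cR_le f w : uball w -> modC (cR f w) <= M * (modC (f w) * weight w `^ (b - 1)).
move=> wB; rewrite /cR 2!modCM modCR ger0_norm//.
apply: mul4_le (PhiR wB) _ _; rewrite//.
rewrite -(@powR_split _ (weight w) (tau0 - 1 + N) _ _ (weight_gt0 wB))//.
by apply: weight_mono => //; have := bt; lra.
Qed.

Lemma cont_Phi w : uball w -> cont_at Phi w. exact: Ck_cont PhiC w. Qed.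
Lemma cont_RbPhi w : uball w -> cont_at (Rb Phi) w.
by move=> wB; exact: (Ck_cont (Ck_Rb oUB PhiC) wB). Qed.
Lemma cmeas_cP f : hol UB f -> cmeas (cP f).
by move=> hf; apply: cmeasM (@cmeas_pow R n N); apply: cmeasM (cmeas_hol hf) _; exact: cmeas_cont cont_Phi.
Qed.
Lemma cmeas_cR f : hol UB f -> cmeas (cR f).
by move=> hf; apply: cmeasM (@cmeas_pow R n N); apply: cmeasM (cmeas_hol hf) _; exact: cmeas_cont cont_RbPhi.
Qed.

Lemma cok_L1 f g : hol UB f -> (L1 f < +oo)%E -> cmeas g ->
 (forB w, modC (g w) <= M * (modC (f w) * weight w `^ (b - 1))) -> cok g.
move=> hf f1 mg h; have mL := emeas_L1 (cmeas_hol hf).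
have mm : emeas (fun w => M%:E * (modC (f w) * weight w `^ (b - 1))%:E)%E by apply: measurable_funeM.
apply: (cok_le mg mm); last by move=> w wB; rewrite -EFinM lee_fin h.
rewrite (IeZ mL)//.
by apply: lte_mul_pinfty; rewrite ?lee_fin.
Qed.

Lemma ker_mod_bnd (e : R) z : 0 <= e -> uball z -> const A, forB w, modC (ker e w z) <= A.
move=> e0 zB; have [A A0 hA] := ker_bnd (- e) zB; exists A => // w wB.
by rewrite modC_ker ?hA//; exact: mul_nr_lt (uball_le wB) zB.
Qed.

(** [Pop_Rb] for the dilated product, with both integrands dominated by means of [star f]. No
    derivative of [f] occurs, because [Rb] annihilates it. *)
Lemma Rb_limit f z : hol UB f -> (L1 f < +oo)%E -> uball z ->
 [/\ cok (cP f), cok (cR f) & slim (fun i => Pop N (prd Phi (rr i) f) z)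
  (rc (kap 0) * (Ik (cP f) a z + rc dN^-1 * Ik (cR f) dN z))].
move=> hf f1 zB; have hf1 := hol_C1 oUB hf;
split; first exact: cok_L1 (cmeas_cP hf) (cP_le f).
 exact: cok_L1 (cmeas_cR hf) (cR_le f).
have [A A0 hA] := ker_mod_bnd a0 zB; have [A' A'0 hA'] := ker_mod_bnd nN0 zB.
have mk1 := cmeas_ker a0 zB; have mk2 := cmeas_ker nN0 zB.
have sm i : smb 1 (prd Phi (rr i) f).
 by have r01 := rr01 i; apply: smbM; exact: smb_dil.
pose F1 i w := prd Phi (rr i) f w * ker a w z * wtp N w.
pose F2 i w := Rb (prd Phi (rr i) f) w * ker dN w z * wtp N w.
have ERb i w : uball w -> Rb (prd Phi (rr i) f) w = Rb Phi (rc (rr i) *: w) * f (rc (rr i) *: w).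
 move=> wB; have r01 := rr01 i; have rB := uball_dil r01 wB.
 rewrite (Rb_mul wB (Ck_dilB r01 PhiC) (Ck_dilB r01 hf1)) Rb_dil//.
 have -> : Rb (fun w => f (rc (rr i) *: w)) w = 0.
  by apply: big1 => j _; rewrite (hol_dbar j (hol_dil r01 hf) wB) mulr0.
 by rewrite mulr0 addr0.
have m1 i : cmeas (F1 i).
 apply: cmeasM (@cmeas_pow R n N); apply: cmeasM mk1; apply: cmeas_cont => w /uball_le; exact: smb_cont (sm i) w.
have m2 i : cmeas (F2 i).
 apply: cmeasM (@cmeas_pow R n N); apply: cmeasM mk2; apply: cmeas_cont => w /uball_le.
 exact: smb_cont (smb_Rb (sm i)) w.
have b1 i w : uball w -> modC (F1 i w) <= A * M * (weight w `^ (b - 1) * modC (f (rc (rr i) *: w))).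
 move=> wB; have r01 := rr01 i;
 rewrite /F1 /prd modCM (modCM (_ * _) (ker _ _ _)) (modCM (Phi _)) modCR ger0_norm//.
 have h1 : weight w `^ N <= weight w `^ (b - 1) by apply: weight_mono => //; have := bN; lra.
 have := mul3_le (modC_ge0 (f (rc (rr i) *: w))) (modC_ge0 _) (PhiM (uball_dil r01 wB)) (powR_ge0 _ _) h1.
 move=> h2; have := ler_pM (modC_ge0 _) (mulr_ge0 (mulr_ge0 (modC_ge0 _) (modC_ge0 _)) (powR_ge0 _ _)) (hA w wB) h2.
 move: (modC (f _)) (modC (Phi _)) (modC (ker _ _ _)) (weight w `^ _) (weight w `^ _) => x1 x2 x3 x4 x5.
 by move=> h; apply: (le_eqs h); ring.
have b2 i w : uball w -> modC (F2 i w) <= A' * M * (weight w `^ (b - 1) * modC (f (rc (rr i) *: w))).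
 move=> wB; have r01 := rr01 i;
 rewrite /F2 ERb// modCM (modCM (_ * _) (ker _ _ _)) (modCM (Rb Phi _)) modCR ger0_norm//.
 have t1 : tau0 - 1 <= 0 by have := tau01; lra.
 have h1 : weight w `^ (tau0 - 1) * weight w `^ N <= weight w `^ (b - 1).
  rewrite -(@powR_split _ (weight w) (tau0 - 1 + N) _ _ (weight_gt0 wB))//.
  by apply: weight_mono => //; have := bt; lra.
 have := mul4_le (modC_ge0 (f (rc (rr i) *: w))) M0 (le_trans (PhiR (uball_dil r01 wB)) (ler_wpM2l M0 (weight_dil_pow r01 wB t1))) (powR_ge0 _ _) h1.
 move=> h3; have := ler_pM (modC_ge0 _) (mulr_ge0 (mulr_ge0 (modC_ge0 _) (modC_ge0 _)) (powR_ge0 _ _)) (hA' w wB) h3.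
 move: (modC (f _)) (modC (Rb _ _)) (modC (ker _ _ _)) (weight w `^ N) (weight w `^ (b - 1)) => x1 x2 x3 x4 x5.
 by move=> h; apply: (le_eqs h); ring.
have c1 g w : (forB u, cont_at g u) -> uball w -> slim (fun i => g (rc (rr i) *: w)) (g w).
 by move=> h wB; apply: slim_dil; exact: h.
have l1 w : uball w -> slim (fun i => F1 i w) (cP f w * ker a w z).
 move=> wB; rewrite /cP mulrAC; apply: slimM; last exact: slim_cst.
 apply: slimM; last exact: slim_cst; rewrite [f w * _]mulrC; apply: slimM; apply: c1 => //; first exact: cont_Phi.
 by move=> u uB; exact: hol_cont hf uB.
have l2 w : uball w -> slim (fun i => F2 i w) (cR f w * ker dN w z).
 move=> wB; rewrite /cR mulrAC; apply: slimM; last exact: slim_cst.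
 apply: slimM; last exact: slim_cst.
 apply: (slim_ext (u := fun i => Rb Phi (rc (rr i) *: w) * f (rc (rr i) *: w))); first by move=> i; rewrite ERb.
 rewrite [f w * _]mulrC; apply: slimM; apply: c1 => //; first exact: cont_RbPhi.
 by move=> u uB; exact: hol_cont hf uB.
have [_ _ s1] := star_dct hf f1 (mulr_ge0 A0 M0) m1 (cmeasM (cmeas_cP hf) mk1) b1 l1.
have [_ _ s2] := star_dct hf f1 (mulr_ge0 A'0 M0) m2 (cmeasM (cmeas_cR hf) mk2) b2 l2.
apply: (slim_ext (u := fun i => rc (kap 0) * (cintB (F1 i) + rc dN^-1 * cintB (F2 i)))).
 by move=> i; have [_ _ ->] := Pop_Rb (sm i) zB.
apply: slimM; first exact: slim_cst.
exact: slimD s1 (slimM (slim_cst _) s2).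
Qed.

End RbLimit.

(** * Limit of [P^N] after repeated holomorphic integrations by parts *)

Section TLLimit.
Implicit Types (w z : V) (g : V -> C).

Definition cT l g w := TL l.+1 g w * wtp (N + l%:R) w.

(** [e < N + l + 1] makes the resulting weight [N + l - e] integrable, and [e >= 0] lets the bound
    at [r w] be replaced by the one at [w]. *)
Lemma TL_limit l g z (A e : R) : Ck l.+1 UB g -> 0 <= A -> 0 <= e -> e < N + l.+1%:R ->
 (forB w, modC (TL l.+1 g w) <= A * weight w `^ (- e)) -> uball z ->
 cok (cT l g) /\
 slim (fun i => Pop N (fun w => g (rc (rr i) *: w)) z) (rc (kap l) * Ik (cT l g) dN z).
move=> hg A0 e0 eN hA zB; have [A' A'0 hA'] := ker_mod_bnd nN0 zB.
have CT : Ck 0 UB (TL l.+1 g) by apply: Ck_TL; rewrite addn0.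
have contT w : uball w -> cont_at (TL l.+1 g) w by exact: Ck_cont CT w.
have mk := cmeas_ker nN0 zB; have mW := @cmeas_pow R n (N + l%:R).
pose F i w := TL l.+1 (fun w => g (rc (rr i) *: w)) w * ker dN w z * wtp (N + l%:R) w.
pose F' i w := TL l.+1 g (rc (rr i) *: w) * ker dN w z * wtp (N + l%:R) w.
have EF i w : uball w -> F i w = F' i w.
 by have r01 := rr01 i; move=> wB; rewrite /F /F' TL_dil.
have mT : cmeas (cT l g) by apply: cmeasM mW; exact: cmeas_cont.
pose c := N + l.+1%:R - e; have c0 : 0 < c by rewrite subr_gt0.
have [D D0 hD] := FR_bnd c0 (q := 0) (ltr_wpDl (ler0n R n) c0).
have mG := emeas_pow (c - 1).
have oo (B : R) : 0 <= B -> (Ie (fun w : V => B%:E * (weight w `^ (c - 1))%:E)%E < +oo)%E.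
 move=> B0; rewrite (IeZ mG)//.
 apply: lte_mul_pinfty; rewrite//; apply: le_lt_trans (ltry D); apply: le_trans (hD z zB).
 by apply: eqle; apply: Ie_eq => w _; rewrite oppr0 powRr0 mul1r.
have est w (x : C) : uball w -> modC x <= A * weight w `^ (- e) ->
  modC (x * wtp (N + l%:R) w) <= A * weight w `^ (c - 1).
 move=> wB hx; rewrite modCM modCR ger0_norm//.
 rewrite (@powR_split _ (weight w) (c - 1) (- e) (N + l%:R) (weight_gt0 wB)); last by rewrite /c -natr1; ring.
 by rewrite mulrA ler_wpM2r ?powR_ge0.
have ok : cok (cT l g).
 apply: (cok_le mT (G := fun w => (A%:E * (weight w `^ (c - 1))%:E)%E)); [exact: measurable_funeM|exact: oo|].
 by move=> w wB; rewrite -EFinM lee_fin est ?hA.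
split=> //.
have [_ _ lim] : [/\ forall i, cok (F' i), cok (fun w => cT l g w * ker dN w z) &
  slim (fun i => cintB (F' i)) (cintB (fun w => cT l g w * ker dN w z))].
 apply: (slim_dct (G := fun w => ((A' * A)%:E * (weight w `^ (c - 1))%:E)%E)).
 - move=> i; have r01 := rr01 i; apply: cmeasM mW; apply: cmeasM mk; exact: cmeas_dil.
 - exact: cmeasM.
 - exact: measurable_funeM.
 - by apply: oo; by [].
 - by move=> w _; rewrite -EFinM lee_fin.
 - move=> i w wB; have r01 := rr01 i;
  rewrite -EFinM lee_fin /F' mulrAC modCM mulrC -mulrA; apply: ler_pM; rewrite ?hA'//.
  by apply: est => //; apply: (le_trans (hA _ (uball_dil r01 wB))); rewrite ler_wpM2l// weight_dil_pow// oppr_le0.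
 - move=> w wB; rewrite /cT mulrAC; apply: slimM; last exact: slim_cst.
  by apply: slimM; [apply: slim_dil; exact: contT|exact: slim_cst].
apply: (slim_ext (u := fun i => rc (kap l) * cintB (F' i))) => [i|]; last by apply: slimM => //; exact: slim_cst.
have r01 := rr01 i; have [_ E] := Pop_TL (smb_dil r01 hg) zB.
by rewrite -(cintB_eq (EF i)); exact: esym E.
Qed.

End TLLimit.

(** * Representation of solutions and the basic difference estimate *)

Section Boot.
Implicit Types (w z u v : V) (f h : V -> C) (J : seq 'I_n).
Let a := dN + 1.
Let eps := tau0 / 2.
Let a0 : 0 <= a.
by rewrite !addr_ge0. Qed.
Let n1 : 1 <= n%:R :> R.
by rewrite ler1n. Qed.
Let eps0 : 0 < eps.
by rewrite divr_gt0. Qed.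
Let hC1 : Ck 1 UB phi.
by have [h _ _] := hG; apply: Ck_le h; exact: kge1. Qed.

(** [M] bounds both data at once, the [B^1] norm of [f] and the supremum of [|h|], so that estimates
    linear in [M] have constants independent of [f] and [h]. *)
Definition sol f h (M : R) := [/\ 0 <= M, hol UB f /\ hol UB h, (L1 f <= M%:E)%E,
 forB z, modC (h z) <= M &
 forB z, phi z * f z = Kop K (fun w => f w *: dbarv phi w) z + h z].
Lemma sol_fin f h M : sol f h M -> (L1 f < +oo)%E.
by case=> _ _ /le_lt_trans h1 _ _; apply: h1; exact: ltry. Qed.

Lemma phi_rb : const M, (forB z, modC (phi z) <= M) /\
 (forB z, modC (Rb phi z) <= M * weight z `^ (tau0 - 1)).
have [M M0 hM] := phi_bnd; have [D D0 hD] := phi_grad.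
exists (M + n%:R * D) => [|]; first by rewrite addr_ge0// mulr_ge0.
split=> z zB; first by rewrite (le_trans (hM z zB))// lerDl mulr_ge0.
apply: (@le_trans _ _ (n%:R * D * weight z `^ (tau0 - 1))); last first.
 by rewrite ler_wpM2r ?powR_ge0// lerDr.
rewrite /Rb (le_trans (modC_sum _ _ _))// -mulrA -[n in n%:R]card_ord -sum1_card natr_sum mulr_suml.
apply: ler_sum => j _; rewrite mul1r modCM modCJ; have [_ h] := hD j z zB.
apply: le_trans h; rewrite ler_piMl//.
by rewrite (le_trans (modC_coord z j))// uball_le.
Qed.

(** [P^N (phi f)] of the dilates has two limits: [phi f - K (f dbar phi)], which equals [h] by the
    equation, and the integrated form of [Rb_limit]. *)
Lemma h_repr f h M z : sol f h M -> uball z ->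
 [/\ cok (cP phi f), cok (cR phi f) &
  h z = rc (kap 0) * (Ik (cP phi f) a z + rc dN^-1 * Ik (cR phi f) dN z)].
move=> s zB; have f1 := sol_fin s; case: s => _ [hf hh] _ _ heq.
have [A A0 [h1 h2]] := phi_rb.
have [k1 k2 lim] := Rb_limit hC1 A0 h1 h2 hf f1 zB; split => //.
by rewrite -(slim_unique (Pop_limit hf f1 zB) lim) (heq z zB) addrC addKr.
Qed.

Lemma Pop_dil f z : hol UB f -> uball z -> slim (fun i => Pop N (fun w => f (rc (rr i) *: w)) z) (f z).
move=> hf zB; apply: (slim_ext (u := fun i => f (rc (rr i) *: z))) => [i|]; last by apply: slim_dil; exact: hol_cont hf zB.
have r01 := rr01 i; apply: (repr_hol0 (g := fun w => f (rc (rr i) *: w)) _ _ zB).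
 exact: (smb_dil r01 (hol_C1 oUB hf)).
by move=> w j wB; exact: hol_dbar j (hol_dil r01 hf) wB.
Qed.

(** [Rb_limit] with the constant 1: [P^N] reproduces the dilates of [f], which converge to [f]. *)
Lemma f_repr f h M z : sol f h M -> uball z ->
 cok (cP (fun=> 1) f) /\ f z = rc (kap 0) * Ik (cP (fun=> 1) f) a z.
move=> s zB; have f1 := sol_fin s; case: s => _ [hf hh] _ _ heq.
have C1 : Ck 1 UB (fun=> 1 : C) by exact: Ck_cst.
have h1 z' : uball z' -> modC (1 : C) <= 1 by rewrite modC1.
have R0 z' : uball z' -> Rb (fun=> 1 : C) z' = 0.
 move=> zB'; apply: big1 => j _; rewrite (_ : dbar j (fun=> 1) z' = 0) ?mulr0//.
 suff hl : hol UB (fun=> 1 : C) by exact: hol_dbar hl zB'.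
 move=> w _; exists 0 => e e0; exists 1 => // l _.
 by rewrite /blin big1 ?subr0 ?subrr ?modC0 ?mulr_ge0 ?nr_ge0 ?(ltW e0)// => i _; rewrite mxE mul0r.
have h2 z' : uball z' -> modC (Rb (fun=> 1 : C) z') <= 1 * weight z' `^ (tau0 - 1).
 by move=> zB'; rewrite R0// modC0 mul1r powR_ge0.
have [k1 k2 lim] := Rb_limit C1 ler01 h1 h2 hf f1 zB; split => //.
have lim2 := Pop_dil hf zB.
have Ep i : Pop N (prd (fun=> 1) (rr i) f) z = Pop N (fun w => f (rc (rr i) *: w)) z.
 by congr (Pop N _ z); apply/funext => w; rewrite /prd mul1r.
have {}lim2 := slim_ext (fun i => esym (Ep i)) lim2.
rewrite (slim_unique lim2 lim); congr (_ * _).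
rewrite (_ : Ik (cR (fun=> 1) f) dN z = 0) ?mulr0 ?addr0//.
rewrite /Ik (cintB_eq (g := fun=> rc 0)); last by move=> w wB; rewrite /cR R0// !(mulr0, mul0r).
by rewrite cintB_rc /Ie integral0.
Qed.

Lemma Ik_le c q z (A : R) (G : V -> R) : cok c -> 0 <= q -> uball z -> 0 <= A ->
 emeas (fun w => (G w)%:E) -> (forB w, 0 <= G w) ->
 (forB w, modC (c w) * dist w z `^ (- q) <= A * G w) ->
 ((modC (Ik c q z))%:E <= (2 * A)%:E * Ie (fun w => (G w)%:E))%E.
move=> ok q0 zB A0 mG G0 h; have [mi _] := cok_Ik ok q0 zB.
apply: (le_trans (modC_cintB mi)); rewrite EFinM -muleA lee_wpmul2l//.
rewrite -IeZ// ; apply: Ie_le.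
- exact: emeas_mod.
- exact: measurable_funeM.
- by move=> w _; rewrite lee_fin modC_ge0.
- move=> w wB; rewrite -EFinM lee_fin modCM modC_ker ?h//.
 exact: mul_nr_lt (uball_le wB) zB.
Qed.

Lemma kap_ge0 : 0 <= kap 0.
by apply/ltW; exact: (kap_gt0 0). Qed.

(** [al] is a constant and so commutes with the derivatives; it will be the value of [phi] at the
    point [z] where the result is evaluated. Freezing it before differentiating avoids derivatives
    of [phi] outside the integral. *)
Lemma Ik_diff c1 c2 q (kp al : C) f h J z : cok c1 -> cok c2 -> 0 <= q -> hol UB f -> uball z ->
 (forB u, f u = kp * Ik c1 q u) -> (forB u, h u = kp * Ik c2 q u) ->
 dzl J h z - al * dzl J f z = Ik (fun w => mu q J w * (kp * (c2 w - al * c1 w))) (q + (size J)%:R) z.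
move=> k1 k2 qp hf zB Ef Eh; have kd : cok (fun w => kp * (c2 w - al * c1 w)).
 by apply: cok_ext (cokZ kp (cokD k2 (cokZ (- al) k1))) => w _; rewrite mulNr.
have E u : uball u -> al * f u + Ik (fun w => kp * (c2 w - al * c1 w)) q u = h u.
 move=> uB; rewrite Ef// Eh//; have i1 := cok_Ik k1 qp uB; have i2 := cok_Ik k2 qp uB.
 have -> : Ik (fun w => kp * (c2 w - al * c1 w)) q u = kp * (Ik c2 q u + (- al) * Ik c1 q u).
  rewrite /Ik -(cintBZ _ i1) -(cintBD i2 (cokZ _ i1)) -(cintBZ _ (cokD i2 (cokZ _ i1))).
  by apply: cintB_eq => w _; move: (ker _ _ _) (c1 w) (c2 w) => x y t; ring.
 by move: (Ik _ _ _) (Ik _ _ _) => x y; ring.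
have Cf : Ck (size J) UB f by apply: (hol_Ck).
have Ci : Ck (size J) UB (Ik (fun w => kp * (c2 w - al * c1 w)) q) by apply: (hol_Ck); exact: hol_Ik.
rewrite (dzl_loc oUB (Ck_add oUB (Ck_scale al oUB Cf) Ci) E zB) (dzl_lin al oUB Cf Ci zB) (dzl_Ik J kd qp zB).
by rewrite addrC addKr.
Qed.

(** Bookkeeping of exponents: [l] derivatives raise the kernel exponent by [l], a gain [dist^d]
    lowers it, and the surplus [s] of weight over [b - 1] lowers it further by [weight_dist]. *)
Lemma Ik_J q l d s Q : 0 <= q -> 0 <= s -> q + l%:R - d - s <= Q ->
 const D, forall f g (A : R) J z, cmeas f -> cok g -> size J = l -> uball z -> 0 <= A ->
 (forB w, modC (g w) <= A * (modC (f w) * (dist w z `^ d * weight w `^ (b - 1 + s)))) ->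
 ((modC (Ik (fun w => mu q J w * g w) (q + (size J)%:R) z))%:E <= (D * A)%:E * Jf f Q (b - 1) z)%E.
move=> qp s0 hQ; have [U U0 hU] := mu_bnd l qp; pose r := q + l%:R - d - s.
exists (2 * (U * (2 `^ s * 2 `^ (Q - r)))) => // f g A J z mf okg sJ zB A0 hg.
have K0 : 0 <= U * (2 `^ s * 2 `^ (Q - r)) * A by [].
rewrite sJ -[2 * _ * A]mulrA; apply: (Ik_le (cok_mu q J okg) _ zB K0).
- by rewrite addr_ge0.
- exact: emeas_Jf0.
- by move=> w _; rewrite !mulr_ge0 ?modC_ge0 ?powR_ge0.
move=> w wB; have d0 := distB_gt0 wB zB;
have f0 := modC_ge0 (f w);
have p0 x := powR_ge0 (dist w z) x.
have E : dist w z `^ (- r) = dist w z `^ d * (dist w z `^ s * dist w z `^ (- (q + l%:R))).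
 by rewrite -(powR_split d0 erefl); apply: powR_split => //; rewrite /r; ring.
rewrite modCM; apply: (le_trans (ler_wpM2r (p0 (- (q + l%:R))) (ler_pM (modC_ge0 _) (modC_ge0 _) (hU J w sJ wB) (hg w wB)))).
apply: (le_trans (le_eqs (ler_wpM2l (mulr_ge0 (mulr_ge0 (mulr_ge0 U0 A0) f0) (mulr_ge0 (p0 d) (p0 (- (q + l%:R))))) (weight_dist (b - 1) s0 wB zB)) _ erefl)); first by ring.
by apply: (le_eqs (ler_wpM2l (mulr_ge0 (mulr_ge0 (mulr_ge0 (mulr_ge0 U0 A0) f0) (powR_ge0 (weight w) (b - 1))) (powR_ge0 2 s)) (dist_pow_up hQ wB zB))); [rewrite -/r E; ring|rewrite -/r; ring].
Qed.

(* [phi(z) d_J f - d_J h] through the kernels: the difference [phi z - phi w] gains [eps]. *)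
Lemma diff_est l : const D, forall f h M J z, sol f h M -> size J = l -> uball z ->
 ((modC (phi z * dzl J f z - dzl J h z))%:E <= D%:E * Jf f (n%:R + b + l%:R - eps) (b - 1) z)%E.
have [D D0 hD] := phi_holder; have [A A0 [_ hA]] := phi_rb.
(* The surplus of weight over [b - 1] in the two integrands, with weights [N] and [N + tau0 - 1];
   both are nonnegative. *)
have k0 := kap_ge0; pose s := N + 1 - b; pose s' := N + tau0 - b.
have s0 : 0 <= s by rewrite /s; have := bN; lra.
have s'0 : 0 <= s' by rewrite /s'; have := bt; lra.
have nV : 0 <= dN^-1 by rewrite invr_ge0.
have q1 : a + l%:R - eps - s <= n%:R + b + l%:R - eps by rewrite /a /s; move: (n%:R : R) => x; lra.
have q2 : dN + l%:R - 0 - s' <= n%:R + b + l%:R - eps.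
 by rewrite /s' /eps; have := tau00; move: (n%:R : R) => x; lra.
have [E E0 hE] := Ik_J a0 s0 q1; have [F F0 hF] := Ik_J nN0 s'0 q2.
have A1 : 0 <= kap 0 * D by exact: mulr_ge0.
have A2 : 0 <= kap 0 * dN^-1 * A by exact: mulr_ge0 (mulr_ge0 k0 nV) A0.
exists (E * (kap 0 * D) + F * (kap 0 * dN^-1 * A)) => [|f h M J z hs sJ zB].
 by apply: addr_ge0; exact: mulr_ge0.
have [okP okR _] := h_repr hs zB; have [ok1 _] := f_repr hs zB.
have [_ [hf hh] _ _ _] := hs; have mf := cmeas_hol hf.
pose d1 w := rc (kap 0) * (cP phi f w - phi z * cP (fun=> 1) f w).
pose d2 w := rc (kap 0) * rc dN^-1 * cR phi f w.
have kd1 : cok d1.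
 by apply: cok_ext (cokZ (rc (kap 0)) (cokD okP (cokZ (- phi z) ok1))) => w _; rewrite mulNr.
have kd2 : cok d2 by exact: cokZ.
pose hu u := rc (kap 0) * Ik (cP phi f) a u.
have Eh u : uball u -> 1 * hu u + Ik d2 dN u = h u.
 move=> uB; have [_ _ ->] := h_repr hs uB; have i3 := cok_Ik okR nN0 uB.
 rewrite mul1r mulrDr mulrA -(cintBZ _ i3); congr (_ + _); apply: cintB_eq => w _; exact/esym/mulrA.
have k1 : Ck (size J) UB hu by apply: (Ck_scale _ oUB); apply: hol_Ck; exact: hol_Ik.
have k2 : Ck (size J) UB (Ik d2 dN) by apply: hol_Ck; exact: hol_Ik.
rewrite modC_distC (dzl_loc oUB (Ck_add oUB (Ck_scale 1 oUB k1) k2) Eh zB) (dzl_lin 1 oUB k1 k2 zB) mul1r addrAC.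
rewrite (Ik_diff (phi z) J ok1 okP a0 hf zB (fun u uB => (f_repr hs uB).2) (fun u _ => erefl)) (dzl_Ik J kd2 nN0 zB).
apply: (le_trans (_ : _ <= (modC (Ik (fun w => mu a J w * d1 w) (a + (size J)%:R) z))%:E + (modC (Ik (fun w => mu dN J w * d2 w) (dN + (size J)%:R) z))%:E)%E).
 by rewrite -EFinD lee_fin modCD.
rewrite [X in (_ <= X * _)%E]EFinD ge0_muleDl ?lee_fin; [apply: leeD|exact: mulr_ge0|exact: mulr_ge0].
 apply: hE => // w wB; rewrite (_ : b - 1 + s = N); last by rewrite /s; ring.
 rewrite (_ : d1 w = rc (kap 0) * (f w * (phi w - phi z) * wtp N w)); last first.
  by rewrite /d1 /cP; move: (rc _) (rc _) (f w) => x y t; ring.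
 rewrite 3!modCM !modCR !ger0_norm ?powR_ge0//.
 have := ler_wpM2l (mulr_ge0 (mulr_ge0 k0 (modC_ge0 (f w))) (powR_ge0 (weight w) N)) (hD z w zB wB).
 by move=> h3; apply: (le_eqs h3); rewrite /eps; ring.
apply: hF => // w wB; rewrite powRr0 mul1r (_ : b - 1 + s' = tau0 - 1 + N); last by rewrite /s'; ring.
rewrite (powR_split (weight_gt0 wB) erefl) /d2 /cR 4!modCM !modCR !ger0_norm ?powR_ge0//.
have h3 := ler_wpM2l (mulr_ge0 (mulr_ge0 (mulr_ge0 k0 nV) (modC_ge0 (f w))) (powR_ge0 (weight w) N)) (hA w wB).
by apply: (le_eqs h3); ring.
Qed.

(** [dist w z >= weight z / 2] inside the reproducing integral; far from optimal at the sphere, but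
    uniform on compact sets. *)
Lemma f_crude l : const D, forall f h M J z, sol f h M -> size J = l -> uball z ->
 modC (dzl J f z) <= D * M * weight z `^ (- (n%:R + b + l%:R)).
set Q := n%:R + b + l%:R; have Q0 : 0 <= Q by rewrite !addr_ge0// ltW.
have s0 : 0 <= N + 1 - b by have := bN; lra.
have q1 : a + l%:R - 0 - (N + 1 - b) <= Q by rewrite /a /Q; move: (n%:R : R) => x; lra.
have [E E0 hE] := Ik_J a0 s0 q1; have k0 := kap_ge0.
exists (E * kap 0 * 2 `^ Q) => [|f h M J z hs sJ zB]; first exact: mulr_ge0 (mulr_ge0 E0 k0) (powR_ge0 _ _).
have [ok1 _] := f_repr hs zB; have [M0 [hf _] hL _ _] := hs; have z0 := weight_gt0 zB.
have Ef u (uB : uball u) := (f_repr hs uB).2; have := Ik_diff 0 J ok1 ok1 a0 hf zB Ef Ef.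
have kc : cok (fun w => rc (kap 0) * (cP (fun=> 1) f w - 0 * cP (fun=> 1) f w)).
 by apply: cok_ext (cokZ (rc (kap 0)) ok1) => w _; rewrite mul0r subr0.
rewrite mul0r subr0 => ->; rewrite -lee_fin.
apply: (le_trans (hE f _ _ J z (cmeas_hol hf) kc sJ zB k0 _)) => [w wB|].
 rewrite mul0r subr0 /cP mulr1 2!modCM !modCR (ger0_norm k0) (ger0_norm (powR_ge0 _ _)) powRr0 mul1r.
 by rewrite (_ : b - 1 + (N + 1 - b) = N)//; ring.
have W0 : 0 <= 2 `^ Q * weight z `^ (- Q) by rewrite mulr_ge0 ?powR_ge0.
have mL := emeas_L1 (cmeas_hol hf).
have J1 : (Jf f Q (b - 1) z <= (2 `^ Q * weight z `^ (- Q))%:E * M%:E)%E.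
 apply: (le_trans _ (lee_wpmul2l _ hL)); rewrite ?lee_fin// /L1 -IeZ//.
 apply: Ie_le; [exact: emeas_Jf0 (cmeas_hol hf) zB|exact: measurable_funeM| |].
  by move=> w _; rewrite lee_fin !mulr_ge0 ?modC_ge0 ?powR_ge0.
 move=> w wB; rewrite -EFinM lee_fin mulrCA; apply: ler_wpM2r; first by rewrite mulr_ge0 ?modC_ge0 ?powR_ge0.
 have <- : (weight z / 2) `^ (- Q) = 2 `^ Q * weight z `^ (- Q).
  rewrite powRM ?invr_ge0 ?(ltW z0)// mulrC; congr (_ * _).
  by rewrite -(@powR_inv1 _ 2)// -powRrM mulN1r opprK.
 apply: powRN_le => //; first by rewrite divr_gt0.
 by rewrite ler_pdivrMr// mulrC weight_le_distr ?uball_le.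
apply: (le_trans (lee_wpmul2l _ J1)); first by rewrite lee_fin mulr_ge0.
by rewrite -!EFinM lee_fin; apply: eqle; ring.
Qed.

Hypothesis phi0 : forall zeta, usphere zeta -> phi zeta <> 0.

(* Divide by [phi] near the sphere; in the interior [f_crude] suffices. *)
Lemma divide_phi : exists2 c : R, 0 < c <= 1 & forB z, weight z <= c -> c <= modC (phi z).
have [c c0 hc] := phi_lower phi0; exists (Num.min c 1); first by rewrite lt_min c0 ltr01 ge_min lexx orbT.
by move=> z zB; rewrite le_min => /andP[h _]; apply: le_trans (hc z zB h); rewrite ge_min lexx.
Qed.

(** [X] is extended-real because it will contain potentials, whose finiteness is not known when the
    lemma is applied. *)
Lemma divide l : const D, forall f h M J z (X : \bar R), sol f h M -> size J = l -> uball z ->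
 (M%:E <= X)%E -> ((modC (dzl J h z))%:E <= X)%E -> ((modC (phi z * dzl J f z - dzl J h z))%:E <= X)%E ->
 ((modC (dzl J f z))%:E <= D%:E * X)%E.
have [c /andP[c0 _] hc] := divide_phi; have [E E0 hE] := f_crude l.
set Q := n%:R + b + l%:R in hE; have Q0 : 0 <= Q by rewrite !addr_ge0// ltW.
have c10 : 0 < c^-1 by rewrite invr_gt0.
have B10 : 0 <= E * c `^ (- Q) by rewrite mulr_ge0 ?powR_ge0.
have D0 : 0 < E * c `^ (- Q) + c^-1 * 2 by rewrite ltr_wpDl// mulr_gt0.
exists (E * c `^ (- Q) + c^-1 * 2) => [|f h M J z X hs sJ zB]; first exact: ltW.
have [M0 _ _ _ _] := hs.
case: X => [x||]; [rewrite !lee_fin => Mx h1 h2|by rewrite gt0_muley ?leey// lte_fin|by rewrite leeNy_eq].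
have x0 := le_trans M0 Mx; rewrite mulrDl; have [wc|wc] := leP (weight z) c; last first.
 rewrite ler_wpDr ?mulr_ge0 ?(ltW c10)//; apply: (le_trans (hE f h M J z hs sJ zB)).
 rewrite mulrAC; apply: ler_pM => //.
 by rewrite ler_wpM2l// powRN_le// ltW.
apply: ler_wpDl; [exact: mulr_ge0|rewrite -mulrA ler_pdivlMl//]; apply: (@le_trans _ _ (modC (phi z * dzl J f z))).
 by rewrite modCM ler_wpM2r ?modC_ge0 ?hc.
by have := modCD (phi z * dzl J f z - dzl J h z) (dzl J h z); rewrite subrK; lra.
Qed.

(** * Boundedness of [f] by iterated potentials *)

Let q0 := n%:R + b - eps.
Let q00 : 0 <= q0.
by rewrite /q0 /eps; have := n1; have := b0; have := tau0h; lra. Qed.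

(** The difference estimate without derivatives, divided by [phi]: a self-improving inequality,
    since [q0] is [eps] below the critical exponent [n + b]. *)
Lemma f_pt : const D, forall f h M z, sol f h M -> uball z ->
 ((modC (f z))%:E <= D%:E * (M%:E + Jf f q0 (b - 1) z))%E.
have [D D0 hD] := divide 0; have [E E0 hE] := diff_est 0.
exists (D * (1 + E)) => [|f h M z hs zB]; first by rewrite mulr_ge0// addr_ge0.
have [M0 _ _ hM _] := hs; have J0 : (0 <= Jf f q0 (b - 1) z)%E by exact: Jf_ge0.
have E1 : (0 <= E%:E)%E by []. have M1 : (0 <= M%:E)%E by rewrite lee_fin.
have MJ : (M%:E <= M%:E + Jf f q0 (b - 1) z)%E by rewrite leeDl.
have XX : (M%:E + Jf f q0 (b - 1) z <= (1 + E)%:E * (M%:E + Jf f q0 (b - 1) z))%E.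
 by rewrite EFinD ge0_muleDl// mul1e leeDl// mule_ge0// (le_trans M1).
rewrite [((D * _)%:E)%E]EFinM -muleA; apply: (hD f h M [::]) => //; first exact: le_trans MJ XX.
 by apply: le_trans (le_trans MJ XX); rewrite lee_fin hM.
apply: (le_trans (hE f h M [::] z hs erefl zB)); rewrite addr0 -/q0.
by apply: lee_pmul; rewrite ?lee_fin ?lerDr// leeDr.
Qed.

(** Replace the larger of the two numbers by the smaller one. *)
Lemma powR_prod_le (x y s t : R) : 0 < x -> 0 < y -> 0 <= s -> 0 <= t ->
 x `^ (- s) * y `^ (- t) <= x `^ (- (s + t)) + y `^ (- (s + t)).
move=> x0 y0 s0 t0.
rewrite (@powR_split _ x (- (s + t)) (- s) (- t) x0) ?(@powR_split _ y (- (s + t)) (- s) (- t) y0); try ring.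
have [xy|/ltW xy] := leP x y.
 by rewrite ler_wpDr ?mulr_ge0 ?powR_ge0// ler_wpM2l ?powR_ge0//; apply: powRN_le.
by rewrite ler_wpDl ?mulr_ge0 ?powR_ge0// ler_wpM2r ?powR_ge0//; apply: powRN_le.
Qed.

(** Multiply by [dist v z^t]: the quasi-triangle inequality spends this power on one of the two
    kernels, and [powR_prod_le] leaves single kernels of exponent [q + q' - t], below the critical
    value [n + b]. *)
Lemma comp2 (q q' t : R) : 0 <= t -> t <= q -> t <= q' -> q + q' - t < n%:R + b ->
 const D, forall v z, uball v -> uball z ->
 (Ie (fun u => (dist u z `^ (- q) * weight u `^ (b - 1) * dist v u `^ (- q'))%:E) <= (D * dist v z `^ (- t))%:E)%E.
move=> t0 tq tq' hq; have [D D0 hD] := FR_bnd b0 hq.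
exists (8 `^ t * 2 * (D + D)) => [|v z vB zB]; first by rewrite !mulr_ge0 ?powR_ge0// addr_ge0.
have v1 := uball_le vB; have z1 := uball_le zB.
have dvz : 0 < dist v z by apply: dist_gt0; rewrite -?uballE.
pose s := q + q' - t; pose B := 8 `^ t * 2 * dist v z `^ (- t).
have B0 : 0 <= B by rewrite !mulr_ge0 ?powR_ge0.
have pw u : uball u -> dist u z `^ (- q) * weight u `^ (b - 1) * dist v u `^ (- q') <=
  B * (dist u z `^ (- s) * weight u `^ (b - 1) + dist u v `^ (- s) * weight u `^ (b - 1)).
 move=> uB; have u1 := uball_le uB.
 have duz : 0 < dist u z by apply: dist_gt0; rewrite -?uballE.
 have duv : 0 < dist u v by apply: dist_gt0; rewrite -?uballE.
 rewrite [dist v u]distC mulrAC -mulrDl mulrA ler_wpM2r ?powR_ge0//.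
 (* The constant 8 covers the 2 and 4 of [dist_quasi] times the larger distance. *)
 have tri : dist v z `^ t <= 8 `^ t * (dist u v `^ t + dist u z `^ t).
  have h := dist_quasi v1 u1 z1; rewrite [dist v u]distC in h.
  rewrite mulrDr -!powRM ?(ltW duz) ?(ltW duv)//.
  have [c|/ltW c] := leP (dist u v) (dist u z).
   rewrite ler_wpDl ?powR_ge0//; apply: ge0_ler_powR; rewrite ?nnegrE ?mulr_ge0 ?(ltW duz) ?(ltW dvz)//; lra.
  rewrite ler_wpDr ?powR_ge0//; apply: ge0_ler_powR; rewrite ?nnegrE ?mulr_ge0 ?(ltW duv) ?(ltW dvz)//; lra.
 have e1 : dist u z `^ (- q) * dist u v `^ (- (q' - t)) <= dist u z `^ (- s) + dist u v `^ (- s).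
  have := powR_prod_le duz duv (le_trans t0 tq) (_ : 0 <= q' - t).
  by rewrite subr_ge0 addrA -/s; apply.
 have e2 : dist u z `^ (- (q - t)) * dist u v `^ (- q') <= dist u z `^ (- s) + dist u v `^ (- s).
  have := powR_prod_le duz duv (_ : 0 <= q - t) (le_trans t0 tq').
  by rewrite subr_ge0 [q - t + q'](_ : _ = s); [apply|rewrite /s; ring].
 rewrite (@powR_split _ (dist u v) (- (q' - t)) (- q') t duv) in e1; last by ring.
 rewrite (@powR_split _ (dist u z) (- (q - t)) (- q) t duz) in e2; last by ring.
 have X0 : 0 <= dist u z `^ (- q) * dist u v `^ (- q') by rewrite mulr_ge0 ?powR_ge0.
 have st := ler_wpM2l (mulr_ge0 X0 (powR_ge0 (dist v z) (- t))) tri.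
 have vt : dist v z `^ (- t) * dist v z `^ t = 1 by rewrite -(@powR_split _ (dist v z) 0) ?powRr0 ?addNr.
 have V0 := powR_ge0 (dist v z) (- t); have E0 := powR_ge0 (8 : R) t.
 have st2 := ler_wpM2l (mulr_ge0 V0 E0) (lerD e1 e2).
 move: st st2 vt; rewrite /B.
 move: (dist v z `^ _) (dist v z `^ _) (dist u z `^ _) (dist u z `^ _) (dist u z `^ _) (dist u v `^ _) (dist u v `^ _) (dist u v `^ _) (8 `^ _).
 move=> x1 x2 x3 x4 x5 x6 x7 x8 x9 st st2 vt.
 apply: (le_trans (le_eqs st _ erefl)); first by rewrite -mulrA vt mulr1.
 by apply: (le_eqs st2); ring.
pose G y u := dist u y `^ (- s) * weight u `^ (b - 1).
have mG y : uball y -> emeas (fun u => (G y u)%:E) by exact: emeas_dist.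
have G0 y u : uball u -> (0 <= (G y u)%:E)%E by rewrite lee_fin mulr_ge0 ?powR_ge0.
apply: (@le_trans _ _ (B%:E * (Id s (b - 1) z + Id s (b - 1) v))%E); last first.
 have := leeD (hD z zB) (hD v vB); rewrite -EFinD => h.
 apply: (@le_trans _ _ (B%:E * (D + D)%:E)%E); first by apply: lee_wpmul2l; rewrite ?lee_fin.
 by rewrite -EFinM lee_fin /B; apply: eqle; ring.
rewrite /Id -(IeD (mG z zB) (mG v vB) (G0 z) (G0 v)) -IeZ//; first last.
- by move=> u uB; rewrite adde_ge0 ?G0.
- by apply: emeasurable_funD; exact: mG.
apply: Ie_le.
- have := emeasM_fin (emeasM_fin (p := fun u => dist u z `^ (- q) * weight u `^ (b - 1)) (emeas_dist (- q) (b - 1) zB) (q := fun u => dist u v `^ (- q') * weight u `^ 0) (emeas_dist (- q') 0 vB)) (@emeas_cst R n 1%:E).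
 by apply: emeas_ext => u _; rewrite powRr0 !mulr1 [dist v u]distC.
- by apply: measurable_funeM; apply: emeasurable_funD; exact: mG.
- by move=> u _; rewrite lee_fin !mulr_ge0 ?powR_ge0.
- by move=> u uB; rewrite -EFinD -EFinM lee_fin; exact: pw.
Qed.

(** Insert the pointwise inequality [f_pt] under the integral and compose the two kernels. *)
Lemma J_step (q : R) : 0 <= q -> q <= q0 -> const D, forall f h M z, sol f h M -> uball z ->
 (Jf f q (b - 1) z <= D%:E * (M%:E + Jf f (Num.max (q - eps / 2) 0)%R (b - 1) z))%E.
(* Lowering by [eps / 2] instead of [eps] keeps [q + q0 - t] strictly below [n + b], where the
   Forelli-Rudin integral is bounded. *)
move=> q1 q2; set t := Num.max _ _.
have t0 : 0 <= t by rewrite le_max lexx orbT.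
have tq : t <= q by rewrite ge_max q1 andbT; have := eps0; lra.
have tq' : t <= q0 by exact: le_trans q2.
have ht : q - eps / 2 <= t by rewrite le_max lexx.
have hq : q + q0 - t < n%:R + b by rewrite /q0; have := eps0; lra.
have hq1 : q < n%:R + b by apply: le_lt_trans q2 _; rewrite /q0; have := eps0; lra.
have [E E0 hE] := comp2 t0 tq tq' hq; have [A A0 hA] := FR_bnd b0 hq1.
have [P P0 hP] := f_pt.
exists (P * (A + E)) => [|f h M z hs zB]; first by rewrite mulr_ge0 ?addr_ge0.
have [M0 [hf _] _ _ _] := hs; have mf := cmeas_hol hf.
pose g u := dist u z `^ (- q) * weight u `^ (b - 1).
have g0 u : 0 <= g u by rewrite mulr_ge0 ?powR_ge0.
have mg : emeas (fun u => (g u)%:E) by exact: emeas_dist.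
have mJ := emeas_Jf q0 (b - 1) mf; have M1 : (0 <= M%:E)%E by [].
have J0 q' u : (0 <= Jf f q' (b - 1) u)%E by exact: Jf_ge0.
have m1 : emeas (fun u => M%:E * (g u)%:E)%E by apply: measurable_funeM.
have m2 : emeas (fun u => (g u)%:E * Jf f q0 (b - 1) u)%E by exact: emeasurable_funM.
have p1 u : uball u -> (0 <= M%:E * (g u)%:E)%E by move=> _; rewrite mule_ge0 ?lee_fin.
have p2 u : uball u -> (0 <= (g u)%:E * Jf f q0 (b - 1) u)%E by move=> _; rewrite mule_ge0 ?lee_fin.
have m3 := emeasurable_funD m1 m2.
apply: (@le_trans _ _ (Ie (fun u => P%:E * (M%:E * (g u)%:E + (g u)%:E * Jf f q0 (b - 1) u))%E)).
 apply: Ie_le; [exact: emeas_Jf0|exact: measurable_funeM|by move=> u _; rewrite lee_fin !mulr_ge0 ?modC_ge0 ?powR_ge0|].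
 move=> u uB; rewrite [(M%:E * _)%E]muleC -ge0_muleDr// muleCA -/(g u) mulrC EFinM.
 by apply: lee_wpmul2l; [rewrite lee_fin|exact: hP hs uB].
rewrite IeZ ?lee_fin// => [|u uB]; last by rewrite adde_ge0 ?p1 ?p2.
rewrite EFinM -muleA lee_wpmul2l ?lee_fin// (IeD m1 m2 p1 p2) (IeZ mg)//.
rewrite EFinD ge0_muleDl ?adde_ge0//; apply: leeD.
 rewrite muleC; apply: (@le_trans _ _ (A%:E * M%:E)%E); first by apply: lee_wpmul2r => //; exact: hA.
 by rewrite lee_wpmul2l// leeDl.
apply: (@le_trans _ _ (E%:E * Jf f t (b - 1) z)%E); last by rewrite lee_wpmul2l// leeDr.
have mH : emeas (fun u => (E * dist u z `^ (- t))%:E).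
 apply: emeasM_fin (emeas_cst E%:E) (emeas_ext _ (emeas_dist (- t) 0 zB)) => u _.
 by rewrite powRr0 mulr1.
apply: (le_trans (Jf_comp (b - 1) mf mg (fun u _ => g0 u) mH (fun u uB => hE u z uB zB))).
rewrite /Jf -IeZ ?lee_fin//; last exact: emeas_Jf0.
by apply: eqle; apply: Ie_eq => u _; rewrite -EFinM; congr (_%:E); ring.
Qed.

(** Once the exponent has been lowered to 0 the potential is the [B^1] norm, at most [M]. *)
Lemma f_bnd : const D, forall f h M z, sol f h M -> uball z -> modC (f z) <= D * M.
have e2 : 0 < eps / 2 by rewrite divr_gt0.
have it i : const D, forall f h M z, sol f h M -> uball z ->
 ((modC (f z))%:E <= D%:E * (M%:E + Jf f (Num.max (q0 - eps / 2 *+ i) 0)%R (b - 1) z))%E.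
 elim: i => [|i [D D0 hD]].
  have [D D0 hD] := f_pt; exists D => [//|f h M z]; rewrite mulr0n subr0 (max_idPl q00); exact: hD.
 set q := Num.max _ _ in hD; have q0' : 0 <= q by rewrite le_max lexx orbT.
 have qq : q <= q0 by rewrite ge_max q00 gerBl mulrn_wge0// ltW.
 have [E E0 hE] := J_step q0' qq; exists (D * (1 + E)) => [|f h M z hs zB]; first by rewrite mulr_ge0 ?addr_ge0.
 have [M0 _ _ _ _] := hs; have := hE f h M z hs zB; have -> : Num.max (q - eps / 2) 0 = Num.max (q0 - eps / 2 *+ i.+1) 0.
  rewrite /q [_ *+ i.+1]mulrSr opprD addrA; move: (q0 - _) => x.
  by case: (leP x 0) => // x0; rewrite !max_r//; lra.
 set J := Jf _ (Num.max (q0 - eps / 2 *+ i.+1) 0)%R _ _ => h1; have J0 : (0 <= J)%E by exact: Jf_ge0.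
 have MJ : (0 <= M%:E + J)%E by rewrite adde_ge0// lee_fin.
 apply: (le_trans (hD f h M z hs zB)); rewrite EFinM -muleA; apply: lee_wpmul2l; rewrite ?lee_fin//.
 rewrite EFinD ge0_muleDl// mul1e; apply: leeD => //; by rewrite leeDl.
(* The number of iterations depends only on [q0] and [eps], so the constant does not depend on the
   solution. *)
have [i hi] : exists i, q0 - eps / 2 *+ i <= 0.
 exists (Num.Def.archi_bound (q0 / (eps / 2))); rewrite subr_le0 -mulr_natr mulrC -ler_pdivrMr//.
 by apply/ltW/archi_boundP; rewrite divr_ge0// ltW.
have [D D0 hD] := it i; exists (D + D) => [|f h M z hs zB]; first exact: addr_ge0.
have [M0 [hf _] hL _ _] := hs; have := hD f h M z hs zB; rewrite (max_idPr hi) => h1.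
have E : Jf f 0 (b - 1) z = L1 f by apply: Ie_eq => u _; rewrite oppr0 powRr0 mul1r.
rewrite -lee_fin; apply: (le_trans h1); rewrite E.
apply: (@le_trans _ _ (D%:E * (M%:E + M%:E))%E); first by rewrite lee_wpmul2l ?lee_fin// leeD.
by rewrite -EFinD -EFinM lee_fin; apply: eqle; ring.
Qed.

(** * Raising the smoothness of [f] up to [tau] *)

Variables (m : nat) (eta : R).
Hypothesis eta0 : 0 < eta.
Hypothesis eta4 : eta <= 1 / 4.
Hypothesis etam : eta <= m%:R - tau.
Hypothesis etak : eta + eta <= k%:R - tau.

(** Growth exponent of the derivatives of order [l] for smoothness [sg]. The positive floor [eta]
    avoids logarithms and keeps [FR_gr], which wants a positive exponent, applicable at low
    orders. *)
Let s (sg : R) l : R := Num.max (l%:R - sg) eta.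
Let s0 sg l : 0 < s sg l.
by rewrite lt_max eta0 orbT. Qed.
Let sS sg l : s sg l <= s sg l.+1.
rewrite /s ge_max !le_max lexx orbT andbT -[l.+1%:R]natr1; apply/orP; left.
by move: (l%:R : R) => x; lra. Qed.
Let s_anti sg sg' l : sg <= sg' -> s sg' l <= s sg l.
by move=> h; rewrite /s ge_max !le_max lexx orbT andbT lerD2l lerN2 h. Qed.
Let taup : 0 < tau.
exact: lt_le_trans tau00 tau0t. Qed.
Let eps_tau : eps <= tau.
by rewrite /eps; have := tau0t; have := tau00; lra. Qed.
Definition Id_grow q c e := const D, forB z, (Id q (c - 1) z <= (D * weight z `^ (- e))%:E)%E.

(** Two model terms, since the difference will consist of one with the Hoelder gain in [dist] and
    one with a better weight; both must lead to the same growth [e]. *)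
Lemma Ik_grow q l d1 c1 d2 c2 e : 0 <= q -> Id_grow (q + l%:R - d1) c1 e -> Id_grow (q + l%:R - d2) c2 e ->
 const D, forall g (A : R) J z, cok g -> size J = l -> uball z -> 0 <= A ->
 (forB w, modC (g w) <= A * (dist w z `^ d1 * weight w `^ (c1 - 1) + dist w z `^ d2 * weight w `^ (c2 - 1))) ->
 modC (Ik (fun w => mu q J w * g w) (q + (size J)%:R) z) <= D * A * weight z `^ (- e).
move=> qp [G1 G10 hG1] [G2 G20 hG2]; have [U U0 hU] := mu_bnd l qp.
exists (2 * U * (G1 + G2)) => [|g A J z okg sJ zB A0 hg]; first by rewrite !mulr_ge0// addr_ge0.
pose g1 d c w := dist w z `^ (- (q + l%:R - d)) * weight w `^ (c - 1).
have g0 d c w : 0 <= g1 d c w by rewrite mulr_ge0 ?powR_ge0.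
have mg d c : emeas (fun w => (g1 d c w)%:E) by exact: emeas_dist.
have UA : 0 <= U * A by exact: mulr_ge0.
rewrite sJ -lee_fin; apply: (le_trans (Ik_le (G := fun w => g1 d1 c1 w + g1 d2 c2 w) (cok_mu q J okg) _ zB UA _ _ _)).
- by rewrite addr_ge0.
- by apply: emeas_ext (emeasurable_funD (mg d1 c1) (mg d2 c2)) => w _; rewrite EFinD.
- by move=> w _; rewrite addr_ge0.
- move=> w wB; have d0 := distB_gt0 wB zB.
 have h := ler_wpM2r (powR_ge0 (dist w z) (- (q + l%:R))) (ler_pM (modC_ge0 _) (modC_ge0 _) (hU J w sJ wB) (hg w wB)).
 have E d : dist w z `^ (- (q + l%:R - d)) = dist w z `^ d * dist w z `^ (- (q + l%:R)) by apply: powR_split => //; ring.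
 by rewrite modCM; apply: (le_eqs h) => //; rewrite /g1 !E; ring.
have p d c w : uball w -> (0 <= (g1 d c w)%:E)%E by rewrite lee_fin.
have -> : Ie (fun w => (g1 d1 c1 w + g1 d2 c2 w)%:E) = (Id (q + l%:R - d1) (c1 - 1) z + Id (q + l%:R - d2) (c2 - 1) z)%E.
 by rewrite /Id -(IeD (mg d1 c1) (mg d2 c2) (p d1 c1) (p d2 c2)); apply: Ie_eq => w _; rewrite EFinD.
have h := leeD (hG1 z zB) (hG2 z zB); rewrite -EFinD in h.
apply: (le_trans (lee_wpmul2l _ h)); first by rewrite lee_fin mulr_ge0.
by rewrite -EFinM lee_fin; apply: eqle; ring.
Qed.

(** The norm of [B^oo_tau] in terms of words: one exponent [m - tau] for all orders up to [m]. *)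
Definition wbound h (M : R) := [/\ hol UB h, 0 <= M &
 forall J z, (size J <= m)%N -> uball z -> modC (dzl J h z) <= M * weight z `^ (tau - m%:R)].

(** Reproduce [h] after [m] integrations by parts: [TL m h] grows like [m - tau], and the weight
    [N + m - 1] turns this into [weight^(N + tau - 1)]. The bound known only at order [m] thus gives
    sharp bounds at every order. *)
Lemma h_est l e : Id_grow (dN + l%:R - 0) (N + tau) e ->
 const D, forall h M J z, wbound h M -> size J = l -> uball z ->
 modC (dzl J h z) <= D * M * weight z `^ (- e).
move=> hI; have [D D0 hD] := Ik_grow nN0 hI hI; have [T T0 hT] := wb_TL m 0.
have m0 : (0 < m)%N by rewrite -(ltr0n R); have := etam; have := eta0; have := taup; lra.
have kap0 := ltW (kap_gt0 m.-1); have E0 : 0 <= m%:R - tau by apply: le_trans etam; exact: ltW.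
exists (D * (kap m.-1 * T)) => [|h M J z [hh M0 hM] sJ zB]; first by rewrite mulr_ge0// mulr_ge0.
have hw : wb (m + 0) (fun=> m%:R - tau) M h.
 by rewrite addn0; apply: wb_words => [|L w sL wB]; [exact: hol_Ck|rewrite opprB; exact: hM].
have TM : 0 <= T * M by exact: mulr_ge0.
have tw w : uball w -> modC (TL m.-1.+1 h w) <= T * M * weight w `^ (- (m%:R - tau)).
 by rewrite prednK// => wB; exact: (wb0 (hT (fun=> m%:R - tau) M h E0 (fun=> lexx _) hw) wB).
have Ch : Ck m.-1.+1 UB h by exact: hol_Ck.
have mE : m.-1%:R + 1 = m%:R :> R by rewrite natr1 prednK.
have EN : m%:R - tau < N + m.-1.+1%:R by rewrite prednK//; have := N0; have := taup; lra.
have [ok _] := TL_limit Ch TM E0 EN tw zB.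
have Eh u : uball u -> h u = rc (kap m.-1) * Ik (cT m.-1 h) dN u.
 by move=> uB; have [_ lim] := TL_limit Ch TM E0 EN tw uB; exact: slim_unique (Pop_dil hh uB) lim.
have okg : cok (fun w => rc (kap m.-1) * (cT m.-1 h w - 0 * cT m.-1 h w)).
 by apply: cok_ext (cokZ (rc (kap m.-1)) ok) => w _; rewrite mul0r subr0.
(* With the constant 0 the difference formula expresses the derivative of [h] alone. *)
have := Ik_diff 0 J ok ok nN0 hh zB Eh Eh; rewrite mul0r subr0 => ->.
have kTM : 0 <= kap m.-1 * T * M by rewrite -mulrA mulr_ge0.
rewrite mulrAC -mulrA mulrAC; apply: (le_trans (hD _ _ J z okg sJ zB kTM _)) => [w wB|]; last by apply: eqle; ring.
rewrite mul0r subr0 powRr0 !mul1r modCM /cT modCM !modCR (ger0_norm kap0) (ger0_norm (powR_ge0 _ _)).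
rewrite (@powR_split _ (weight w) (N + tau - 1) (- (m%:R - tau)) (N + m.-1%:R) (weight_gt0 wB)); last by rewrite -mE; ring.
have h2 := ler_wpM2l kap0 (ler_wpM2r (powR_ge0 (weight w) (N + m.-1%:R)) (tw w wB)).
have h1 := mulr_ge0 kTM (mulr_ge0 (powR_ge0 (weight w) (- (m%:R - tau))) (powR_ge0 (weight w) (N + m.-1%:R))).
by apply: (le_eqs (lerD h1 h2)); rewrite ?add0r//; ring.
Qed.

Lemma h_words l : const D, forall h M J z, wbound h M -> size J = l -> uball z ->
 modC (dzl J h z) <= D * M * weight z `^ (- s tau l).
apply: h_est; apply: (FR_gr _ (s0 tau l)); first by rewrite ltr_wpDl.
have : l%:R - tau <= s tau l by rewrite le_max lexx.
by move: (s _ _) (n%:R : R) => x y; lra.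
Qed.

(** At order 0 the exponent is subcritical because [tau > 0]. The norm only bounds
    [|h| weight^(m - tau)], so boundedness of [h], required in [sol], has to be derived. *)
Lemma h_bnd : const D, forall h M z, wbound h M -> uball z -> modC (h z) <= D * M.
have c0 : 0 < N + tau by rewrite ltr_wpDl.
have q : dN + 0%:R - 0 < n%:R + (N + tau) by have := taup; move: (n%:R : R) => x; lra.
have hI : Id_grow (dN + 0%:R - 0) (N + tau) 0.
 by have [D D0 hD] := FR_bnd c0 q; exists D => // z zB; rewrite [X in weight z `^ X]oppr0 powRr0 mulr1; exact: hD.
have [D D0 hD] := h_est hI.
exists D => // h M z hh zB; have := hD h M [::] z hh erefl zB; by rewrite oppr0 powRr0 mulr1.
Qed.

Definition sob f h M := sol f h M /\ wbound h M.
Definition smooth_to sg := forall l, const D, forall f h M J z, sob f h M -> size J = l -> uball z ->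
 modC (dzl J f z) <= D * M * weight z `^ (- s sg l).

(** [divide] with [X] a multiple of [weight^(- s sg l)], at least [M] since the exponent is
    negative; the derivatives of [h] are even better because [sg <= tau]. *)
Lemma smooth_divide sg l (D : R) : 0 <= D -> sg <= tau ->
 (forall f h M J z, sob f h M -> size J = l -> uball z ->
  modC (phi z * dzl J f z - dzl J h z) <= D * M * weight z `^ (- s sg l)) ->
 const D', forall f h M J z, sob f h M -> size J = l -> uball z ->
  modC (dzl J f z) <= D' * M * weight z `^ (- s sg l).
move=> D0 sgt hD; have [E E0 hE] := divide l; have [H H0 hH] := h_words l.
exists (E * (1 + H + D)) => [|f h M J z hs sJ zB]; first by rewrite mulr_ge0 ?addr_ge0.
have [hs1 hs2] := hs; have [_ M0 _] := hs2; set W := weight z `^ (- s sg l).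
have W1 : 1 <= W by apply: weight_powR_ge1 => //; rewrite oppr_le0 ltW.
have MW : M <= M * W by rewrite ler_peMr.
have MW0 : 0 <= M * W by exact: le_trans MW.
have h1 : modC (dzl J h z) <= H * (M * W).
 apply: (le_trans (hH h M J z hs2 sJ zB)); rewrite mulrA ler_wpM2l ?mulr_ge0//.
 by apply: weight_mono => //; rewrite lerN2; exact: s_anti.
have h2 := hD f h M J z hs sJ zB; have HM := mulr_ge0 H0 MW0; have DM := mulr_ge0 D0 MW0.
rewrite -lee_fin -2![E * _ * _]mulrA EFinM; rewrite -/W -mulrA in h2.
by apply: (hE f h M J z _ hs1 sJ zB); rewrite lee_fin; lra.
Qed.

(** With [f] bounded, the potential in [diff_est] becomes a Forelli-Rudin integral of exponent
    [n + b + l - eps]. *)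
Lemma smooth_base : smooth_to eps.
move=> l; have [D D0 hD] := diff_est l; have [F F0 hF] := f_bnd.
have qs : n%:R + b + l%:R - eps <= n%:R + b + s eps l by rewrite -addrA lerD2l le_max lexx.
have [G G0 hG'] := FR_gr b0 (s0 eps l) qs.
apply: (smooth_divide (D := D * (F * G))) => // f h M J z [hs _] sJ zB.
have [M0 [hf _] _ _ _] := hs; rewrite -lee_fin; apply: (le_trans (hD f h M J z hs sJ zB)).
apply: (@le_trans _ _ (D%:E * ((F * M)%:E * (G * weight z `^ (- s eps l))%:E))%E); last first.
 by rewrite -!EFinM lee_fin; apply: eqle; ring.
apply: lee_wpmul2l; rewrite ?lee_fin//.
apply: (@le_trans _ _ ((F * M)%:E * Id (n%:R + b + l%:R - eps) (b - 1) z)%E); last first.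
 by apply: lee_wpmul2l; [rewrite lee_fin mulr_ge0|exact: hG'].
have mG := emeas_dist (- (n%:R + b + l%:R - eps)) (b - 1) zB.
rewrite /Id -(IeZ mG)//.
apply: Ie_le.
- exact: emeas_Jf0 (cmeas_hol hf) zB.
- exact: measurable_funeM.
- by move=> w _; rewrite lee_fin !mulr_ge0 ?modC_ge0 ?powR_ge0.
- by move=> w wB; rewrite -EFinM lee_fin ler_wpM2r ?mulr_ge0 ?powR_ge0// (hF f h M).
Qed.

Lemma smooth_unif sg L : smooth_to sg -> const D, forall f h M J z, sob f h M -> (size J <= L)%N -> uball z ->
 modC (dzl J f z) <= D * M * weight z `^ (- s sg (size J)).
move=> hQ; elim: L => [|L [D D0 hD]].
 by have [D D0 hD] := hQ 0%N; exists D => // f h M J z hs; rewrite leqn0 => /eqP sJ zB; rewrite sJ; exact: (hD f h).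
have [E E0 hE] := hQ L.+1; exists (D + E) => [|f h M J z hs sJ zB]; first exact: addr_ge0.
have [_ [_ M0 _]] := hs; have W0 := powR_ge0 (weight z) (- s sg (size J)).
have [e|/eqP e] := eqVneq (size J) L.+1.
 have := hE f h M J z hs e zB; rewrite -e => /le_trans; apply.
 by rewrite !ler_wpM2r// lerDr.
have sJ' : (size J <= L)%N by rewrite leq_eqVlt in sJ; case/orP: sJ => // /eqP.
by apply: (le_trans (hD f h M J z hs sJ' zB)); rewrite !ler_wpM2r// lerDl.
Qed.

(** Exponents for [f]: at order 0 the floor [eta] is replaced by 0, since [f] is bounded. *)
Let e2 sg p : R := if p is 0%N then 0 else s sg p.

Lemma smooth_wb sg : smooth_to sg -> const D, forall f h M, sob f h M -> wb k (e2 sg) (D * M) f.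
move=> /(smooth_unif k)[D D0 hD]; have [F F0 hF] := f_bnd.
exists (D + F) => [|f h M hs]; first exact: addr_ge0.
have [hs1 [_ M0 _]] := hs; have [_ [hf _] _ _ _] := hs1.
apply: wb_words => [|J w sJ wB]; first exact: (hol_Ck).
case: J sJ => [|j J] sJ.
 by rewrite oppr0 powRr0 mulr1; apply: (le_trans (hF f h M w hs1 wB)); rewrite ler_wpM2r// lerDr.
apply: (le_trans (hD f h M _ w hs sJ wB)); rewrite ler_wpM2r ?powR_ge0// ler_wpM2r// lerDl//.
Qed.

Lemma phi_wb : exists A : R, wb k (s tau) A phi.
have [A A0 hA] := phi_words eta0; exists A.
have [hC _ _] := hG; apply: wb_words hC _ => J w sJ wB; exact: hA.
Qed.

(** Since [phi] takes at least one derivative, at most [k - 1] are left for [f]. When just one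
    exponent is at the floor, the remaining order pays for [eta <= 1/4] and [eps < 1/4]; when both
    are, [eta + eta <= k - tau] does. *)
Lemma s_e2 sg i j : 0 < sg -> sg <= tau -> (i.+1 + j <= k)%N -> s tau i.+1 + e2 sg j <= k%:R - Num.min (sg + eps) tau.
move=> sg0 sgt ijk.
have ij : i.+1%:R + j%:R <= k%:R :> R by rewrite -natrD ler_nat.
have i0 : 0 <= i%:R :> R by []. have iS : i.+1%:R = i%:R + 1 :> R by rewrite natr1.
have : k%:R - tau <= k%:R - Num.min (sg + eps) tau by rewrite lerD2l lerN2 ge_min lexx orbT.
have : k%:R - (sg + eps) <= k%:R - Num.min (sg + eps) tau by rewrite lerD2l lerN2 ge_min lexx.
have := etak; have := eta4; have := tau0h; have := eta0; rewrite /eps.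
move: (Num.min _ _) => M e0 th e4 ek h1 h2; rewrite -lerBrDr /s ge_max; rewrite iS in ij *.
case: j ij {ijk} => [|j] ij; rewrite /e2 /s; first by rewrite subr0; apply/andP; split; lra.
have j0 : 0 <= j%:R :> R by []. have jS : j.+1%:R = j%:R + 1 :> R by rewrite natr1.
rewrite jS in ij *.
by case: (leP (j%:R + 1 - sg) eta) => h3; apply/andP; split; lra.
Qed.

(** By [TL_comm] the integrand of the difference is [(phi w - phi z) TL k f + S]. The first term has
    the old growth [k - sg] but the factor [dist^eps]; in [S] some derivative falls on [phi], and
    the growth [k - sg'] is already the new one. *)
Lemma smooth_step sg : 0 < sg -> sg <= tau -> smooth_to sg -> smooth_to (Num.min (sg + eps) tau).
move=> sg0 sgt hQ l; set sg' := Num.min _ _.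
have sg't : sg' <= tau by rewrite ge_min lexx orbT.
have sg'0 : 0 < sg' by rewrite lt_min taup addr_gt0.
have sg'e : sg' <= sg + eps by rewrite ge_min lexx.
have sgsg' : sg <= sg' by rewrite le_min sgt lerDl ltW.
have k0 := kge1; have kE : k = k.-1.+1 by rewrite prednK.
have kE' : k%:R = k.-1%:R + 1 :> R by rewrite {1}kE -natr1.
have tk := tauk.
have [B B0 hB] := smooth_wb hQ; have [A hA] := phi_wb; have [T T0 hT] := wb_TL k 0.
have [D D0 hD] := TL_comm hA (sS tau) (ltW (s0 tau 0)) (leqnn k).
have [P P0 hP] := phi_holder; have [Mp Mp0 [hMp _]] := phi_rb.
have e2S p : e2 sg p <= e2 sg p.+1 by case: p => [|p]; [exact: ltW (s0 sg 1)|exact: sS].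
have e2k : e2 sg k = k%:R - sg.
 by rewrite /e2; case: (k) k0 etak => // k1 _ h; rewrite /s; apply/max_idPl; have := eta0; lra.
set kp := kap k.-1; have kap0 : 0 <= kp by exact/ltW/kap_gt0.
(* Both model terms lead to the growth [s sg' l]: in the first, [sg' <= sg + eps] is compensated by
   the exponent [eps] of [dist]. *)
have [||G G0 hG'] := @Ik_grow dN l eps (N + sg) 0 (N + sg') (s sg' l) nN0.
1,2: by apply: FR_gr; rewrite ?ltr_wpDl//; have : l%:R - sg' <= s sg' l; [rewrite le_max lexx|move: (s _ _) (n%:R : R) => x y; lra].
pose Ac := kp * (P * T + D) * B; have PTD : 0 <= P * T + D by rewrite addr_ge0 ?mulr_ge0.
have Ac0 : 0 <= Ac by rewrite mulr_ge0// mulr_ge0.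
apply: (smooth_divide (D := G * Ac)) => // f h M J z hs sJ zB.
have [hs1 [hh M0 _]] := hs; have f1 := sol_fin hs1; have [_ [hf _] _ _ heq] := hs1.
have BM : 0 <= B * M by exact: mulr_ge0.
have wf := hB f h M hs.
have tf w : uball w -> modC (TL k f w) <= T * (B * M) * weight w `^ (- (k%:R - sg)).
 have wfk : wb (k + 0) (e2 sg) (B * M) f by rewrite addn0.
 by move=> wB; have := wb0 (hT _ _ _ (lexx 0) e2S wfk) wB; rewrite add0n e2k.
have E0 : 0 <= k%:R - sg' by lra.
have [S [ES hS]] := hD f _ _ _ wf e2S (lexx 0) E0 (fun i j (ij : (i.+1 + j <= k)%N) => s_e2 sg0 sgt ij).
have tS w : uball w -> modC (S w) <= D * (B * M) * weight w `^ (- (k%:R - sg')) by exact: wb0 hS.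
have E1 : 0 <= k%:R - sg by lra.
have EN : k%:R - sg < N + k.-1.+1%:R by rewrite -kE; have := N0; lra.
have Cf : Ck k UB f by exact: (hol_Ck).
have Cpf : Ck k UB (fun u => phi u * f u) by have [hC _ _] := hG; exact: Ck_mul.
have TB : 0 <= T * (B * M) by exact: mulr_ge0.
pose Q := (Mp * T + D) * (B * M); have Q0 : 0 <= Q by rewrite mulr_ge0// addr_ge0 ?mulr_ge0.
have tpf w : uball w -> modC (TL k (fun u => phi u * f u) w) <= Q * weight w `^ (- (k%:R - sg)).
 move=> wB; rewrite ES//; apply: (le_trans (modCD _ _)); rewrite modCM.
 have h1 := ler_pM (modC_ge0 _) (modC_ge0 _) (hMp w wB) (tf w wB).
 have h2 : weight w `^ (- (k%:R - sg')) <= weight w `^ (- (k%:R - sg)) by apply: weight_mono => //; lra.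
 have h3 := le_trans (tS w wB) (ler_wpM2l (mulr_ge0 D0 BM) h2).
 by apply: (le_eqs (lerD h1 h3)) => //; rewrite /Q; ring.
pose d1 := cT k.-1 f; pose d2 := cT k.-1 (fun u => phi u * f u).
have Ck1 : Ck k.-1.+1 UB f by rewrite -kE. have Ck2 : Ck k.-1.+1 UB (fun u => phi u * f u) by rewrite -kE.
have tf' w : uball w -> modC (TL k.-1.+1 f w) <= T * (B * M) * weight w `^ (- (k%:R - sg)) by rewrite -kE; exact: tf.
have tpf' w : uball w -> modC (TL k.-1.+1 (fun u => phi u * f u) w) <= Q * weight w `^ (- (k%:R - sg)) by rewrite -kE; exact: tpf.
have [ok1 _] := TL_limit Ck1 TB E1 EN tf' zB; have [ok2 _] := TL_limit Ck2 Q0 E1 EN tpf' zB.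
have Ef u : uball u -> f u = rc kp * Ik d1 dN u.
 by move=> uB; have [_ lim] := TL_limit Ck1 TB E1 EN tf' uB; exact: slim_unique (Pop_dil hf uB) lim.
have Eh u : uball u -> h u = rc kp * Ik d2 dN u.
 move=> uB; have [_ lim] := TL_limit Ck2 Q0 E1 EN tpf' uB.
 have lim2 := Pop_limit hf f1 uB.
 by rewrite -(slim_unique lim2 lim) (heq u uB) addrC addKr.
have okd : cok (fun w => rc kp * (d2 w - phi z * d1 w)).
 by apply: cok_ext (cokZ (rc kp) (cokD ok2 (cokZ (- phi z) ok1))) => w _; rewrite mulNr.
have AM : 0 <= Ac * M by exact: mulr_ge0.
rewrite modC_distC (Ik_diff (phi z) J ok1 ok2 nN0 hf zB Ef Eh) -[G * Ac * M]mulrA.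
apply: (hG' _ _ J z okd sJ zB AM) => w wB; have w0 := weight_gt0 wB.
have -> : d2 w - phi z * d1 w = ((phi w - phi z) * TL k f w + S w) * wtp (N + k.-1%:R) w.
 by rewrite /d1 /d2 /cT -kE ES//; move: (TL _ _ _) (rc _) (S w) => x y t; ring.
have h1 := ler_pM (modC_ge0 _) (modC_ge0 _) (hP z w zB wB) (tf w wB); rewrite -modCM in h1.
have h2 := ler_wpM2r (powR_ge0 (weight w) (N + k.-1%:R)) (le_trans (modCD _ _) (lerD h1 (tS w wB))).
rewrite 2!modCM !modCR (ger0_norm kap0) (ger0_norm (powR_ge0 _ _)); apply: (le_trans (ler_wpM2l kap0 h2)).
rewrite powRr0 mul1r /Ac (@powR_split _ (weight w) (N + sg - 1) (- (k%:R - sg)) (N + k.-1%:R) w0); last by rewrite kE'; ring.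
rewrite (@powR_split _ (weight w) (N + sg' - 1) (- (k%:R - sg')) (N + k.-1%:R) w0); last by rewrite kE'; ring.
have q3 := powR_ge0 (weight w) (- (k%:R - sg)); have q4 := powR_ge0 (weight w) (N + k.-1%:R).
have q5 := powR_ge0 (weight w) (- (k%:R - sg')); have q6 := powR_ge0 (dist w z) eps.
have r1 := mulr_ge0 (mulr_ge0 D0 BM) (mulr_ge0 q6 (mulr_ge0 q3 q4)).
have r2 := mulr_ge0 (mulr_ge0 (mulr_ge0 P0 T0) BM) (mulr_ge0 q5 q4).
rewrite -subr_ge0; move: (mulr_ge0 kap0 (addr_ge0 r1 r2)); rewrite -/eps.
move: (dist w z `^ eps) (weight w `^ _) (weight w `^ _) (weight w `^ _) => x1 x2 x3 x4 r3.
by apply: (le_eqs r3) => //; ring.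
Qed.

(** Finitely many steps of length [eps], cut off at [tau] because neither [h] nor [phi] allows
    more. *)
Lemma smooth_tau : smooth_to tau.
have it i : smooth_to (Num.min (eps + eps *+ i) tau).
 elim: i => [|i ih]; first by rewrite mulr0n addr0 (min_idPl eps_tau); exact: smooth_base.
 have p0 : 0 < Num.min (eps + eps *+ i) tau by rewrite lt_min taup ltr_wpDr// mulrn_wge0// ltW.
 have pt : Num.min (eps + eps *+ i) tau <= tau by rewrite ge_min lexx orbT.
 have := smooth_step p0 pt ih; congr smooth_to; rewrite mulrSr addrA /Num.min.
 by case: (ltP (eps + eps *+ i) tau) => h1//; case: ltP => h2; case: ltP => h3//; have := eps0; lra.
have := it (Num.Def.archi_bound (tau / eps)); rewrite (min_idPr _)//.
have : tau / eps < (Num.Def.archi_bound (tau / eps))%:R by apply: archi_boundP; rewrite divr_ge0// ltW.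
rewrite ltr_pdivrMr// mulrC mulr_natr => h; apply/ltW/(lt_le_trans h); rewrite lerDr; exact: ltW.
Qed.

End Boot.

End Charpentier.

Theorem theorem3p1 (R : realType) (n : nat) (N : R) (K : Cn R n -> Cn R n -> Cn R n)
    (tau0 tau : R) (k : nat) (phi : Cn R n -> cplx R) (N0 : R) (m : nat) :
  (0 < n)%N ->
  0 <= N ->
  charpentier_kernel N K ->
  0 < tau0 -> tau0 <= tau -> tau < k%:R -> tau0 < 1 / 2 ->
  inG tau0 tau k phi ->
  (forall zeta, usphere zeta -> phi zeta <> 0) ->
  0 < N0 -> N0 < N + tau0 ->
  tau < m%:R ->
  exists2 c : R, 0 < c &
    forall f h : Cn R n -> cplx R,
      inB1 N0 f -> inBinf m tau h ->
      (forB z, 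
        phi z * f z = Kop K (fun w => f w *: dbarv phi w) z + h z) ->
      inBinf m tau f /\
      (normBinf m tau f <= c%:E * (normB1 N0 f + normBinf m tau h))%E.
Proof.
move=> n0 Np HK t0 tt tk th hG phi0 b0 bt tm.
(* The bound [m - tau] lets every growth exponent of order at most [m] fit the final norm; the other
   two are those of [s_e2]. *)
pose eta := Num.min (1 / 4) (Num.min (m%:R - tau) ((k%:R - tau) / 2)).
have eta0 : 0 < eta by rewrite !lt_min divr_gt0// subr_gt0 tm divr_gt0// subr_gt0.
have eta4 : eta <= 1 / 4 by rewrite ge_min lexx.
have etam : eta <= m%:R - tau by rewrite !ge_min lexx orbT.
have etak : eta + eta <= k%:R - tau.
 have : eta <= (k%:R - tau) / 2 by rewrite !ge_min lexx !orbT.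
 by lra.
have hQ := smooth_tau n0 Np HK t0 th tt tk hG b0 bt phi0 eta0 eta4 etam etak.
have [H H0 hH] := h_bnd n0 Np HK t0 tt eta0 etam.
have [D D0 hD] : exists2 D : nat -> R, forall l, 0 <= D l & forall l f h M J z,
  sob K tau phi N0 m f h M -> size J = l -> uball z ->
  modC (dzl J f z) <= D l * M * weight z `^ (- Num.max (l%:R - tau) eta).
 have /choice[D hD] : forall l, exists D : R, 0 <= D /\ forall f h M J z, sob K tau phi N0 m f h M -> size J = l -> uball z ->
   modC (dzl J f z) <= D * M * weight z `^ (- Num.max (l%:R - tau) eta).
  by move=> l; have [D D0 hD] := hQ l; exists D.
 by exists D => [l|l]; have [] := hD l.
pose cd j : R := #|{: {ffun 'I_n -> 'I_j.+1} * {ffun 'I_n -> 'I_j.+1}}|%:R.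
(* One term for each order: [cd j] counts the pairs of multi-indices in [abs_d_hol_le], and [1 + H]
   comes from passing to [M'] below. *)
pose c := \sum_(j < m.+1) D j * (1 + H) * cd j.
have c0 : 0 <= c by apply: sumr_ge0 => j _; rewrite mulr_ge0// mulr_ge0// addr_ge0.
exists (1 + c) => [|f h [hf f1] [hh h1] heq]; first by rewrite ltr_pwDl.
have hf' := hf; have {}hf := holomorphic_hol hf; have {}hh := holomorphic_hol hh.
pose G := fun (j : nat) (g : Cn R n -> cplx R) => supB (fun z => abs_d j g z * weight z `^ (m%:R - tau)).
have G0 j g : (0 <= G j g)%E.
 by apply: supB_ge0 => z _; rewrite mulr_ge0 ?powR_ge0//; apply: sumr_ge0 => *; exact: modC_ge0.
have B0 (g : Cn R n -> cplx R) : (0 <= normBinf m tau g)%E by apply: sume_ge0 => j _; exact: (G0 j _).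
have L0 : (0 <= normB1 N0 f)%E by exact: L1_ge0.
pose M := fine (normB1 N0 f + normBinf m tau h).
have EM : (normB1 N0 f + normBinf m tau h)%E = M%:E.
 by rewrite /M fineK// ge0_fin_numE; [exact: lte_add_pinfty|exact: adde_ge0].
have M0 : 0 <= M by rewrite -lee_fin -EM adde_ge0.
have wbh : wbound tau m h M.
 split=> // J z sJ zB; have z0 := weight_gt0 zB.
 rewrite -(opprB m%:R) powRN ler_pdivlMr ?powR_gt0// -lee_fin -EM.
 apply: (@le_trans _ _ (normBinf m tau h)); last by rewrite leeDr.
 apply: (@le_trans _ _ (G (size J) h)).
  apply: le_trans (supB_ge _ zB); rewrite lee_fin ler_wpM2r ?powR_ge0//.
  by apply: abs_d_ge => //; exact: (hol_Ck n0 Np HK).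
 have sJ' : (size J < m.+1)%N by [].
 by rewrite /normBinf (bigD1 (Ordinal sJ')) //= leeDl// sume_ge0// => j _; exact: (G0 j _).
(* Enlarged so that it also dominates [|h|], which [h_bnd] bounds by [H * M]. *)
pose M' := (1 + H) * M; have MM : M <= M' by rewrite ler_peMl// lerDl.
have M'0 : 0 <= M' by exact: le_trans MM.
have hs : sob K tau phi N0 m f h M'.
 split; last first.
  have [_ _ hw] := wbh; split=> // J z sJ zB; apply: (le_trans (hw J z sJ zB)).
  by rewrite ler_wpM2r ?powR_ge0.
 split=> //.
  apply: (@le_trans _ _ M%:E); last by rewrite lee_fin.
  by rewrite -EM leeDl.
 move=> z zB; apply: (le_trans (hH h M z wbh zB)); rewrite ler_wpM2r//; lra.
have Gj (j : 'I_m.+1) : (G j f <= (D j * (1 + H) * cd j * M)%:E)%E.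
 apply: ub_ereal_sup => _ [z zB <-]; rewrite lee_fin; have z0 := weight_gt0 zB.
 have w0 := powR_ge0 (weight z) (m%:R - tau).
 have := @abs_d_hol_le R n j f z (D j * M' * weight z `^ (- (m%:R - tau))) hf zB.
 move=> /(_ (mulr_ge0 (mulr_ge0 (D0 j) M'0) (powR_ge0 _ _))) h2.
 apply: (le_trans (ler_wpM2r w0 (h2 _))) => [J sJ|].
  apply: (le_trans (hD j f h M' J z hs sJ zB)); apply: (ler_wpM2l (mulr_ge0 (D0 j) M'0)).
  apply: weight_mono => //; rewrite lerN2 ge_max etam andbT lerD2r ler_nat -ltnS; exact: ltn_ord.
 rewrite -[_ *+ #|_|]mulr_natr mulrAC powRN divfK ?gt_eqF ?powR_gt0// /M' /cd.
 by apply: eqle; ring.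
have fin : (normBinf m tau f <= (c * M)%:E)%E.
 by rewrite /c mulr_suml -sumEFin; apply: lee_sum => j _; exact: Gj.
split.
 by split; last by apply: le_lt_trans fin _; exact: ltry.
by rewrite EM -EFinM; apply: (le_trans fin); rewrite lee_fin ler_wpM2r// lerDr.
Qed.
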